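(* Let $Q$ be an affine quiver and let $M$ be an indecomposable finite-dimensional representation of $Q$ over $\mathbb{C}$ with dimension vector $\mathbf d$. Then for any $\mathbf e\in\mathbb{Z}_{\ge0}^{Q_0}$, the $\mathbf{e}$-dimensional transverse quiver Grassmannian $\mathrm{Tr}_{\mathbf e}(M)$ coincides with the set of smooth points in irreducible components of (minimal possible) dimension $\langle\mathbf e,\mathbf d-\mathbf e\rangle$ in the quiver Grassmannian $\mathrm{Gr}_{\mathbf e}(M)$, the latter being viewed as a scheme. That is, a point $N\in\mathrm{Gr}_{\mathbf e}(M)$ lies in $\mathrm{Tr}_{\mathbf e}(M)$ if and only if $N$ is a smooth point of the scheme $\mathrm{Gr}_{\mathbf e}(M)$ lying in an irreducible component of dimension $\langle\mathbf e,\mathbf d-\mathbf e\rangle$.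
   Context: An affine quiver is an acyclic orientation $Q=(Q_0,Q_1)$ of an extended Dynkin diagram of type $\widetilde A$, $\widetilde D$ or $\widetilde E$; $Q_0$ is its set of vertices and $Q_1$ its set of arrows. $\mathrm{rep}(Q)$ is the category of finite-dimensional representations of $Q$ over $\mathbb{C}$, identified with the category of finitely generated left modules over the path algebra $\mathbb{C}Q$. The dimension vector of a representation $M$ is denoted $\mathbf{dim}\, M\in\mathbb{Z}_{\ge 0}^{Q_0}$. The Euler form is $\langle\mathbf a,\mathbf b\rangle=\sum_{i\in Q_0}a_ib_i-\sum_{(i\to j)\in Q_1}a_ib_j$; it satisfies $\langle\mathbf{dim}\, X,\mathbf{dim}\, Y\rangle=\dim\mathrm{Hom}(X,Y)-\dim\mathrm{Ext}^1(X,Y)$ for representations $X,Y$. Quiver Grassmannians: for a representation $M$ with dimension vector $\mathbf d=(d_i)_{i\in Q_0}$ and $\mathbf{e}=(e_i)_{i\in Q_0}\in\mathbb{Z}_{\ge0}^{Q_0}$, $\mathrm{Gr}_{\mathbf e}(M)=\{N \text{ subrepresentation of } M \mid \mathbf{dim}\, N=\mathbf e\}$, and $\mathrm{Gr}(M)=\bigsqcup_{\mathbf e\in\mathbb{Z}_{\ge0}^{Q_0}}\mathrm{Gr}_{\mathbf e}(M)$. The quiver Grassmannian $\mathrm{Gr}_{\mathbf e}(M)$ is viewed as a (possibly non-reduced) projective scheme over $\mathbb{C}$: it is the closed subscheme of $\prod_{i\in Q_0}\mathrm{Gr}(e_i,M_i)$ (with $\mathrm{Gr}(e_i,M_i)$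 the Grassmannian of $e_i$-dimensional subspaces of $M_i\simeq\mathbb{C}^{d_i}$) defined by the conditions $M_\alpha(V_i)\subset V_j$ for every arrow $\alpha:i\to j$; equivalently, it is the scheme-theoretic fibre over $M$ of the projection to the variety of $\mathbf d$-dimensional representations from the variety of pairs (representation, $\mathbf e$-dimensional subrepresentation). Its Zariski tangent space at $N$ has dimension $\dim\mathrm{Hom}(N,M/N)$. Points are closed points, and a smooth point is a smooth point of this scheme, i.e. one where the dimension of the tangent space equals the local dimension of the scheme. A representation $M$ is rigid if $\mathrm{Ext}^1(M,M)=0$. Since $Q$ is affine, every indecomposable representation is preprojective, regular or preinjective, and each regular component of the Auslander-Reiten quiver is a tube. Each indecomposable regular representation is uniquely of the form $R^{(n)}$ with $R$ quasi-simple (i.e. a simple object of the abelian category of regular representations) and $n\ge1$ its quasi-length; here $R^{(n)}$ is the indecomposable regular representation with quasi-socle $R$ and quasi-length $n$. By convention $R^{(0)}=0$. For $n\le m$, $R^{(m)}$ has a unique subrepresentation isomorphic to $R^{(n)}$ that is regular of quasi-length $n$ (the image of the monomorphism $\iota: R^{(n)}\to R^{(m)}$ given by the ray of the tube), and $R^{(n)}$ is identified with this subrepresentation of $R^{(m)}$; accordingly $\mathrm{Gr}(R^{(n)})$ is regarded as a subset of $\mathrm{Gr}(R^{(m)})$. Transverse quiver Grassmannian: let $M$ be an indecomposable representation of the affine quiver $Q$. (i) If $M$ is rigid, set $\mathrm{Tr}(M)=\mathrm{Gr}(M)$. (ii) If $M$ is not rigid, then $M$ is regular and lies in a tube of some rank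 $p\ge1$. Let $R_i$, $i\in\mathbb{Z}/p\mathbb{Z}$, be the quasi-simple representations in this tube, ordered so that $\tau R_i\simeq R_{i-1}$ for all $i$, where $\tau$ is the Auslander-Reiten translation. Up to relabeling, $M\simeq R_0^{(lp+k)}$ for unique integers $l\ge1$ and $0\le k\le p-1$. Then $$\mathrm{Tr}(M)=\mathrm{Gr}(M)\setminus\{N\in\mathrm{Gr}(M)\mid R_0^{(k+1)}\subset N\subset R_0^{(lp-1)}\},$$ where $R_0^{(k+1)}$ and $R_0^{(lp-1)}$ are viewed as the unique regular subrepresentations of $M=R_0^{(lp+k)}$ of quasi-lengths $k+1$ and $lp-1$ respectively, i.e. the images of the monomorphisms $R_0^{(k+1)}\to M$ and $R_0^{(lp-1)}\to M$ given by the ray of the tube (the removed set is empty if $k+1>lp-1$). For $\mathbf e\in\mathbb{Z}_{\ge0}^{Q_0}$, set $\mathrm{Tr}_{\mathbf e}(M)=\mathrm{Tr}(M)\cap\mathrm{Gr}_{\mathbf e}(M)$. *)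

(* Defs.v *)
From HB Require Import structures.
From mathcomp Require Import all_boot all_order all_algebra.
From mathcomp Require Import all_classical all_reals topology.
(* The notations of mpoly clash with those of topology. *)
From mathcomp Require mpoly.
Import (canonicals) mpoly.

Set Implicit Arguments.
Unset Strict Implicit.
Unset Printing Implicit Defensive.

Import GRing.Theory.
Local Open Scope ring_scope.
Local Open Scope classical_set_scope.

Record quiver := Quiver {
  vertex : finType;
  arrow : finType;
  src : arrow -> vertex;
  tgt : arrow -> vertex }.

(* [ext_dynkin n E]: the graph with vertices 0, ..., n - 1 and list of edges E
   (each edge written once, with an arbitrary order of its end points) is an
   extended Dynkin diagram. The diagram of type A~_1 is a double edge. *)
Inductive ext_dynkin : nat -> seq (nat * nat) -> Prop :=
| ext_dynkin_A n : (0 < n)%N ->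
    ext_dynkin n.+1 (rcons [seq (k, k.+1) | k <- iota 0 n] (n, 0))
| ext_dynkin_D n : (4 <= n)%N ->
    ext_dynkin n.+1 ([:: (0, 2); (1, 2)]
                  ++ [seq (k, k.+1) | k <- iota 2 (n - 4)]
                  ++ [:: (n - 2, n - 1); (n - 2, n)])%N
| ext_dynkin_E6 :
    ext_dynkin 7 [:: (0, 1); (1, 2); (2, 3); (3, 4); (2, 5); (5, 6)]%N
| ext_dynkin_E7 :
    ext_dynkin 8 [:: (0, 1); (1, 2); (2, 3); (3, 4); (4, 5); (5, 6); (3, 7)]%N
| ext_dynkin_E8 :
    ext_dynkin 9 [:: (0, 1); (1, 2); (2, 3); (3, 4); (4, 5); (5, 6); (6, 7);
                     (2, 8)]%N.

Definition orientation_of (Q : quiver) (n : nat) (E : seq (nat * nat)) :=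
  exists (f : vertex Q -> 'I_n) (g : arrow Q -> 'I_(size E)),
    [/\ bijective f, bijective g
      & forall a : arrow Q,
          nth (0, 0)%N E (g a) = (f (src a) : nat, f (tgt a) : nat)
       \/ nth (0, 0)%N E (g a) = (f (tgt a) : nat, f (src a) : nat)].

Definition adjacent (Q : quiver) : rel (vertex Q) :=
  fun i j => [exists a : arrow Q, (src a == i) && (tgt a == j)].

Definition acyclic (Q : quiver) :=
  forall a : arrow Q, ~~ connect (@adjacent Q) (tgt a) (src a).

Definition affine_quiver (Q : quiver) :=
  (exists n E, ext_dynkin n E /\ orientation_of Q n E) /\ acyclic Q.

Definition euler_form (Q : quiver) (a b : vertex Q -> int) : int :=
  \sum_i a i * b i - \sum_(x : arrow Q) a (src x) * b (tgt x).

Section Representations.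
Variables (K : fieldType) (Q : quiver).

Record rep := Rep {
  rep_space :> vertex Q -> vectType K;
  rep_map : forall a : arrow Q, 'Hom(rep_space (src a), rep_space (tgt a)) }.

Definition dimvec (M : rep) (i : vertex Q) : nat := \dim {: M i}.

Record rep_hom (M N : rep) := RepHom {
  hom_at :> forall i, 'Hom(M i, N i);
  hom_comm : forall a : arrow Q,
    (hom_at (tgt a) \o rep_map M a = rep_map N a \o hom_at (src a))%VF }.

Definition hom_inj (M N : rep) (f : rep_hom M N) := forall i, injective (f i).
Definition hom_surj (M N : rep) (f : rep_hom M N) :=
  forall i, limg (f i) = fullv.

Definition iso (M N : rep) := exists f : rep_hom M N, hom_inj f /\ hom_surj f.

Record subrep (M : rep) := SubRep {
  sub_at :> forall i, {vspace M i};
  sub_stable : forall a : arrow Q,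
    (rep_map M a @: sub_at (src a) <= sub_at (tgt a))%VS }.

(* N as a representation; vsproj (N i) is the identity on N i *)
Definition rep_of (M : rep) (N : subrep M) : rep :=
  @Rep (fun i => subvs_of (N i))
       (fun a => linfun (vsproj (N (tgt a))) \o rep_map M a \o linfun vsval)%VF.

Definition sub_le (M : rep) (A B : subrep M) := forall i, (A i <= B i)%VS.

Definition rep_zero (M : rep) := forall i, {: M i}%VS = 0%VS.

Definition complementary (M : rep) (A B : subrep M) :=
  forall i, (A i + B i)%VS = fullv /\ (A i :&: B i)%VS = 0%VS.

Definition indecomposable (M : rep) :=
  ~ rep_zero M /\
  forall A B : subrep M, complementary A B ->
    rep_zero (rep_of A) \/ rep_zero (rep_of B).

Definition short_exact (L E N : rep) (f : rep_hom L E) (g : rep_hom E N) :=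
  [/\ hom_inj f, hom_surj g & forall i, limg (f i) = lker (g i)].

Definition section (L E : rep) (f : rep_hom L E) :=
  exists r : rep_hom E L, forall i, (r i \o f i)%VF = \1%VF.
Definition retraction (E N : rep) (g : rep_hom E N) :=
  exists s : rep_hom N E, forall i, (g i \o s i)%VF = \1%VF.

(* Ext^1(M, M) = 0, for the Ext group of Yoneda classes of extensions *)
Definition rigid (M : rep) :=
  forall (E : rep) (f : rep_hom M E) (g : rep_hom E M),
    short_exact f g -> retraction g.

Definition left_almost_split (L E : rep) (f : rep_hom L E) :=
  ~ section f /\
  forall (X : rep) (h : rep_hom L X), ~ section h ->
    exists h' : rep_hom E X, forall i, (h' i \o f i)%VF = h i.
Definition right_almost_split (E N : rep) (g : rep_hom E N) :=
  ~ retraction g /\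
  forall (X : rep) (h : rep_hom X N), ~ retraction h ->
    exists h' : rep_hom X E, forall i, (g i \o h' i)%VF = h i.

(* L is the Auslander-Reiten translate of N, i.e. L and N are the end terms of
   an almost split sequence. This relation determines N and L from each other
   up to isomorphism; it forces both to be indecomposable, N to be
   non-projective and L to be non-injective. *)
Definition tau (N L : rep) :=
  exists (E : rep) (f : rep_hom L E) (g : rep_hom E N),
    [/\ short_exact f g, left_almost_split f & right_almost_split g].

Definition projective (P : rep) :=
  forall (X Y : rep) (g : rep_hom X Y) (h : rep_hom P Y), hom_surj g ->
    exists h' : rep_hom P X, forall i, (g i \o h' i)%VF = h i.
Definition injective_rep (I : rep) :=
  forall (X Y : rep) (f : rep_hom X Y) (h : rep_hom X I), hom_inj f ->
    exists h' : rep_hom Y I, forall i, (h' i \o f i)%VF = h i.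

(* the indecomposable M such that tau^m M is projective for some m >= 0 *)
Inductive preprojective : rep -> Prop :=
| preprojective_proj P : indecomposable P -> projective P -> preprojective P
| preprojective_tau N L : tau N L -> preprojective L -> preprojective N.

(* the indecomposable M such that tau^-m M is injective for some m >= 0 *)
Inductive preinjective : rep -> Prop :=
| preinjective_inj I : indecomposable I -> injective_rep I -> preinjective I
| preinjective_tau N L : tau N L -> preinjective N -> preinjective L.

Definition regular (M : rep) :=
  forall A B : subrep M, complementary A B -> indecomposable (rep_of A) ->
    ~ preprojective (rep_of A) /\ ~ preinjective (rep_of A).

(* The subobjects of M in the category of regular representations are the
   subrepresentations of M that are regular. *)
Definition quasi_simple (M : rep) :=
  [/\ regular M, ~ rep_zero M
    & forall A : subrep M, regular (rep_of A) ->
        rep_zero (rep_of A) \/ forall i, A i = fullv].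

(* existence of a composition series of length n in the category of regular
   representations *)
Inductive quasi_length : rep -> nat -> Prop :=
| quasi_length0 M : rep_zero M -> quasi_length M 0
| quasi_lengthS L E S n (f : rep_hom L E) (g : rep_hom E S) :
    regular E -> short_exact f g -> quasi_length L n -> quasi_simple S ->
    quasi_length E n.+1.

(* the sum of all quasi-simple subrepresentations *)
Definition quasi_socle (M : rep) (S : subrep M) :=
  (forall A : subrep M, quasi_simple (rep_of A) -> sub_le A S) /\
  (forall B : subrep M,
     (forall A : subrep M, quasi_simple (rep_of A) -> sub_le A B) ->
     sub_le S B).

(* M is isomorphic to R^(n), for R quasi-simple and n >= 1 *)
Definition regular_indec (R : rep) (n : nat) (M : rep) :=
  [/\ indecomposable M, regular M, quasi_length M n
    & exists2 S : subrep M, quasi_socle S & iso (rep_of S) R].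

(* (R i), for i in Z/p, is the list of the quasi-simple representations of a
   tube of rank p: these form a single finite tau-orbit. *)
Definition tube (p : nat) (R : 'I_p -> rep) :=
  [/\ forall i, quasi_simple (R i),
      forall i j, iso (R i) (R j) -> i = j
    & forall i, tau (R i) (R (ord_pred i))].

(* The index 0 of the definition is the index i below. A and B are the unique
   regular subrepresentations of M of quasi-lengths k + 1 and l p - 1. *)
Definition non_transverse (M : rep) (N : subrep M) :=
  exists (p : nat) (R : 'I_p -> rep) (i : 'I_p) (l k : nat),
    [/\ tube R, (1 <= l)%N, (k < p)%N, regular_indec (R i) (l * p + k) M
      & exists A B : subrep M,
          [/\ regular (rep_of A) /\ quasi_length (rep_of A) k.+1,
              regular (rep_of B) /\ quasi_length (rep_of B) (l * p - 1),
              sub_le A N & sub_le N B]].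

Definition Tr (M : rep) : set (subrep M) :=
  [set N | ~ rigid M -> ~ non_transverse N].

(* closed points of the scheme Gr_e(M), for K algebraically closed *)
Record qGr (M : rep) (e : vertex Q -> nat) := QGr {
  qGr_sub :> subrep M;
  qGr_dim : forall i, \dim (qGr_sub i) = e i }.

Definition Tr_e (M : rep) (e : vertex Q -> nat) : set (qGr M e) :=
  [set N | Tr (N : subrep M)].

End Representations.

Arguments Tr_e {K Q} M e _.

Section Zariski.
Variables (K : fieldType) (Q : quiver) (M : rep K Q) (e : vertex Q -> nat).

Definition frame := forall i, (e i).-tuple (M i).

Definition frame_of (N : qGr M e) (b : frame) := forall i, basis_of (N i) (b i).

Definition entry := {i : vertex Q & 'I_(e i) * 'I_(dimvec M i)}%type.

Definition frame_entry (b : frame) (x : entry) : K :=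
  coord (vbasis {: M (tag x)}) (tagged x).2 (tnth (b (tag x)) (tagged x).1).

Definition frame_poly := mpoly.mpoly #|{: entry}| K.

Definition frame_eval (p : frame_poly) (b : frame) : K :=
  mpoly.meval (fun k => frame_entry b (enum_val k)) p.

(* A product of Grassmannians is the quotient of the variety of tuples of
   frames by a product of general linear groups, and carries the quotient
   topology: a set of points is closed when the set of all bases of its members
   is cut out by polynomials in the entries of the basis vectors. *)
Definition zariski_closed (Z : set (qGr M e)) :=
  exists P : set frame_poly, forall (N : qGr M e) (b : frame), frame_of N b ->
    (Z N <-> forall p, P p -> frame_eval p b = 0).

Definition zariski_open (U : set (qGr M e)) := zariski_closed (~` U).

Lemma zariski_openT : zariski_open setT.
Proof.
exists [set (1 : frame_poly)] => N b _; rewrite setCT; split=> // /(_ 1 erefl).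
by rewrite /frame_eval mpoly.meval1 => /eqP; rewrite oner_eq0.
Qed.

Lemma zariski_openI : setI_closed zariski_open.
Proof.
move=> A B [P PA] [P' PB].
exists [set r : frame_poly | exists p q, [/\ P p, P' q & r = p * q]] => N b Nb.
rewrite setCI; split=> [[AN|BN] r [p [q [Pp Pq ->]]]|H].
- by rewrite /frame_eval mpoly.mevalM [X in X * _]((PA N b Nb).1 AN p Pp) mul0r.
- by rewrite /frame_eval mpoly.mevalM [X in _ * X]((PB N b Nb).1 BN q Pq) mulr0.
- have [?|nA] := pselect ((~` A) N); first by left.
  right; apply/(PB N b Nb) => q Pq.
  apply: contrapT => qb; apply: nA; apply/(PA N b Nb) => p Pp.
  have /eqP := H (p * q) (ex_intro _ p (ex_intro _ q (And3 Pp Pq erefl))).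
  by rewrite /frame_eval mpoly.mevalM mulf_eq0 => /orP[/eqP //|/eqP].
Qed.

Lemma zariski_open_bigU (I : Type) (f : I -> set (qGr M e)) :
  (forall i, zariski_open (f i)) -> zariski_open (\bigcup_i f i).
Proof.
move=> fo.
exists [set p : frame_poly | exists i, forall N b, frame_of N b -> ~ f i N ->
          frame_eval p b = 0] => N b Nb.
split=> [nN p [i Hp]|H [i _ fiN]].
  by apply: Hp (Nb) _ => fiN; apply: nN; exists i.
have [P HP] := fo i.
have : (~` f i) N; last by [].
apply/(HP N b Nb) => p Pp; apply: H; exists i => N' b' Nb' nf.
by apply: (HP N' b' Nb').1.
Qed.

HB.instance Definition _ := gen_eqMixin (qGr M e).
HB.instance Definition _ := gen_choiceMixin (qGr M e).
HB.instance Definition _ := @isOpenTopological.Build (qGr M e)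
  zariski_open zariski_openT zariski_openI zariski_open_bigU.

End Zariski.

Section Krull.
Variable T : topologicalType.

Definition irreducible (S : set T) :=
  S !=set0 /\
  forall A B : set T, closed A -> closed B -> S `<=` A `|` B ->
    S `<=` A \/ S `<=` B.

Definition irreducible_component (Z : set T) :=
  irreducible Z /\
  forall Z' : set T, irreducible Z' -> Z `<=` Z' -> Z' `<=` Z.

(* S has a strictly increasing chain Z 0, ..., Z n of relatively closed
   irreducible subsets *)
Definition has_chain (S : set T) (n : nat) :=
  exists Z : nat -> set T,
    (forall j, (j <= n)%N -> closed (Z j) /\ irreducible (Z j `&` S)) /\
    (forall j, (j < n)%N -> Z j `&` S `<` Z j.+1 `&` S).

Definition krull_dim (S : set T) (n : nat) :=
  has_chain S n /\ ~ has_chain S n.+1.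

(* the minimum of the dimensions of the open neighbourhoods of x *)
Definition local_dim (x : T) (n : nat) :=
  (exists U : set T, [/\ open U, U x & krull_dim U n]) /\
  forall U : set T, open U -> U x -> has_chain U n.

End Krull.

Section Smooth.
Variables (K : fieldType) (Q : quiver) (M : rep K Q) (e : vertex Q -> nat).
Variable N : qGr M e.

(* The tangent vectors at N are the points of the scheme Gr_e(M) over the dual
   numbers K[eps] whose reduction is N. Write v + eps w for the elements of
   K[eps] (x) M_i. The K[eps]-points over N of the Grassmannian of M_i are the
   submodules {v + eps w | v \in N_i, w - psi v \in N_i}, for psi a linear map
   from N_i to M_i, and psi only matters modulo the maps with values in N_i;
   this is the identification of the tangent space of the Grassmannian with
   Hom(N_i, M_i / N_i), whose linear structure is that of the tangent space. *)
Definition lift_family := forall i, 'Hom(subvs_of (N i), M i).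

Definition dual_point (psi : lift_family) (i : vertex Q) (v w : M i) :=
  v \in N i /\ w - psi i (vsproj (N i) v) \in N i.
Arguments dual_point : clear implicits.

(* the equations M_a (V_i) \subset V_j of the scheme, over K[eps] *)
Definition tangent (psi : lift_family) :=
  forall (a : arrow Q) (v w : M (src a)), dual_point psi (src a) v w ->
    dual_point psi (tgt a) (rep_map M a v) (rep_map M a w).

Definition null_tangent (psi : lift_family) :=
  forall i (u : subvs_of (N i)), psi i u \in N i.

Definition tangent_dim (n : nat) :=
  exists t : 'I_n -> lift_family,
    (forall j, tangent (t j)) /\
    forall psi, tangent psi ->
      exists! c : 'rV[K]_n,
        null_tangent (fun i => psi i - \sum_j c 0 j *: t j i).

Definition smooth_point := exists n, tangent_dim n /\ local_dim N n.

End Smooth.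

(* Main.v *)
(* A point N is transverse if and only if Ext(N, M / N) = 0, and this holds if and only
   if N is a smooth point on a component of dimension <e, d - e>.

   For the first equivalence, a rigid M has no Ext(N, M / N) because the category is
   hereditary. Otherwise M is uniserial in a tube, Ext(N, M / N) is dual to
   Hom(M / N, tau N), and a nonzero map yields regular subobjects A <= N <= B of M of
   quasi-lengths at least k + 1 and at most l p - 1; conversely Ext(A, M / B) is not 0
   for the subobjects of these quasi-lengths, by the Euler form.

   For the second one, let h be the dimension of the tangent space Hom(N, M / N), so that
   <e, d - e> = h - dim Ext(N, M / N). Near N the scheme lies in a subscheme V(g) of an
   affine space, smooth of dimension h at N, and Gr = V(g) when the Ext space is 0. The
   solutions of g = 0 in formal power series in h variables define a prime ideal
   P = (g) in the local ring at N (Krull's intersection theorem), and setting variables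
   to 0 gives a chain of primes of length h, realised by closed sets through N by the
   Nullstellensatz. Derivations of function fields bound the length of all chains by h.
   Conversely a chain of length h near N has P as the ideal of its last member, so that
   every component through N has dimension at least h. *)

From HB Require Import structures.
Require Import Defs.
From mathcomp Require Import all_boot all_order all_algebra.
From mathcomp Require Import all_classical all_reals topology complex.
From mathcomp Require mpoly.
Import (canonicals) mpoly.
From mathcomp Require Import zify ring lra.

Set Implicit Arguments.
Unset Strict Implicit.
Unset Printing Implicit Defensive.

Import Order.TTheory GRing.Theory Num.Theory.
Local Open Scope ring_scope.

(** * Linear algebra *)

(** No classification of the representations of affine quivers enters. Hom and Ext are kernel and
    cokernel of one linear map [dlt], so Ext is right exact by construction and the Euler form is a
    rank count. The object representing the dual of Ext(X, -) is found as the largest L with a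
    functional on Ext(X, L) that no nonzero map into L kills. The rest of the algebra comes from the
    defect: the symmetrised Euler form is a sum of squares, so in an infinite tau-orbit two
    dimension vectors differ by a multiple of delta. Hence an orbit that never meets a projective
    has defect at least 0, regular means semistable of defect 0, quasi-simple means stable, and
    stable objects are tau-periodic.

    On the geometric side the Grassmannian may be singular and reducible, and its dimension has to
    be controlled at one point. The chart equations read x_l = q_l(x) with q_l quadratic, so the
    power series solution is an explicit iteration, of which only truncations are used, and the
    Jacobian determinant at N is 1. *)

Lemma dchoice (I : Type) (V : I -> Type) (P : forall i, V i -> Prop) :
  (forall i, exists y, P i y) -> exists f : forall i, V i, forall i, P i (f i).
Proof. by move=> H; exists (fun i => projT1 (cid (H i))) => i; case: cid. Qed.

Section Fam.
Import VectorInternalTheory.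
Variables (K : fieldType) (I : finType) (V : I -> vectType K).

(** A named copy of the dependent product, so that families of linear maps over the vertices or the
    arrows form a [vectType] and have a dimension. *)
Definition fam := forall i, V i.

HB.instance Definition _ := gen_eqMixin fam.
HB.instance Definition _ := gen_choiceMixin fam.

Let fadd (f g : fam) : fam := fun i => f i + g i.
Let fopp (f : fam) : fam := fun i => - f i.
Let fzero : fam := fun i => 0.
Let fscale (a : K) (f : fam) : fam := fun i => a *: f i.

Fact fam_addA : associative fadd.
Proof. by move=> f g h; apply: functional_extensionality_dep => i; rewrite /fadd addrA. Qed.
Fact fam_addC : commutative fadd.
Proof. by move=> f g; apply: functional_extensionality_dep => i; rewrite /fadd addrC. Qed.
Fact fam_add0 : left_id fzero fadd.
Proof. by move=> f; apply: functional_extensionality_dep => i; rewrite /fadd add0r. Qed.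
Fact fam_addN : left_inverse fzero fopp fadd.
Proof. by move=> f; apply: functional_extensionality_dep => i; rewrite /fadd addNr. Qed.

HB.instance Definition _ :=
  GRing.isZmodule.Build fam fam_addA fam_addC fam_add0 fam_addN.

Fact fam_scaleA a b (v : fam) : fscale a (fscale b v) = fscale (a * b) v.
Proof. by apply: functional_extensionality_dep => i; rewrite /fscale scalerA. Qed.
Fact fam_scale1 : left_id 1 fscale.
Proof. by move=> f; apply: functional_extensionality_dep => i; rewrite /fscale scale1r. Qed.
Fact fam_scaleDr : right_distributive fscale +%R.
Proof. by move=> a f g; apply: functional_extensionality_dep => i; apply: scalerDr. Qed.
Fact fam_scaleDl v : {morph fscale^~ v : a b / a + b}.
Proof. by move=> a b; apply: functional_extensionality_dep => i; apply: scalerDl. Qed.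

HB.instance Definition _ := GRing.Zmodule_isLmodule.Build K fam
  fam_scaleA fam_scale1 fam_scaleDr fam_scaleDl.

Lemma famD (f g : fam) i : (f + g) i = f i + g i. Proof. by []. Qed.
Lemma famN (f : fam) i : (- f) i = - f i. Proof. by []. Qed.
Lemma famZ a (f : fam) i : (a *: f) i = a *: f i. Proof. by []. Qed.
Lemma fam0 i : (0 : fam) i = 0. Proof. by []. Qed.
Lemma fam_sum J (r : seq J) P (F : J -> fam) i :
  (\sum_(j <- r | P j) F j) i = \sum_(j <- r | P j) F j i.
Proof. by elim/big_rec2: _ => // j x y Pj <-. Qed.

Lemma famP (f g : fam) : (forall i, f i = g i) <-> f = g.
Proof. by split=> [H|-> //]; exact: functional_extensionality_dep. Qed.

Local Notation idx := {i : I & 'I_(dim (V i))}.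

Fact fam_vect_iso : Vector.axiom #|{: idx}| fam.
Proof.
pose to (f : fam) : 'rV[K]_#|{: idx}| :=
  \row_k v2r (f (tag (enum_val k))) 0 (tagged (enum_val k)).
pose of_ (r : 'rV[K]_#|{: idx}|) : fam :=
  fun i => r2v (\row_j r 0 (enum_rank (Tagged (fun i => 'I_(dim (V i))) j))).
exists to.
  by move=> a f g; apply/rowP => k; rewrite !mxE famD famZ linearP !mxE.
exists of_ => [f|r].
  apply/famP => i; apply: (can_inj v2rK); rewrite r2vK.
  by apply/rowP => j; rewrite !mxE enum_rankK.
by apply/rowP => k; rewrite !mxE r2vK !mxE -[RHS](congr1 (r 0) (enum_valK k)); case: (enum_val k).
Qed.

HB.instance Definition _ := Lmodule_hasFinDim.Build K fam fam_vect_iso.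

Lemma dim_fam : \dim {: fam} = (\sum_i \dim {: V i})%N.
Proof.
rewrite dimvf {1}/dim /= card_tagged sumnE big_map big_enum /=.
by apply: eq_bigr => i _; rewrite dimvf card_ord.
Qed.

End Fam.

Section LinAlg.
Import VectorInternalTheory.
Variable K : fieldType.

Lemma lkerP (V W : vectType K) (f : 'Hom(V, W)) v : reflect (f v = 0) (v \in lker f).
Proof. by rewrite memv_ker; apply: eqP. Qed.

Lemma injP_lker (V W : vectType K) (f : 'Hom(V, W)) :
  injective f <-> forall v, f v = 0 -> v = 0.
Proof.
split=> [fi v fv|H]; first by apply: fi; rewrite fv linear0.
by move=> x y e; apply/eqP; rewrite -subr_eq0; apply/eqP/H; rewrite linearB /= e subrr.
Qed.

Lemma inj_linv (V W : vectType K) (f : 'Hom(V, W)) :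
  injective f -> exists g : 'Hom(W, V), (g \o f = \1)%VF.
Proof.
move=> fi; exists (f^-1)%VF; apply/lfunP => v; rewrite comp_lfunE lfunE /=.
have f0 : lker f = 0%VS.
  apply/eqP; rewrite -subv0; apply/subvP => w /lkerP fw.
  by rewrite memv0; apply/eqP/fi; rewrite fw linear0.
by rewrite lker0_lfunK // f0.
Qed.

Lemma surj_rinv (V W : vectType K) (f : 'Hom(V, W)) :
  limg f = fullv -> exists g : 'Hom(W, V), (f \o g = \1)%VF.
Proof.
move=> fs; exists (f^-1)%VF; apply/lfunP => v; rewrite comp_lfunE lfunE /=.
by rewrite limg_lfunVK // fs memvf.
Qed.

Lemma limg_fullP (V W : vectType K) (f : 'Hom(V, W)) :
  limg f = fullv <-> forall w, exists v, f v = w.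
Proof.
split=> [fs w|H].
  have: w \in limg f by rewrite fs memvf.
  by case/memv_imgP=> v _ ->; exists v.
apply/vspaceP => w; rewrite memvf; have [v <-] := H w.
by rewrite memv_img ?memvf.
Qed.

(** P need not be decidable: a subspace of maximal dimension among those inside P contains all of P,
    because adding the line of one more vector of P stays inside P. *)
Lemma vspace_of_pred (V : vectType K) (P : V -> Prop) :
  P 0 -> (forall a u v, P u -> P v -> P (a *: u + v)) ->
  exists U : {vspace V}, forall v, P v <-> v \in U.
Proof.
move=> P0 PL.
pose sub (U : {vspace V}) := forall v, v \in U -> P v.
have ex0: exists n, `[< exists U, sub U /\ \dim U = n >].
  by exists 0%N; apply/asboolP; exists 0%VS; split; rewrite ?dimv0 // => v; rewrite memv0 => /eqP ->.
have ub n : `[< exists U, sub U /\ \dim U = n >] -> (n <= \dim {:V})%N.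
  by move=> /asboolP[U [_ <-]]; rewrite dimvS // subvf.
case: (ex_maxnP ex0 ub) => n /asboolP[U [sU dU]] nmax.
exists U => v; split; last exact: sU.
move=> Pv; apply/negP => /negP vU.
have: sub (U + <[v]>)%VS.
  move=> w /memv_addP[u uU [x /vlineP[a ->] ->]].
  by rewrite addrC; apply: PL => //; apply: sU.
move=> sU'; have: (\dim (U + <[v]>)%VS <= n)%N by apply: nmax; apply/asboolP; exists (U + <[v]>)%VS.
rewrite -dU leqNgt => /negP; apply.
rewrite ltnNge; apply/negP => le.
have /eqP e : U == (U + <[v]>)%VS by rewrite eqEdim addvSl le.
by move: vU; rewrite e memvE addvSr.
Qed.

(** The functional is a coordinate of [x - projv U x] that does not vanish at v, divided by its
    value at v. *)
Lemma sep_functional (V : vectType K) (U : {vspace V}) v : v \notin U ->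
  exists f : 'Hom(V, K^o), f v = 1 /\ forall u, u \in U -> f u = 0.
Proof.
move=> vU; pose w := v - projv U v.
have w0 : w != 0.
  apply/eqP => /eqP; rewrite subr_eq0 => /eqP e.
  by move: vU; rewrite e memv_proj.
have [i ci] : exists i, v2r w 0 i != 0.
  apply/existsP; apply: contraNT w0; rewrite negb_exists => /forallP H.
  apply/eqP/(can_inj v2rK)/rowP => i; rewrite linear0 mxE; apply/eqP.
  by have := H i; rewrite negbK.
pose g (x : V) : K^o := (v2r w 0 i)^-1 * v2r (x - projv U x) 0 i.
have gl : linear g.
  move=> a x y; rewrite /g [projv U _]linearP /=.
  have -> : a *: x + y - (a *: projv U x + projv U y) = a *: (x - projv U x) + (y - projv U y).
    by rewrite scalerBr opprD addrACA.
  rewrite linearP !mxE mulrDr; congr (_ + _); by rewrite mulrCA.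
pose Lg := GRing.isLinear.Build K V K^o *%R g gl.
pose gL : {linear V -> K^o} := HB.pack g Lg.
exists (linfun gL); split.
  by rewrite lfunE /= /g mulVf.
by move=> u uU; rewrite lfunE /= /g projv_id // subrr linear0 mxE mulr0.
Qed.

End LinAlg.

Section MkHom.
Variables (K : fieldType) (V W : vectType K).

Definition mkhom (f : V -> W) (fl : linear f) : 'Hom(V, W) :=
  linfun (HB.pack f (GRing.isLinear.Build K V W *:%R f fl) : {linear V -> W}).

Lemma mkhomE f fl v : @mkhom f fl v = f v.
Proof. by rewrite lfunE. Qed.

End MkHom.

Section LfunLin.
Variables (K : fieldType) (V W : vectType K) (f : 'Hom(V, W)).
Lemma lfB x y : f (x - y) = f x - f y. Proof. exact: linearB. Qed.
Lemma lfD x y : f (x + y) = f x + f y. Proof. exact: linearD. Qed.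
Lemma lf0 : f 0 = 0. Proof. exact: linear0. Qed.
Lemma lfZ k x : f (k *: x) = k *: f x. Proof. exact: linearZ. Qed.
End LfunLin.

(** * Representations and extensions *)

(* A representation of an acyclic quiver has the two-term complex C0 X Y -> C1 X Y
   with kernel Hom(X, Y) and cokernel Ext(X, Y); the maps of [C0] need not be
   homomorphisms. *)
Notation C0 X Y := (fam (fun i => 'Hom(rep_space X i, rep_space Y i))).
Notation C1 X Y := (fam (fun a => 'Hom(rep_space X (src a), rep_space Y (tgt a)))).

Section RepCat.
Variables (K : fieldType) (Q : quiver).
Implicit Types (X Y Z M : rep K Q).

Definition isHom X Y (f : C0 X Y) :=
  forall a x, f (tgt a) (rep_map X a x) = rep_map Y a (f (src a) x).

Definition mono X Y (f : C0 X Y) := forall i x, f i x = 0 -> x = 0.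
Definition epi X Y (f : C0 X Y) := forall i y, exists x, f i x = y.
Definition isoF X Y (f : C0 X Y) := mono f /\ epi f.

Definition idF X : C0 X X := fun i => \1%VF.
Definition cmp X Y Z (g : C0 Y Z) (f : C0 X Y) : C0 X Z := fun i => (g i \o f i)%VF.

Lemma cmpE X Y Z (g : C0 Y Z) (f : C0 X Y) i x : cmp g f i x = g i (f i x).
Proof. by rewrite comp_lfunE. Qed.
Lemma idFE X i x : idF X i x = x. Proof. exact: id_lfunE. Qed.

Lemma C0P X Y (f g : C0 X Y) : (forall i x, f i x = g i x) -> f = g.
Proof. by move=> H; apply/famP => i; apply/lfunP. Qed.
Lemma C1P X Y (f g : C1 X Y) : (forall a x, f a x = g a x) -> f = g.
Proof. by move=> H; apply/famP => i; apply/lfunP. Qed.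

Lemma addFE X Y (f g : C0 X Y) i x : (f + g) i x = f i x + g i x.
Proof. by rewrite famD add_lfunE. Qed.
Lemma oppFE X Y (f : C0 X Y) i x : (- f) i x = - f i x.
Proof. by rewrite famN opp_lfunE. Qed.
Lemma scaleFE X Y k (f : C0 X Y) i x : (k *: f) i x = k *: f i x.
Proof. by rewrite famZ scale_lfunE. Qed.
Lemma zeroFE X Y i x : (0 : C0 X Y) i x = 0.
Proof. by rewrite fam0 zero_lfunE. Qed.
Lemma addF1E X Y (f g : C1 X Y) i x : (f + g) i x = f i x + g i x.
Proof. by rewrite famD add_lfunE. Qed.
Lemma oppF1E X Y (f : C1 X Y) i x : (- f) i x = - f i x.
Proof. by rewrite famN opp_lfunE. Qed.
Lemma scaleF1E X Y k (f : C1 X Y) i x : (k *: f) i x = k *: f i x.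
Proof. by rewrite famZ scale_lfunE. Qed.
Lemma zeroF1E X Y i x : (0 : C1 X Y) i x = 0.
Proof. by rewrite fam0 zero_lfunE. Qed.
Definition FE := (cmpE, idFE, addFE, oppFE, scaleFE, zeroFE, addF1E, oppF1E, scaleF1E, zeroF1E).

Let dlt_fun X Y (f : C0 X Y) : C1 X Y :=
  fun a => ((rep_map Y a \o f (src a))%VF - (f (tgt a) \o rep_map X a)%VF).
Fact dlt_linear X Y : linear (@dlt_fun X Y).
Proof.
move=> k f g; apply: C1P => a x; rewrite !FE /dlt_fun !(add_lfunE, opp_lfunE, comp_lfunE) !FE.
by rewrite linearP scalerBr opprD addrACA.
Qed.
Definition dlt X Y : 'Hom(C0 X Y, C1 X Y) := mkhom (@dlt_linear X Y).

Lemma dltE X Y (f : C0 X Y) a x :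
  dlt X Y f a x = rep_map Y a (f (src a) x) - f (tgt a) (rep_map X a x).
Proof. by rewrite mkhomE /dlt_fun !(add_lfunE, opp_lfunE, comp_lfunE). Qed.

Lemma isHomP X Y (f : C0 X Y) : isHom f <-> f \in lker (dlt X Y).
Proof.
split=> [fh|/lkerP H a x].
  by apply/lkerP/C1P => a x; rewrite dltE FE fh subrr.
by apply/eqP; rewrite eq_sym -subr_eq0 -dltE H FE.
Qed.

Definition hom X Y := \dim (lker (dlt X Y)).
Definition ext X Y := (\dim {: C1 X Y} - \dim (limg (dlt X Y)))%N.

Lemma dim_fam_Hom (I : finType) (V W : I -> vectType K) :
  \dim {: fam (fun i => 'Hom(V i, W i))} = (\sum_i \dim {: V i} * \dim {: W i})%N.
Proof. by rewrite dim_fam; apply: eq_bigr => i _; rewrite !dimvf. Qed.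

Lemma Posz_sum (I : finType) (F : I -> nat) :
  Posz (\sum_i F i)%N = \sum_i Posz (F i).
Proof. exact: (big_morph Posz PoszD erefl). Qed.

(** The Euler form is the Euler characteristic of the complex C0 -> C1, so rank-nullity gives it
    without any resolution. *)
Lemma euler_hom_ext X Y : (hom X Y)%:Z - (ext X Y)%:Z =
  euler_form (fun i => (dimvec X i)%:Z) (fun i => (dimvec Y i)%:Z).
Proof.
rewrite /hom /ext /euler_form.
have le : (\dim (limg (dlt X Y)) <= \dim {: C1 X Y})%N by rewrite dimvS ?subvf.
have e : (\dim (lker (dlt X Y)) + \dim (limg (dlt X Y)) = \dim {: C0 X Y})%N.
  by rewrite -(limg_ker_dim (dlt X Y) fullv) capfv.
rewrite -subzn // opprB addrA -PoszD e !dim_fam_Hom !Posz_sum.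
by congr (_ - _); apply: eq_bigr => i _; rewrite PoszM.
Qed.

Lemma ext0P X Y : ext X Y = 0%N <-> forall c, c \in limg (dlt X Y).
Proof.
rewrite /ext; split=> [/eqP|H].
  rewrite subn_eq0 => le c; suff -> : limg (dlt X Y) = fullv by rewrite memvf.
  by apply/eqP; rewrite eqEdim subvf.
suff -> : limg (dlt X Y) = fullv by rewrite subnn.
by apply/vspaceP => c; rewrite H memvf.
Qed.

Lemma hom0P X Y : hom X Y = 0%N <-> forall f : C0 X Y, isHom f -> f = 0.
Proof.
rewrite /hom; split=> [/eqP|H].
  by rewrite dimv_eq0 => /eqP k0 f /isHomP; rewrite k0 memv0 => /eqP.
apply/eqP; rewrite dimv_eq0 -subv0; apply/subvP => f /isHomP/H ->.
exact: mem0v.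
Qed.

Lemma hom_neq0 X Y : hom X Y <> 0%N -> exists2 f : C0 X Y, isHom f & f <> 0.
Proof.
move=> h; apply: contrapT => H; apply: h; apply/hom0P => f fh.
by apply: contrapT => f0; apply: H; exists f.
Qed.

Lemma hom_neq0I X Y (f : C0 X Y) : isHom f -> f <> 0 -> hom X Y <> 0%N.
Proof. by move=> fh f0 /hom0P/(_ f fh). Qed.

Lemma isHom_id X : isHom (idF X).
Proof. by move=> a x; rewrite !FE. Qed.
Lemma isHom_cmp X Y Z (g : C0 Y Z) (f : C0 X Y) : isHom g -> isHom f -> isHom (cmp g f).
Proof. by move=> gh fh a x; rewrite !FE fh gh. Qed.
Lemma isHomD X Y (f g : C0 X Y) : isHom f -> isHom g -> isHom (f + g).
Proof. by rewrite !isHomP; apply: memvD. Qed.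
Lemma isHomB X Y (f g : C0 X Y) : isHom f -> isHom g -> isHom (f - g).
Proof. by rewrite !isHomP; apply: memvB. Qed.
Lemma isHomZ X Y k (f : C0 X Y) : isHom f -> isHom (k *: f).
Proof. by rewrite !isHomP; apply: memvZ. Qed.
Lemma isHom0 X Y : isHom (0 : C0 X Y).
Proof. by rewrite isHomP mem0v. Qed.

Lemma monoF_inj X Y (f : C0 X Y) i : mono f -> injective (f i).
Proof. by move=> fm; apply/injP_lker; apply: fm. Qed.

Lemma mono_linv X Y (f : C0 X Y) : mono f -> exists r : C0 Y X, cmp r f = idF X.
Proof.
move=> fm.
have /dchoice [r Hr] : forall i, exists r : 'Hom(Y i, X i), (r \o f i = \1)%VF.
  by move=> i; apply: inj_linv; apply: monoF_inj.
by exists r; apply/famP.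
Qed.
End RepCat.

Section RepCat2.
Variables (K : fieldType) (Q : quiver).
Implicit Types (X Y Z W E M : rep K Q).

Lemma epi_rinv X Y (f : C0 X Y) : epi f -> exists s : C0 Y X, cmp f s = idF Y.
Proof.
move=> fe.
have /dchoice [r Hr] : forall i, exists r : 'Hom(Y i, X i), (f i \o r = \1)%VF.
  by move=> i; apply: surj_rinv; apply/limg_fullP; apply: fe.
by exists r; apply/famP.
Qed.

Lemma cmp_id X Y (f : C0 X Y) (g : C0 Y X) : cmp f g = idF Y -> forall i x, f i (g i x) = x.
Proof. by move=> e i x; rewrite -cmpE e idFE. Qed.

Lemma monoB X Y (f : C0 X Y) i x y : mono f -> f i x = f i y -> x = y.
Proof. by move=> fm e; apply: (monoF_inj fm e). Qed.

Lemma isoF_inv X Y (f : C0 X Y) : isHom f -> isoF f ->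
  exists g : C0 Y X, [/\ isHom g, cmp f g = idF Y, cmp g f = idF X & isoF g].
Proof.
move=> fh [fm fe]; have [g fg] := epi_rinv fe.
have fgE := cmp_id fg.
have gfE i x : g i (f i x) = x by apply: (monoB fm); rewrite fgE.
exists g; split=> //.
- by move=> a x; apply: (monoB fm); rewrite fgE fh fgE.
- by apply: C0P => i x; rewrite !FE.
split=> [i y g0|i x]; last by exists (f i x).
by rewrite -(fgE i y) g0 linear0.
Qed.

Lemma lift_mono X Y Z (i : C0 Y Z) (f : C0 X Z) : isHom i -> mono i -> isHom f ->
  (forall v x, exists y, i v y = f v x) ->
  exists2 g : C0 X Y, isHom g & forall v x, i v (g v x) = f v x.
Proof.
move=> ih im fh H; have [r ri] := mono_linv im; have rE := cmp_id ri.
have ir v x : i v (r v (f v x)) = f v x by have [y <-] := H v x; rewrite rE.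
exists (cmp r f) => [a x|v x]; last by rewrite FE ir.
by apply: (monoB im); rewrite ih !FE !ir fh.
Qed.

Lemma desc_epi X Y Z (p : C0 X Y) (f : C0 X Z) : isHom p -> epi p -> isHom f ->
  (forall v x, p v x = 0 -> f v x = 0) ->
  exists2 g : C0 Y Z, isHom g & forall v x, g v (p v x) = f v x.
Proof.
move=> ph pe fh H; have [s ps] := epi_rinv pe; have sE := cmp_id ps.
have fE v x : f v (s v (p v x)) = f v x.
  apply/eqP; rewrite -subr_eq0 -linearB; apply/eqP/H.
  by rewrite linearB /= sE subrr.
exists (cmp f s) => [a y|v x]; last by rewrite FE fE.
have [x <-] := pe _ y.
by rewrite !FE -ph fE fh fE.
Qed.

Definition incl M (N : subrep M) : C0 (rep_of N) M := fun i => linfun vsval.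
Lemma inclE M (N : subrep M) i u : incl N i u = vsval u.
Proof. by rewrite lfunE. Qed.

Lemma sub_stableE M (N : subrep M) a x : x \in N (src a) -> rep_map M a x \in N (tgt a).
Proof. by move=> xN; apply: (subvP (sub_stable N a)); apply: memv_img. Qed.

Lemma isHom_incl M (N : subrep M) : isHom (incl N).
Proof.
move=> a u; rewrite !inclE /= !comp_lfunE !lfunE /= vsprojK //.
by apply: sub_stableE; apply: subvsP.
Qed.
Arguments isHom_incl {M} N.

Lemma mono_incl M (N : subrep M) : mono (incl N).
Proof. by move=> i u; rewrite inclE => u0; apply: val_inj; exact: u0. Qed.
Arguments mono_incl {M} N.

Lemma inclP M (N : subrep M) i x : x \in N i <-> exists u, incl N i u = x.
Proof.
split=> [xN|[u <-]]; last by rewrite inclE subvsP.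
by exists (vsproj (N i) x); rewrite inclE vsprojK.
Qed.

Definition mkSub M (U : forall i, {vspace M i})
  (H : forall a x, x \in U (src a) -> rep_map M a x \in U (tgt a)) : subrep M :=
  @SubRep _ _ M U (fun a => introT subvP (fun y yU =>
     let: ex_intro2 x xU e := memv_imgP yU in eq_ind_r (fun z => z \in U (tgt a)) (H a x xU) e)).

Lemma subrep_of_pred M (P : forall i, M i -> Prop) :
  (forall i, P i 0) -> (forall i k u v, P i u -> P i v -> P i (k *: u + v)) ->
  (forall a x, P (src a) x -> P (tgt a) (rep_map M a x)) ->
  exists N : subrep M, forall i x, x \in N i <-> P i x.
Proof.
move=> P0 PL Pa.
have /dchoice [U HU] : forall i, exists U : {vspace M i}, forall x, P i x <-> x \in U.
  by move=> i; apply: (vspace_of_pred (P0 i) (PL i)).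
have st a x : x \in U (src a) -> rep_map M a x \in U (tgt a).
  by move=> xU; apply: (HU _ _).1; apply: Pa; apply: (HU _ _).2.
by exists (mkSub st) => i x; split=> [/(HU i x).2|/(HU i x).1].
Qed.

Lemma sub_ker X Y (f : C0 X Y) : isHom f ->
  exists N : subrep X, forall i x, x \in N i <-> f i x = 0.
Proof.
move=> fh; apply: subrep_of_pred => [i|i k u v fu fv|a x fx].
- exact: linear0.
- by rewrite linearP /= fu fv scaler0 addr0.
- by rewrite fh fx linear0.
Qed.

Lemma sub_im X Y (f : C0 X Y) : isHom f ->
  exists N : subrep Y, forall i y, y \in N i <-> exists x, f i x = y.
Proof.
move=> fh; apply: subrep_of_pred => [i|i k u v [x <-] [y <-]|a y [x <-]].
- by exists 0; exact: linear0.
- by exists (k *: x + y); rewrite linearP.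
- by exists (rep_map X a x); rewrite fh.
Qed.

Lemma sub_map X Y (f : C0 X Y) (A : subrep X) : isHom f ->
  exists N : subrep Y, forall i y, y \in N i <-> exists2 x, x \in A i & f i x = y.
Proof.
move=> fh; have [N HN] := sub_im (isHom_cmp fh (isHom_incl A)).
exists N => i y; rewrite HN; split=> [[u]|[x /inclP[u <-] <-]].
  by rewrite FE; exists (incl A i u) => //; rewrite inclE subvsP.
by exists u; rewrite FE.
Qed.

Lemma sub_pre X Y (f : C0 X Y) (B : subrep Y) : isHom f ->
  exists N : subrep X, forall i x, x \in N i <-> f i x \in B i.
Proof.
move=> fh; apply: subrep_of_pred => [i|i k u v fu fv|a x fx].
- by rewrite linear0 mem0v.
- by rewrite linearP /= memvD ?memvZ.
- by rewrite fh sub_stableE.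
Qed.

Lemma subrep_full M : exists N : subrep M, forall i, N i = fullv.
Proof.
have st (a : arrow Q) (x : M (src a)) : x \in fullv -> rep_map M a x \in fullv by rewrite !memvf.
by exists (@mkSub M (fun i => fullv) st).
Qed.
Lemma subrep_zero M : exists N : subrep M, forall i, N i = 0%VS.
Proof.
have st (a : arrow Q) (x : M (src a)) : x \in 0%VS -> rep_map M a x \in 0%VS.
  by rewrite !memv0 => /eqP ->; rewrite linear0.
by exists (@mkSub M (fun i => 0%VS) st).
Qed.

(* the quotient M / N lives on the chosen complement of N *)
Definition prjv (V : vectType K) (U : {vspace V}) : 'Hom(V, subvs_of (U^C)%VS) :=
  (linfun (vsproj (U^C)%VS) \o daddv_pi (U^C)%VS U)%VF.

Lemma capvC0 (V : vectType K) (U : {vspace V}) : (U^C :&: U)%VS = 0%VS.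
Proof. by rewrite capvC capv_compl. Qed.

Lemma prjv_dec (V : vectType K) (U : {vspace V}) v : v - vsval (prjv U v) \in U.
Proof.
rewrite /prjv comp_lfunE lfunE /= vsprojK ?memv_pi //.
have vf : v \in (U^C + U)%VS by rewrite addvC addv_complf memvf.
have := daddv_pi_add (capvC0 U) vf.
by move=> e; rewrite -[X in X - _]e addrC addKr memv_pi.
Qed.

Lemma prjv_section (V : vectType K) (U : {vspace V}) (u : subvs_of (U^C)%VS) : prjv U (vsval u) = u.
Proof.
apply: val_inj; rewrite /prjv comp_lfunE lfunE /= vsprojK ?memv_pi //.
by rewrite daddv_pi_id ?capvC0 ?subvsP.
Qed.

Lemma prjv_eq0 (V : vectType K) (U : {vspace V}) v : prjv U v = 0 <-> v \in U.
Proof.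
split=> [p0|vU]; first by have := prjv_dec U v; rewrite p0 => H; rewrite -[v]subr0; exact: H.
have uU : vsval (prjv U v) \in U.
  by rewrite -[vsval _](subKr v) memvB // prjv_dec.
have: vsval (prjv U v) \in (U^C :&: U)%VS by rewrite memv_cap subvsP.
by rewrite capvC0 memv0 => /eqP e; apply: val_inj; exact: e.
Qed.

Definition quo M (N : subrep M) : rep K Q :=
  @Rep K Q (fun i => subvs_of (N i)^C%VS)
    (fun a => prjv (N (tgt a)) \o rep_map M a \o linfun vsval)%VF.
Definition prj M (N : subrep M) : C0 M (quo N) := fun i => prjv (N i).

Lemma quo_map M (N : subrep M) a u :
  rep_map (quo N) a u = prjv (N (tgt a)) (rep_map M a (vsval u)).
Proof. by rewrite /= 2!comp_lfunE; congr (prjv _ (rep_map M a _)); apply: lfunE. Qed.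

Lemma prjP M (N : subrep M) i x : prj N i x = 0 <-> x \in N i.
Proof. exact: prjv_eq0. Qed.

Lemma isHom_prj M (N : subrep M) : isHom (prj N).
Proof.
move=> a x; rewrite quo_map; apply/eqP; rewrite -subr_eq0 -linearB -linearB /=.
by apply/eqP/prjv_eq0/sub_stableE/prjv_dec.
Qed.
Arguments isHom_prj {M} N.

Lemma epi_prj M (N : subrep M) : epi (prj N).
Proof. by move=> i u; exists (vsval u); exact: (@prjv_section _ (N i) u). Qed.
Arguments epi_prj {M} N.

Definition ses X E Y (i : C0 X E) (p : C0 E Y) :=
  [/\ isHom i, isHom p, mono i, epi p &
      forall v x, p v x = 0 <-> exists y, i v y = x].

Lemma ses_quo M (N : subrep M) : ses (incl N) (prj N).
Proof.
split; [exact: isHom_incl|exact: isHom_prj|exact: mono_incl|exact: epi_prj|].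
by move=> v x; rewrite prjP inclP.
Qed.

Lemma ses_ker X Y (f : C0 X Y) : isHom f -> epi f ->
  exists N : subrep X, (forall i x, x \in N i <-> f i x = 0) /\ ses (incl N) f.
Proof.
move=> fh fe; have [N HN] := sub_ker fh; exists N; split=> //.
split=> //; [exact: isHom_incl|exact: mono_incl|].
by move=> v x; rewrite -HN inclP.
Qed.

Lemma ses_dim X E Y (i : C0 X E) (p : C0 E Y) : ses i p ->
  forall v, dimvec E v = (dimvec X v + dimvec Y v)%N.
Proof.
move=> [_ _ im pe H] v; rewrite /dimvec -(limg_ker_dim (p v) fullv) capfv.
have -> : limg (p v) = fullv by apply/limg_fullP; apply: pe.
congr (_ + _)%N; rewrite -[RHS](limg_ker_dim (i v) fullv) capfv.
have -> : lker (i v) = 0%VS.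
  by apply/eqP; rewrite -subv0; apply/subvP => x /lkerP/im ->; apply: mem0v.
rewrite dimv0 add0n; congr (\dim _); apply/vspaceP => x.
apply/lkerP/memv_imgP => [/H[y <-]|[y _ ->]]; first by exists y; rewrite ?memvf.
by apply/H; exists y.
Qed.

Lemma dim_rep_of M (N : subrep M) i : dimvec (rep_of N) i = \dim (N i).
Proof. by rewrite /dimvec /= dimvf. Qed.

Lemma mono_dim X Y (f : C0 X Y) i : mono f -> (dimvec X i <= dimvec Y i)%N.
Proof.
move=> fm; rewrite /dimvec -(limg_ker_dim (f i) fullv) capfv.
have -> : lker (f i) = 0%VS.
  by apply/eqP; rewrite -subv0; apply/subvP => x /lkerP/fm ->; apply: mem0v.
by rewrite dimv0 add0n dimvS ?subvf.
Qed.

Lemma epi_dim X Y (f : C0 X Y) i : epi f -> (dimvec Y i <= dimvec X i)%N.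
Proof.
move=> fe; rewrite /dimvec -[X in (_ <= X)%N](limg_ker_dim (f i) fullv) capfv.
have -> : limg (f i) = fullv by apply/limg_fullP; apply: fe.
exact: leq_addl.
Qed.

Lemma iso_dim X Y (f : C0 X Y) i : isoF f -> dimvec X i = dimvec Y i.
Proof. by move=> [fm fe]; apply/eqP; rewrite eqn_leq (mono_dim _ fm) (epi_dim _ fe). Qed.

Lemma mono_iso X Y (f : C0 X Y) : mono f -> (forall i, dimvec Y i <= dimvec X i)%N -> isoF f.
Proof.
move=> fm H; split=> // i; apply/limg_fullP; apply/eqP; rewrite eqEdim subvf /=.
have := limg_ker_dim (f i) fullv; rewrite capfv.
have -> : lker (f i) = 0%VS.
  by apply/eqP; rewrite -subv0; apply/subvP => x /lkerP/fm ->; apply: mem0v.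
by rewrite dimv0 add0n => ->; apply: H.
Qed.

Lemma epi_iso X Y (f : C0 X Y) : epi f -> (forall i, dimvec X i <= dimvec Y i)%N -> isoF f.
Proof.
move=> fe H; split=> // i x fx; have := limg_ker_dim (f i) fullv; rewrite capfv.
have -> : limg (f i) = fullv by apply/limg_fullP; apply: fe.
move=> e; have : (\dim (lker (f i)) <= 0)%N.
  by rewrite -(leq_add2r (\dim {: Y i})) e add0n; apply: H.
rewrite leqn0 dimv_eq0 => /eqP k0.
by apply/eqP; rewrite -memv0 -k0; apply/lkerP.
Qed.

End RepCat2.

Arguments isHom_incl {K Q M} N.
Arguments mono_incl {K Q M} N.
Arguments isHom_prj {K Q M} N.
Arguments epi_prj {K Q M} N.
Arguments isHom_id {K Q} X.
Arguments isHom0 {K Q} X Y.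

Lemma sub_exchange (V : zmodType) (A B C D : V) : A - B = C - D -> D - B = C - A.
Proof.
move=> e; have -> : C = A - B + D by rewrite e subrK.
by rewrite addrAC [A - B]addrC addrK addrC.
Qed.

Section Ext.
Variables (K : fieldType) (Q : quiver).
Implicit Types (X Y Z W E M : rep K Q).

Fact push_linear X Y Z (f : C0 Y Z) :
  linear (fun c : C1 X Y => (fun a => (f (tgt a) \o c a)%VF) : C1 X Z).
Proof.
move=> k c d; apply: C1P => a x; rewrite !FE !comp_lfunE !FE.
by rewrite linearP.
Qed.
Definition push X Y Z (f : C0 Y Z) : 'Hom(C1 X Y, C1 X Z) := mkhom (push_linear (X := X) f).

Lemma pushE X Y Z (f : C0 Y Z) (c : C1 X Y) a x : push X f c a x = f (tgt a) (c a x).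
Proof. by rewrite mkhomE comp_lfunE. Qed.

Fact pull_linear X' X Y (u : C0 X' X) :
  linear (fun c : C1 X Y => (fun a => (c a \o u (src a))%VF) : C1 X' Y).
Proof. by move=> k c d; apply: C1P => a x; rewrite !FE !comp_lfunE !FE. Qed.
Definition pull X' X Y (u : C0 X' X) : 'Hom(C1 X Y, C1 X' Y) := mkhom (pull_linear (Y := Y) u).

Lemma pullE X' X Y (u : C0 X' X) (c : C1 X Y) a x : pull Y u c a x = c a (u (src a) x).
Proof. by rewrite mkhomE comp_lfunE. Qed.

Lemma push_dlt X Y Z (f : C0 Y Z) (u : C0 X Y) : isHom f ->
  push X f (dlt X Y u) = dlt X Z (cmp f u).
Proof. by move=> fh; apply: C1P => a x; rewrite pushE !dltE !FE linearB /= fh. Qed.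

Lemma pull_dlt X' X Y (u : C0 X' X) (w : C0 X Y) : isHom u ->
  pull Y u (dlt X Y w) = dlt X' Y (cmp w u).
Proof. by move=> uh; apply: C1P => a x; rewrite pullE !dltE !FE uh. Qed.

Lemma push_img X Y Z (f : C0 Y Z) c : isHom f -> c \in limg (dlt X Y) ->
  push X f c \in limg (dlt X Z).
Proof. by move=> fh /memv_imgP[u _ ->]; rewrite push_dlt // memv_img ?memvf. Qed.

Lemma pull_img X' X Y (u : C0 X' X) c : isHom u -> c \in limg (dlt X Y) ->
  pull Y u c \in limg (dlt X' Y).
Proof. by move=> fh /memv_imgP[w _ ->]; rewrite pull_dlt // memv_img ?memvf. Qed.

Lemma push_cmp X Y Z W (g : C0 Z W) (f : C0 Y Z) c : push X (cmp g f) c = push X g (push X f c).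
Proof. by apply: C1P => a x; rewrite !pushE FE. Qed.
Lemma push_id X Y c : push X (idF Y) c = c.
Proof. by apply: C1P => a x; rewrite pushE FE. Qed.
Lemma push_pull X' X Y Z (f : C0 Y Z) (u : C0 X' X) c : push X' f (pull Y u c) = pull Z u (push X f c).
Proof. by apply: C1P => a x; rewrite !(pushE, pullE). Qed.
Lemma pushD X Y Z (f g : C0 Y Z) c : push X (f + g) c = push X f c + push X g c.
Proof. by apply: C1P => a x; rewrite !(pushE, FE). Qed.
Lemma pushZ X Y Z k (f : C0 Y Z) c : push X (k *: f) c = k *: push X f c.
Proof. by apply: C1P => a x; rewrite !(pushE, FE). Qed.
Lemma pull_cmp X'' X' X Y (u : C0 X' X) (w : C0 X'' X') c : pull Y (cmp u w) c = pull Y w (pull Y u c).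
Proof. by apply: C1P => a x; rewrite !pullE FE. Qed.
Lemma pull_id X Y c : pull Y (idF X) c = c.
Proof. by apply: C1P => a x; rewrite pullE FE. Qed.
Lemma pullD X' X Y (f g : C0 X' X) c : pull Y (f + g) c = pull Y f c + pull Y g c.
Proof. by apply: C1P => a x; rewrite !(pullE, FE) linearD. Qed.
Lemma pullZ X' X Y k (f : C0 X' X) c : pull Y (k *: f) c = k *: pull Y f c.
Proof. by apply: C1P => a x; rewrite !(pullE, FE) linearZ. Qed.

Lemma push_surj X Y Z (f : C0 Y Z) : epi f -> forall d, exists c, push X f c = d.
Proof.
move=> /epi_rinv[s fs] d; exists (push X s d).
by apply: C1P => a x; rewrite !pushE (cmp_id fs).
Qed.

Lemma pull_surj X' X Y (u : C0 X' X) : mono u -> forall d, exists c, pull Y u c = d.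
Proof.
move=> /mono_linv[r ru] d; exists (pull Y r d).
by apply: C1P => a x; rewrite !pullE (cmp_id ru).
Qed.

(* c is a cocycle for the class of 0 -> X -> E -> Y -> 0 *)
Definition is_class X E Y (i : C0 X E) (p : C0 E Y) (c : C1 Y X) :=
  exists s : C0 Y E, cmp p s = idF Y /\ push Y i c = dlt Y E s.

Lemma ses_class X E Y (i : C0 X E) (p : C0 E Y) : ses i p -> exists c, is_class i p c.
Proof.
move=> [ih ph im pe ex]; have [s ps] := epi_rinv pe.
have [r ri] := mono_linv im.
exists (push Y r (dlt Y E s)); exists s; split=> //.
apply: C1P => a y; rewrite !pushE.
have [z <-] : exists z, i (tgt a) z = dlt Y E s a y; last by rewrite (cmp_id ri).
by apply/ex; rewrite dltE linearB /= ph !(cmp_id ps) subrr.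
Qed.

(** A path algebra has no relations, so every cochain is a cocycle: E is the direct sum of X and Y,
    with c added to the arrows as off-diagonal entry. *)
Lemma class_ses Y X (c : C1 Y X) :
  exists (E : rep K Q) (i : C0 X E) (p : C0 E Y), ses i p /\ is_class i p c.
Proof.
pose m a (e : X (src a) * Y (src a)) : (X (tgt a) * Y (tgt a))%type :=
  (rep_map X a e.1 + c a e.2, rep_map Y a e.2).
have ml a : linear (@m a).
  move=> k [x1 y1] [x2 y2]; rewrite /m /= !linearP /=.
  by congr (_, _) => /=; rewrite scalerDr addrACA.
pose E := @Rep K Q (fun v => (X v * Y v)%type : vectType K) (fun a => mkhom (@ml a)).
have il v : linear (fun x : X v => (x, 0) : (X v * Y v)%type).
  by move=> k x y; congr (_, _) => /=; rewrite scaler0 addr0.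
have pl v : linear (fun e : (X v * Y v)%type => e.2) by [].
have sl v : linear (fun y : Y v => (0, y) : (X v * Y v)%type).
  by move=> k x y; congr (_, _) => /=; rewrite scaler0 addr0.
pose i : C0 X E := fun v => mkhom (@il v).
pose p : C0 E Y := fun v => mkhom (@pl v).
pose s : C0 Y E := fun v => mkhom (@sl v).
have iE v x : i v x = (x, 0) by rewrite mkhomE.
have pE v e : p v e = e.2 by rewrite mkhomE.
have sE v x : s v x = (0, x) by rewrite mkhomE.
have EE a e : rep_map E a e = m a e by rewrite /= mkhomE.
exists E, i, p; split; first split.
- by move=> a x; rewrite EE !iE /m /= !linear0 addr0.
- by move=> a e; rewrite EE !pE.
- by move=> v x; rewrite iE => -[].
- by move=> v y; exists (0, y); rewrite pE.
- move=> v [x y]; rewrite pE /=; split=> [->|[z]]; first by exists x; rewrite iE.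
  by rewrite iE => -[_ <-].
exists s; split; first by apply: C0P => v x; rewrite !FE sE pE.
apply: C1P => a y; rewrite pushE dltE EE !sE iE /m /= linear0 add0r.
by congr (_, _); rewrite /= ?subr0 ?subrr.
Qed.

(** Exactness of Hom(E, W) -> Hom(X, W) -> Ext(Y, W) in the middle, with the connecting map written
    on cocycles. *)
Lemma ext_push X E Y W (i : C0 X E) (p : C0 E Y) c (f : C0 X W) :
  ses i p -> is_class i p c -> isHom f ->
  (exists2 g : C0 E W, isHom g & cmp g i = f) <-> push Y f c \in limg (dlt Y W).
Proof.
move=> [ih ph im pe ex] [s [ps ic]] fh; split=> [[g gh <-]|/memv_imgP[u _ fc]].
  by rewrite push_cmp ic push_dlt // memv_img ?memvf.
have [r ri] := mono_linv im; have rE := cmp_id ri; have sE := cmp_id ps.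
(* A linear retraction of i. By [rhoE] it fails to commute with the arrows exactly by c, and
   [cmp u p] makes up for this failure in [cmp f rho]. *)
pose rho : C0 E X := cmp r (idF E - cmp s p).
have irho v e : i v (rho v e) = e - s v (p v e).
  rewrite /rho !FE; have [x <-] : exists x, i v x = e - s v (p v e); last by rewrite rE.
  by apply/ex; rewrite linearB /= sE subrr.
have rhoi v x : rho v (i v x) = x.
  apply: (monoB im); rewrite irho.
  by have -> : p v (i v x) = 0; [apply/ex; exists x | rewrite linear0 subr0].
have rhoE a e : rho (tgt a) (rep_map E a e) = rep_map X a (rho (src a) e) + c a (p (src a) e).
  apply: (monoB im); rewrite irho linearD /= ih irho.
  have -> : i (tgt a) (c a (p (src a) e)) = dlt Y E s a (p (src a) e) by rewrite -ic pushE.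
  by rewrite dltE ph linearB /= addrA subrK.
clearbody rho; exists (cmp f rho + cmp u p).
  move=> a e; rewrite !FE rhoE linearD /= fh ph.
  have -> : f (tgt a) (c a (p (src a) e)) = dlt Y W u a (p (src a) e) by rewrite -fc pushE.
  by rewrite dltE linearD /= -addrA subrK.
apply: C0P => v x; rewrite !FE rhoi.
by have -> : p v (i v x) = 0; [apply/ex; exists x | rewrite linear0 addr0].
Qed.

Lemma ext_pull X E Y Z (i : C0 X E) (p : C0 E Y) c (h : C0 Z Y) :
  ses i p -> is_class i p c -> isHom h ->
  (exists2 l : C0 Z E, isHom l & cmp p l = h) <-> pull X h c \in limg (dlt Z X).
Proof.
move=> [ih ph im pe ex] [s [ps ic]] hh; have sE := cmp_id ps; split=> [[l lh ph']|/memv_imgP[w _ hc]].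
  have [w Hw] : exists w : C0 Z X, forall v z, i v (w v z) = s v (h v z) - l v z.
    have [r ri] := mono_linv im; exists (cmp r (cmp s h - l)) => v z; rewrite !FE.
    have [x <-] : exists x, i v x = s v (h v z) - l v z; last by rewrite (cmp_id ri).
    by apply/ex; rewrite linearB /= sE -ph' FE subrr.
  have -> : pull X h c = dlt Z X w; last by rewrite memv_img ?memvf.
  apply: C1P => a z; apply: (monoB im); rewrite pullE dltE linearB /= ih !Hw.
  have -> : i (tgt a) (c a (h (src a) z)) = dlt Y E s a (h (src a) z) by rewrite -ic pushE.
  by rewrite dltE linearB /= lh hh opprB addrA subrK.
exists (cmp s h - cmp i w).
  move=> a z; rewrite !FE linearB /=.
  have := congr1 (fun d : C1 Z X => i (tgt a) (d a z)) hc.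
  rewrite pullE dltE linearB /= ih => e.
  have: i (tgt a) (c a (h (src a) z)) = dlt Y E s a (h (src a) z) by rewrite -ic pushE.
  rewrite dltE -hh e => e2.
  exact: sub_exchange e2.
apply: C0P => v z; rewrite !FE linearB /= sE.
by have -> : p v (i v (w v z)) = 0; [apply/ex; exists (w v z) | rewrite subr0].
Qed.

End Ext.

(** * Fitting's lemma and indecomposable summands *)

Section Indec.
Variables (K : fieldType) (Q : quiver).
Implicit Types (X Y Z W E M : rep K Q).

Definition tot X := (\sum_i dimvec X i)%N.

Lemma rep_zeroP X : rep_zero X <-> forall i (x : X i), x = 0.
Proof.
split=> [H i x|H i]; first by apply/eqP; rewrite -memv0 -H memvf.
by apply/vspaceP => x; rewrite memvf memv0 (H i x) eqxx.
Qed.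

Lemma rep_zero_dim X : rep_zero X <-> forall i, dimvec X i = 0%N.
Proof.
split=> H i; first by rewrite /dimvec H dimv0.
by apply/eqP; rewrite -dimv_eq0; apply/eqP/H.
Qed.

Lemma tot0P X : rep_zero X <-> tot X = 0%N.
Proof.
rewrite rep_zero_dim; split=> [H|/eqP].
  by rewrite /tot big1.
by rewrite sum_nat_eq0 => /forallP H i; apply/eqP; apply: H.
Qed.

Lemma rep_zero_hom X : rep_zero X <-> idF X = 0.
Proof.
rewrite rep_zeroP; split=> [H|e i x]; first by apply: C0P => i x; rewrite [LHS]H [RHS]H.
by rewrite -(idFE x) e FE.
Qed.

Lemma zero_from X Y (f : C0 X Y) : rep_zero X -> f = 0.
Proof. by move/rep_zeroP => H; apply: C0P => i x; rewrite (H i x) !linear0. Qed.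
Lemma zero_to X Y (f : C0 X Y) : rep_zero Y -> f = 0.
Proof. by move/rep_zeroP => H; apply: C0P => i x; rewrite [LHS]H [RHS]H. Qed.

Lemma tot_mono X Y (f : C0 X Y) : mono f -> (tot X <= tot Y)%N.
Proof. by move=> fm; apply: leq_sum => i _; apply: mono_dim fm. Qed.
Lemma tot_epi X Y (f : C0 X Y) : epi f -> (tot Y <= tot X)%N.
Proof. by move=> fm; apply: leq_sum => i _; apply: epi_dim fm. Qed.
Lemma tot_ses X E Y (i : C0 X E) (p : C0 E Y) : ses i p -> tot E = (tot X + tot Y)%N.
Proof. by move/ses_dim=> H; rewrite /tot -big_split; apply: eq_bigr => v _; apply: H. Qed.

Lemma leq_sum_eq (I : finType) (F G : I -> nat) :
  (forall i, F i <= G i)%N -> (\sum_i G i <= \sum_i F i)%N -> forall i, (G i <= F i)%N.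
Proof.
move=> le le' i; rewrite leqNgt; apply/negP => lt; move: le'; rewrite leqNgt => /negP; apply.
rewrite (bigD1 i) // [X in (_ < X)%N](bigD1 i) //= -addSn.
by apply: leq_add => //; apply: leq_sum.
Qed.

Lemma mono_tot_iso X Y (f : C0 X Y) : mono f -> (tot Y <= tot X)%N -> isoF f.
Proof.
move=> fm le; apply: mono_iso => //; apply: leq_sum_eq => // i; exact: mono_dim fm.
Qed.
Lemma epi_tot_iso X Y (f : C0 X Y) : epi f -> (tot X <= tot Y)%N -> isoF f.
Proof.
move=> fm le; apply: epi_iso => //; apply: leq_sum_eq => // i; exact: epi_dim fm.
Qed.

Lemma isoF_cmp X Y Z (g : C0 Y Z) (f : C0 X Y) : isoF g -> isoF f -> isoF (cmp g f).
Proof.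
move=> [gm ge] [fm fe]; split=> [i x|i z]; first by rewrite FE => /gm/fm.
by have [y <-] := ge i z; have [x <-] := fe i y; exists x; rewrite FE.
Qed.

Lemma cmp_mono X Y Z (g : C0 Y Z) (f : C0 X Y) : mono (cmp g f) -> mono f.
Proof. by move=> m i x fx; apply: (m i); rewrite FE fx linear0. Qed.
Lemma cmp_epi X Y Z (g : C0 Y Z) (f : C0 X Y) : epi (cmp g f) -> epi g.
Proof. by move=> e i z; have [x <-] := e i z; exists (f i x); rewrite FE. Qed.
Lemma idF_iso X : isoF (idF X).
Proof. by split=> [i x|i x]; [rewrite FE | exists x; rewrite FE]. Qed.
Lemma cmpA X Y Z W (h : C0 Z W) (g : C0 Y Z) (f : C0 X Y) : cmp h (cmp g f) = cmp (cmp h g) f.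
Proof. by apply: C0P => i x; rewrite !FE. Qed.
Lemma cmp1F X Y (f : C0 X Y) : cmp (idF Y) f = f.
Proof. by apply: C0P => i x; rewrite !FE. Qed.
Lemma cmpF1 X Y (f : C0 X Y) : cmp f (idF X) = f.
Proof. by apply: C0P => i x; rewrite !FE. Qed.
Lemma cmpDr X Y Z (g : C0 Y Z) (f h : C0 X Y) : cmp g (f + h) = cmp g f + cmp g h.
Proof. by apply: C0P => i x; rewrite !FE linearD. Qed.
Lemma cmp0F X Y Z (f : C0 X Y) : cmp (0 : C0 Y Z) f = 0.
Proof. by apply: C0P => i x; rewrite !FE. Qed.
Lemma cmpF0 X Y Z (f : C0 Y Z) : cmp f (0 : C0 X Y) = 0.
Proof. by apply: C0P => i x; rewrite !FE linear0. Qed.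
Lemma id_mono X Y (f : C0 X Y) (g : C0 Y X) : cmp g f = idF X -> mono f.
Proof. by move=> e; apply: (@cmp_mono _ _ _ g); rewrite e; case: (idF_iso X). Qed.
Lemma id_epi X Y (f : C0 X Y) (g : C0 Y X) : cmp g f = idF X -> epi g.
Proof. by move=> e; apply: (@cmp_epi _ _ _ g f); rewrite e; case: (idF_iso X). Qed.
Lemma mono_comp X Y Z (g : C0 Y Z) (f : C0 X Y) : mono g -> mono f -> mono (cmp g f).
Proof. by move=> gm fm i x; rewrite FE => /gm/fm. Qed.
Lemma epi_comp X Y Z (g : C0 Y Z) (f : C0 X Y) : epi g -> epi f -> epi (cmp g f).
Proof. by move=> ge fe i z; have [y <-] := ge i z; have [x <-] := fe i y; exists x; rewrite FE. Qed.

Lemma compl_split X (A B : subrep X) : complementary A B ->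
  exists r : C0 X (rep_of A), [/\ isHom r, cmp r (incl A) = idF (rep_of A) &
    forall i x, r i x = 0 <-> x \in B i].
Proof.
move=> AB.
pose g := cmp (prj B) (incl A).
have gh : isHom g := isHom_cmp (isHom_prj B) (isHom_incl A).
have gi : isoF g.
  split=> [i u|i z].
    rewrite /g FE => /prjP; rewrite inclE => uB; apply: (@mono_incl _ _ _ A).
    rewrite inclE; apply/eqP; rewrite -memv0 -(AB i).2 memv_cap uB andbT; exact: subvsP.
  have [x <-] := epi_prj B i z.
  have : x \in (A i + B i)%VS by rewrite (AB i).1 memvf.
  case/memv_addP => u /inclP[u' <-] [v vB ->]; exists u'.
  by rewrite /g FE linearD /= (prjP B v).2 // addr0.
have [k [kh gk kg ki]] := isoF_inv gh gi.
exists (cmp k (prj B)); split; first exact: isHom_cmp kh (isHom_prj B).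
  by rewrite -cmpA.
move=> i x; rewrite -(prjP B) FE; split=> [/ki.1 //|->]; exact: linear0.
Qed.

Lemma complC X (A B : subrep X) : complementary A B -> complementary B A.
Proof. by move=> H i; have [h1 h2] := H i; rewrite addvC capvC. Qed.

Lemma indec_split X Y (s : C0 Y X) (r : C0 X Y) : indecomposable X ->
  isHom s -> isHom r -> cmp r s = idF Y -> rep_zero Y \/ isoF s.
Proof.
move=> [X0 HX] sh rh rs; have rsE := cmp_id rs.
have [A HA] := sub_im sh; have [B HB] := sub_ker rh.
have AB : complementary A B.
  move=> i; split; apply/vspaceP => x; rewrite ?memvf.
    apply/memv_addP; exists (s i (r i x)); first by apply/HA; exists (r i x).
    exists (x - s i (r i x)); first by apply/HB; rewrite linearB /= rsE subrr.
    by rewrite addrC subrK.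
  rewrite memv0; apply/memv_capP/eqP => [[/(HA _ _).1[y <-] /(HB _ _).1]|->]; last by rewrite !mem0v.
  by rewrite rsE => ->; rewrite linear0.
have [zA|zB] := HX A B AB; [left|right].
  apply/rep_zeroP => i y; rewrite -(rsE i y); have := (HA i (s i y)).2 (ex_intro _ y erefl).
  by case/inclP => u <-; rewrite ((rep_zeroP (rep_of A)).1 zA i u) !linear0.
split; first exact: id_mono rs.
move=> i x; exists (r i x).
have : x - s i (r i x) \in B i by apply/HB; rewrite linearB /= rsE subrr.
case/inclP => u; rewrite ((rep_zeroP (rep_of B)).1 zB i u) linear0 => /esym/eqP.
by rewrite subr_eq0 => /eqP.
Qed.

Fixpoint itF X (f : C0 X X) n : C0 X X := if n is n'.+1 then cmp f (itF f n') else idF X.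

Lemma isHom_itF X (f : C0 X X) n : isHom f -> isHom (itF f n).
Proof. by move=> fh; elim: n => [|n IH]; [apply: isHom_id|apply: isHom_cmp]. Qed.
Lemma itFD X (f : C0 X X) m n i x : itF f (m + n) i x = itF f m i (itF f n i x).
Proof. by elim: m => [|m IH]; rewrite /= !FE // IH. Qed.

(** For a power of f whose kernel has maximal total dimension, the kernel no longer grows; it
    therefore meets the image trivially and complements it by dimension. *)
Lemma fitting X (f : C0 X X) : indecomposable X -> isHom f ->
  isoF f \/ exists n, itF f n = 0.
Proof.
move=> [X0 HX] fh.
pose kd n := (\sum_i \dim (lker (itF f n i)))%N.
have ex0 : exists m, `[< exists n, kd n = m >] by exists (kd 0%N); apply/asboolP; exists 0%N.
have ub m : `[< exists n, kd n = m >] -> (m <= tot X)%N.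
  by move=> /asboolP[n <-]; apply: leq_sum => i _; rewrite dimvS ?subvf.
case: (ex_maxnP ex0 ub) => m /asboolP[n <-] nmax.
have kS k i x : itF f (k + n) i x = 0 -> itF f n i x = 0.
  move=> e; have le j : (lker (itF f n j) <= lker (itF f (k + n) j))%VS.
    by apply/subvP => y /lkerP y0; apply/lkerP; rewrite itFD y0 linear0.
  have /leq_sum_eq : forall j, (\dim (lker (itF f n j)) <= \dim (lker (itF f (k + n) j)))%N.
    by move=> j; apply: dimvS.
  move=> /(_ (nmax _ (asboolT (ex_intro _ (k + n)%N erefl))) i) leq.
  have /eqP eqk : lker (itF f n i) == lker (itF f (k + n) i) by rewrite eqEdim le leq.
  by apply/lkerP; rewrite eqk; apply/lkerP.
have gh := isHom_itF n fh.
have [A HA] := sub_im gh; have [B HB] := sub_ker gh.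
have AB : complementary A B.
  move=> i; have cap0 : (A i :&: B i)%VS = 0%VS.
    apply/vspaceP => x; rewrite memv0.
    apply/memv_capP/eqP => [[xA xB]|->]; last by rewrite !mem0v.
    have [y e] := (HA i x).1 xA; have := (HB i x).1 xB.
    by rewrite -e -itFD => /kS.
  split=> //; apply/eqP; rewrite eqEdim subvf /= dimv_disjoint_sum //.
  have -> : A i = limg (itF f n i).
    apply/vspaceP => y; apply/idP/memv_imgP => [/HA[x <-]|[x _ ->]]; first by exists x; rewrite ?memvf.
    by apply/HA; exists x.
  have -> : B i = lker (itF f n i) by apply/vspaceP => y; apply/idP/lkerP => /HB.
  by rewrite addnC -[X in (X <= _)%N](limg_ker_dim (itF f n i) fullv) capfv.
have [/rep_zeroP zA|/rep_zeroP zB] := HX A B AB; [right; exists n|left].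
  apply: C0P => i x; have /inclP[u <-] := (HA i (itF f n i x)).2 (ex_intro _ x erefl).
  by rewrite (zA i u) linear0 FE.
apply: mono_tot_iso => // i x fx; have : x \in B i.
  by apply/HB; apply: (kS 1%N); rewrite addnC itFD /= !FE fx linear0.
by case/inclP => u <-; rewrite (zB i u) linear0.
Qed.

Lemma one_sub_nilp X (f g : C0 X X) n : itF f n = 0 -> f + g = idF X -> isoF g.
Proof.
move=> fn fg; apply: mono_tot_iso => // i x gx.
have fx : f i x = x by rewrite -[RHS](idFE x) -fg FE gx addr0.
have : itF f n i x = x by elim: (n) => [|k IH] /=; rewrite !FE // IH.
by rewrite fn FE.
Qed.

(** The endomorphism ring is local: if k inverts f + g and k f is nilpotent, then k g = 1 - k f is
    invertible. *)
Lemma nonisoD X (f g : C0 X X) : indecomposable X -> isHom f -> isHom g ->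
  ~ isoF f -> ~ isoF g -> ~ isoF (f + g).
Proof.
move=> iX fh gh nf ng hi.
have [k [kh hk kg ki]] := isoF_inv (isHomD fh gh) hi.
have kfh : isHom (cmp k f) by apply: isHom_cmp.
have [ff|[n fn]] := fitting iX kfh.
  by apply: nf; apply: mono_tot_iso => //; apply: (@cmp_mono _ _ _ k); case: ff.
have : isoF (cmp k g) by apply: (one_sub_nilp fn); rewrite -cmpDr.
by move=> gg; apply: ng; apply: mono_tot_iso => //; apply: (@cmp_mono _ _ _ k); case: gg.
Qed.

(** The non-isomorphisms form a proper subspace of End(X). The functional stands in for the
    projection to the residue division ring and will single out the almost split extension. *)
Lemma indec_eps X : indecomposable X -> exists e : 'Hom(C0 X X, K^o),
  e (idF X) = 1 /\ forall f : C0 X X, isHom f -> ~ isoF f -> e f = 0.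
Proof.
move=> iX; have nz := iX.1.
have z0 : isHom (0 : C0 X X) /\ ~ isoF (0 : C0 X X).
  split; first exact: isHom0.
  by move=> [m _]; apply: nz; apply/rep_zeroP => i x; apply: (m i); rewrite FE.
have zL k (u v : C0 X X) : isHom u /\ ~ isoF u -> isHom v /\ ~ isoF v ->
    isHom (k *: u + v) /\ ~ isoF (k *: u + v).
  move=> [uh ui] [vh vi]; have kuh : isHom (k *: u) := isHomZ k uh.
  split; first exact: isHomD.
  apply: nonisoD => // -[m _]; have [k0|k0] := eqVneq k 0.
    by apply: nz; apply/rep_zeroP => i x; apply: (m i); rewrite FE k0 scale0r.
  apply: ui; apply: mono_tot_iso => // i x ux; apply: (m i); by rewrite FE ux scaler0.
have [U HU] := @vspace_of_pred _ _ (fun f : C0 X X => isHom f /\ ~ isoF f) z0 zL.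
have : idF X \notin U by apply/negP => /HU[_]; apply; apply: idF_iso.
case/sep_functional => e [e1 e0]; exists e; split=> // f fh fi.
by apply: e0; apply/HU.
Qed.

Definition wt (w : vertex Q -> int) X : int := \sum_i w i * (dimvec X i)%:Z.

Lemma wt_ses w X E Y (i : C0 X E) (p : C0 E Y) : ses i p -> wt w E = wt w X + wt w Y.
Proof.
move/ses_dim=> H; rewrite /wt -big_split; apply: eq_bigr => v _.
by rewrite H PoszD mulrDr.
Qed.
Lemma compl_ses X (A B : subrep X) : complementary A B -> exists r : C0 X (rep_of A), ses (incl B) r.
Proof.
move=> AB; have [r [rh ri rk]] := compl_split AB; exists r; split=> //.
- exact: isHom_incl.
- exact: mono_incl.
- exact: id_epi ri.
by move=> v x; rewrite rk inclP.
Qed.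

Lemma not_indec X : ~ rep_zero X -> ~ indecomposable X ->
  exists A B : subrep X, [/\ complementary A B, ~ rep_zero (rep_of A) & ~ rep_zero (rep_of B)].
Proof.
move=> X0 nX; apply: contrapT => H; apply: nX; split=> // A B AB.
by apply: contrapT => /not_orP[nA nB]; apply: H; exists A, B.
Qed.

(** The weight is additive on direct sums, so a property that a sum always passes to one of its
    terms reaches an indecomposable summand. It is used for the sign of the defect. *)
Lemma indec_summand (w : vertex Q -> int) (P : int -> Prop) X :
  (forall a b, P (a + b) -> P a \/ P b) -> ~ rep_zero X -> P (wt w X) ->
  exists (Y : rep K Q) (s : C0 Y X) (r : C0 X Y),
   [/\ indecomposable Y, isHom s, isHom r, cmp r s = idF Y & P (wt w Y)].
Proof.
move=> PD; have [n] := ubnP (tot X); elim: n X => // n IH X lt X0 PX.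
have [iX|niX] := pselect (indecomposable X).
  by exists X, (idF X), (idF X); split=> //; [apply: isHom_id|apply: isHom_id|rewrite cmp1F].
have [A [B [AB A0 B0]]] := not_indec X0 niX.
wlog PA : A B AB A0 B0 / P (wt w (rep_of A)).
  move=> H; have [r rs] := compl_ses AB; move: (PX); rewrite (wt_ses w rs) => /PD[PB|PA].
    exact: (H B A (complC AB)).
  exact: (H A B AB).
have [r rs] := compl_ses AB; have [ra [rah rai rak]] := compl_split AB.
have ltA : (tot (rep_of A) < n)%N.
  apply: leq_trans (_ : tot X <= n)%N; last by rewrite -ltnS.
  rewrite (tot_ses rs) -[X in (X < _)%N]add0n ltn_add2r lt0n.
  by apply/eqP => /tot0P; apply: B0.
have [Y [s [r' [iY sh r'h r's PY]]]] := IH _ ltA A0 PA.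
exists Y, (cmp (incl A) s), (cmp r' ra); split=> //.
- exact: isHom_cmp (isHom_incl A) sh.
- exact: isHom_cmp.
by rewrite cmpA -(cmpA r') rai cmpF1.
Qed.

End Indec.

(** * Auslander-Reiten translates *)

Section DimBound.
Variables (K : fieldType) (I J : finType) (s t : J -> I) (ht : I -> nat).
Hypothesis htP : forall a, (ht (t a) < ht (s a))%N.

Definition place (V : I -> vectType K) i (v : V i) : fam V := fun j =>
  if i =P j is ReflectT e then eq_rect i V v j e else 0.

Lemma place_eq (V : I -> vectType K) i (v : V i) : place v i = v.
Proof.
rewrite /place; case: eqP => // e.
by rewrite (eq_irrelevance e erefl).
Qed.
Lemma place_neq (V : I -> vectType K) i j (v : V i) : i != j -> place v j = 0.
Proof. by rewrite /place; case: eqP. Qed.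
Lemma place_linear (V : I -> vectType K) i : linear (fun v : V i => place v).
Proof.
move=> k x y; apply/famP => j; rewrite famD famZ /place; case: eqP => [e|_].
  by case: j / e.
by rewrite scaler0 addr0.
Qed.

(* iterating [bnd] along the height bounds every V i by the socle dimension n0 *)
Fixpoint bnd n0 h := if h is h'.+1 then (n0 + #|J| * bnd n0 h')%N else 0%N.

Lemma leq_bnd n0 h h' : (h <= h')%N -> (bnd n0 h <= bnd n0 h')%N.
Proof.
elim: h h' => // h IH [|h'] //= le; rewrite leq_add2l leq_mul2l.
by rewrite IH ?orbT.
Qed.

(** Vectors of V i killed by all arrows lie in the socle, of dimension at most n0; modulo them V i
    embeds in the sum of the targets of its arrows, which have smaller height. *)
Lemma dim_bound (V : I -> vectType K) (A : forall a, 'Hom(V (s a), V (t a))) n0 :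
  (forall U : {vspace fam V}, (forall w, w \in U -> forall a, A a (w (s a)) = 0) ->
     (\dim U <= n0)%N) ->
  forall i, (\dim {: V i} <= bnd n0 (ht i).+1)%N.
Proof.
move=> soc i; have [h] := ubnP (ht i); elim: h i => // h IH i lt.
pose J' := {a : J | s a == i}.
have gl : linear (fun v : V i => (fun a : J' => A (val a) (place v (s (val a)))) : fam (fun a : J' => V (t (val a)))).
  move=> k x y; apply/famP => a; rewrite famD famZ.
  by rewrite place_linear famD famZ linearP.
pose g := mkhom gl; pose pl := mkhom (@place_linear V i).
have plE v : pl v = place v by rewrite mkhomE.
have plk : lker pl = 0%VS.
  apply/eqP; rewrite -subv0; apply/subvP => v /lkerP; rewrite plE => e.
  by rewrite memv0 -(place_eq v) e fam0.
rewrite -(limg_ker_dim g fullv) capfv /=; apply: leq_add.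
  have -> : \dim (lker g) = \dim (pl @: lker g)%VS by rewrite limg_dim_eq // plk capv0.
  apply: soc => w /memv_imgP[v /lkerP gv ->] a; rewrite plE.
  have [e|ne] := eqVneq (s a) i.
    have := congr1 (fun w : fam (fun a : J' => V (t (val a))) => w (exist _ a (introT eqP e) : J')) gv.
    by rewrite mkhomE /= fam0.
  by rewrite place_neq 1?eq_sym // linear0.
apply: leq_trans (dimvS (subvf _)) _; rewrite dim_fam.
apply: (@leq_trans (\sum_(a : J') bnd n0 (ht i))%N).
  apply: leq_sum => -[a /= /eqP sa] _.
  have := htP a; rewrite sa => lta.
  apply: leq_trans (IH _ (leq_trans lta lt)) _; exact: leq_bnd.
rewrite sum_nat_const leq_mul // card_sub; exact: max_card.
Qed.

End DimBound.

Section Acyclic.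
Variable Q : quiver.
Hypothesis aQ : acyclic Q.

Definition height (i : vertex Q) := #|[pred j | connect (@adjacent Q) i j]|.
Lemma adjP a : @adjacent Q (src a) (tgt a).
Proof. by apply/existsP; exists a; rewrite !eqxx. Qed.
Lemma height_lt a : (height (tgt a) < height (src a))%N.
Proof.
apply/proper_card/properP; split.
  by apply/fintype.subsetP => j; rewrite !inE; apply: connect_trans; apply: connect1 (adjP a).
by exists (src a); rewrite !inE ?connect0 //; apply: aQ.
Qed.
Definition coheight (i : vertex Q) := (#|vertex Q| - height i)%N.
Lemma coheight_lt a : (coheight (src a) < coheight (tgt a))%N.
Proof.
rewrite /coheight ltn_sub2l ?height_lt //.
by apply: leq_trans (height_lt a) _; apply: max_card.
Qed.
End Acyclic.

(** * Objects representing the dual of Ext *)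

Section Universal.
Variables (K : fieldType) (Q : quiver).
Hypothesis aQ : acyclic Q.
Implicit Types (X Y Z W E M : rep K Q).

Definition is_funct X Y (phi : 'Hom(C1 X Y, K^o)) := forall u, phi (dlt X Y u) = 0.

Lemma functP X Y (phi : 'Hom(C1 X Y, K^o)) c : is_funct phi -> c \in limg (dlt X Y) -> phi c = 0.
Proof. by move=> H /memv_imgP[u _ ->]. Qed.

Lemma funct_sep X Y (c : C1 X Y) : c \notin limg (dlt X Y) ->
  exists2 phi : 'Hom(C1 X Y, K^o), is_funct phi & phi c = 1.
Proof.
move/sep_functional => [f [f1 f0]]; exists f => // u.
by apply: f0; rewrite memv_img ?memvf.
Qed.

Lemma push_lift X Y Z (f : C0 Y Z) (c : C1 X Z) :
  (forall a x, exists y, f (tgt a) y = c a x) -> exists c', push X f c' = c.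
Proof.
move=> H; exists ((fun a => ((f (tgt a))^-1 \o c a)%VF) : C1 X Y).
apply: C1P => a x; rewrite pushE comp_lfunE limg_lfunVK //.
by have [y <-] := H a x; rewrite memv_img ?memvf.
Qed.

Lemma pull_lift X' X Y (u : C0 X' X) (c : C1 X' Y) :
  (forall a x, u (src a) x = 0 -> c a x = 0) -> exists c', pull Y u c' = c.
Proof.
move=> H; exists ((fun a => (c a \o (u (src a))^-1)%VF) : C1 X Y).
apply: C1P => a x; rewrite pullE comp_lfunE; apply/eqP; rewrite -subr_eq0 -linearB /=.
by apply/eqP/H; rewrite linearB /= limg_lfunVK ?subrr ?memv_img ?memvf.
Qed.

Lemma dsum X Y : exists (P : rep K Q) (i1 : C0 X P) (i2 : C0 Y P) (p1 : C0 P X) (p2 : C0 P Y),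
  [/\ isHom i1, isHom i2, isHom p1 & isHom p2] /\
  [/\ cmp p1 i1 = idF X, cmp p2 i2 = idF Y, cmp p1 i2 = 0 & cmp p2 i1 = 0].
Proof.
have [P [i [p [ip cl]]]] := class_ses (0 : C1 Y X).
have [ih ph im pe ex] := ip.
have [s sh ps] : exists2 s, isHom s & cmp p s = idF Y.
  by apply/(ext_pull ip cl (isHom_id Y)); rewrite linear0 mem0v.
have [r rh ri] : exists2 r, isHom r & cmp r i = idF X.
  by apply/(ext_push ip cl (isHom_id X)); rewrite linear0 mem0v.
have pi0 : cmp p i = 0 by apply: C0P => v x; rewrite !FE; apply/ex; exists x.
exists P, i, (s - cmp i (cmp r s)), r, p; do 2 split=> //.
- by apply: isHomB => //; apply: isHom_cmp => //; apply: isHom_cmp.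
- apply: C0P => v x; rewrite !FE linearB /= (cmp_id ps).
  by have -> : p v (i v (r v (s v x))) = 0; [apply/ex; eexists | rewrite subr0].
- by apply: C0P => v x; rewrite !FE linearB /= (cmp_id ri) subrr.
Qed.

(* maps from [semis] to Y detect the elements of Y killed by all arrows *)
Definition semis : rep K Q := @Rep K Q (fun _ => K^o : vectType K) (fun _ => 0).

(** Injectivity of the map f |-> phi o push f from Hom(Z, Y) to the dual of the cochains, for all Z;
    [cofaithfulF] is its mirror image. *)
Definition faithfulF X Y (phi : 'Hom(C1 X Y, K^o)) := forall Z (f : C0 Z Y),
  isHom f -> (forall c, phi (push X f c) = 0) -> f = 0.
Definition cofaithfulF X Y (phi : 'Hom(C1 X Y, K^o)) := forall Z (f : C0 X Z),
  isHom f -> (forall c, phi (pull Y f c) = 0) -> f = 0.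

(** Families of vectors killed by all arrows are the maps from [semis] to Y. Faithfulness embeds
    them in the dual of the fixed space C1 X semis, which bounds the socle of Y and, by height, Y
    itself. *)
Lemma faithful_bound X : exists b, forall Y (phi : 'Hom(C1 X Y, K^o)),
  faithfulF phi -> (tot Y <= b)%N.
Proof.
pose n0 := \dim {: 'Hom(C1 X semis, K^o)}.
exists (\sum_(i : vertex Q) bnd (arrow Q) n0 (height i).+1)%N => Y phi fphi.
apply: leq_sum => i _; apply: (dim_bound (height_lt aQ) (A := fun a => rep_map Y a)) => U HU.
pose fw (w : fam (fun i => Y i)) : C0 semis Y := fun i =>
  mkhom (f := fun k : K^o => k *: w i) (fun a x y => etrans (scalerDl _ _ _) (congr1 (+%R^~ _) (esym (scalerA _ _ _)))).
have fwE w j k : fw w j k = k *: w j by rewrite mkhomE.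
have Tl : linear (fun w => (phi \o push X (fw w))%VF).
  move=> k v w; apply/lfunP => c; rewrite add_lfunE scale_lfunE !comp_lfunE -linearP; congr (phi _).
  by apply: C1P => a x; rewrite !FE !pushE !fwE famD famZ scalerDr !scalerA mulrC.
pose T := mkhom Tl.
have -> : \dim U = \dim (T @: U)%VS.
  rewrite limg_dim_eq //; apply/eqP; rewrite -subv0; apply/subvP => w /memv_capP[wU /lkerP Tw].
  rewrite memv0; apply/eqP/famP => j; rewrite fam0.
  have fh : isHom (fw w).
    by move=> a k; rewrite !fwE /= lfunE /= scale0r linearZ /= (HU w wU) scaler0.
  have f0 : fw w = 0.
    by apply: fphi fh _ => c; rewrite -comp_lfunE -[(_ \o _)%VF](mkhomE Tl) -/T Tw lfunE.
  by rewrite -[w j]scale1r -fwE f0 FE.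
by rewrite dimvS ?subvf.
Qed.

Lemma cofaithful_bound Y : exists b, forall X (phi : 'Hom(C1 X Y, K^o)),
  cofaithfulF phi -> (tot X <= b)%N.
Proof.
pose n0 := \dim {: 'Hom(C1 semis Y, K^o)}.
exists (\sum_(i : vertex Q) bnd (arrow Q) n0 (coheight i).+1)%N => X phi fphi.
apply: leq_sum => i _; pose D i : vectType K := 'Hom(X i, K^o).
have -> : dimvec X i = \dim {: D i}.
  by rewrite /dimvec !dimvf /D /dim /= muln1.
have Al a : linear (fun f : D (tgt a) => (f \o rep_map X a)%VF : D (src a)).
  by move=> k f g; rewrite comp_lfunDl comp_lfunZl.
apply: (dim_bound (coheight_lt aQ) (A := fun a => mkhom (Al a))) => U HU.
pose fw (w : fam D) : C0 X semis := fun i => w i.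
have Tl : linear (fun w => (phi \o pull Y (fw w))%VF).
  move=> k v w; apply/lfunP => c; rewrite add_lfunE scale_lfunE !comp_lfunE -linearP; congr (phi _).
  by apply: C1P => a x; rewrite !FE !pullE /fw famD famZ add_lfunE scale_lfunE linearP.
pose T := mkhom Tl.
have -> : \dim U = \dim (T @: U)%VS.
  rewrite limg_dim_eq //; apply/eqP; rewrite -subv0; apply/subvP => w /memv_capP[wU /lkerP Tw].
  rewrite memv0; apply/eqP.
  have fh : isHom (fw w).
    move=> a x; rewrite /= lfunE /=; have := HU w wU a; rewrite mkhomE => e.
    by rewrite -comp_lfunE e lfunE.
  apply: (fphi _ (fw w) fh) => c.
  by rewrite -comp_lfunE -[(_ \o _)%VF](mkhomE Tl) -/T Tw lfunE.
by rewrite dimvS ?subvf.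
Qed.

(* For X indecomposable and not projective, the object L representing the functor
   Z |-> Ext(X, Z)^* is the Auslander-Reiten translate of X. *)
Definition univF X L (phi : 'Hom(C1 X L, K^o)) :=
  [/\ is_funct phi,
   forall Y (psi : 'Hom(C1 X Y, K^o)), is_funct psi ->
     exists2 v : C0 Y L, isHom v & forall c, phi (push X v c) = psi c &
   faithfulF phi].
Definition univG Y X (phi : 'Hom(C1 X Y, K^o)) :=
  [/\ is_funct phi,
   forall Z (psi : 'Hom(C1 Z Y, K^o)), is_funct psi ->
     exists2 v : C0 X Z, isHom v & forall c, phi (pull Y v c) = psi c &
   cofaithfulF phi].

Lemma pushB X Y Z (f g : C0 Y Z) c : push X (f - g) c = push X f c - push X g c.
Proof. by apply: C1P => a x; rewrite !(pushE, FE). Qed.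

Lemma push0 X Y Z c : push X (0 : C0 Y Z) c = 0.
Proof. by apply: C1P => a x; rewrite pushE !FE. Qed.
Lemma pull0 X' X Y c : pull Y (0 : C0 X' X) c = 0.
Proof. by apply: C1P => a x; rewrite pullE !FE linear0. Qed.

(** L carries a faithful functional and has maximal dimension. Given psi on Y, the sum functional on
    L + Y becomes faithful modulo the largest subrepresentation that it kills. L embeds in this
    quotient, equals it by maximality, and the map from Y to the quotient represents psi. *)
Theorem exists_univF X : exists L (phi : 'Hom(C1 X L, K^o)), univF phi.
Proof.
have [b Hb] := faithful_bound X.
have [Z0 Z0z] : exists Z0 : rep K Q, rep_zero Z0.
  have [N HN] := subrep_zero X; exists (rep_of N).
  by apply/rep_zero_dim => i; rewrite dim_rep_of HN dimv0.
pose ok L (phi : 'Hom(C1 X L, K^o)) := is_funct phi /\ faithfulF phi.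
have ex0 : exists n, `[< exists L (phi : 'Hom(C1 X L, K^o)), ok L phi /\ tot L = n >].
  exists (tot Z0); apply/asboolP; exists Z0, 0; split=> //; split=> [u|Z f fh _].
    by rewrite lfunE.
  exact: zero_to.
have ub n : `[< exists L (phi : 'Hom(C1 X L, K^o)), ok L phi /\ tot L = n >] -> (n <= b)%N.
  by move=> /asboolP[L [phi [[_ fphi] <-]]]; apply: Hb fphi.
case: (ex_maxnP ex0 ub) => n /asboolP[L [phi [[phif phiF] totL]]] nmax.
exists L, phi; split=> // Y psi psif.
have [P [i1 [i2 [p1 [p2 [[i1h i2h p1h p2h] [p11 p22 p12 p21]]]]]]] := dsum L Y.
pose chi : 'Hom(C1 X P, K^o) := (phi \o push X p1)%VF + (psi \o push X p2)%VF.
have chiE c : chi c = phi (push X p1 c) + psi (push X p2 c).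
  by rewrite add_lfunE !comp_lfunE.
have chif : is_funct chi by move=> u; rewrite chiE !push_dlt // phif psif addr0.
pose killed (Z : subrep P) := forall c, chi (push X (incl Z) c) = 0.
have exk : exists m, `[< exists Z : subrep P, killed Z /\ tot (rep_of Z) = m >].
  have [Z HZ] := subrep_zero P; exists (tot (rep_of Z)); apply/asboolP; exists Z; split=> // c.
  have -> : incl Z = 0.
    by apply: zero_from; apply/rep_zero_dim => i; rewrite dim_rep_of HZ dimv0.
  have -> : push X (0 : C0 (rep_of Z) P) c = 0 by exact: push0.
  by rewrite linear0.
have ubk m : `[< exists Z : subrep P, killed Z /\ tot (rep_of Z) = m >] -> (m <= tot P)%N.
  by move=> /asboolP[Z [_ <-]]; apply: tot_mono (mono_incl Z).
case: (ex_maxnP exk ubk) => m /asboolP[Z [kZ totZ]] mmax.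
pose q := prj Z; have qh : isHom q := isHom_prj Z; have qe : epi q := epi_prj Z.
have [s qs] := epi_rinv qe; have qsE := cmp_id qs.
pose chib : 'Hom(C1 X (quo Z), K^o) := (chi \o push X s)%VF.
have chibE c : chib (push X q c) = chi c.
  rewrite comp_lfunE; apply/eqP; rewrite -subr_eq0 -linearB /=.
  have [c' <-] : exists c', push X (incl Z) c' = push X s (push X q c) - c; last by rewrite kZ eqxx.
  apply: push_lift => a x; apply/inclP/prjP.
  by rewrite !FE !pushE linearB /= -/q qsE subrr.
have chibf : is_funct chib.
  move=> u; have <- : push X q (dlt X P (cmp s u)) = dlt X (quo Z) u.
    by rewrite push_dlt //; congr (dlt X _ _); rewrite cmpA qs cmp1F.
  by rewrite chibE chif.
have chibF : faithfulF chib.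
  move=> W f fh f0; have [B HB] := sub_im fh; have [Z' HZ'] := sub_pre B qh.
  have kZ' : killed Z'.
    move=> c; rewrite -chibE -push_cmp.
    have [c' <-] : exists c', push X f c' = push X (cmp q (incl Z')) c; last by rewrite f0.
    apply: push_lift => a x; rewrite pushE FE; apply/HB/HZ'/inclP; by eexists.
  have ZZ' i : (Z i <= Z' i)%VS.
    apply/subvP => x /prjP xZ; apply/HZ'; rewrite /q xZ; exact: mem0v.
  have le : (tot (rep_of Z') <= tot (rep_of Z))%N.
    by rewrite totZ; apply: mmax; apply/asboolP; exists Z'.
  have eqZ i : Z i = Z' i.
    apply/eqP; rewrite eqEdim ZZ' -!dim_rep_of.
    by apply: leq_sum_eq i => // i; rewrite !dim_rep_of dimvS.
  apply: C0P => i w; rewrite FE -(qsE i (f i w)).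
  have : s i (f i w) \in Z' i by apply/HZ'; rewrite qsE; apply/HB; exists w.
  by rewrite -eqZ => /prjP.
have qi1 : mono (cmp q i1).
  have qi1h : isHom (cmp q i1) := isHom_cmp qh i1h.
  have [N HN] := sub_ker qi1h.
  suff i0 : incl N = 0.
    by move=> i x /HN/inclP[u <-]; rewrite i0 FE.
  apply: phiF (isHom_incl N) _ => c.
  have -> : push X (incl N) c = push X p1 (push X i1 (push X (incl N) c)).
    by rewrite -[in RHS]push_cmp p11 push_id.
  have -> : phi (push X p1 (push X i1 (push X (incl N) c))) = chi (push X i1 (push X (incl N) c)).
    rewrite chiE -[in X in _ + psi X]push_cmp p21.
    have -> : push X (0 : C0 L Y) (push X (incl N) c) = 0 by exact: push0.
    by rewrite linear0 addr0.
  rewrite -chibE -!push_cmp.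
  have -> : cmp (cmp q i1) (incl N) = 0.
    apply: C0P => i u; have : incl N i u \in N i by apply/inclP; exists u.
    by move/HN; rewrite !FE.
  have -> : push X (0 : C0 (rep_of N) (quo Z)) c = 0 by exact: push0.
  by rewrite linear0.
have qi1i : isoF (cmp q i1).
  apply: mono_tot_iso => //; rewrite totL; apply: nmax; apply/asboolP; by exists (quo Z), chib.
have [g [gh ig _ _]] := isoF_inv (isHom_cmp qh i1h) qi1i.
exists (cmp g (cmp q i2)); first by apply: isHom_cmp => //; apply: isHom_cmp.
move=> c.
have -> : phi (push X (cmp g (cmp q i2)) c) = chi (push X i1 (push X (cmp g (cmp q i2)) c)).
  rewrite chiE -!push_cmp !cmpA p11 p21 cmp1F !cmp0F.
  have -> : push X (0 : C0 Y Y) c = 0 by exact: push0.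
  by rewrite linear0 addr0.
rewrite -chibE -!push_cmp !cmpA ig cmp1F push_cmp chibE chiE -!push_cmp p12 p22 push_id.
have -> : push X (0 : C0 Y L) c = 0 by exact: push0.
by rewrite linear0 add0r.
Qed.

End Universal.

Section UniversalG.
Variables (K : fieldType) (Q : quiver).
Hypothesis aQ : acyclic Q.
Implicit Types (X Y W E M : rep K Q).

(** The dual construction: in place of a quotient, the smallest subrepresentation of X + X' such
    that the functional factors through restriction to it. *)
Theorem exists_univG Y : exists X (phi : 'Hom(C1 X Y, K^o)), univG phi.
Proof.
have [b Hb] := cofaithful_bound aQ Y.
have [Z0 Z0z] : exists Z0 : rep K Q, rep_zero Z0.
  have [N HN] := subrep_zero Y; exists (rep_of N).
  by apply/rep_zero_dim => i; rewrite dim_rep_of HN dimv0.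
pose ok X (phi : 'Hom(C1 X Y, K^o)) := is_funct phi /\ cofaithfulF phi.
have ex0 : exists n, `[< exists X (phi : 'Hom(C1 X Y, K^o)), ok X phi /\ tot X = n >].
  exists (tot Z0); apply/asboolP; exists Z0, 0; split=> //; split=> [u|Z f fh _].
    by rewrite lfunE.
  exact: zero_from.
have ub n : `[< exists X (phi : 'Hom(C1 X Y, K^o)), ok X phi /\ tot X = n >] -> (n <= b)%N.
  by move=> /asboolP[X [phi [[_ fphi] <-]]]; apply: Hb fphi.
case: (ex_maxnP ex0 ub) => n /asboolP[X [phi [[phif phiF] totX]]] nmax.
exists X, phi; split=> // X' psi psif.
have [P [i1 [i2 [p1 [p2 [[i1h i2h p1h p2h] [p11 p22 p12 p21]]]]]]] := dsum X X'.
pose chi : 'Hom(C1 P Y, K^o) := (phi \o pull Y i1)%VF + (psi \o pull Y i2)%VF.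
have chiE c : chi c = phi (pull Y i1 c) + psi (pull Y i2 c).
  by rewrite add_lfunE !comp_lfunE.
have chif : is_funct chi by move=> u; rewrite chiE !pull_dlt // phif psif addr0.
pose supp (Z : subrep P) := forall c, pull Y (incl Z) c = 0 -> chi c = 0.
have exk : exists m, `[< exists Z : subrep P, supp Z /\ tot (rep_of Z) = m >].
  have [Z HZ] := subrep_full P; exists (tot (rep_of Z)); apply/asboolP; exists Z; split=> // c c0.
  have -> : c = 0; last by rewrite linear0.
  apply: C1P => a x; have /inclP[u <-] : x \in Z (src a) by rewrite HZ memvf.
  by rewrite -pullE c0 !FE.
case: (ex_minnP exk) => m /asboolP[Z [kZ totZ]] mmin.
pose q := incl Z; have qh : isHom q := isHom_incl Z; have qm : mono q := mono_incl Z.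
have [r rq] := mono_linv qm; have rqE := cmp_id rq.
pose chib : 'Hom(C1 (rep_of Z) Y, K^o) := (chi \o pull Y r)%VF.
have chibE c : chib (pull Y q c) = chi c.
  rewrite comp_lfunE; apply/eqP; rewrite -subr_eq0 -linearB; apply/eqP/kZ.
  change (pull Y q (pull Y r (pull Y q c) - c) = 0); rewrite lfB.
  by rewrite -!pull_cmp -cmpA rq cmpF1 subrr.
have chibf : is_funct chib.
  move=> u; have <- : pull Y q (dlt P Y (cmp u r)) = dlt (rep_of Z) Y u.
    by rewrite pull_dlt //; congr (dlt _ Y _); rewrite -cmpA rq cmpF1.
  by rewrite chibE chif.
have chibF : cofaithfulF chib.
  move=> W f fh f0; have [B HB] := sub_ker fh; have [Z' HZ'] := sub_map B qh.
  have kZ' : supp Z'.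
    move=> c c0; rewrite -chibE.
    have [c' <-] : exists c', pull Y f c' = pull Y q c; last by rewrite f0.
    apply: pull_lift => a x /HB xB; rewrite pullE.
    have /inclP[u <-] : q (src a) x \in Z' (src a) by apply/HZ'; exists x.
    by rewrite -pullE c0 FE.
  have ZZ' i : (Z' i <= Z i)%VS.
    by apply/subvP => x /HZ'[y _ <-]; apply/inclP; exists y.
  have le : (tot (rep_of Z) <= tot (rep_of Z'))%N.
    by rewrite totZ; apply: mmin; apply/asboolP; exists Z'.
  have eqZ i : Z' i = Z i.
    apply/eqP; rewrite eqEdim ZZ' -!dim_rep_of.
    by apply: leq_sum_eq i => // i; rewrite !dim_rep_of dimvS.
  apply: C0P => i w; rewrite FE; apply/HB.
  have : q i w \in Z' i by rewrite eqZ; apply/inclP; exists w.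
  by move/HZ' => [x xB /(monoB qm) <-].
have phiE c : phi c = chib (pull Y (cmp p1 q) c).
  by rewrite pull_cmp chibE chiE -!pull_cmp p11 p12 pull_id pull0 linear0 addr0.
have p1qh : isHom (cmp p1 q) by apply: isHom_cmp.
have qi1 : epi (cmp p1 q).
  have [N HN] := sub_im p1qh.
  suff i0 : prj N = 0.
    move=> i x; apply/HN/prjP; by rewrite i0 FE.
  apply: phiF (isHom_prj N) _ => c; rewrite phiE -pull_cmp.
  have -> : cmp (prj N) (cmp p1 q) = 0; last by rewrite pull0 linear0.
  by apply: C0P => i u; rewrite FE [RHS]FE; apply/prjP/HN; exists u.
have qi1i : isoF (cmp p1 q).
  apply: epi_tot_iso => //; rewrite totX; apply: nmax; apply/asboolP; by exists (rep_of Z), chib.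
have [g [gh ig gi _]] := isoF_inv p1qh qi1i.
exists (cmp p2 (cmp q g)); first by apply: isHom_cmp => //; apply: isHom_cmp.
move=> c; rewrite phiE -pull_cmp.
have -> : cmp (cmp p2 (cmp q g)) (cmp p1 q) = cmp p2 q.
  by rewrite -cmpA -(cmpA q) gi cmpF1.
by rewrite pull_cmp chibE chiE -!pull_cmp p22 p21 pull_id pull0 linear0 add0r.
Qed.

End UniversalG.

(** * Duality of finite-dimensional vector spaces *)

Section Dual.
Variable K : fieldType.

Lemma dim_dual (V : vectType K) : \dim {: 'Hom(V, K^o)} = \dim {: V}.
Proof. by rewrite !dimvf /dim /= muln1. Qed.

Lemma dim_annihilator (V : vectType K) (U : {vspace V}) (A : {vspace 'Hom(V, K^o)}) :
  (forall f, f \in A <-> forall u, u \in U -> f u = 0) ->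
  \dim A = (\dim {: V} - \dim U)%N.
Proof.
move=> HA.
have Tl : linear (fun f : 'Hom(V, K^o) => (f \o linfun (@vsval _ _ U))%VF : 'Hom(subvs_of U, K^o)).
  by move=> k f g; rewrite comp_lfunDl comp_lfunZl.
pose T := mkhom Tl.
have TE f u : T f u = f (vsval u) by rewrite mkhomE comp_lfunE lfunE.
have -> : A = lker T.
  apply/vspaceP => f; apply/idP/lkerP => [/HA f0|f0].
    by apply/lfunP => u; rewrite TE lfunE; apply: f0; apply: subvsP.
  by apply/HA => u uU; rewrite -(vsprojK uU) -TE f0 lfunE.
have TS : limg T = fullv.
  apply/limg_fullP => g; exists (g \o linfun (vsproj U) \o projv U)%VF.
  apply/lfunP => u; rewrite TE !comp_lfunE lfunE projv_id ?subvsP //.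
  congr (g _); exact: vsvalK.
rewrite -dim_dual -(limg_ker_dim T fullv) capfv TS dim_dual.
by rewrite [\dim {: subvs_of U}]dimvf /dim /= addnK.
Qed.

Lemma dual_full (H : vectType K) (U : {vspace 'Hom(H, K^o)}) :
  (forall h, (forall f, f \in U -> f h = 0) -> h = 0) -> U = fullv.
Proof.
move=> HU; apply/eqP; rewrite eqEdim subvf /= dim_dual.
have el h : linear (fun f : subvs_of U => (vsval f) h).
  by move=> k f g; rewrite add_lfunE scale_lfunE.
have Tl : linear (fun h => mkhom (@el h) : 'Hom(subvs_of U, K^o)).
  by move=> k x y; apply/lfunP => f; rewrite add_lfunE scale_lfunE !mkhomE linearP.
pose T := mkhom Tl.
have T0 : lker T = 0%VS.
  apply/eqP; rewrite -subv0; apply/subvP => h /lkerP Th; rewrite memv0; apply/eqP/HU => f fU.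
  by rewrite -(vsprojK fU) -(mkhomE (@el h)) -(mkhomE Tl) -/T Th lfunE.
rewrite -(limg_ker_dim T fullv) T0 capv0 dimv0 add0n.
apply: leq_trans (dimvS (subvf _)) _.
by rewrite dim_dual [\dim {: subvs_of U}]dimvf.
Qed.

(** S embeds in the dual of W, so evaluation at vectors of W gives every functional on S. This
    yields extension classes with prescribed pairings. *)
Lemma double_dual (H W : vectType K) (T : 'Hom(H, 'Hom(W, K^o))) (S : {vspace H}) (e : 'Hom(H, K^o)) :
  (forall h, h \in S -> T h = 0 -> h = 0) ->
  exists w, forall h, h \in S -> T h w = e h.
Proof.
move=> Ti.
have wl w : linear (fun h : subvs_of S => T (vsval h) w).
  by move=> k f g; rewrite !linearP add_lfunE scale_lfunE.
have Rl : linear (fun w => mkhom (@wl w) : 'Hom(subvs_of S, K^o)).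
  by move=> k x y; apply/lfunP => f; rewrite add_lfunE scale_lfunE !mkhomE linearP.
have : limg (mkhom Rl) = fullv.
  apply: dual_full => h h0; apply: val_inj; apply: (Ti _ (subvsP h)); apply/lfunP => w.
  rewrite lfunE -(mkhomE (@wl w)) -(mkhomE Rl); apply: h0; exact: memv_img (memvf _).
move/limg_fullP => /(_ (e \o linfun vsval)%VF) [w Hw]; exists w => h hS.
by rewrite -(vsprojK hS) -(mkhomE (@wl w)) -(mkhomE Rl) Hw comp_lfunE lfunE.
Qed.

Lemma extend_functional (D C : vectType K) (T : 'Hom(D, C)) (B : {vspace C}) (phi : 'Hom(D, K^o)) :
  (forall d, T d \in B -> phi d = 0) ->
  exists psi : 'Hom(C, K^o), (forall d, psi (T d) = phi d) /\ forall b, b \in B -> psi b = 0.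
Proof.
move=> H.
(* the functional lives on the range of T modulo B *)
pose T' : 'Hom(D, subvs_of (B^C)%VS) := (prjv B \o T)%VF.
have T'0 d : T' d = 0 -> phi d = 0 by rewrite comp_lfunE => /prjv_eq0/H.
exists (phi \o T'^-1 \o projv (limg T') \o prjv B)%VF; split=> [d|b bB]; last first.
  by rewrite 3!comp_lfunE (prjv_eq0 B b).2 // !linear0.
rewrite 3!comp_lfunE.
have e : prjv B (T d) = T' d by rewrite [RHS]comp_lfunE.
rewrite e projv_id ?memv_img ?memvf //; apply/eqP; rewrite -subr_eq0 -linearB /=.
by apply/eqP/T'0; rewrite linearB /= limg_lfunVK ?subrr // memv_img ?memvf.
Qed.

End Dual.

(** * Auslander-Reiten formulas and almost split sequences *)

Section AR.
Variables (K : fieldType) (Q : quiver).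
Hypothesis aQ : acyclic Q.
Implicit Types (X Y Z W E M L : rep K Q).

Lemma pushfun_linear X Z L (phi : 'Hom(C1 X L, K^o)) :
  linear (fun v : C0 Z L => (phi \o push X v)%VF).
Proof.
move=> k v w; apply/lfunP => c.
by rewrite add_lfunE scale_lfunE !comp_lfunE pushD pushZ lfD lfZ.
Qed.
Definition pushfun X Z L (phi : 'Hom(C1 X L, K^o)) : 'Hom(C0 Z L, 'Hom(C1 X Z, K^o)) :=
  mkhom (@pushfun_linear X Z L phi).
Lemma pushfunE X Z L (phi : 'Hom(C1 X L, K^o)) (v : C0 Z L) c : pushfun Z phi v c = phi (push X v c).
Proof. by rewrite mkhomE comp_lfunE. Qed.

Lemma univF_hom X L (phi : 'Hom(C1 X L, K^o)) : univF phi -> forall Z, hom Z L = ext X Z.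
Proof.
move=> [pf pu pF] Z; rewrite /hom /ext.
pose S := lker (dlt Z L); pose A := (pushfun Z phi @: S)%VS.
rewrite -/S; have <- : \dim A = (\dim {: C1 X Z} - \dim (limg (dlt X Z)))%N.
  apply: dim_annihilator => f; split=> [/memv_imgP[v vS ->] u /memv_imgP[w _ ->]|H].
    by rewrite pushfunE push_dlt ?pf //; apply/isHomP.
  have [v vh vE] := pu Z f (fun u => H _ (memv_img _ (memvf u))).
  apply/memv_imgP; exists v; first exact/isHomP.
  by apply/lfunP => c; rewrite pushfunE vE.
rewrite limg_dim_eq //; apply/eqP; rewrite -subv0; apply/subvP => v /memv_capP[/isHomP vh /lkerP Tv].
by rewrite memv0; apply/eqP/pF => // c; rewrite -pushfunE Tv lfunE.
Qed.

Lemma univF_iso X L L' (phi : 'Hom(C1 X L, K^o)) (s : C0 L' L) : univF phi ->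
  isHom s -> isoF s -> univF (phi \o push X s)%VF.
Proof.
move=> [pf pu pF] sh si; have [g [gh sg gs _]] := isoF_inv sh si.
split=> [u|Y psi psif|Z f fh f0].
- by rewrite comp_lfunE push_dlt ?pf.
- have [v vh vE] := pu Y psi psif; exists (cmp g v); first exact: isHom_cmp.
  by move=> c; rewrite comp_lfunE -push_cmp cmpA sg cmp1F.
have sf0 : cmp s f = 0.
  by apply: pF; [apply: isHom_cmp | move=> c; rewrite push_cmp -comp_lfunE].
by rewrite -(cmp1F f) -gs -cmpA sf0 cmpF0.
Qed.

Section Pairing.
Variables (X L : rep K Q) (phi : 'Hom(C1 X L, K^o)).
Hypothesis uphi : univF phi.

(** By hypothesis phi vanishes on the image of Hom(X, Z) -> Ext(X, L), the kernel of Ext(X, L) ->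
    Ext(X, E), so it extends to Ext(X, E). A map E -> L representing the extension retracts i by
    faithfulness, and c splits. *)
Lemma pairing_left Z (c : C1 Z L) :
  (forall u : C0 X Z, isHom u -> phi (pull L u c) = 0) -> c \in limg (dlt Z L).
Proof.
have [pf pu pF] := uphi; move=> Hc.
have [E [i [p [ip ci]]]] := class_ses c; have [s [ps ics]] := ci.
have [ih ph im pe ex] := ip.
have [psi [psiE psiB]] : exists psi : 'Hom(C1 X E, K^o),
    (forall d, psi (push X i d) = phi d) /\ forall b, b \in limg (dlt X E) -> psi b = 0.
  apply: extend_functional => d /memv_imgP[e _ de].
  have uh : isHom (cmp p e).
    apply/isHomP/lkerP; rewrite -push_dlt // -de -push_cmp.
    have -> : cmp p i = 0 by apply: C0P => v x; rewrite !FE; apply/ex; exists x.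
    exact: push0.
  pose u := cmp p e.
  have [r ri] := mono_linv im; pose w := cmp r (e - cmp s u).
  have iw : cmp i w = e - cmp s u.
    apply: C0P => v x; rewrite cmpE /w cmpE.
    have [y <-] : exists y, i v y = (e - cmp s u) v x; last by rewrite (cmp_id ri).
    by apply/ex; rewrite !FE lfB (cmp_id ps) subrr.
  have dE : d = pull L u c + dlt X L w.
    apply: C1P => a x; apply: (monoB im); rewrite -pushE de.
    have -> : e = cmp s u + cmp i w by rewrite iw addrC subrK.
    by rewrite lfD -(pull_dlt s) // -(push_dlt w) // -ics -push_pull !FE lfD -!pushE.
  by rewrite dE lfD pf addr0 Hc.
have psif : is_funct psi by move=> u; apply: psiB; rewrite memv_img ?memvf.
have [g gh gE] := pu E psi psif.
rewrite -[c]push_id; apply/(ext_push ip ci (isHom_id L)); exists g => //.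
apply/eqP; rewrite -subr_eq0; apply/eqP/pF.
  by apply: isHomB; [apply: isHom_cmp | apply: isHom_id].
by move=> d; rewrite pushB lfB push_cmp gE psiE push_id subrr.
Qed.

(** N is the image of u. If u' did not lift through an epimorphism with class c, a functional
    detecting the obstruction would be represented by some v. As Ext(Z, L) -> Ext(N, L) is onto, the
    class v c comes from Z, and there it pairs nontrivially with u. *)
Lemma pairing_lift Z (u : C0 X Z) : isHom u ->
  (forall c, phi (pull L u c) = 0) ->
  exists N (u' : C0 X N) (j : C0 N Z), [/\ isHom u', epi u', isHom j, u = cmp j u' &
   forall W (q : C0 W N), isHom q -> epi q -> exists2 l : C0 X W, isHom l & cmp q l = u'].
Proof.
have [pf pu pF] := uphi; move=> uh Hu.
have [N HN] := sub_im uh.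
have [u' u'h u'E] : exists2 u' : C0 X (rep_of N), isHom u' & forall v x, incl N v (u' v x) = u v x.
  apply: lift_mono => //; [exact: isHom_incl|exact: mono_incl|].
  by move=> v x; apply/inclP/HN; exists x.
have ue : u = cmp (incl N) u' by apply: C0P => v x; rewrite FE u'E.
have u'e : epi u'.
  move=> v y; have /HN[x xy] : incl N v y \in N v by apply/inclP; exists y.
  by exists x; apply: (monoB (mono_incl N)); rewrite u'E.
exists (rep_of N), u', (incl N); split=> //; first exact: isHom_incl.
move=> W q qh qe; have [B [_ Bs]] := ses_ker qh qe.
have [c cl] := ses_class Bs.
apply/(ext_pull Bs cl u'h); apply: contrapT => /negP.
case/funct_sep => psi psif psi1; have [v vh vE] := pu _ psi psif.
have [c' c'E] := pull_surj (mono_incl N) (push _ v c).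
have := Hu c'; rewrite ue pull_cmp c'E -push_pull vE psi1 => /eqP.
by rewrite oner_eq0.
Qed.
End Pairing.

Definition isProj P := forall Z, ext P Z = 0%N.
Definition isInj I := forall Z, ext Z I = 0%N.

(** For an extension of X with projection g, the composite u g is an epimorphism onto N, so u = u g
    l for some l. Then g l is not nilpotent; by Fitting it is invertible, and g splits. *)
Lemma super_lift_proj X N (u : C0 X N) : indecomposable X -> isHom u -> u <> 0 ->
  (forall W (q : C0 W N), isHom q -> epi q -> exists2 l : C0 X W, isHom l & cmp q l = u) ->
  epi u -> isProj X.
Proof.
move=> iX uh u0 Hl ue Z; apply/ext0P => c.
have [A [j [g [jg cl]]]] := class_ses c; have [_ gh _ ge _] := jg.
have [l lh gl] := Hl _ (cmp u g) (isHom_cmp uh gh) (epi_comp ue ge).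
have [gli|[n gn]] := fitting iX (isHom_cmp gh lh).
  have [k [kh glk _ _]] := isoF_inv (isHom_cmp gh lh) gli.
  rewrite -[c]pull_id; apply/(ext_pull jg cl (isHom_id X)).
  by exists (cmp l k); [apply: isHom_cmp | rewrite cmpA].
case: u0; have : cmp u (itF (cmp g l) n) = u.
  by elim: n {gn} => [|n IH] /=; rewrite ?cmpF1 // !cmpA gl.
by rewrite gn cmpF0.
Qed.

(** The pairing of Hom(X, Z) with Ext(Z, L) is nondegenerate: on one side by [pairing_left], and on
    the other because a nonzero u in the kernel would make X projective. *)
Lemma univF_ext X L (phi : 'Hom(C1 X L, K^o)) : univF phi -> indecomposable X -> ~ isProj X ->
  forall Z, ext Z L = hom X Z.
Proof.
move=> uphi iX nP Z; rewrite /ext /hom; pose H := lker (dlt X Z); rewrite -/H.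
have Tl1 c : linear (fun h : subvs_of H => phi (pull L (vsval h) c)).
  by move=> k f g; rewrite -lfZ -lfD; congr (phi _); rewrite linearP pullD pullZ.
have Tl : linear (fun c => mkhom (Tl1 c) : 'Hom(subvs_of H, K^o)).
  move=> k x y; apply/lfunP => f; rewrite add_lfunE scale_lfunE !(mkhomE (Tl1 _)).
  by rewrite !lfD !lfZ.
pose T := mkhom Tl.
have TE c u : isHom u -> T c (vsproj H u) = phi (pull L u c).
  by move=> /isHomP uH; rewrite (mkhomE Tl) (mkhomE (Tl1 _)) vsprojK.
have kT : lker T = limg (dlt Z L).
  apply/vspaceP => c; apply/lkerP/idP => [Tc|cB].
    by apply: (pairing_left uphi) => u uh; rewrite -TE // Tc zero_lfunE.
  have [pf _ _] := uphi; apply/lfunP => h; rewrite -(vsvalK h) TE; last by apply/isHomP/subvsP.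
  by rewrite zero_lfunE; apply: functP pf _; apply: pull_img => //; apply/isHomP/subvsP.
have TS : limg T = fullv.
  apply: dual_full => h Hh; apply: contrapT => h0; apply: nP.
  have uh : isHom (vsval h) by apply/isHomP/subvsP.
  have [c|N [u' [j [u'h u'e jh ue Hl]]]] := pairing_lift uphi uh.
    rewrite -TE // vsvalK; apply: Hh; exact: memv_img (memvf _).
  apply: (super_lift_proj iX u'h _ Hl u'e) => u'0; apply: h0; apply: val_inj.
  by rewrite /= ue u'0 cmpF0.
rewrite -kT -(limg_ker_dim T fullv) capfv TS dim_dual [\dim {: subvs_of H}]dimvf /dim /=.
by rewrite addnC addnK.
Qed.

Definition lasF L E (f : C0 L E) :=
  ~ (exists2 r, isHom r & cmp r f = idF L) /\
  forall X (h : C0 L X), isHom h -> ~ (exists2 r, isHom r & cmp r h = idF L) ->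
    exists2 h', isHom h' & cmp h' f = h.
Definition rasF E N (g : C0 E N) :=
  ~ (exists2 s, isHom s & cmp g s = idF N) /\
  forall X (h : C0 X N), isHom h -> ~ (exists2 s, isHom s & cmp h s = idF N) ->
    exists2 h', isHom h' & cmp g h' = h.
Definition tauF N L := exists E (f : C0 L E) (g : C0 E N), [/\ ses f g, lasF f & rasF g].

Lemma class_map_right L E X F Y (i : C0 L E) (p : C0 E X) c (i' : C0 L F) (p' : C0 F Y) c'
    (k : C0 E F) (kb : C0 X Y) :
  ses i' p' -> is_class i p c -> is_class i' p' c' -> isHom k -> isHom kb ->
  cmp k i = i' -> cmp p' k = cmp kb p -> c - pull L kb c' \in limg (dlt X L).
Proof.
move=> [i'h p'h i'm p'e ex'] [s [ps ic]] [s' [p's' ic']] kh kbh ki pk.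
have [r ri] := mono_linv i'm; pose w := cmp r (cmp k s - cmp s' kb).
have iw : cmp i' w = cmp k s - cmp s' kb.
  apply: C0P => v x; rewrite cmpE /w cmpE.
  have [y <-] : exists y, i' v y = (cmp k s - cmp s' kb) v x; last by rewrite (cmp_id ri).
  apply/ex'; rewrite addFE oppFE !cmpE lfB (cmp_id p's') -(cmpE p' k) pk cmpE (cmp_id ps).
  by rewrite subrr.
suff -> : c - pull L kb c' = dlt X L w by rewrite memv_img ?memvf.
have : push X i' (c - pull L kb c') = push X i' (dlt X L w).
  rewrite push_dlt // iw !lfB -{1}ki push_cmp ic push_dlt //.
  by rewrite push_pull ic' pull_dlt.
move=> e; apply: C1P => a x; apply: (monoB i'm).
by rewrite -!pushE e.
Qed.

Lemma class_map_left L E X F Y (i : C0 L E) (p : C0 E X) c (i' : C0 Y F) (p' : C0 F X) c'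
    (k : C0 F E) (kb : C0 Y L) :
  ses i p -> is_class i p c -> is_class i' p' c' -> isHom k -> isHom kb ->
  cmp p k = p' -> cmp k i' = cmp i kb -> push X kb c' - c \in limg (dlt X L).
Proof.
move=> [ih ph im pe ex] [s [ps ic]] [s' [p's' ic']] kh kbh pk ki.
have [r ri] := mono_linv im; pose w := cmp r (cmp k s' - s).
have iw : cmp i w = cmp k s' - s.
  apply: C0P => v x; rewrite cmpE /w cmpE.
  have [y <-] : exists y, i v y = (cmp k s' - s) v x; last by rewrite (cmp_id ri).
  by apply/ex; rewrite addFE oppFE lfB (cmp_id ps) cmpE -(cmpE p k) pk (cmp_id p's') subrr.
suff -> : push X kb c' - c = dlt X L w by rewrite memv_img ?memvf.
have : push X i (push X kb c' - c) = push X i (dlt X L w).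
  by rewrite push_dlt // iw !lfB -push_cmp -ki push_cmp ic' push_dlt // ic.
move=> e; apply: C1P => a x; apply: (monoB im).
by rewrite -!pushE e.
Qed.

Lemma notsec_class L E X (i : C0 L E) (p : C0 E X) c : ses i p -> is_class i p c ->
  (exists2 r, isHom r & cmp r i = idF L) <-> c \in limg (dlt X L).
Proof. by move=> ip cl; rewrite (ext_push ip cl (isHom_id L)) push_id. Qed.
Lemma notret_class L E X (i : C0 L E) (p : C0 E X) c : ses i p -> is_class i p c ->
  (exists2 s, isHom s & cmp p s = idF X) <-> c \in limg (dlt X L).
Proof. by move=> ip cl; rewrite (ext_pull ip cl (isHom_id X)) pull_id. Qed.

(** If h does not lift, the pulled back sequence does not split, so its inclusion i' extends along
    i. The induced map kb : X -> Y satisfies (h kb)^* c = c up to a coboundary. Were h kb nilpotent,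
    c would split; so it is invertible and h is a retraction. *)
Lemma las_ras L E X (i : C0 L E) (p : C0 E X) : ses i p -> indecomposable X -> lasF i -> rasF p.
Proof.
move=> ip iX [ns las]; have [c cl] := ses_class ip; have [ih ph im pe ex] := ip.
have cB := notsec_class ip cl.
split=> [/(notret_class ip cl)/cB //|Y h hh nh].
apply/(ext_pull ip cl hh); apply: contrapT => hB; apply: nh.
have [F [i' [p' [ip' cl']]]] := class_ses (pull L h c); have [i'h p'h i'm p'e ex'] := ip'.
have [k kh ki] := las F i' i'h (fun H => hB ((notsec_class ip' cl').1 H)).
have [kb kbh kbE] : exists2 kb : C0 X Y, isHom kb & forall v x, kb v (p v x) = cmp p' k v x.
  apply: desc_epi => //; first exact: isHom_cmp.
  by move=> v x /ex[y <-]; rewrite cmpE -(cmpE k) ki; apply/ex'; exists y.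
have pk : cmp p' k = cmp kb p by apply: C0P => v x; rewrite -kbE [RHS]cmpE.
have cc := class_map_right ip' cl cl' kh kbh ki pk.
have eh : isHom (cmp h kb) by apply: isHom_cmp.
have [ei|[n en]] := fitting iX eh.
  have [g [gh eg _ _]] := isoF_inv eh ei; exists (cmp kb g); first exact: isHom_cmp.
  by rewrite cmpA.
case: (ns); apply/cB.
suff H m : c - pull L (itF (cmp h kb) m) c \in limg (dlt X L).
  by have := H n; rewrite en pull0 subr0.
elim: m => [|m IH]; first by rewrite /= pull_id subrr mem0v.
have := memvD IH (pull_img (isHom_itF m eh) cc).
by rewrite lfB addrA subrK -pull_cmp -pull_cmp.
Qed.

Lemma itFSr X (f : C0 X X) n : itF f n.+1 = cmp (itF f n) f.
Proof.
elim: n => [|n IH]; first by rewrite /= cmpF1 cmp1F.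
by rewrite -[LHS]/(cmp f (itF f n.+1)) {1}IH cmpA.
Qed.

Lemma ras_las L E X (i : C0 L E) (p : C0 E X) : ses i p -> indecomposable L -> rasF p -> lasF i.
Proof.
move=> ip iL [ns ras]; have [c cl] := ses_class ip; have [ih ph im pe ex] := ip.
have cB := notret_class ip cl.
split=> [/(notsec_class ip cl)/cB //|Y h hh nh].
apply/(ext_push ip cl hh); apply: contrapT => hB; apply: nh.
have [F [i' [p' [ip' cl']]]] := class_ses (push X h c); have [i'h p'h i'm p'e ex'] := ip'.
have [k kh pk] := ras F p' p'h (fun H => hB ((notret_class ip' cl').1 H)).
have [kb kbh kbE] : exists2 kb : C0 Y L, isHom kb & forall v x, i v (kb v x) = cmp k i' v x.
  apply: lift_mono => //; first exact: isHom_cmp.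
  move=> v x; apply/ex; rewrite -cmpE cmpA pk cmpE; apply/ex'; by exists x.
have ki : cmp k i' = cmp i kb by apply: C0P => v x; rewrite -kbE [RHS]cmpE.
have cc := class_map_left ip cl cl' kh kbh pk ki.
have eh : isHom (cmp kb h) by apply: isHom_cmp.
have [ei|[n en]] := fitting iL eh.
  have [g [gh _ ge _]] := isoF_inv eh ei; exists (cmp g kb); first exact: isHom_cmp.
  by rewrite -cmpA.
case: (ns); apply/cB.
suff H m : push X (itF (cmp kb h) m) c - c \in limg (dlt X L).
  by have := H n; rewrite en push0 sub0r memvN.
elim: m => [|m IH]; first by rewrite /= push_id subrr mem0v.
have := memvD (push_img (isHom_itF m eh) cc) IH.
by rewrite lfB addrA subrK itFSr push_cmp push_cmp.
Qed.

End AR.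

Section AR2.
Variables (K : fieldType) (Q : quiver).
Hypothesis aQ : acyclic Q.
Implicit Types (X Y Z W E M L N P I : rep K Q).

Lemma indecP X : indecomposable X <-> ~ rep_zero X /\
  forall Y (s : C0 Y X) (r : C0 X Y), isHom s -> isHom r -> cmp r s = idF Y ->
    rep_zero Y \/ isoF s.
Proof.
split=> [iX|[X0 H]]; first by split=> [|Y s r sh rh rs]; [case: iX | apply: indec_split iX sh rh rs].
split=> // A B AB; have [r [rh ri rk]] := compl_split AB.
have [zA|[_ ie]] := H _ _ _ (isHom_incl A) rh ri; [by left|right].
apply/rep_zeroP => i b; apply: (mono_incl B).
have bB : incl B i b \in B i by apply/inclP; exists b.
have [a ea] := ie i (incl B i b).
have : r i (incl B i b) = 0 by apply/rk.
by rewrite -ea (cmp_id ri) => ->; rewrite lf0.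
Qed.

Lemma indec_iso X Y (f : C0 X Y) : isHom f -> isoF f -> indecomposable X -> indecomposable Y.
Proof.
move=> fh fi iX; have [g [gh fg gf gi]] := isoF_inv fh fi; apply/indecP; split.
  move=> /rep_zeroP Y0; apply: iX.1; apply/rep_zeroP => i x.
  by rewrite -(cmp_id gf x) (Y0 i (f i x)) lf0.
move=> Z s r sh rh rs.
have [|z|[_ e]] := indec_split iX (isHom_cmp gh sh) (isHom_cmp rh fh).
- by rewrite cmpA -(cmpA r) fg cmpF1.
- by left.
right; split; first exact: id_mono rs.
move=> i y; have [z ez] := e i (g i y); exists z; apply: (monoB gi.1); by rewrite -ez FE.
Qed.

Definition famRH X Y (h : rep_hom X Y) : C0 X Y := fun i => h i.
Lemma isHom_RH X Y (h : rep_hom X Y) : isHom (famRH h).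
Proof.
by move=> a x; have := congr1 (fun f : 'Hom(_, _) => f x) (hom_comm h a); rewrite !comp_lfunE.
Qed.
Lemma isHom_comm X Y (f : C0 X Y) : isHom f -> forall a : arrow Q,
  (f (tgt a) \o rep_map X a = rep_map Y a \o f (src a))%VF.
Proof. by move=> fh a; apply/lfunP => x; rewrite !comp_lfunE fh. Qed.
Definition toRH X Y (f : C0 X Y) (fh : isHom f) : rep_hom X Y := RepHom (isHom_comm fh).

Lemma cmp_lf X Y Z (g : C0 Y Z) (f : C0 X Y) (h : C0 X Z) :
  (forall i, (g i \o f i)%VF = h i) <-> cmp g f = h.
Proof. exact: famP. Qed.

Lemma proj_ext P : projective P <-> isProj P.
Proof.
split=> [PP Z|H X Y g h gs].
  apply/ext0P => c; have [E [i [p [ip cl]]]] := class_ses c; have [ih ph im pe ex] := ip.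
  have [s Hs] := PP E P (toRH ph) (toRH (isHom_id P)) (fun i => (limg_fullP _).2 (pe i)).
  by apply/(notret_class ip cl); exists (famRH s); [apply: isHom_RH | apply/cmp_lf].
have [A [_ As]] := ses_ker (isHom_RH g) (fun i => (limg_fullP _).1 (gs i)).
have [c cl] := ses_class As.
have [l lh le] := (ext_pull As cl (isHom_RH h)).2 ((ext0P _ _).1 (H _) _).
by exists (toRH lh); apply/cmp_lf.
Qed.

Lemma inj_ext I : injective_rep I <-> isInj I.
Proof.
split=> [PP Z|H X Y g h gs].
  apply/ext0P => c; have [E [i [p [ip cl]]]] := class_ses c; have [ih ph im pe ex] := ip.
  have [r Hr] := PP I E (toRH ih) (toRH (isHom_id I)) (fun i => monoF_inj im).
  by apply/(notsec_class ip cl); exists (famRH r); [apply: isHom_RH | apply/cmp_lf].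
have gm : mono (famRH g) by move=> i x; apply/injP_lker: x; apply: gs.
have [N HN] := sub_im (isHom_RH g).
have As : ses (famRH g) (prj N).
  split=> //; [exact: isHom_RH|exact: isHom_prj|exact: epi_prj|].
  by move=> v x; rewrite prjP HN.
have [c cl] := ses_class As.
have [l lh le] := (ext_push As cl (isHom_RH h)).2 ((ext0P _ _).1 (H _) _).
by exists (toRH lh); apply/cmp_lf.
Qed.

Lemma ses_RH X E Y (f : rep_hom X E) (g : rep_hom E Y) :
  short_exact f g <-> ses (famRH f) (famRH g).
Proof.
split=> [[fi gs ex]|[_ _ fm ge ex]]; split.
- exact: isHom_RH.
- exact: isHom_RH.
- by move=> i x; apply/injP_lker: x; apply: fi.
- by move=> i; apply/limg_fullP; apply: gs.
- move=> v x; split=> [/lkerP|[y <-]]; last by apply/lkerP; rewrite -ex memv_img ?memvf.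
  by rewrite -ex => /memv_imgP[y _ ->]; exists y.
- by move=> i; apply: monoF_inj.
- by move=> i; apply/limg_fullP; apply: ge.
move=> i; apply/vspaceP => x; apply/memv_imgP/lkerP => [[y _ ->]|/ex[y <-]].
  by apply/ex; exists y.
by exists y; rewrite ?memvf.
Qed.

Lemma section_RH L E (f : rep_hom L E) :
  section f <-> exists2 r, isHom r & cmp r (famRH f) = idF L.
Proof.
split=> [[r Hr]|[r rh Hr]]; first by exists (famRH r); [apply: isHom_RH | apply/cmp_lf].
by exists (toRH rh); apply/cmp_lf.
Qed.
Lemma retraction_RH L E (f : rep_hom L E) :
  retraction f <-> exists2 r, isHom r & cmp (famRH f) r = idF E.
Proof.
split=> [[r Hr]|[r rh Hr]]; first by exists (famRH r); [apply: isHom_RH | apply/cmp_lf].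
by exists (toRH rh); apply/cmp_lf.
Qed.

Lemma las_RH L E (f : rep_hom L E) : left_almost_split f <-> lasF (famRH f).
Proof.
split=> -[ns H]; split; try by move=> /section_RH.
- move=> X h hh nh; have [|h' Hh'] := H X (toRH hh); first by move/section_RH.
  by exists (famRH h'); [apply: isHom_RH | apply/cmp_lf].
- move=> X h nh; have [|h' hh' Hh'] := H X (famRH h) (isHom_RH h); first by move/section_RH.
  by exists (toRH hh'); apply/cmp_lf.
Qed.
Lemma ras_RH L E (f : rep_hom L E) : right_almost_split f <-> rasF (famRH f).
Proof.
split=> -[ns H]; split; try by move=> /retraction_RH.
- move=> X h hh nh; have [|h' Hh'] := H X (toRH hh); first by move/retraction_RH.
  by exists (famRH h'); [apply: isHom_RH | apply/cmp_lf].
- move=> X h nh; have [|h' hh' Hh'] := H X (famRH h) (isHom_RH h); first by move/retraction_RH.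
  by exists (toRH hh'); apply/cmp_lf.
Qed.

Lemma tau_RH N L : tau N L <-> tauF N L.
Proof.
split=> [[E [f [g [/ses_RH s /las_RH l /ras_RH r]]]]|[E [f [g [s l r]]]]].
  by exists E, (famRH f), (famRH g).
have [fh gh _ _ _] := s; exists E, (toRH fh), (toRH gh).
by split; [apply/ses_RH | apply/las_RH | apply/ras_RH].
Qed.

Lemma rigid_RH M : rigid M <-> ext M M = 0%N.
Proof.
split=> [H|H E f g /ses_RH fg].
  apply/ext0P => c; have [E [i [p [ip cl]]]] := class_ses c; have [ih ph im pe ex] := ip.
  apply/(notret_class ip cl).
  by have /retraction_RH : retraction (toRH ph) by apply: (H E (toRH ih)); apply/ses_RH.
have [c cl] := ses_class fg.
by apply/retraction_RH/(notret_class fg cl); apply: (ext0P _ _).1.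
Qed.

Lemma iso_RH M N : iso M N <-> exists f : C0 M N, isHom f /\ isoF f.
Proof.
split=> [[f [fi fs]]|[f [fh [fm fe]]]].
  exists (famRH f); split; first exact: isHom_RH.
  split=> i; last by apply/limg_fullP; apply: fs.
  by move=> x; apply/injP_lker: x; apply: fi.
exists (toRH fh); split=> i; first exact: monoF_inj.
by apply/limg_fullP; apply: fe.
Qed.

(** If N is a sum of two nonzero parts, neither inclusion is a retraction; both lift through g, and
    the lifts add up to a splitting of g. *)
Lemma ras_indec E N (g : C0 E N) : isHom g -> rasF g -> indecomposable N.
Proof.
move=> gh [ns ras]; split.
  by move=> N0; apply: ns; exists 0; [apply: isHom0 | rewrite (zero_from (idF N) N0) cmpF0].
move=> A B AB; apply: contrapT => /not_orP[A0 B0]; apply: ns.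
have nsub (C D : subrep N) : complementary C D -> ~ rep_zero (rep_of D) ->
    exists2 h, isHom h & cmp g h = incl C.
  move=> CD D0; apply: ras (isHom_incl C) _ => -[s sh ss]; apply: D0.
  apply/rep_zeroP => i d; apply: (mono_incl D).
  have dD : incl D i d \in D i by apply/inclP; exists d.
  have dC : incl D i d \in C i by apply/inclP; exists (s i (incl D i d)); rewrite (cmp_id ss).
  by apply/eqP; rewrite -memv0 -(CD i).2 memv_cap dC.
have [a ah ga] := nsub A B AB B0; have [b bh gb] := nsub B A (complC AB) A0.
have [r [rh ri rk]] := compl_split AB.
have [q qh qE] : exists2 q : C0 N (rep_of B), isHom q & forall v x, incl B v (q v x) = (idF N - cmp (incl A) r) v x.
  apply: lift_mono; [exact: isHom_incl|exact: mono_incl| |].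
    by apply: isHomB; [apply: isHom_id | apply: isHom_cmp (isHom_incl A) rh].
  move=> v x; apply/inclP/rk; rewrite addFE oppFE lfB idFE cmpE.
  by rewrite (cmp_id ri) subrr.
exists (cmp a r + cmp b q); first by apply: isHomD; apply: isHom_cmp.
rewrite cmpDr !cmpA ga gb; apply: C0P => v x.
by rewrite addFE [X in _ + X]cmpE qE addFE oppFE addrC subrK.
Qed.

Lemma ras_notproj L E N (f : C0 L E) (g : C0 E N) : ses f g -> rasF g -> ~ isProj N.
Proof.
move=> fg [ns _] PN; have [c cl] := ses_class fg; apply: ns.
by apply/(notret_class fg cl); apply: (ext0P _ _).1.
Qed.

Lemma notProj_ex X : ~ isProj X -> exists Z, ext X Z <> 0%N.
Proof. by move=> nP; apply: contrapT => H; apply: nP => Z; apply: contrapT => e; apply: H; exists Z. Qed.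
Lemma notInj_ex X : ~ isInj X -> exists Z, ext Z X <> 0%N.
Proof. by move=> nP; apply: contrapT => H; apply: nP => Z; apply: contrapT => e; apply: H; exists Z. Qed.

Lemma any_summand X : ~ rep_zero X -> exists (Y : rep K Q) (s : C0 Y X) (r : C0 X Y),
  [/\ indecomposable Y, isHom s, isHom r & cmp r s = idF Y].
Proof.
move=> X0; have [Y [s [r [iY sh rh rs _]]]] :=
  @indec_summand _ _ (fun=> 0) (fun _ => True) X (fun a b _ => or_introl Logic.I) X0 Logic.I.
by exists Y, s, r.
Qed.

(** For an indecomposable summand L1 of L, the class eta is chosen dual to the functional of
    [indec_eps]. It then pairs to 0 with non-isomorphisms, which makes its sequence left almost
    split. *)
Lemma univF_tau X L (phi : 'Hom(C1 X L, K^o)) : univF phi -> indecomposable X -> ~ isProj X ->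
  indecomposable L /\ tauF X L.
Proof.
move=> uphi iX nP; have [pf pu pF] := uphi.
have L0 : ~ rep_zero L.
  have [Z Z0] := notProj_ex nP; move=> L0; apply: Z0; rewrite -(univF_hom uphi).
  by apply/hom0P => f _; apply: zero_to.
have [L1 [s [r [iL1 sh rh rs]]]] := any_summand L0.
have [e [e1 e0]] := indec_eps iL1.
have cl_ : linear (fun v : C0 L1 L => e (cmp r v)).
  move=> k v w; rewrite -lfZ -lfD; congr (e _); apply: C0P => i x.
  by rewrite !FE lfD lfZ.
have [eta etaE] : exists eta : C1 X L1, forall v, isHom v -> phi (push X v eta) = e (cmp r v).
  have [|w Hw] := @double_dual _ _ _ (pushfun L1 phi) (lker (dlt L1 L)) (mkhom cl_).
    move=> h /isHomP hh h0; apply: pF => // c; by rewrite -pushfunE h0 lfunE.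
  by exists w => v vh; rewrite -pushfunE Hw ?(mkhomE cl_) //; apply/isHomP.
have [E [i [p [ip cl]]]] := class_ses eta; have [ih ph im pe ex] := ip.
have phis : phi (push X s eta) = 1 by rewrite etaE // rs e1.
have li : lasF i.
  split.
    move/(notsec_class ip cl)/(push_img sh)/(functP pf); rewrite phis => /eqP.
    by rewrite oner_eq0.
  move=> Y h hh nh; apply/(ext_push ip cl hh); apply: contrapT => /negP.
  case/funct_sep => psi psif psi1; have [v vh vE] := pu _ psi psif.
  have := vE (push X h eta); rewrite -push_cmp etaE; last exact: isHom_cmp.
  rewrite psi1 e0; first by move/eqP; rewrite eq_sym oner_eq0.
    by apply: isHom_cmp => //; apply: isHom_cmp.
  move=> ki; have [g [gh _ gk _]] := isoF_inv (isHom_cmp rh (isHom_cmp vh hh)) ki.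
  apply: nh; exists (cmp g (cmp r v)); first by apply: isHom_cmp => //; apply: isHom_cmp.
  by rewrite -!cmpA.
have rp := las_ras ip iX li.
suff si : isoF s.
  split; first exact: indec_iso sh si iL1.
  have [g [gh sg gs gi]] := isoF_inv sh si.
  have [c0 c0cl] := ses_class ip.
  exists E, (cmp i g), p; split=> //.
    split=> //; [exact: isHom_cmp|exact: mono_comp im gi.1|].
    move=> v x; rewrite ex; split=> [[y <-]|[y <-]]; last by rewrite FE; eexists.
    by exists (s v y); rewrite FE (cmp_id gs).
  split=> [[k kh kE]|Y h hh nh].
    apply: li.1; exists (cmp g k); first exact: isHom_cmp.
    have : cmp (cmp (cmp g (cmp k (cmp i g))) s) (idF L1) = idF L1 by rewrite kE cmpF1 cmpF1.
    by rewrite cmpF1 -!cmpA gs cmpF1.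
  have [|h' h'h h'E] := li.2 Y (cmp h s) (isHom_cmp hh sh).
    move=> [k kh kE]; apply: nh; exists (cmp s k); first exact: isHom_cmp.
    have : cmp (cmp s (cmp k (cmp h s))) g = idF L by rewrite kE cmpF1.
    by rewrite -!cmpA sg cmpF1.
  by exists h' => //; rewrite cmpA h'E -cmpA sg cmpF1.
(* If the complement N of L1 were nonzero, some class c2 in Ext(X, N) would pair to 1 with the
   inclusion of N and to 0 with maps through L1. Comparison with the almost split sequence gives kb
   : N -> L1 taking c2 to eta; but phi is 0 on s kb c2 and 1 on s eta. *)
have [N HN] := sub_ker rh.
have [pi pih piE] : exists2 q : C0 L (rep_of N), isHom q & forall v x, incl N v (q v x) = (idF L - cmp s r) v x.
  apply: lift_mono; [exact: isHom_incl|exact: mono_incl| |].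
    by apply: isHomB; [apply: isHom_id | apply: isHom_cmp].
  move=> v x; apply/inclP/HN; rewrite addFE oppFE lfB idFE cmpE.
  by rewrite (cmp_id rs) subrr.
have rN v u : r v (incl N v u) = 0 by apply/HN/inclP; exists u.
have piN : cmp pi (incl N) = idF (rep_of N).
  apply: C0P => v u; apply: (monoB (mono_incl N)).
  by rewrite cmpE piE addFE oppFE cmpE rN lf0 subr0 !idFE.
have piS : cmp pi s = 0.
  apply: C0P => v u; apply: (monoB (mono_incl N)).
  by rewrite cmpE piE addFE oppFE cmpE (cmp_id rs) idFE subrr zeroFE lf0.
have [N0|N0] := pselect (rep_zero (rep_of N)).
  apply: contrapT => nsi; apply: nsi; split; first exact: id_mono rs.
  move=> v x; exists (r v x); have := piE v x; rewrite ((rep_zeroP _).1 N0 v (pi v x)) lf0.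
  by rewrite addFE oppFE idFE cmpE => /esym/eqP; rewrite subr_eq0 => /eqP.
pose P0 (f : C0 (rep_of N) L) := exists h : C0 (rep_of N) L1, f = cmp s h.
have [U HU] : exists U : {vspace C0 (rep_of N) L}, forall f, P0 f <-> f \in U.
  apply: vspace_of_pred => [|k f g [h1 ->] [h2 ->]]; first by exists 0; rewrite cmpF0.
  by exists (k *: h1 + h2); apply: C0P => v x; rewrite !FE lfD lfZ.
have : incl N \notin U.
  apply/negP => /HU[h e']; apply: N0; apply/rep_zero_hom.
  by rewrite -piN e' cmpA piS cmp0F.
case/sep_functional => e2 [e21 e20].
have [|c2 c2E] := @double_dual _ _ _ (pushfun (rep_of N) phi) (lker (dlt (rep_of N) L)) e2.
  move=> h /isHomP hh h0; apply: pF => // c; by rewrite -pushfunE h0 lfunE.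
have phiN : phi (push X (incl N) c2) = 1.
  by rewrite -pushfunE c2E ?e21 //; apply/isHomP/isHom_incl.
have [F [i' [p' [ip' cl']]]] := class_ses c2; have [i'h p'h i'm p'e ex'] := ip'.
have [k kh pk] : exists2 k, isHom k & cmp p k = p'.
  apply: rp.2 p'h _ => /(notret_class ip' cl')/(push_img (isHom_incl N))/(functP pf).
  by rewrite phiN => /eqP; rewrite oner_eq0.
have [kb kbh kbE] : exists2 kb : C0 (rep_of N) L1, isHom kb & forall v x, i v (kb v x) = cmp k i' v x.
  apply: lift_mono => //; first exact: isHom_cmp.
  move=> v x; apply/ex; rewrite -cmpE cmpA pk cmpE; apply/ex'; by exists x.
have ki : cmp k i' = cmp i kb by apply: C0P => v x; rewrite -kbE [RHS]cmpE.
have := functP pf (push_img sh (class_map_left ip cl cl' kh kbh pk ki)).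
rewrite lfB lfB phis -push_cmp -pushfunE c2E; last by apply/isHomP/isHom_cmp.
rewrite e20 ?sub0r; last by apply/HU; exists kb.
by move/eqP; rewrite oppr_eq0 oner_eq0.
Qed.

(** Every almost split sequence starts at the representing object: a functional detecting c is
    represented by u : L -> L0, which does not extend to E. Hence u is a section, and an isomorphism
    because L0 is indecomposable. *)
Lemma tau_univ X L : tauF X L -> [/\ indecomposable X, ~ isProj X, indecomposable L &
  exists phi : 'Hom(C1 X L, K^o), univF phi].
Proof.
move=> [E [i [p [ip li rp]]]]; have [ih ph im pe ex] := ip.
have iX := ras_indec ph rp; have nP := ras_notproj ip rp.
have [L0 [phi uphi]] := exists_univF aQ X.
have [pf pu pF] := uphi; have [iL0 _] := univF_tau uphi iX nP.
have [c cl] := ses_class ip.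
have cB : c \notin limg (dlt X L) by apply/negP => /(notsec_class ip cl); apply: li.1.
have [psi psif psi1] := funct_sep cB; have [u uh uE] := pu _ psi psif.
have [r rh ru] : exists2 r, isHom r & cmp r u = idF L.
  apply: contrapT => nu; have [k kh kE] := li.2 _ u uh nu.
  have : push X u c \in limg (dlt X L0) by apply/(ext_push ip cl uh); exists k.
  by move/(functP pf); rewrite uE psi1 => /eqP; rewrite oner_eq0.
have [L0'|ui] := indec_split iL0 uh rh ru.
  case: li.1; exists 0; first exact: isHom0.
  by rewrite cmp0F (zero_from (idF L) L0').
split=> //; last by eexists; apply: univF_iso uphi uh ui.
have [g [gh _ _ gi]] := isoF_inv uh ui; exact: indec_iso gh gi iL0.
Qed.

(** The Auslander-Reiten formulas; they hold with full Hom spaces, not only modulo projectives or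
    injectives, because the category is hereditary. *)
Theorem tauP X L : tau X L -> [/\ indecomposable X, indecomposable L,
  forall Z, hom Z L = ext X Z & forall Z, ext Z L = hom X Z].
Proof.
move=> /tau_RH/tau_univ[iX nP iL [phi uphi]]; split=> //.
  exact: univF_hom uphi.
exact: univF_ext uphi iX nP.
Qed.

Theorem tau_ex X : indecomposable X -> ~ isProj X -> exists L, tau X L.
Proof.
move=> iX nP; have [L [phi uphi]] := exists_univF aQ X.
by exists L; apply/tau_RH; have [] := univF_tau uphi iX nP.
Qed.

Theorem tau_ex' Y : indecomposable Y -> ~ isInj Y -> exists X, tau X Y.
Proof.
move=> iY nI; have [X0 [phi uphi]] := exists_univG aQ Y.
have [pf pu pF] := uphi.
have X00 : ~ rep_zero X0.
  have [Z Z0] := notInj_ex nI; move=> L0; apply: Z0; apply/ext0P => c.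
  apply: contrapT => /negP/funct_sep[psi psif psi1]; have [v vh vE] := pu _ psi psif.
  by move: psi1; rewrite -vE (zero_from v L0) pull0 lf0 => /esym/eqP; rewrite oner_eq0.
have [X [s [r [iX sh rh rs]]]] := any_summand X00.
have [e [e1 e0]] := indec_eps iX.
have cl_ : linear (fun v : C0 X0 X => e (cmp v s)).
  by move=> k v w; rewrite -lfZ -lfD; congr (e _); apply: C0P => i x; rewrite !FE.
have Tl : linear (fun v : C0 X0 X => (phi \o pull Y v)%VF).
  move=> k v w; apply/lfunP => c.
  by rewrite add_lfunE scale_lfunE !comp_lfunE pullD pullZ lfD lfZ.
have TE v c : mkhom Tl v c = phi (pull Y v c) by rewrite (mkhomE Tl) comp_lfunE.
have [eta etaE] : exists eta : C1 X Y, forall v, isHom v -> phi (pull Y v eta) = e (cmp v s).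
  have [|w Hw] := @double_dual _ _ _ (mkhom Tl) (lker (dlt X0 X)) (mkhom cl_).
    move=> h /isHomP hh h0; apply: pF => // c; by rewrite -TE h0 lfunE.
  by exists w => v vh; rewrite -TE Hw ?(mkhomE cl_) //; apply/isHomP.
have [E [i [p [ip cl]]]] := class_ses eta; have [ih ph im pe ex] := ip.
have phis : phi (pull Y r eta) = 1 by rewrite etaE // rs e1.
exists X; apply/tau_RH; exists E, i, p.
suff rp : rasF p by split=> //; apply: ras_las ip iY rp.
split.
  move/(notret_class ip cl)/(pull_img rh)/(functP pf); rewrite phis => /eqP.
  by rewrite oner_eq0.
move=> Z h hh nh; apply/(ext_pull ip cl hh); apply: contrapT => /negP.
case/funct_sep => psi psif psi1; have [v vh vE] := pu _ psi psif.
have := vE (pull Y h eta); rewrite -pull_cmp etaE; last exact: isHom_cmp.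
rewrite psi1 e0; first by move/eqP; rewrite eq_sym oner_eq0.
  by apply: isHom_cmp => //; apply: isHom_cmp.
move=> ki; have [g [gh kg _ _]] := isoF_inv (isHom_cmp (isHom_cmp hh vh) sh) ki.
apply: nh; exists (cmp v (cmp s g)); first by apply: isHom_cmp => //; apply: isHom_cmp.
by rewrite !cmpA.
Qed.

End AR2.

(** * The Euler form of an affine quiver *)

Section AffineForm.
Variables (V J : finType) (s t : J -> V) (d : V -> nat) (r0 : V) (rk : V -> nat).
Variable E : (V -> int) -> (V -> int) -> int.
Hypothesis d_gt0 : forall i, (0 < d i)%N.
Hypothesis rkP : forall i, i != r0 -> exists a,
  (s a = i /\ (rk (t a) < rk i)%N) \/ (t a = i /\ (rk (s a) < rk i)%N).
Hypothesis EDl : forall a b c, E (fun i => a i + b i) c = E a c + E b c.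
Hypothesis EDr : forall a b c, E c (fun i => a i + b i) = E c a + E c b.
Hypothesis EZl : forall k a c, E (fun i => k * a i) c = k * E a c.
Hypothesis EZr : forall k a c, E c (fun i => k * a i) = k * E c a.
Hypothesis Enondeg : forall v, (forall y, E y v = 0) -> forall i, v i = 0.

Let u (x : V -> int) i : rat := (x i)%:~R / (d i)%:R.
(** The symmetrised form as a weighted sum over the edges, which makes it positive semidefinite with
    radical the multiples of d. E stays abstract because both the Euler form and its transpose will
    be used. *)
Hypothesis Esym : forall x z, (E x z + E z x)%:~R =
  \sum_a (d (s a))%:R * (d (t a))%:R * (u x (s a) - u x (t a)) * (u z (s a) - u z (t a)).

Let dz i : int := (d i)%:Z.

Lemma Eext a a' b b' : a =1 a' -> b =1 b' -> E a b = E a' b'.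
Proof. by move=> e1 e2; rewrite (funext e1) (funext e2). Qed.

Let dr i : (d i)%:R != 0 :> rat.
Proof. by rewrite pnatr_eq0 -lt0n. Qed.

Let u_dz i : u dz i = 1.
Proof. by rewrite /u /dz -pmulrn divff ?dr. Qed.

Lemma Edz z : E z dz = - E dz z.
Proof.
apply/eqP; rewrite -addr_eq0 -(intr_eq0 rat) addrC Esym; apply/eqP.
by apply: big1 => a _; rewrite !u_dz subrr mulr0 mul0r.
Qed.

Let term_ge0 x a :
  0 <= (d (s a))%:R * (d (t a))%:R * (u x (s a) - u x (t a)) * (u x (s a) - u x (t a)).
Proof. by rewrite -mulrA -expr2 mulr_ge0 ?sqr_ge0 // mulr_ge0 ?ler0n. Qed.

Lemma q_ge0 x : 0 <= E x x.
Proof.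
have: 0 <= (E x x + E x x)%:~R :> rat.
  by rewrite Esym; apply: sumr_ge0 => a _; apply: term_ge0.
by rewrite ler0z => h; lia.
Qed.

Lemma edge_eq x a : E x x = 0 -> u x (s a) = u x (t a).
Proof.
move=> q0; have: (E x x + E x x)%:~R = 0 :> rat by rewrite q0.
rewrite Esym => /eqP; rewrite psumr_eq0; last first.
  by move=> b _; apply: term_ge0.
move=> /allP /(_ a (mem_index_enum _)) /=; rewrite !mulf_eq0 !(negbTE (dr _)) /= orbb.
by rewrite subr_eq0 => /eqP.
Qed.

Lemma u_const x : E x x = 0 -> forall i, u x i = u x r0.
Proof.
move=> q0 i; have [n] := ubnP (rk i); elim: n i => // n IH i lt.
have [->//|/rkP[a [[e l]|[e l]]]] := eqVneq i r0.
  by rewrite -e (edge_eq a q0) IH //; lia.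
by rewrite -e -(edge_eq a q0) IH //; lia.
Qed.

(** Where the form vanishes, x / d is constant along edges, hence everywhere by connectedness. To
    stay in the integers, (d r0) x is compared with (x r0) d. *)
Lemma radical x : E x x = 0 -> E dz x = 0 /\ forall z, E x z + E z x = 0.
Proof.
move=> q0; split; last first.
  move=> z; apply/eqP; rewrite -(intr_eq0 rat) Esym; apply/eqP.
  by apply: big1 => a _; rewrite (edge_eq a q0) subrr mulr0 mul0r.
have uc := u_const q0.
have h : E dz (fun i => dz r0 * x i) = E dz (fun i => x r0 * dz i).
  apply: Eext => // i; have := uc i; rewrite /u => /eqP; rewrite eqr_div //.
  move=> /eqP e; apply/eqP; rewrite -(eqr_int rat) !intrM /dz -!pmulrn -e mulrC.
  exact: eqxx.
move: h; rewrite !EZr.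
have -> : E dz dz = 0 by have := Edz dz; lia.
rewrite mulr0 => /eqP; rewrite mulf_eq0 => /orP[|/eqP //].
by rewrite /dz eqz_nat => /eqP e; have := d_gt0 r0; rewrite e.
Qed.

(* The form is invariant under translation by dz, so x may be moved to the slab 0 <= x r0 < dz r0. *)
Let fl (x : V -> int) : int := (x r0 %/ dz r0)%Z.
Let nf (x : V -> int) i : int := x i - fl x * dz i.

Lemma q_nf x : E (nf x) (nf x) = E x x.
Proof.
have -> : E (nf x) (nf x) = E (fun i => x i + (- fl x) * dz i) (fun i => x i + (- fl x) * dz i).
  by apply: Eext => i; rewrite /nf mulNr.
rewrite EDl !EDr !EZl !EZr Edz.
have -> : E dz dz = 0 by have := Edz dz; lia.
ring.
Qed.

(** After reduction x / d lies between 0 and 1 at the root. Along an edge the square of its change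
    is at most 2 q, so the change is at most 2 q + 1, and the rank bounds the number of edges to the
    root. *)
Definition box (q : int) : nat := (\max_i (d i * (1 + rk i * (2 * `|q| + 1))))%N.

Lemma nf_bound x i : (`|nf x i| <= box (E x x))%N.
Proof.
set q := E x x; have q0 : 0 <= q := q_ge0 x; set z := nf x.
have qz : E z z = q := q_nf x.
pose B : rat := (2 * `|q| + 1)%N%:R.
have eb a : `|u z (s a) - u z (t a)| <= B.
  set w := _ - _.
  have : w ^+ 2 <= (2 * `|q|)%N%:R.
    have -> : (2 * `|q|)%N%:R = (E z z + E z z)%:~R :> rat.
      by rewrite qz -[in RHS](gez0_abs q0) pmulrn; congr (_%:~R); lia.
    rewrite Esym (bigD1 a) //= -[X in X <= _]addr0; apply: lerD; last first.
      by apply: sumr_ge0 => b _; apply: term_ge0.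
    rewrite -/w -mulrA -expr2 ler_peMl ?sqr_ge0 // -natrM ler1n muln_gt0 !d_gt0 //.
  rewrite /B natrD => h; have [le|lt] := lerP `|w| 1; first by apply: le_trans le _; rewrite lerDr.
  apply: le_trans (_ : `|w| ^+ 2 <= _).
    by rewrite expr2 ler_peMl ?(ltW lt) //.
  by rewrite real_normK ?num_real // (le_trans h) // lerDl.
have ub j : `|u z j| <= 1 + (rk j)%:R * B.
  have [n] := ubnP (rk j); elim: n j => // n IH j lt.
  have step k : (rk k < rk j)%N -> `|u z j - u z k| <= B -> `|u z j| <= 1 + (rk j)%:R * B.
    move=> l le; have := IH k (leq_trans l lt); move=> IHk.
    have -> : u z j = u z k + (u z j - u z k) by rewrite addrC subrK.
    apply: le_trans (ler_normD _ _) _; apply: le_trans (lerD IHk le) _.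
    rewrite -addrA lerD2l -[X in _ + X]mul1r -mulrDl ler_wpM2r ?ler0n //.
    by rewrite -[1]/(1%:R) -natrD ler_nat; lia.
  have [->|/rkP[a [[e l]|[e l]]]] := eqVneq j r0.
  - rewrite /u /z /nf /fl.
    have dp : (0 < dz r0)%R by rewrite /dz ltz_nat.
    have := divz_eq (x r0) (dz r0) => e.
    have -> : x r0 - (x r0 %/ dz r0)%Z * dz r0 = (x r0 %% dz r0)%Z by rewrite {1}e; ring.
    have m0 := modz_ge0 (x r0) (lt0r_neq0 dp); have m1 := ltz_pmod (x r0) dp.
    rewrite ger0_norm; last by rewrite divr_ge0 ?ler0z ?ler0n.
    apply: le_trans (_ : 1 <= _); last by rewrite lerDl mulr_ge0 ?ler0n.
    by rewrite ler_pdivrMr ?ltr0n // mul1r pmulrn ler_int ltW.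
  - by apply: (step (t a)) => //; rewrite -e eb.
  - by apply: (step (s a)) => //; rewrite -e distrC eb.
have : (`|z i|%N <= d i * (1 + rk i * (2 * `|q| + 1)))%N.
  have := ub i; rewrite /u normrM normfV (ger0_norm (ler0n _ _)).
  rewrite ler_pdivrMr ?ltr0n // -intr_norm.
  have -> : (1 + (rk i)%:R * B) * (d i)%:R = ((d i * (1 + rk i * (2 * `|q| + 1)))%N%:Z)%:~R :> rat.
    by rewrite /B -pmulrn mulrC -natrM nat1r -natrM.
  by rewrite ler_int -abszE lez_nat.
move/leq_trans; apply.
exact: (leq_bigmax (F:=fun i => d i * (1 + rk i * (2 * `|q| + 1)))%N i).
Qed.

Lemma pigeon (x : nat -> V -> int) : (forall n, E (x n) (x n) = E (x 0%N) (x 0%N)) ->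
  exists i j k, (i < j)%N /\ forall v, x j v = x i v + k * dz v.
Proof.
move=> Hq; pose b := box (E (x 0%N) (x 0%N)).
have bP n v : (`|nf (x n) v| <= b)%N by rewrite /b -(Hq n) nf_bound.
pose T := {ffun V -> 'I_(b.*2.+1)}.
pose f (n : 'I_#|T|.+1) : T := [ffun v => inord `|(nf (x n) v + b%:Z)%R|%N].
have /injectivePn[i [j ij eij]] : ~~ injectiveb f.
  by apply/injectiveP => /leq_card; rewrite card_ord ltnn.
have nfe v : nf (x i) v = nf (x j) v.
  have := congr1 val (congr1 (fun g : T => g v) eij); rewrite !ffunE /=.
  by have := bP i v; have := bP j v => h1 h2; rewrite !inordK; lia.
wlog lt : i j ij eij nfe / (i < j)%N.
  move=> H; have [|l|/val_inj e] := ltngtP (i : nat) (j : nat).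
  - exact: H.
  - by apply: (H j i) => //; rewrite eq_sym.
  - by rewrite e eqxx in ij.
exists i, j, (fl (x j) - fl (x i)); split=> // v.
by have := nfe v; rewrite /nf => e; rewrite mulrBl; lia.
Qed.

Lemma E_sum (I : Type) (r : seq I) (y : I -> V -> int) z :
  E (fun v => \sum_(k <- r) y k v) z = \sum_(k <- r) E (y k) z.
Proof.
elim: r => [|k r IH].
  have -> : E (fun v => \sum_(k <- [::]) y k v) z = E (fun v => 0 * z v) z.
    by apply: Eext => // v; rewrite big_nil mul0r.
  by rewrite EZl mul0r big_nil.
rewrite big_cons -IH -EDl; apply: Eext => // v; by rewrite big_cons.
Qed.
Lemma E_sumr (I : Type) (r : seq I) (y : I -> V -> int) z :
  E z (fun v => \sum_(k <- r) y k v) = \sum_(k <- r) E z (y k).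
Proof.
elim: r => [|k r IH].
  have -> : E z (fun v => \sum_(k <- [::]) y k v) = E z (fun v => 0 * z v).
    by apply: Eext => // v; rewrite big_nil mul0r.
  by rewrite EZr mul0r big_nil.
rewrite big_cons -IH -EDr; apply: Eext => // v; by rewrite big_cons.
Qed.

(** * Orbits of the Coxeter transformation *)

Section Orbit.
Variable x : nat -> V -> int.
Hypothesis xS : forall n y, E y (x n.+1) = - E (x n) y.

Lemma orbit_q n : E (x n) (x n) = E (x 0%N) (x 0%N).
Proof. by elim: n => // n <-; rewrite xS xS opprK. Qed.
Lemma orbit_def n : E dz (x n) = E dz (x 0%N).
Proof. by elim: n => // n <-; rewrite xS -[RHS]opprK -Edz. Qed.

(** The sum y over one stretch of the orbit telescopes: by [xS], in E y z + E z y only the end terms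
    remain, and x j - x i = k dz. *)
Lemma orbit_sum i j k : (i < j)%N -> (forall v, x j v = x i v + k * dz v) ->
  exists y : V -> int, E dz y = (j - i)%:Z * E dz (x 0%N) /\
    forall z, E y z + E z y = k * E dz z.
Proof.
move=> lt e; exists (fun v => \sum_(i <= n < j) x n v); split.
  rewrite E_sumr (eq_bigr (fun=> E dz (x 0%N))); last by move=> n _; rewrite orbit_def.
  by rewrite sumr_const_nat -mulr_natl natz.
move=> z; rewrite E_sum E_sumr.
have : \sum_(i <= n < j) E z (x n.+1) = - \sum_(i <= n < j) E (x n) z.
  by rewrite -sumrN; apply: eq_bigr => n _; rewrite xS.
have -> : \sum_(i <= n < j) E z (x n.+1) = \sum_(i <= n < j) E z (x n) + k * E z dz.
  apply/eqP; rewrite addrC -subr_eq -sumrB; apply/eqP.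
  rewrite telescope_sumr; last exact: ltnW.
  have -> : E z (x j) = E z (x i) + k * E z dz by rewrite -EZr -EDr; apply: Eext.
  by rewrite addrC addKr.
rewrite Edz; lia.
Qed.

Lemma dz_neq0 : ~ (forall z, E dz z = 0).
Proof.
move=> H; have := Enondeg (v := dz) _ r0; rewrite /dz => e.
have /eqP : (d r0)%:Z = 0 by apply: e => y; rewrite Edz H oppr0.
by rewrite eqz_nat => /eqP h; have := d_gt0 r0; rewrite h.
Qed.

(** Defect 0 gives E y y = 0, so y is in the radical and k E dz is the zero functional;
    nondegeneracy then gives k = 0. *)
Lemma orbit_periodic : E dz (x 0%N) = 0 ->
  exists i j, (i < j)%N /\ forall v, x j v = x i v.
Proof.
move=> d0; have [i [j [k [lt e]]]] := pigeon orbit_q.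
have [y [dy yz]] := orbit_sum lt e.
have q0 : E y y = 0 by have := yz y; rewrite dy d0 !mulr0; lia.
have [_ r] := radical q0; exists i, j; split=> // v.
suff k0 : k = 0 by rewrite e k0 mul0r addr0.
apply/eqP/negP => /negP k0; apply: dz_neq0 => z.
by have := yz z; rewrite r => /esym/eqP; rewrite mulf_eq0 (negbTE k0) => /eqP.
Qed.

Lemma orbit_shift i j k : (forall v, x j v = x i v + k * dz v) ->
  forall m v, x (j + m)%N v = x (i + m)%N v + k * dz v.
Proof.
move=> e; elim=> [|m IH] v; first by rewrite !addn0.
rewrite !addnS; apply/eqP; rewrite -subr_eq0; apply/eqP.
pose w v := x (j + m).+1 v + (-1) * (x (i + m).+1 v + k * dz v).
have : w v = 0.
  apply: Enondeg => y; rewrite /w EDr EZr EDr EZr !xS.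
  have -> : E (x (j + m)%N) y = E (x (i + m)%N) y + k * E dz y by rewrite -EZl -EDl; apply: Eext.
  by rewrite Edz; ring.
by rewrite /w mulN1r.
Qed.

(** If the defect were negative, 2 E y y = k E dz y would force k < 0, and repeating the shift by k
    dz along the orbit would produce negative entries. *)
Lemma orbit_def_ge0 : (forall n v, 0 <= x n v) -> 0 <= E dz (x 0%N).
Proof.
move=> x0; rewrite leNgt; apply/negP => dn.
have [i [j [k [lt e]]]] := pigeon orbit_q.
have [y [dy yz]] := orbit_sum lt e.
have k0 : k < 0.
  have := yz y; have := q_ge0 y; rewrite dy.
  have jp : 0 < (j - i)%:Z by rewrite ltz_nat subn_gt0.
  move=> qy ey; rewrite ltNge; apply/negP => kp.
  have : k * ((j - i)%:Z * E dz (x 0%N)) <= 0.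
    by rewrite mulr_ge0_le0 // mulr_ge0_le0 ?ltW.
  rewrite -ey => le; have qy0 : E y y = 0 by lia.
  have [dy0 _] := radical qy0; move/eqP: dy; rewrite dy0 eq_sym mulf_eq0.
  by rewrite (gt_eqF jp) (lt_eqF dn).
have it m : forall v, x (i + m * (j - i))%N v = x i v + m%:Z * k * dz v.
  elim: m => [|m IH] v; first by rewrite mul0n addn0 !mul0r addr0.
  have -> : (i + m.+1 * (j - i) = j + m * (j - i))%N by rewrite mulSn; lia.
  rewrite (orbit_shift e) IH -addn1 PoszD; ring.
have := it (`|x i r0|.+1)%N r0; set m := (`|x i r0|.+1)%N => em.
have := x0 (i + m * (j - i))%N r0; rewrite em => h.
have dp : 1 <= dz r0 by rewrite /dz lez_nat.
have : m%:Z * k * dz r0 <= - m%:Z.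
  rewrite -[X in _ <= X]mulr1 mulNr -mulrN -mulrA ler_wpM2l // -[dz r0]opprK mulrN lerN2.
  have : 1 * 1 <= (- k) * dz r0 by apply: ler_pM => //; lia.
  by rewrite mulr1 mulrN mulNr.
have := x0 i r0; rewrite /m; lia.
Qed.
End Orbit.

End AffineForm.

(** * Extended Dynkin diagrams *)

Definition edge_sum (D : nat -> nat) k (p : nat * nat) : nat :=
  ((p.1 == k) * D p.2 + (p.2 == k) * D p.1)%N.

Lemma sum_iota (F : nat -> nat) m c k :
  (\sum_(j <- iota m c) (j == k) * F j = (m <= k < m + c) * F k)%N.
Proof.
elim: c m => [|c IH] m.
  rewrite big_nil addn0; case: (leqP m k) => //= h; by rewrite ltnNge h.
rewrite /= big_cons IH; have [->|ne] := eqVneq m k.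
  by rewrite ltnn mul1n /= leqnn -addSnnS leq_addr mul1n addn0.
rewrite mul0n add0n; congr (nat_of_bool _ * _)%N; lia.
Qed.

Lemma sum_iotaS (F : nat -> nat) m c k : (0 < m)%N \/ (0 < k)%N ->
  (\sum_(j <- iota m c) (j.+1 == k) * F j = (m < k <= m + c) * F k.-1)%N.
Proof.
case: k => [|k] h.
  by rewrite ltn0 mul0n big1.
by under eq_bigr do rewrite eqSS; rewrite sum_iota /= ltnS.
Qed.

Lemma sum_path (D : nat -> nat) m c k :
  (\sum_(p <- [seq (j, j.+1) | j <- iota m c]) edge_sum D k p =
   (m <= k < m + c) * D k.+1 + (m < k <= m + c) * D k.-1)%N.
Proof.
rewrite big_map /edge_sum /= big_split /= sum_iota; congr (_ + _)%N.
case: k => [|k]; first by rewrite ltn0 mul0n big1.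
by apply: sum_iotaS; right.
Qed.

(** D is the minimal positive imaginary root. For type E the lists are the usual labels of the
    diagrams, and the default 1 of [nth] keeps D positive off the diagram. *)
Lemma ext_dynkin_harmonic n E : ext_dynkin n E -> exists D : nat -> nat,
  (forall k, 0 < D k)%N /\
  forall k, (k < n)%N -> (\sum_(p <- E) edge_sum D k p = 2 * D k)%N.
Proof.
case=> [m m0|m m4|||].
- exists (fun=> 1%N); split=> // k lt.
  rewrite -cats1 big_cat /= sum_path big_seq1 /edge_sum /=; lia.
- exists (fun k => 1 + ((1 < k) && (k < m - 1)))%N; split=> [k|k lt]; first by rewrite add1n.
  rewrite !big_cat /= sum_path !big_cons !big_nil /edge_sum /= !mulnDr !muln1 !mulnb.
  have [->|k0] := eqVneq k 0%N; first lia.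
  have [->|k1] := eqVneq k 1%N; first lia.
  have [k2|k2] := eqVneq k 2; have [k3|k3|k3] := ltngtP k (m - 2)%N;
    have [k4|k4|k4] := ltngtP k (m - 1)%N; lia.
- exists (nth 1%N [:: 1; 2; 3; 2; 1; 2; 1]%N); split=> [k|k].
    by do 8 (case: k => [|k] //).
  by do 7 (case: k => [|k]; first by rewrite !big_cons big_nil).
- exists (nth 1%N [:: 1; 2; 3; 4; 3; 2; 1; 2]%N); split=> [k|k].
    by do 9 (case: k => [|k] //).
  by do 8 (case: k => [|k]; first by rewrite !big_cons big_nil).
- exists (nth 1%N [:: 2; 4; 6; 5; 4; 3; 2; 1; 3]%N); split=> [k|k].
    by do 10 (case: k => [|k] //).
  by do 9 (case: k => [|k]; first by rewrite !big_cons big_nil).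
Qed.

(** A rooted spanning tree in a form suited to induction. The rank is the numbering itself, except
    in type D, where the leaves 0 and 1, numbered below the root 2, get a rank above all others. *)
Lemma ext_dynkin_connected n E : ext_dynkin n E -> exists (r : nat) (rk : nat -> nat),
  (r < n)%N /\ forall k, (k < n)%N -> k != r -> exists2 p, p \in E &
    (p.1 = k /\ (rk p.2 < rk k)%N) \/ (p.2 = k /\ (rk p.1 < rk k)%N).
Proof.
have chain k m c : (m < k <= m + c)%N -> (k.-1, k) \in [seq (j, j.+1) | j <- iota m c].
  move=> h; apply/mapP; exists k.-1; rewrite ?mem_iota; first lia.
  by congr (_, _); lia.
case=> [m m0|m m4|||].
- exists 0%N, id; split=> // k lt k0; exists (k.-1, k); last by right; split=> //=; lia.
  rewrite mem_rcons inE chain ?orbT //; lia.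
- exists 2%N, (fun k => if (k < 2)%N then m.+1 else k); split=> [|k lt k2]; first lia.
  have [k0|k0] := eqVneq k 0%N.
    by exists (0, 2)%N; [rewrite !mem_cat !inE | left; rewrite k0; split=> //=; lia].
  have [k1|k1] := eqVneq k 1%N.
    by exists (1, 2)%N; [rewrite !mem_cat !inE | left; rewrite k1; split=> //=; lia].
  have [km|km] := eqVneq k m.
    exists (m - 2, m)%N; last by right; split=> //=; do 2 (case: ifP => ?); lia.
    by rewrite !mem_cat !inE eqxx !orbT.
  have [km1|km1] := eqVneq k (m - 1)%N.
    exists (m - 2, m - 1)%N; last by right; split=> //=; do 2 (case: ifP => ?); lia.
    by rewrite !mem_cat !inE eqxx !orbT.
  exists (k.-1, k); last by right; split=> //=; do 2 (case: ifP => ?); lia.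
  by rewrite !mem_cat chain ?orbT //; lia.
- exists 0%N, id; split=> // k; case: k => [|[|[|[|[|[|[|k]]]]]]] // _ _.
  + exists (0, 1)%N; [by []|by right].
  + exists (1, 2)%N; [by []|by right].
  + exists (2, 3)%N; [by []|by right].
  + exists (3, 4)%N; [by []|by right].
  + exists (2, 5)%N; [by []|by right].
  + exists (5, 6)%N; [by []|by right].
- exists 0%N, id; split=> // k; case: k => [|[|[|[|[|[|[|[|k]]]]]]]] // _ _.
  + exists (0, 1)%N; [by []|by right].
  + exists (1, 2)%N; [by []|by right].
  + exists (2, 3)%N; [by []|by right].
  + exists (3, 4)%N; [by []|by right].
  + exists (4, 5)%N; [by []|by right].
  + exists (5, 6)%N; [by []|by right].
  + exists (3, 7)%N; [by []|by right].
- exists 0%N, id; split=> // k; case: k => [|[|[|[|[|[|[|[|[|k]]]]]]]]] // _ _.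
  + exists (0, 1)%N; [by []|by right].
  + exists (1, 2)%N; [by []|by right].
  + exists (2, 3)%N; [by []|by right].
  + exists (3, 4)%N; [by []|by right].
  + exists (4, 5)%N; [by []|by right].
  + exists (5, 6)%N; [by []|by right].
  + exists (6, 7)%N; [by []|by right].
  + exists (2, 8)%N; [by []|by right].
Qed.

Section AffineData.
Variable Q : quiver.

Lemma affine_data : affine_quiver Q -> exists (d : vertex Q -> nat) (r0 : vertex Q) (rk : vertex Q -> nat),
  [/\ forall i, (0 < d i)%N,
      forall i, (\sum_(a : arrow Q) ((src a == i) * d (tgt a) + (tgt a == i) * d (src a)) = 2 * d i)%N
    & forall i, i != r0 -> exists a : arrow Q,
       (src a = i /\ (rk (tgt a) < rk i)%N) \/ (tgt a = i /\ (rk (src a) < rk i)%N)].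
Proof.
move=> [[n [E [dE [f [g [[f' ff' f'f] [g' gg' g'g] Hfg]]]]]] _].
have [D [D0 HD]] := ext_dynkin_harmonic dE.
have [r [rk [rn Hr]]] := ext_dynkin_connected dE.
have fI : injective f := can_inj ff'.
have feq i j : ((f i : nat) == f j) = (i == j) by rewrite val_eqE (inj_eq fI).
exists (fun v => D (f v)), (f' (Ordinal rn)), (fun v => rk (f v)); split=> [i|i|i ir].
- exact: D0.
- rewrite -(HD (f i) (ltn_ord _)) (big_nth (0, 0)%N) big_mkord.
  rewrite (reindex g) /=; last by exists g' => x _.
  apply: eq_bigr => a _; rewrite /edge_sum; have [->|->] /= := Hfg a.
    by rewrite !feq.
  by rewrite !feq addnC.
- have fr : (f i : nat) != r.
    apply: contraNneq ir => e; apply/eqP/fI; rewrite f'f; exact: val_inj.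
  have [p pE H] := Hr _ (ltn_ord _) fr.
  have lt : (index p E < size E)%N by rewrite index_mem.
  exists (g' (Ordinal lt)); have := Hfg (g' (Ordinal lt)); rewrite g'g /= nth_index //.
  case=> e; have /= e1 := congr1 fst e; have /= e2 := congr1 snd e; rewrite e1 e2 in H;
    case: H => -[/val_inj/fI h1 h2].
  + by left.
  + by right.
  + by right.
  + by left.
Qed.

End AffineData.

Section EulerForm.
Variable Q : quiver.
Local Notation e := (@euler_form Q).

Lemma euler_lin (a b c : vertex Q -> int) k :
  [/\ e (fun i => a i + b i) c = e a c + e b c, e c (fun i => a i + b i) = e c a + e c b,
      e (fun i => k * a i) c = k * e a c & e c (fun i => k * a i) = k * e c a].
Proof.
rewrite /euler_form; split.
- rewrite [RHS]addrACA -opprD -!big_split /=; congr (_ - _); apply: eq_bigr => i _; ring.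
- rewrite [RHS]addrACA -opprD -!big_split /=; congr (_ - _); apply: eq_bigr => i _; ring.
- rewrite mulrBr !mulr_sumr; congr (_ - _); apply: eq_bigr => i _; ring.
- rewrite mulrBr !mulr_sumr; congr (_ - _); apply: eq_bigr => i _; ring.
Qed.

Definition unitv (i : vertex Q) : vertex Q -> int := fun j => (j == i)%:Z.

Lemma euler_unitl i v : e (unitv i) v = v i - \sum_(a | src a == i) v (tgt a).
Proof.
rewrite /euler_form; congr (_ - _).
  by rewrite (bigD1 i) //= big1 ?addr0 /unitv ?eqxx ?mul1r // => j /negbTE ->; rewrite mul0r.
by rewrite [RHS]big_mkcond; apply: eq_bigr => a _; rewrite /unitv; case: eqP; rewrite ?mul1r ?mul0r.
Qed.
Lemma euler_unitr i v : e v (unitv i) = v i - \sum_(a | tgt a == i) v (src a).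
Proof.
rewrite /euler_form; congr (_ - _).
  by rewrite (bigD1 i) //= big1 ?addr0 /unitv ?eqxx ?mulr1 // => j /negbTE ->; rewrite mulr0.
by rewrite [RHS]big_mkcond; apply: eq_bigr => a _; rewrite /unitv; case: eqP; rewrite ?mulr1 ?mulr0.
Qed.

Hypothesis aQ : acyclic Q.

Lemma euler_nondegr v : (forall y, e y v = 0) -> forall i, v i = 0.
Proof.
move=> H i; have [n] := ubnP (height i); elim: n i => // n IH i lt.
have := H (unitv i); rewrite euler_unitl big1 ?subr0 // => a /eqP sa.
by apply: IH; have := height_lt aQ a; rewrite sa => h; lia.
Qed.
Lemma euler_nondegl v : (forall y, e v y = 0) -> forall i, v i = 0.
Proof.
move=> H i; have [n] := ubnP (coheight i); elim: n i => // n IH i lt.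
have := H (unitv i); rewrite euler_unitr big1 ?subr0 // => a /eqP sa.
by apply: IH; have := coheight_lt aQ a; rewrite sa => h; lia.
Qed.

Variable d : vertex Q -> nat.
Hypothesis d_gt0 : forall i, (0 < d i)%N.
Hypothesis harm : forall i,
  (\sum_(a : arrow Q) ((src a == i) * d (tgt a) + (tgt a == i) * d (src a)) = 2 * d i)%N.

(** Expanding the products gives the mixed terms of the Euler form and terms in x z / d, which the
    harmonic relation collects into 2 x z at each vertex. *)
Lemma euler_sym (x z : vertex Q -> int) : (e x z + e z x)%:~R =
  \sum_(a : arrow Q) (d (src a))%:R * (d (tgt a))%:R *
    ((x (src a))%:~R / (d (src a))%:R - (x (tgt a))%:~R / (d (tgt a))%:R) *
    ((z (src a))%:~R / (d (src a))%:R - (z (tgt a))%:~R / (d (tgt a))%:R) :> rat.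
Proof.
have dr i : (d i)%:R != 0 :> rat by rewrite pnatr_eq0 -lt0n.
pose w i : rat := (x i)%:~R * (z i)%:~R / (d i)%:R.
have hs : \sum_(a : arrow Q) ((d (tgt a))%:R * w (src a) + (d (src a))%:R * w (tgt a)) =
    \sum_i 2 * ((x i)%:~R * (z i)%:~R) :> rat.
  transitivity (\sum_(a : arrow Q) \sum_i (((src a == i) * d (tgt a) + (tgt a == i) * d (src a))%N%:R * w i)).
    apply: eq_bigr => a _; under eq_bigr do rewrite natrD mulrDl.
    rewrite big_split /=; congr (_ + _).
      rewrite (bigD1 (src a)) //= eqxx mul1n big1 ?addr0 // => i /negbTE.
      by rewrite eq_sym => ->; rewrite mul0n mul0r.
    rewrite (bigD1 (tgt a)) //= eqxx mul1n big1 ?addr0 // => i /negbTE.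
    by rewrite eq_sym => ->; rewrite mul0n mul0r.
  rewrite exchange_big; apply: eq_bigr => i _; rewrite -mulr_suml -natr_sum harm /w natrM.
  by rewrite -mulrA; congr (_ * _); rewrite mulrC divfK.
transitivity (\sum_i 2 * ((x i)%:~R * (z i)%:~R) -
   \sum_(a : arrow Q) ((x (src a))%:~R * (z (tgt a))%:~R + (z (src a))%:~R * (x (tgt a))%:~R) :> rat).
  rewrite /euler_form addrACA -opprD -!big_split /= rmorphB /= !rmorph_sum /=.
  by congr (_ - _); apply: eq_bigr => i _; rewrite rmorphD !rmorphM /=; ring.
rewrite -hs -sumrB; apply: eq_bigr => a _; rewrite /w; field.
by rewrite !dr.
Qed.

End EulerForm.

(* [ad_delta] is a positive multiple of the minimal positive imaginary root *)
Record affdata (Q : quiver) := AffData {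
  ad_acyclic : acyclic Q;
  ad_delta : vertex Q -> nat;
  ad_root : vertex Q;
  ad_rank : vertex Q -> nat;
  ad_gt0 : forall i, (0 < ad_delta i)%N;
  ad_harmonic : forall i, (\sum_(a : arrow Q)
    ((src a == i) * ad_delta (tgt a) + (tgt a == i) * ad_delta (src a)) = 2 * ad_delta i)%N;
  ad_connected : forall i, i != ad_root -> exists a : arrow Q,
    (src a = i /\ (ad_rank (tgt a) < ad_rank i)%N) \/ (tgt a = i /\ (ad_rank (src a) < ad_rank i)%N) }.

Section HomExt.
Variables (K : fieldType) (Q : quiver).
Implicit Types (X Y Z W E M L N P I : rep K Q).

Definition dv X : vertex Q -> int := fun i => (dimvec X i)%:Z.
Lemma euler_he X Y : euler_form (dv X) (dv Y) = (hom X Y)%:Z - (ext X Y)%:Z.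
Proof. by rewrite euler_hom_ext. Qed.
Lemma dv_iso X Y (f : C0 X Y) : isoF f -> dv X = dv Y.
Proof. by move=> fi; apply/funext => i; rewrite /dv (iso_dim i fi). Qed.

(** Right exactness of Ext: a cochain on a subobject extends linearly. In the next lemma a cochain
    into a quotient lifts linearly. *)
Lemma ext0_sub X X' Y (u : C0 X' X) : isHom u -> mono u -> ext X Y = 0%N -> ext X' Y = 0%N.
Proof.
move=> uh um /ext0P H; apply/ext0P => c; have [c' <-] := pull_surj um c.
exact: pull_img.
Qed.
Lemma ext0_quo X Y Z (f : C0 Y Z) : isHom f -> epi f -> ext X Y = 0%N -> ext X Z = 0%N.
Proof.
move=> uh um /ext0P H; apply/ext0P => c; have [c' <-] := push_surj um c.
exact: push_img.
Qed.

Lemma dv_ses X E Y (i : C0 X E) (p : C0 E Y) : ses i p -> dv E = (fun v => dv X v + dv Y v).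
Proof. by move=> s; apply/funext => v; rewrite /dv (ses_dim s) PoszD. Qed.

Lemma im_fact X Y (f : C0 X Y) : isHom f -> exists N (q : C0 X N) (j : C0 N Y),
  [/\ isHom q, epi q, isHom j, mono j & f = cmp j q].
Proof.
move=> fh; have [N HN] := sub_im fh.
have [q qh qE] : exists2 q : C0 X (rep_of N), isHom q & forall v x, incl N v (q v x) = f v x.
  apply: lift_mono => //; [exact: isHom_incl|exact: mono_incl|].
  by move=> v x; apply/inclP/HN; exists x.
exists (rep_of N), q, (incl N); split=> //.
- move=> v y; have /HN[x xy] : incl N v y \in N v by apply/inclP; exists y.
  by exists x; apply: (monoB (mono_incl N)); rewrite qE.
- exact: isHom_incl.
- exact: mono_incl.
by apply: C0P => v x; rewrite FE qE.
Qed.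

Lemma ker_ses X Y (f : C0 X Y) : isHom f -> epi f -> exists N (j : C0 N X), ses j f.
Proof. by move=> fh fe; have [N [_ s]] := ses_ker fh fe; exists (rep_of N), (incl N). Qed.
Lemma coker_ses X Y (f : C0 X Y) : isHom f -> mono f -> exists N (p : C0 Y N), ses f p.
Proof.
move=> fh fm; have [N HN] := sub_im fh; exists (quo N), (prj N); split=> //.
- exact: isHom_prj.
- exact: epi_prj.
by move=> v x; rewrite prjP HN.
Qed.

Lemma not_zero_mono X Y (f : C0 X Y) : mono f -> ~ rep_zero X -> f <> 0.
Proof.
by move=> fm X0 f0; apply: X0; apply/rep_zeroP => i x; apply: (fm i); rewrite f0 FE.
Qed.
Lemma not_zero_epi X Y (f : C0 X Y) : epi f -> ~ rep_zero Y -> f <> 0.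
Proof.
move=> fe Y0 f0; apply: Y0; apply/rep_zeroP => i y; have [x <-] := fe i y.
by rewrite f0 FE.
Qed.
Lemma zero_epi X Y (f : C0 X Y) : epi f -> rep_zero X -> rep_zero Y.
Proof.
move=> fe X0; apply/rep_zeroP => i y; have [x <-] := fe i y.
by rewrite (zero_from f X0) FE.
Qed.
Lemma zero_mono X Y (f : C0 X Y) : mono f -> rep_zero Y -> rep_zero X.
Proof.
move=> fm Y0; apply/rep_zeroP => i x; apply: (fm i); by rewrite (zero_to f Y0) FE.
Qed.

Definition simple (i : vertex Q) : rep K Q :=
  @Rep K Q (fun j => 'rV[K]_(j == i) : vectType K) (fun _ => 0).
Lemma dv_simple i : dv (simple i) = unitv i.
Proof. by apply/funext => j; rewrite /dv /dimvec /= dimvf /dim /= mul1n. Qed.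

End HomExt.

(** * Regular representations and tubes *)

Section Semistable.
Variables (K : fieldType) (Q : quiver).
Variable A : affdata Q.
Let aQ := ad_acyclic A.
Let d := ad_delta A.
Let r0 := ad_root A.
Let rk := ad_rank A.
Let d_gt0 : forall i, (0 < d i)%N := @ad_gt0 _ A.
Let harm := @ad_harmonic _ A.
Let rkP := @ad_connected _ A.
Implicit Types (X Y Z W E M L N P I T : rep K Q).
Local Notation e := (@euler_form Q).

Let eDl a b c : e (fun i => a i + b i) c = e a c + e b c. Proof. by case: (euler_lin a b c 0). Qed.
Let eDr a b c : e c (fun i => a i + b i) = e c a + e c b. Proof. by case: (euler_lin a b c 0). Qed.
Let eZl k a c : e (fun i => k * a i) c = k * e a c. Proof. by case: (euler_lin a a c k). Qed.
Let eZr k a c : e c (fun i => k * a i) = k * e c a. Proof. by case: (euler_lin a a c k). Qed.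
Let dz : vertex Q -> int := fun i => (d i)%:Z.

Let edz z : e z dz = - e dz z.
Proof. exact: (Edz d_gt0 (euler_sym d_gt0 harm)). Qed.

Lemma e_unit_suml y v : e y v = \sum_i y i * e (unitv i) v.
Proof.
rewrite {1}/euler_form; under [RHS]eq_bigr do rewrite euler_unitl mulrBr.
rewrite sumrB; congr (_ - _).
rewrite (partition_big (@src Q) xpredT) //=; apply: eq_bigr => i _.
by rewrite mulr_sumr; apply: eq_bigr => a /eqP ->.
Qed.
Lemma e_unit_sumr y v : e y v = \sum_i v i * e y (unitv i).
Proof.
rewrite {1}/euler_form; under [RHS]eq_bigr do rewrite euler_unitr mulrBr.
rewrite sumrB; congr (_ - _); first by apply: eq_bigr => i _; rewrite mulrC.
rewrite (partition_big (@tgt Q) xpredT) //=; apply: eq_bigr => i _.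
by rewrite mulr_sumr; apply: eq_bigr => a /eqP ->; rewrite mulrC.
Qed.

(** The defect, up to the positive factor between [ad_delta] and the minimal root. *)
Definition df X := e dz (dv X).
Let w i := e dz (unitv i).
Lemma df_wt X : df X = wt w X.
Proof. by rewrite /df e_unit_sumr; apply: eq_bigr => i _; rewrite mulrC. Qed.

Lemma df_ses X E Y (i : C0 X E) (p : C0 E Y) : ses i p -> df E = df X + df Y.
Proof. by move=> s; rewrite /df (dv_ses s) eDr. Qed.
Lemma df_iso X Y (f : C0 X Y) : isoF f -> df X = df Y.
Proof. by move=> fi; rewrite /df (dv_iso fi). Qed.
Lemma dv0 X : rep_zero X -> dv X = fun=> 0.
Proof. by move/rep_zero_dim => H; apply/funext => i; rewrite /dv H. Qed.
Lemma dv_eq0 X : (forall i, dv X i = 0) -> rep_zero X.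
Proof. by move=> H; apply/rep_zero_dim => i; apply/eqP; rewrite -eqz_nat; apply/eqP/H. Qed.
Lemma df0 X : rep_zero X -> df X = 0.
Proof.
move/dv0 => H; rewrite /df H.
have -> : e dz (fun=> 0) = e dz (fun i => 0 * 0) by congr (e _ _); apply/funext => i; rewrite mul0r.
by rewrite (eZr 0 (fun=> 0)) mul0r.
Qed.

(** The action of tau on dimension vectors is minus a transpose with respect to the Euler form; the
    two Auslander-Reiten formulas only have to be tested on simples. *)
Lemma tau_dv X Y : tau X Y -> forall y, e y (dv Y) = - e (dv X) y.
Proof.
move=> /(tauP aQ)[_ _ h1 h2] y; rewrite e_unit_suml [in RHS]e_unit_sumr -sumrN.
apply: eq_bigr => i _; rewrite -mulrN; congr (_ * _).
by rewrite -(dv_simple K i) !euler_he h1 h2; lia.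
Qed.

Lemma tau_df X Y : tau X Y -> df Y = df X.
Proof. by move=> t; rewrite /df (tau_dv t) -[RHS]opprK -edz. Qed.

(** The defect of P is minus a sum of dimensions of Hom(P, S), S simple, with positive weights. If
    all of these vanished, nondegeneracy would make the dimension vector 0. *)
Lemma proj_df P : ~ rep_zero P -> isProj P -> df P < 0.
Proof.
move=> P0 PP; have hE i : e (dv P) (unitv i) = (hom P (simple K i))%:Z.
  by rewrite -(dv_simple K i) euler_he PP subr0.
rewrite /df -[e dz _]opprK -edz oppr_lt0 e_unit_sumr lt_neqAle.
have pos i : 0 <= dz i * e (dv P) (unitv i) by rewrite hE mulr_ge0.
rewrite sumr_ge0 // andbT eq_sym psumr_eq0 //; apply/negP => /allP H; apply: P0; apply: dv_eq0.
apply: (euler_nondegl aQ) => y; rewrite e_unit_sumr big1 // => i _.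
have := H i (mem_index_enum _); rewrite /= mulf_eq0 /dz eqz_nat => /orP[/eqP h|/eqP ->].
  by have := d_gt0 i; rewrite h.
by rewrite mulr0.
Qed.

Lemma inj_df P : ~ rep_zero P -> isInj P -> 0 < df P.
Proof.
move=> P0 PP; have hE i : e (unitv i) (dv P) = (hom (simple K i) P)%:Z.
  by rewrite -(dv_simple K i) euler_he PP subr0.
rewrite /df e_unit_suml lt_neqAle.
have pos i : 0 <= dz i * e (unitv i) (dv P) by rewrite hE mulr_ge0.
rewrite sumr_ge0 // andbT eq_sym psumr_eq0 //; apply/negP => /allP H; apply: P0; apply: dv_eq0.
apply: (euler_nondegr aQ) => y; rewrite e_unit_suml big1 // => i _.
have := H i (mem_index_enum _); rewrite /= mulf_eq0 /dz eqz_nat => /orP[/eqP h|/eqP ->].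
  by have := d_gt0 i; rewrite h.
by rewrite mulr0.
Qed.

Lemma pp_df X : preprojective X -> indecomposable X /\ df X < 0.
Proof.
elim=> [P iP /proj_ext PP|N L t _ [_ h]]; first by split=> //; apply: proj_df iP.1 PP.
by split; [have [] := tauP aQ t | rewrite -(tau_df t)].
Qed.
Lemma pi_df X : preinjective X -> indecomposable X /\ 0 < df X.
Proof.
elim=> [P iP /inj_ext PP|N L t _ [_ h]]; first by split=> //; apply: inj_df iP.1 PP.
by split; [have [] := tauP aQ t | rewrite (tau_df t)].
Qed.

(** Otherwise no translate of X is projective, and the tau-orbit is an infinite sequence of
    nonnegative vectors, whose defect is at least 0. *)
Lemma df_neg_pp X : indecomposable X -> df X < 0 -> preprojective X.
Proof.
move=> iX; rewrite ltNge => /negP dX; apply: contrapT => nX; apply: dX.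
pose good Y := indecomposable Y /\ ~ preprojective Y.
have /choice[F HF] : forall Y, exists Z, good Y -> tau Y Z /\ good Z.
  move=> Y; have [[iY nY]|] := pselect (good Y); last by exists Y.
  have nP : ~ isProj Y by move=> /proj_ext P; apply: nY; apply: preprojective_proj.
  have [Z t] := tau_ex aQ iY nP; exists Z => _; split=> //; split; first by have [] := tauP aQ t.
  by move=> pZ; apply: nY; apply: preprojective_tau t pZ.
pose x n := iter n F X.
have gx n : good (x n) by elim: n => //= n /HF[].
have tx n : tau (x n) (x n.+1) by have [] := HF _ (gx n).
apply: (@orbit_def_ge0 _ _ _ _ d r0 rk e d_gt0 rkP eDl eDr eZl eZr (euler_nondegr aQ) (euler_sym d_gt0 harm) (fun n => dv (x n))).
  by move=> n y; rewrite (tau_dv (tx n)).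
by move=> n v; rewrite /dv.
Qed.

Lemma df_pos_pi X : indecomposable X -> 0 < df X -> preinjective X.
Proof.
move=> iX; rewrite ltNge => /negP dX; apply: contrapT => nX; apply: dX.
pose good Y := indecomposable Y /\ ~ preinjective Y.
have /choice[F HF] : forall Y, exists Z, good Y -> tau Z Y /\ good Z.
  move=> Y; have [[iY nY]|] := pselect (good Y); last by exists Y.
  have nP : ~ isInj Y by move=> /inj_ext P; apply: nY; apply: preinjective_inj.
  have [Z t] := tau_ex' aQ iY nP; exists Z => _; split=> //; split; first by have [] := tauP aQ t.
  by move=> pZ; apply: nY; apply: preinjective_tau t pZ.
pose x n := iter n F X.
have gx n : good (x n) by elim: n => //= n /HF[].
have tx n : tau (x n.+1) (x n) by have [] := HF _ (gx n).
rewrite /df -[e dz _]opprK -edz oppr_le0.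
(* Inverse translates obey the same relation for the transposed form, with respect to which the
   defect changes sign. *)
apply: (@orbit_def_ge0 _ _ _ _ d r0 rk (fun a b => e b a) d_gt0 rkP _ _ _ _ (euler_nondegl aQ) _ (fun n => dv (x n))) => //.
- by move=> a b; rewrite addrC (euler_sym d_gt0 harm).
- by move=> n y; rewrite (tau_dv (tx n)) opprK.
Qed.

(* semistability for the defect *)
Definition sst X := df X = 0 /\ forall Y (f : C0 Y X), isHom f -> mono f -> df Y <= 0.

Lemma sst_quo_ge X Y (f : C0 X Y) : sst X -> isHom f -> epi f -> 0 <= df Y.
Proof.
move=> [X0 Xs] fh fe; have [N [j js]] := ker_ses fh fe; have [jh _ jm _ _] := js.
by have := df_ses js; have := Xs _ _ jh jm; lia.
Qed.
Lemma sst_sub X Y (f : C0 Y X) : sst X -> isHom f -> mono f -> df Y = 0 -> sst Y.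
Proof.
move=> [X0 Xs] fh fm Y0; split=> // Z g gh gm; apply: (Xs _ (cmp f g)); first exact: isHom_cmp.
exact: mono_comp.
Qed.
Lemma sst_zero X : rep_zero X -> sst X.
Proof.
move=> X0; split=> [|Y f fh fm]; first exact: df0.
by rewrite (df0 (zero_mono fm X0)).
Qed.
Lemma sst_ext X E Y (i : C0 X E) (p : C0 E Y) : ses i p -> sst X -> sst Y -> sst E.
Proof.
move=> s [X0 Xs] [Y0 Ys]; split=> [|Z f fh fm]; first by rewrite (df_ses s) X0 Y0.
have [ih ph im pe ex] := s.
have [N [q [j [qh qe jh jm E1]]]] := im_fact (isHom_cmp ph fh).
have [Z' [k ks]] := ker_ses qh qe; have [kh _ km _ kex] := ks.
rewrite (df_ses ks); have := Ys _ _ jh jm.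
have [g gh gE] : exists2 g : C0 Z' X, isHom g & forall v x, i v (g v x) = cmp f k v x.
  apply: lift_mono => //; first exact: isHom_cmp.
  move=> v x; apply/ex; rewrite cmpE -(cmpE p f) E1 cmpE.
  have -> : q v (k v x) = 0 by apply/kex; exists x.
  by rewrite lf0.
have gm : mono g.
  move=> v x gx; apply: (km v); apply: (fm v); by rewrite -cmpE -gE gx lf0.
by have := Xs _ _ gh gm; lia.
Qed.
Lemma sst_quo X Y (f : C0 X Y) : sst X -> isHom f -> epi f -> df Y = 0 -> sst Y.
Proof.
move=> sX fh fe Y0; split=> // Z g gh gm.
have [C [p ps]] := coker_ses gh gm; have [_ ph _ pe _] := ps.
by have := df_ses ps; have := sst_quo_ge sX (isHom_cmp ph fh) (epi_comp pe fe); lia.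
Qed.
Lemma sst_iso X Y (f : C0 X Y) : sst X -> isHom f -> isoF f -> sst Y.
Proof. by move=> sX fh fi; apply: (sst_quo sX fh fi.2); rewrite -(df_iso fi); case: sX. Qed.

Lemma sst_summand X Y (s : C0 Y X) (r : C0 X Y) : sst X -> isHom s -> isHom r ->
  cmp r s = idF Y -> sst Y.
Proof.
move=> sX sh rh rs; apply: (sst_sub sX sh (id_mono rs)).
have := sst_quo_ge sX rh (id_epi rs); have := sX.2 _ _ sh (id_mono rs); lia.
Qed.

Lemma indec_summand_df (P : int -> Prop) X :
  (forall a b, P (a + b) -> P a \/ P b) -> ~ rep_zero X -> P (df X) ->
  exists (Y : rep K Q) (s : C0 Y X) (r : C0 X Y),
   [/\ indecomposable Y, isHom s, isHom r, cmp r s = idF Y & P (df Y)].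
Proof.
move=> PD X0; rewrite df_wt => PX; have [Y [s [r [iY sh rh rs]]]] := indec_summand PD X0 PX.
by rewrite -df_wt => PY; exists Y, s, r.
Qed.

(** Inverse translation of both objects reduces to I injective. Images of injectives are injective
    in a hereditary category, so the image splits off X, and X would be injective with positive
    defect. *)
Lemma pi_hom0 I : preinjective I -> forall X, indecomposable X -> df X <= 0 -> hom I X = 0%N.
Proof.
elim=> [J iJ /inj_ext JJ|N L t _ IH] X iX dX.
  apply/hom0P => f fh; apply: contrapT => f0.
  have [N [q [j [qh qe jh jm E1]]]] := im_fact fh.
  have NI : isInj N by move=> Z; apply: ext0_quo qh qe (JJ Z).
  have N0 : ~ rep_zero N by move=> N0; apply: f0; rewrite E1 (zero_to q N0) cmpF0.
  have [C [p ps]] := coker_ses jh jm; have [c cl] := ses_class ps.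
  have [r rh rj] := (notsec_class ps cl).2 ((ext0P _ _).1 (NI _) c).
  have [//|ji] := indec_split iX jh rh rj.
  by have := inj_df N0 NI; rewrite (df_iso ji); lia.
have nI : ~ isInj X by move=> /(inj_df iX.1); lia.
have [X' t'] := tau_ex' aQ iX nI.
have [iX' _ g1 _] := tauP aQ t'; have [_ _ _ h2] := tauP aQ t.
by rewrite g1 h2 IH // -(tau_df t').
Qed.

End Semistable.

Section Eigen.
Import VectorInternalTheory.

Lemma lfun_eigen (K : numClosedFieldType) (V : vectType K) (f : 'End(V)) :
  (0 < \dim {: V})%N -> exists k v, v <> 0 /\ f v = k *: v.
Proof.
move=> d0; pose g := (v2r \o f \o r2v).
have n0 : (0 < dim V)%N by rewrite dimvf in d0.
have [k /eigenvalueP[u uE u0]] := eigenvalue_closed (lin1_mx g) n0.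
exists k, (r2v u); split.
  move=> e; move: u0; rewrite -[u]r2vK e.
  by rewrite linear0 eqxx.
apply: (can_inj v2rK); rewrite linearZ /= r2vK -uE.
by rewrite mul_rV_lin1.
Qed.

End Eigen.

(** * Stable representations for the defect *)

Section Stable.
Variables (K : numClosedFieldType) (Q : quiver) (A : affdata Q).
Let aQ := ad_acyclic A.
Implicit Types (X Y Z W E M L N P I T S R : rep K Q).
Local Notation df := (df A).
Local Notation sst := (sst A).

Lemma pi_sst_hom0 I X : indecomposable I -> 0 < df I -> sst X -> hom I X = 0%N.
Proof.
move=> iI dI sX; apply/hom0P => f fh; apply: contrapT => f0.
have [N [q [j [qh qe jh jm E1]]]] := im_fact fh.
have N0 : ~ rep_zero N by move=> N0; apply: f0; rewrite E1 (zero_to q N0) cmpF0.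
have PD (a b : int) : a + b <= 0 -> a <= 0 \/ b <= 0.
  by move=> h; have [?|?] := lerP a 0; [left | right; lia].
have [Y [s [r [iY sh rh rs dY]]]] := indec_summand_df PD N0 (sX.2 _ _ jh jm).
have rqh : isHom (cmp r q) := isHom_cmp rh qh.
have := pi_hom0 (df_pos_pi iI dI) iY dY => /hom0P/(_ _ rqh).
by apply: not_zero_epi iY.1; apply: epi_comp qe; apply: id_epi rs.
Qed.

Lemma ext0_sst_pi I M : sst M -> indecomposable I -> 0 < df I -> ext M I = 0%N.
Proof.
move=> sM iI dI; have [II|nI] := pselect (isInj I); first exact: II.
have [I' t] := tau_ex' aQ iI nI; have [iI' _ _ h] := tauP aQ t.
by rewrite h pi_sst_hom0 // -(tau_df A t).
Qed.

(** A subobject of positive defect has an indecomposable summand of positive defect; this summand is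
    preinjective and has no nonzero map to X. *)
Lemma indec_sst X : indecomposable X -> df X = 0 -> sst X.
Proof.
move=> iX dX; split=> // Y f fh fm; rewrite leNgt; apply/negP => dY.
have Y0 : ~ rep_zero Y by move=> /(df0 A) e; rewrite e ltxx in dY.
have PD (a b : int) : 0 < a + b -> 0 < a \/ 0 < b.
  by move=> h; have [?|?] := ltrP 0 a; [left | right; lia].
have [Z [s [r [iZ sh rh rs dZ]]]] := indec_summand_df PD Y0 dY.
have := pi_hom0 (A := A) (df_pos_pi iZ dZ) iX; rewrite dX => /(_ (lexx _)).
apply: hom_neq0I (isHom_cmp fh sh) _; apply: not_zero_mono iZ.1.
by apply: mono_comp fm _; apply: id_mono rs.
Qed.

Lemma summand_sst X : (forall Y (s : C0 Y X) (r : C0 X Y), indecomposable Y -> isHom s ->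
  isHom r -> cmp r s = idF Y -> df Y = 0) -> sst X.
Proof.
have [n] := ubnP (tot X); elim: n X => // n IH X lt H.
have [X0|X0] := pselect (rep_zero X); first exact: sst_zero.
have [iX|nX] := pselect (indecomposable X).
  apply: indec_sst => //; apply: (H _ _ _ iX (isHom_id X) (isHom_id X)); exact: cmp1F.
have [B [C [BC B0 C0']]] := not_indec X0 nX.
have side (D D' : subrep X) : complementary D D' -> ~ rep_zero (rep_of D') -> sst (rep_of D).
  move=> DD D0; have [r [rh ri _]] := compl_split DD; apply: IH.
    have [q qs] := compl_ses DD; have := tot_ses qs.
    have : tot (rep_of D') <> 0%N by move/tot0P.
    by move=> h1 h2; rewrite ltnS in lt; lia.
  move=> Y s q iY sh qh qs; apply: (H _ (cmp (incl D) s) (cmp q r)) => //.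
  - exact: isHom_cmp (isHom_incl D) sh.
  - exact: isHom_cmp.
  by rewrite cmpA -(cmpA q) ri cmpF1.
have [q qs] := compl_ses BC.
by apply: (sst_ext qs); [apply: side (complC BC) B0 | apply: side BC C0'].
Qed.

(** Replaces a condition on direct summands by one on subobjects, which passes to extensions and to
    subobjects and quotients of defect 0. *)
Lemma regular_sst X : regular X <-> sst X.
Proof.
split=> [H|sX B C BC iB].
  apply: summand_sst => Y s r iY sh rh rs; have rsE := cmp_id rs.
  have [B HB] := sub_im sh; have [C HC] := sub_ker rh.
  have BC : complementary B C.
    move=> i; split; apply/vspaceP => x; rewrite ?memvf.
      apply/memv_addP; exists (s i (r i x)); first by apply/HB; exists (r i x).
      exists (x - s i (r i x)); first by apply/HC; rewrite lfB rsE subrr.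
      by rewrite addrC subrK.
    rewrite memv0; apply/memv_capP/eqP => [[xB xC]|->]; last by rewrite !mem0v.
    have [y e] := (HB i x).1 xB; have := (HC i x).1 xC.
    by rewrite -e rsE => ->; rewrite lf0.
  have [g gh gE] : exists2 g : C0 Y (rep_of B), isHom g & forall v x, incl B v (g v x) = s v x.
    apply: lift_mono => //; [exact: isHom_incl|exact: mono_incl|].
    by move=> v x; apply/inclP/HB; exists x.
  have gi : isoF g.
    split=> [v x gx|v y]; first by apply: (id_mono rs); rewrite -gE gx lf0.
    have /HB[x xy] : incl B v y \in B v by apply/inclP; exists y.
    by exists x; apply: (monoB (mono_incl B)); rewrite gE.
  have iB := indec_iso gh gi iY.
  rewrite (df_iso A gi); have [np ni] := H B C BC iB.
  apply/eqP; rewrite eq_le !leNgt; apply/andP; split; apply/negP => h.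
    by apply: ni; apply: df_pos_pi h.
  by apply: np; apply: df_neg_pp h.
have [r [rh ri _]] := compl_split BC.
have [dB _] := sst_summand sX (isHom_incl B) rh ri.
by split=> [/(pp_df A)|/(pi_df A)][_]; rewrite dB ltxx.
Qed.

Definition stable T := [/\ sst T, ~ rep_zero T &
  forall Y (f : C0 Y T), isHom f -> mono f -> df Y = 0 -> rep_zero Y \/ isoF f].

Lemma quasi_simple_stable T : quasi_simple T <-> stable T.
Proof.
split=> [[rT T0 HT]|[sT T0 HT]].
  have sT := (regular_sst T).1 rT; split=> // Y f fh fm dY.
  have [B HB] := sub_im fh.
  have [g gh gE] : exists2 g : C0 Y (rep_of B), isHom g & forall v x, incl B v (g v x) = f v x.
    apply: lift_mono => //; [exact: isHom_incl|exact: mono_incl|].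
    by move=> v x; apply/inclP/HB; exists x.
  have gi : isoF g.
    split=> [v x gx|v y]; first by apply: (fm v); rewrite -gE gx lf0.
    have /HB[x xy] : incl B v y \in B v by apply/inclP; exists y.
    by exists x; apply: (monoB (mono_incl B)); rewrite gE.
  have sB : sst (rep_of B).
    by apply: sst_sub sT (isHom_incl B) (mono_incl B) _; rewrite -(df_iso A gi).
  have [zB|fB] := HT B ((regular_sst _).2 sB); [left|right].
    exact: zero_mono gi.1 zB.
  split=> // v y; by apply/HB; rewrite fB memvf.
split=> // [|B]; first exact/regular_sst.
move=> /regular_sst[dB _]; have [zB|[_ fe]] := HT _ _ (isHom_incl B) (mono_incl B) dB; first by left.
right=> i; apply/vspaceP => x; rewrite memvf; apply/inclP; exact: fe.
Qed.

Lemma stable_isoF T S (j : C0 T S) : stable T -> isHom j -> isoF j -> stable S.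
Proof.
move=> sT jh ji; have [k' [k'h jk kj ki]] := isoF_inv jh ji; have [sT0 T0 HT] := sT.
split=> [|S0|Y g gh gm dY]; first exact: sst_iso sT0 jh ji.
  by apply: T0; apply: zero_mono ji.1 S0.
have [|Y0|[_ ge]] := HT Y (cmp k' g) (isHom_cmp k'h gh) _ dY; [|by left|].
  exact: mono_comp ki.1 gm.
right; split=> // i y; have [x xy] := ge i (k' i y); exists x.
by apply: (monoB ki.1); rewrite -xy FE.
Qed.

Lemma stable_epi X T (f : C0 X T) : sst X -> stable T -> isHom f -> f <> 0 -> epi f.
Proof.
move=> sX [sT T0 HT] fh f0; have [N [q [j [qh qe jh jm E1]]]] := im_fact fh.
have dN : df N = 0 by have := sT.2 _ _ jh jm; have := sst_quo_ge sX qh qe; lia.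
have [N0|[_ je]] := HT _ _ jh jm dN; last by rewrite E1; apply: epi_comp.
by case: f0; rewrite E1 (zero_to q N0) cmpF0.
Qed.

Lemma stable_mono X T (f : C0 T X) : sst X -> stable T -> isHom f -> f <> 0 -> mono f.
Proof.
move=> sX [sT T0 HT] fh f0; have [N [q [j [qh qe jh jm E1]]]] := im_fact fh.
have dN : df N = 0 by have := sX.2 _ _ jh jm; have := sst_quo_ge sT qh qe; lia.
have [Z [k ks]] := ker_ses qh qe; have [kh _ km _ kex] := ks.
have dZ : df Z = 0 by have := df_ses A ks; have := sT.1; lia.
have [Z0|[_ ke]] := HT _ _ kh km dZ.
  rewrite E1; apply: mono_comp => // i x /kex[y <-].
  by rewrite (zero_from k Z0) FE.
case: f0; apply: C0P => i x; rewrite E1 !FE; have [y <-] := ke i x.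
by have -> : q i (k i y) = 0; [apply/kex; exists y | rewrite lf0].
Qed.

Lemma stable_iso T S (f : C0 T S) : stable T -> stable S -> isHom f -> f <> 0 -> isoF f.
Proof.
move=> sT sS fh f0; split; first by case: (sS) => sS' _ _; apply: stable_mono f0.
by case: (sT) => sT' _ _; apply: stable_epi f0.
Qed.

(** An eigenvalue k of f at one vertex makes f - k non-injective, and a nonzero endomorphism of a
    stable object is injective. *)
Lemma stable_scalar T (f : C0 T T) : stable T -> isHom f -> exists k, f = k *: idF T.
Proof.
move=> sT fh; have [_ T0 _] := sT.
have [i Ti] : exists i, (0 < \dim {: T i})%N.
  apply: contrapT => H; apply: T0; apply/rep_zero_dim => i; apply/eqP; rewrite -leqn0 leqNgt.
  by apply/negP => h; apply: H; exists i.
have [k [v [v0 fv]]] := lfun_eigen (f i) Ti; exists k.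
apply/eqP; rewrite -subr_eq0; apply/eqP; apply: contrapT => g0.
have gh : isHom (f - k *: idF T) by apply: isHomB fh (isHomZ k (isHom_id T)).
have [gm _] := stable_iso sT sT gh g0; apply: v0; apply: (gm i).
by rewrite !FE fv subrr.
Qed.

Lemma hom_stable1 T : stable T -> hom T T = 1%N.
Proof.
move=> sT; rewrite /hom.
have -> : lker (dlt T T) = <[idF T]>%VS.
  apply/vspaceP => f; apply/idP/vlineP => [/isHomP fh|[k ->]].
    by have [k e] := stable_scalar sT fh; exists k.
  by apply: memvZ; apply/isHomP/isHom_id.
rewrite dim_vline; case: eqP => // /rep_zero_hom T0; by case: sT.
Qed.

Lemma hom_stable_iso T S : stable T -> stable S -> hom T S <> 0%N ->
  exists f : C0 T S, isHom f /\ isoF f.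
Proof. by move=> sT sS /hom_neq0[f fh f0]; exists f; split=> //; apply: stable_iso f0. Qed.

Lemma indec_stable T : stable T -> indecomposable T.
Proof.
move=> [sT T0 HT]; apply/indecP; split=> // Y s r sh rh rs.
have [dY _] := sst_summand sT sh rh rs; exact: HT sh (id_mono rs) dY.
Qed.

Lemma stable_sub X : sst X -> ~ rep_zero X -> exists T (j : C0 T X), [/\ stable T, isHom j & mono j].
Proof.
have [n] := ubnP (tot X); elim: n X => // n IH X lt sX X0.
have [H|nH] := pselect (forall Y (f : C0 Y X), isHom f -> mono f -> df Y = 0 -> rep_zero Y \/ isoF f).
  by exists X, (idF X); split=> //; [apply: isHom_id|case: (idF_iso X)].
have [Y [f [fh fm dY Y0 nf]]] : exists Y (f : C0 Y X), [/\ isHom f, mono f, df Y = 0, ~ rep_zero Y & ~ isoF f].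
  apply: contrapT => H; apply: nH => Y f fh fm dY; apply: contrapT => /not_orP[Y0 nf].
  by apply: H; exists Y, f.
have ltY : (tot Y < n)%N.
  apply: leq_trans (_ : (tot X <= n)%N); last by rewrite -ltnS.
  rewrite ltn_neqAle (tot_mono fm) andbT; apply/eqP => e; apply: nf.
  by apply: mono_tot_iso => //; rewrite e.
have [T [j [sT jh jm]]] := IH Y ltY (sst_sub sX fh fm dY) Y0.
by exists T, (cmp f j); split=> //; [apply: isHom_cmp | apply: mono_comp].
Qed.

Lemma stable_quo X : sst X -> ~ rep_zero X -> exists T (j : C0 X T), [/\ stable T, isHom j & epi j].
Proof.
have [n] := ubnP (tot X); elim: n X => // n IH X lt sX X0.
have [H|nH] := pselect (forall Y (f : C0 Y X), isHom f -> mono f -> df Y = 0 -> rep_zero Y \/ isoF f).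
  by exists X, (idF X); split=> //; [apply: isHom_id|case: (idF_iso X)].
have [Y [f [fh fm dY Y0 nf]]] : exists Y (f : C0 Y X), [/\ isHom f, mono f, df Y = 0, ~ rep_zero Y & ~ isoF f].
  apply: contrapT => H; apply: nH => Y f fh fm dY; apply: contrapT => /not_orP[Y0 nf].
  by apply: H; exists Y, f.
have [N [p ps]] := coker_ses fh fm; have [_ ph _ pe _] := ps.
have dN : df N = 0 by have := df_ses A ps; have := sX.1; lia.
have := tot_ses ps; have : tot Y <> 0%N by move/tot0P.
move=> tY tX; rewrite ltnS in lt.
have N0 : ~ rep_zero N.
  by move/tot0P => tN; apply: nf; apply: mono_tot_iso => //; lia.
have ltN : (tot N < n)%N by lia.
have [T [j [sT jh je]]] := IH N ltN (sst_quo sX ph pe dN) N0.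
by exists T, (cmp j p); split=> //; [apply: isHom_cmp | apply: epi_comp].
Qed.

Lemma sst_notproj X : indecomposable X -> df X = 0 -> ~ isProj X.
Proof. by move=> iX dX /(proj_df A iX.1); rewrite dX ltxx. Qed.
Lemma sst_notinj X : indecomposable X -> df X = 0 -> ~ isInj X.
Proof. by move=> iX dX /(inj_df A iX.1); rewrite dX ltxx. Qed.

(** A dimension vector for the translate of a possibly decomposable N: [tau] only relates
    indecomposables, so the vectors of the summands are added. *)
Lemma tau_vec N : sst N -> ~ rep_zero N -> exists v : vertex Q -> int,
  [/\ forall i, 0 <= v i, exists i, v i <> 0 & forall y, euler_form y v = - euler_form (dv N) y].
Proof.
have [n] := ubnP (tot N); elim: n N => // n IH N lt sN N0.
have [iN|nN] := pselect (indecomposable N).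
  have [L t] := tau_ex aQ iN (sst_notproj iN sN.1).
  exists (dv L); split=> [i|| y]; [by rewrite /dv| |exact: (tau_dv A t)].
  apply: contrapT => H; have [_ [L0 _] _ _] := tauP aQ t; apply: L0; apply: dv_eq0 => i.
  by apply: contrapT => h; apply: H; exists i.
have [B [C [BC B0 C0']]] := not_indec N0 nN.
have side (D D' : subrep N) : complementary D D' -> ~ rep_zero (rep_of D') ->
    sst (rep_of D) /\ (tot (rep_of D) < n)%N.
  move=> DD D0; have [r [rh ri _]] := compl_split DD.
  split; first exact: sst_summand sN (isHom_incl D) rh ri.
  have [q qs] := compl_ses DD; have := tot_ses qs.
  have : tot (rep_of D') <> 0%N by move/tot0P.
  by move=> h1 h2; rewrite ltnS in lt; lia.
have [sB tB] := side B C BC C0'; have [sC tC] := side C B (complC BC) B0.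
have [v [v0 [i vi] vE]] := IH _ tB sB B0; have [u [u0 _ uE]] := IH _ tC sC C0'.
have [q qs] := compl_ses BC.
exists (fun j => u j + v j); split=> [j||y].
- exact: addr_ge0.
- by exists i; have := v0 i; have := u0 i; lia.
have [h1 h2 _ _] := euler_lin u v y 0; have [h3 h4 _ _] := euler_lin (dv (rep_of C)) (dv (rep_of B)) y 0.
by rewrite h2 (dv_ses qs) h3 vE uE [RHS]opprD.
Qed.

Lemma tau_hom X Y X' Y' : tau X X' -> tau Y Y' -> hom X' Y' = hom X Y.
Proof.
move=> tX tY; have [_ _ h1 _] := tauP aQ tY; have [_ _ _ h2] := tauP aQ tX.
by rewrite h1 h2.
Qed.

(** Let S be a stable subobject of T' and R its inverse translate. The inclusion corresponds to a
    nonzero map R -> T, which is onto. If its kernel were nonzero, the dimension vector of S would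
    be that of T' plus a nonzero nonnegative vector; so S has the size of T'. *)
Lemma tau_stable T T' : stable T -> tau T T' -> stable T'.
Proof.
move=> sT t; have [iT iT' _ _] := tauP aQ t; have [sT0 T0 HT] := sT.
have dT' : df T' = 0 by rewrite (tau_df A t); case: sT0.
have sT' := indec_sst iT' dT'.
have [S [j [sS jh jm]]] := stable_sub sT' iT'.1.
have iS := indec_stable sS; have dS : df S = 0 by case: sS => -[].
have [R tR] := tau_ex' aQ iS (sst_notinj iS dS); have [iR _ _ _] := tauP aQ tR.
have sR : sst R by apply: indec_sst iR _; rewrite -(tau_df A tR).
have : hom S T' <> 0%N.
  by apply: hom_neq0I jh _; apply: not_zero_mono jm _; case: sS.
rewrite (tau_hom tR t) => /hom_neq0[f fh f0]; have fe := stable_epi sR sT fh f0.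
have [N [k ks]] := ker_ses fh fe; have [kh _ km _ _] := ks.
have sN : sst N.
  apply: (sst_sub sR kh km); have := df_ses A ks; have := sR.1; have := sT0.1; lia.
have [N0|N0] := pselect (rep_zero N); last first.
  have [v [v0 [i vi] vE]] := tau_vec sN N0.
  have e : (fun i => dv T' i + v i) = dv S.
    apply/funext => l; apply/eqP; rewrite -subr_eq0 -mulN1r; apply/eqP.
    apply: (euler_nondegr aQ (v := fun l => dv T' l + v l + (-1) * dv S l)) => y.
    have [_ h2 _ h4] := euler_lin (fun l => dv T' l + v l) (fun l => -1 * dv S l) y 0.
    have [_ h6 _ _] := euler_lin (dv T') v y 0; have [_ _ _ h8] := euler_lin (dv S) (dv S) y (-1).
    have [h9 _ _ _] := euler_lin (dv N) (dv T) y 0.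
    by rewrite h2 h6 h8 vE (tau_dv A t) (tau_dv A tR) (dv_ses ks) h9; ring.
  have := congr1 (fun g => g i) e; have := mono_dim i jm; have := v0 i; rewrite /dv; lia.
have eST : dv S = dv T'.
  apply/funext => l; apply/eqP; rewrite -subr_eq0 -mulN1r; apply/eqP.
  apply: (euler_nondegr aQ (v := fun l => dv S l + (-1) * dv T' l)) => y.
  have [_ h2 _ _] := euler_lin (dv S) (fun l => -1 * dv T' l) y 0.
  have [_ _ _ h8] := euler_lin (dv T') (dv T') y (-1).
  have fi : isoF f.
    by apply: epi_tot_iso => //; rewrite (tot_ses ks) ((tot0P N).1 N0).
  by rewrite h2 h8 (tau_dv A t) (tau_dv A tR) (dv_iso fi); ring.
have ji : isoF j.
  apply: mono_tot_iso => //; apply: leq_sum => i _.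
  by have := congr1 (fun g => g i) eST; rewrite /dv; lia.
exact: stable_isoF sS jh ji.
Qed.

End Stable.

(** * Uniserial objects of a tube *)

Section Uniserial.
Variables (K : numClosedFieldType) (Q : quiver) (A : affdata Q).
Let aQ := ad_acyclic A.
Implicit Types (X Y Z W E M L N P I T S R U V : rep K Q).
Local Notation df := (df A).
Local Notation sst := (sst A).
Local Notation stable := (stable A).

Definition isoR X Y := exists f : C0 X Y, isHom f /\ isoF f.
Lemma isoR_sym X Y : isoR X Y -> isoR Y X.
Proof. by move=> [f [fh fi]]; have [g [gh _ _ gi]] := isoF_inv fh fi; exists g. Qed.
Lemma isoR_trans X Y Z : isoR X Y -> isoR Y Z -> isoR X Z.
Proof.
by move=> [f [fh fi]] [g [gh gi]]; exists (cmp g f); split; [apply: isHom_cmp | apply: isoF_cmp].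
Qed.

Lemma tau_isoR N L L' : tau N L -> isoR L L' -> tau N L'.
Proof.
move=> /tau_RH[E [i [p [ip li rp]]]] [s [sh si]]; apply/tau_RH.
have [g [gh sg gs gi]] := isoF_inv sh si; have [ih ph im pe ex] := ip.
exists E, (cmp i g), p; split=> //.
  split=> //; [exact: isHom_cmp|exact: mono_comp im gi.1|].
  move=> v x; rewrite ex; split=> [[y <-]|[y <-]]; last by rewrite FE; eexists.
  by exists (s v y); rewrite FE (cmp_id gs).
split=> [[k kh kE]|Y h hh nh].
  apply: li.1; exists (cmp g k); first exact: isHom_cmp.
  have : cmp (cmp (cmp g (cmp k (cmp i g))) s) (idF L) = idF L by rewrite kE cmpF1 cmpF1.
  by rewrite cmpF1 -!cmpA gs cmpF1.
have [|h' h'h h'E] := li.2 Y (cmp h s) (isHom_cmp hh sh).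
  move=> [k kh kE]; apply: nh; exists (cmp s k); first exact: isHom_cmp.
  have : cmp (cmp s (cmp k (cmp h s))) g = idF L' by rewrite kE cmpF1.
  by rewrite -!cmpA sg cmpF1.
by exists h' => //; rewrite cmpA h'E -cmpA sg cmpF1.
Qed.

(* a tau-orbit of stable representations, indexed periodically *)
Record orbit := Orbit {
  op : nat;
  oT :> nat -> rep K Q;
  op_gt0 : (0 < op)%N;
  o_stable : forall i, stable (oT i);
  o_tau : forall i, tau (oT i) (oT i.+1);
  o_per : forall i, oT (i + op)%N = oT i;
  o_inj : forall i j, isoR (oT i) (oT j) -> i = j %[mod op] }.

Lemma q_euler_ge0 (x : vertex Q -> int) : 0 <= euler_form x x.
Proof. exact: (q_ge0 (euler_sym (@ad_gt0 _ A) (@ad_harmonic _ A))). Qed.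

Lemma orbit_ex T : stable T -> exists O : orbit, oT O 0%N = T.
Proof.
move=> sT.
have /choice[F HF] : forall Y, exists Z, stable Y -> tau Y Z /\ stable Z.
  move=> Y; have [sY|] := pselect (stable Y); last by exists Y.
  have dY : df Y = 0 by case: (sY) => -[].
  have [Z t] := tau_ex aQ (indec_stable sY) (sst_notproj (indec_stable sY) dY).
  by exists Z => _; split=> //; apply: tau_stable t.
pose x n := iter n F T.
have sx n : stable (x n) by elim: n => //= n /HF[].
have tx n : tau (x n) (x n.+1) by have [] := HF _ (sx n).
have cancel i j : isoR (x i.+1) (x j.+1) -> isoR (x i) (x j).
  move=> [f [fh fi]]; apply: hom_stable_iso => //; rewrite -(tau_hom A (tx i) (tx j)).
  apply: hom_neq0I fh _; apply: not_zero_mono fi.1 _; by case: (sx i.+1).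
have cancel0 i j k : isoR (x (i + k)%N) (x (j + k)%N) -> isoR (x i) (x j).
  by elim: k => [|k IH]; rewrite ?addn0 // !addnS => /cancel/IH.
have per : exists p, (0 < p)%N /\ isoR (x 0%N) (x p).
  have d0 : euler_form (fun i => (ad_delta A i)%:Z) (dv (x 0%N)) = 0.
    by case: (sx 0%N) => -[].
  have [h1 h2 h3 h4] : [/\ forall a b c, euler_form (fun i => a i + b i) c = @euler_form Q a c + euler_form b c,
     forall a b c, euler_form c (fun i => a i + b i) = @euler_form Q c a + euler_form c b,
     forall k a c, euler_form (fun i => k * a i) c = k * @euler_form Q a c &
     forall k a c, euler_form c (fun i => k * a i) = k * @euler_form Q c a].
    by split=> [a b c|a b c|k a c|k a c];
      [case: (euler_lin a b c 0) | case: (euler_lin a b c 0) | case: (euler_lin a a c k) | case: (euler_lin a a c k)].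
  have [i [j [lt e]]] := @orbit_periodic _ _ _ _ _ _ _ (@euler_form Q) (@ad_gt0 _ A) (@ad_connected _ A)
    h1 h2 h3 h4 (euler_nondegr aQ) (euler_sym (@ad_gt0 _ A) (@ad_harmonic _ A)) (fun n => dv (x n))
    (fun n y => tau_dv A (tx n) y) d0.
  have eij : dv (x j) = dv (x i) by apply/funext.
  (* If the form is 0, then Ext(x i, x i) is nonzero and x i is isomorphic to its translate: the
     rank is 1. Otherwise x i and x j, having the same dimension vector, have a positive Euler form
     and so a nonzero map between them. *)
  have := q_euler_ge0 (dv (x i)); rewrite le_eqVlt => /orP[/eqP q0|q0].
    exists 1%N; split=> //; apply: (cancel0 _ _ i); rewrite add0n add1n.
    apply: hom_stable_iso => //; have [_ _ hh _] := tauP aQ (tx i); rewrite hh.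
    by move: q0; rewrite euler_he (hom_stable1 (sx i)); lia.
  exists (j - i)%N; split; first by rewrite subn_gt0.
  apply: (cancel0 _ _ i); rewrite add0n subnK ?(ltnW lt) //.
  apply: hom_stable_iso => //; have := euler_he (x i) (x j); rewrite eij; lia.
have ex0 : exists p, (0 < p)%N && `[< isoR (x 0%N) (x p) >].
  by have [p [p0 pi]] := per; exists p; rewrite p0; apply/asboolP.
case: (ex_minnP ex0) => p /andP[p0 /asboolP pi] pmin.
have np i j : (i < j < p)%N -> ~ isoR (x i) (x j).
  move=> /andP[ij jp] h; have : (p <= j - i)%N; last by lia.
  apply: pmin; rewrite subn_gt0 ij; apply/asboolP.
  by apply: (cancel0 _ _ i); rewrite add0n subnK ?(ltnW ij).
(* Re-indexing modulo the least period turns periodicity up to isomorphism into an equality. *)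
unshelve eexists (@Orbit p (fun i => x (i %% p)%N) p0 _ _ _ _).
- by move=> i; apply: sx.
- move=> i /=; have [lt|ge] := ltnP (i %% p).+1 p.
    suff -> : (i.+1 %% p = (i %% p).+1)%N by [].
    by rewrite -addn1 -modnDml addn1 modn_small.
  have e : ((i %% p).+1 = p)%N by have := ltn_pmod i p0; lia.
  have -> : (i.+1 %% p = 0)%N by rewrite -addn1 -modnDml addn1 e modnn.
  apply: (@tau_isoR _ (x (i %% p).+1)); first exact: tx.
  by rewrite e; apply: isoR_sym.
- by move=> i /=; rewrite modnDr.
- move=> i j /= h; have hi := ltn_pmod i p0; have hj := ltn_pmod j p0.
  have [lt|lt|//] := ltngtP (i %% p) (j %% p).
    by case: (np _ _ (introT andP (conj lt hj)) h).
  by case: (np _ _ (introT andP (conj lt hi)) (isoR_sym h)).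
by rewrite /= mod0n.
Qed.

(** T is the whole quasi-top of U: maps from U to stable representations factor through pi. *)
Definition isTop U T (pi : C0 U T) := [/\ stable T, isHom pi, epi pi &
  forall S (f : C0 U S), stable S -> isHom f -> forall v x, pi v x = 0 -> f v x = 0].

Variable O : orbit.

(* U is uniserial of quasi-length n with quasi-top O i; the quasi-socle is then O (i + n - 1). *)
Fixpoint uni n i U : Prop := if n is n'.+1 then
  exists V (j : C0 V U) (pi : C0 U (O i)), [/\ ses j pi, isTop pi & uni n' i.+1 V]
  else rep_zero U.

Lemma uni_sst n i U : uni n i U -> sst U.
Proof.
elim: n i U => [|n IH] i U; first exact: sst_zero.
move=> [V [j [pi [s [[sT _ _] _ _ _] uV]]]]; exact: sst_ext s (IH _ _ uV) sT.
Qed.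

Lemma uni_tot n i U : uni n i U -> (n <= tot U)%N.
Proof.
elim: n i U => [|n IH] i U //= [V [j [pi [s [[_ T0 _] _ _ _] uV]]]].
rewrite (tot_ses s) -addn1; apply: leq_add (IH _ _ uV) _.
by rewrite lt0n; apply/eqP => /tot0P.
Qed.

Lemma uni_per n i U : uni n i U -> uni n (i + op O)%N U.
Proof.
elim: n i U => [|n IH] i U //= [V [j [pi [s t uV]]]].
have := IH _ _ uV; rewrite addSn => uV'.
pose P T := exists pi : C0 U T, ses j pi /\ isTop pi.
have : P (O i) by exists pi.
by rewrite -(o_per O i) => -[pi' [s' t']]; exists V, j, pi'.
Qed.

Lemma uni_iso n i U U' : isoR U U' -> uni n i U -> uni n i U'.
Proof.
move=> [f [fh fi]]; have [g [gh fg gf gi]] := isoF_inv fh fi; case: n => [|n] /=.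
  by move=> U0; apply: zero_mono gi.1 U0.
move=> [V [j [pi [[jh pih jm pie ex] [sT _ _ kl] uV]]]].
exists V, (cmp f j), (cmp pi g); split=> //.
  split; [exact: isHom_cmp|exact: isHom_cmp|exact: mono_comp fi.1 jm|exact: epi_comp pie gi.2|].
  move=> v x; rewrite FE ex; split=> [[y e]|[y <-]].
    by exists y; rewrite FE e (cmp_id fg).
  by exists y; rewrite FE (cmp_id gf).
split; [by []|exact: isHom_cmp|exact: epi_comp pie gi.2|].
move=> S h sS hh v x; rewrite FE => px.
have := kl S (cmp h f) sS (isHom_cmp hh fh) v (g v x) px; by rewrite FE (cmp_id fg).
Qed.

(** If Y is proper, a map from U / Y onto a stable object, seen on U, factors through pi by an
    isomorphism; so pi kills Y. *)
Lemma top_sub U T (pi : C0 U T) Y (f : C0 Y U) : sst U -> isTop pi -> isHom f -> mono f ->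
  df Y = 0 -> isoF f \/ cmp pi f = 0.
Proof.
move=> sU [sT pih pie kl] fh fm dY; have [C [p ps]] := coker_ses fh fm.
have [_ ph _ pe pex] := ps.
have [C0'|C0'] := pselect (rep_zero C).
  left; apply: mono_tot_iso => //; by rewrite (tot_ses ps) ((tot0P C).1 C0') addn0.
right; have dC : df C = 0 by have := df_ses A ps; have := sU.1; lia.
have [S [q [sS qh qe]]] := stable_quo (sst_quo sU ph pe dC) C0'.
have kqp := kl S (cmp q p) sS (isHom_cmp qh ph).
have [k kh kE] := desc_epi pih pie (isHom_cmp qh ph) kqp.
have k0 : k <> 0.
  move=> k0; apply: (not_zero_epi (epi_comp qe pe)); first by case: sS.
  by apply: C0P => v x; rewrite -kE k0 !FE.
have [km _] := stable_iso sT sS kh k0.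
apply: C0P => v y; rewrite [RHS]FE cmpE; apply: (km v); rewrite kE cmpE.
by have -> : p v (f v y) = 0; [apply/pex; exists y | rewrite lf0].
Qed.

Lemma uni_chain n i U Y Z (f : C0 Y U) (g : C0 Z U) : uni n i U ->
  isHom f -> mono f -> df Y = 0 -> isHom g -> mono g -> df Z = 0 ->
  (exists2 h : C0 Y Z, isHom h & cmp g h = f) \/ (exists2 h : C0 Z Y, isHom h & cmp f h = g).
Proof.
elim: n i U f g => [|n IH] i U f g uU fh fm dY gh gm dZ.
  left; exists 0; first exact: isHom0.
  by rewrite cmpF0 (zero_to f uU).
have sU := uni_sst uU; move: uU => [V [j [pi [s t uV]]]].
have [jh pih jm pie ex] := s.
have [fi|f0] := top_sub sU t fh fm dY.
  right; have [k [kh fk _ _]] := isoF_inv fh fi; exists (cmp k g); first exact: isHom_cmp.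
  by rewrite cmpA fk cmp1F.
have [gi|g0] := top_sub sU t gh gm dZ.
  left; have [k [kh gk _ _]] := isoF_inv gh gi; exists (cmp k f); first exact: isHom_cmp.
  by rewrite cmpA gk cmp1F.
have lift W (h : C0 W U) : isHom h -> cmp pi h = 0 -> mono h -> exists h' : C0 W V, [/\ isHom h', cmp j h' = h & mono h'].
  move=> hh h0 hm; have [h' h'h h'E] : exists2 h' : C0 W V, isHom h' & forall v x, j v (h' v x) = h v x.
    by apply: lift_mono => // v x; apply/ex; rewrite -cmpE h0 FE.
  have e : cmp j h' = h by apply: C0P => v x; rewrite FE h'E.
  exists h'; split=> //; apply: (@cmp_mono _ _ _ _ _ j); by rewrite e.
have [f' [f'h jf f'm]] := lift _ f fh f0 fm; have [g' [g'h jg g'm]] := lift _ g gh g0 gm.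
have [[h hh he]|[h hh he]] := IH _ V f' g' uV f'h f'm dY g'h g'm dZ; [left|right]; exists h => //.
  by rewrite -jg -jf -he cmpA.
by rewrite -jg -jf -he cmpA.
Qed.

Lemma uni_sub n i U Y (f : C0 Y U) : uni n i U -> isHom f -> mono f -> df Y = 0 ->
  exists2 m, (m <= n)%N & uni m (i + (n - m))%N Y.
Proof.
elim: n i U f => [|n IH] i U f uU fh fm dY.
  by exists 0%N => //=; apply: zero_mono fm uU.
have sU := uni_sst uU; have [V [j [pi [s t uV]]]] := uU.
have [jh pih jm pie ex] := s.
have [fi|f0] := top_sub sU t fh fm dY.
  exists n.+1 => //; rewrite subnn addn0; apply: uni_iso uU; apply: isoR_sym; by exists f.
have [h' h'h h'E] : exists2 h' : C0 Y V, isHom h' & forall v x, j v (h' v x) = f v x.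
  by apply: lift_mono => // v x; apply/ex; rewrite -cmpE f0 FE.
have h'm : mono h' by move=> v x h0; apply: (fm v); rewrite -h'E h0 lf0.
have [m mn um] := IH _ V h' uV h'h h'm dY.
exists m; first exact: leqW.
by rewrite subSn // addnS -addSn.
Qed.

Lemma ext_one X Y (c1 c2 : C1 X Y) : ext X Y = 1%N -> c1 \notin limg (dlt X Y) ->
  exists k, c2 - k *: c1 \in limg (dlt X Y).
Proof.
rewrite /ext => e1 n1; set B := limg (dlt X Y) in e1 n1 *.
have : c2 \in (B + <[c1]>)%VS.
  have /eqP -> : (B + <[c1]>)%VS == fullv; last by rewrite memvf.
  rewrite eqEdim subvf /=.
  have lt : (\dim B < \dim (B + <[c1]>))%N.
    rewrite ltnNge; apply/negP => le; have /eqP e : B == (B + <[c1]>)%VS by rewrite eqEdim addvSl le.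
    by move: n1; rewrite e memvE addvSr.
  by apply: leq_trans lt; rewrite -addn1 -leq_subLR e1.
move/memv_addP => [b bB [_ /vlineP[k ->] ->]]; exists k; by rewrite addrK.
Qed.

Lemma top_uni U i (pi : C0 U (O i)) : sst U -> isTop pi -> exists n, uni n.+1 i U.
Proof.
have [b] := ubnP (tot U); elim: b U i pi => // b IH U i pi lt sU t.
have [sT pih pie kl] := t.
have [V [j s]] := ker_ses pih pie; have [jh _ jm _ ex] := s.
have [V0|V0] := pselect (rep_zero V); first by exists 0%N, V, j, pi.
have dV : df V = 0 by have := df_ses A s; have := sU.1; have := sT; case=> -[-> _] _ _; lia.
have sV := sst_sub sU jh jm dV.
have [c cl] := ses_class s.
have nosplit S (f : C0 V S) : stable S -> isHom f -> push (O i) f c \in limg (dlt (O i) S) -> f = 0.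
  move=> sS fh /(ext_push s cl fh)[g gh gE]; apply: C0P => v x.
  by rewrite -gE !FE; apply: (kl S g sS gh); apply/ex; exists x.
have isoS S (f : C0 V S) : stable S -> isHom f -> f <> 0 -> isoR S (O i.+1).
  move=> sS fh f0; apply: (hom_stable_iso sS (o_stable O i.+1)).
  have [_ _ -> _] := tauP aQ (o_tau O i); move=> /ext0P H; exact: f0 (nosplit S f sS fh (H _)).
have [S [f [sS fh fe]]] := stable_quo sV V0.
have f0 : f <> 0 by apply: not_zero_epi fe _; case: sS.
have [u [uh ui]] := isoS S f sS fh f0.
have pi'h : isHom (cmp u f) := isHom_cmp uh fh.
have t' : isTop (cmp u f).
  split=> //; [exact: o_stable|exact: epi_comp ui.2 fe|].
  move=> S' f' sS' f'h v x; have [->|f'0] := pselect (f' = 0); first by move=> _; rewrite zeroFE.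
  have [w [wh wi]] := isoS S' f' sS' f'h f'0.
  have wf'h := isHom_cmp wh f'h.
  have e1 : ext (O i) (O i.+1) = 1%N.
    have [_ _ <- _] := tauP aQ (o_tau O i); exact: hom_stable1 (o_stable O i.+1).
  have nB : push (O i) (cmp u f) c \notin limg (dlt (O i) (O i.+1)).
    apply/negP => /(nosplit _ _ (o_stable O i.+1) pi'h); apply: not_zero_epi.
      exact: epi_comp ui.2 fe.
    by case: (o_stable O i.+1).
  have [k kB] := ext_one (push (O i) (cmp w f') c) e1 nB.
  rewrite -pushZ -pushB in kB.
  have := nosplit _ _ (o_stable O i.+1) (isHomB wf'h (isHomZ k pi'h)) kB.
  move=> /(congr1 (fun h : C0 V (O i.+1) => h v x)); rewrite addFE oppFE scaleFE zeroFE => e px.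
  by apply: (wi.1 v); move: e; rewrite px scaler0 subr0 cmpE.
have ltV : (tot V < b)%N.
  have := tot_ses s; have : tot (O i) <> 0%N by move/tot0P; case: sT.
  by move=> h1 h2; rewrite ltnS in lt; lia.
have [n un] := IH V i.+1 _ ltV sV t'.
by exists n.+1, V, j, pi.
Qed.

(** The class c lies over a nonsplit class c0 in the extensions of O i by the quasi-top of U, so no
    nonzero map from U to a stable object extends to E, and O i is the quasi-top of E. *)
Lemma uni_extend n i U : uni n.+1 i.+1 U -> exists U' (j : C0 U U'),
  [/\ uni n.+2 i U', isHom j & mono j].
Proof.
move=> uU; have [V [j [pi [s t uV]]]] := uU; have [sT pih pie kl] := t.
have e1 : ext (O i) (O i.+1) = 1%N.
  have [_ _ <- _] := tauP aQ (o_tau O i); exact: hom_stable1 (o_stable O i.+1).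
have [c0 c0B] : exists c0, c0 \notin limg (dlt (O i) (O i.+1)).
  apply: contrapT => H; have /ext0P : forall c, c \in limg (dlt (O i) (O i.+1)).
    by move=> c; apply: contrapT => /negP h; apply: H; exists c.
  by rewrite e1.
have [c cE] := push_surj pie c0.
have [E [i' [p [ip cl]]]] := class_ses c; have [ih ph im pe ex] := ip.
exists E, i'; split=> //; exists U, i', p; split=> //; split=> //; first exact: o_stable.
move=> S f sS fh v x px; have [fi0|fi0] := pselect (cmp f i' = 0).
  by have /ex[y <-] := px; rewrite -cmpE fi0 FE.
exfalso; have fih := isHom_cmp fh ih.
have [k kh kE] := desc_epi pih pie fih (kl S _ sS fih).
have ke : cmp k pi = cmp f i' by apply: C0P => w y; rewrite FE kE.
have k0 : k <> 0 by move=> k0; apply: fi0; rewrite -ke k0 cmp0F.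
have [g [gh _ gk _]] := isoF_inv kh (stable_iso sT sS kh k0).
have : push (O i) (cmp f i') c \in limg (dlt (O i) S) by apply/(ext_push ip cl fih); exists f.
rewrite -ke push_cmp cE => /(push_img gh); rewrite -push_cmp gk push_id.
by apply/negP.
Qed.

Lemma uni_extendN (N : nat) n i U : uni n.+1 (i + N)%N U -> exists U' (j : C0 U U'),
  [/\ uni (n.+1 + N)%N i U', isHom j & mono j].
Proof.
elim: N n U => [|N IH] n U.
  rewrite !addn0 => uU; exists U, (idF U).
  by split=> //; [apply: isHom_id|case: (idF_iso U)].
rewrite addnS => /uni_extend[U1 [j1 [u1 j1h j1m]]].
have [U2 [j2 [u2 j2h j2m]]] := IH n.+1 U1 u1.
exists U2, (cmp j2 j1); split; [by rewrite addnS -addSn|exact: isHom_cmp|exact: mono_comp].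
Qed.

Lemma uni_perN (N : nat) n i U : uni n i U -> uni n (i + N * op O)%N U.
Proof.
elim: N => [|N IH] uU; first by rewrite mul0n addn0.
by rewrite mulSn addnCA addnC; apply: uni_per; apply: IH.
Qed.

(** L plays the role of tau X for a possibly decomposable X. A subobject of positive defect would
    contain an indecomposable I of positive defect with Hom(I, L), and hence Ext(X, I), nonzero. *)
Lemma univF_sub_le X L (phi : 'Hom(C1 X L, K^o)) Y (f : C0 Y L) :
  univF phi -> (forall I, indecomposable I -> 0 < df I -> ext X I = 0%N) ->
  isHom f -> mono f -> df Y <= 0.
Proof.
move=> uphi HX fh fm; rewrite leNgt; apply/negP => dY.
have Y0 : ~ rep_zero Y by move=> /(df0 A) e; rewrite e ltxx in dY.
have PD (a b : int) : 0 < a + b -> 0 < a \/ 0 < b.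
  by move=> h; have [?|?] := ltrP 0 a; [left | right; lia].
have [I [s [r [iI sh rh rs dI]]]] := indec_summand_df PD Y0 dY.
have := HX I iI dI; rewrite -(univF_hom uphi); apply: hom_neq0I (isHom_cmp fh sh) _.
by apply: not_zero_mono iI.1; apply: mono_comp fm _; apply: id_mono rs.
Qed.

(** A long enough prolongation U' of U behaves like an injective object. A functional detecting the
    obstruction in Ext(M / U, U') is a map v from U' to the object L of M / U. As regular subobjects
    of U' form a chain, either ker v contains U, and v kills the obstruction, or it lies in U, and
    U' is too small. *)
Lemma uni_embed n i U M (f : C0 U M) : uni n.+1 i U -> sst M -> isHom f -> mono f ->
  exists n' i' U' (j : C0 U U') (g : C0 M U'),
    [/\ uni n' i' U', isHom j, mono j, isHom g & cmp g f = j].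
Proof.
move=> uU sM fh fm; have [X [p ps]] := coker_ses fh fm; have [_ ph _ pe pex] := ps.
have sX : sst X.
  by apply: (sst_quo sM ph pe); have := df_ses A ps; have := sM.1; have := (uni_sst uU).1; lia.
have [L [phi uphi]] := exists_univF aQ X; have [pf pu pF] := uphi.
(* If ker v lies in U, then [tot U'] is at most [tot U + tot L], whereas U' has quasi-length above
   N. Below, the index is raised by a multiple of the period so that N can be subtracted from it. *)
pose N := (tot U + tot L).+1.
have uU' : uni n.+1 (i + (N * op O - N) + N)%N U.
  by rewrite -addnA subnK ?leq_pmulr ?op_gt0 //; apply: uni_perN.
have [U' [j [u' jh jm]]] := uni_extendN uU'.
have sU' := uni_sst u'.
have [c cl] := ses_class ps.
suff : push X j c \in limg (dlt X U').
  move/(ext_push ps cl jh) => [g gh gE].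
  by exists (n.+1 + N)%N, (i + (N * op O - N))%N, U', j, g.
apply: contrapT => /negP/funct_sep[psi psif psi1]; have [v vh vE] := pu _ psi psif.
have [Y [q [k [qh qe kh km E1]]]] := im_fact vh.
have dY : df Y = 0.
  have := sst_quo_ge sU' qh qe.
  have := univF_sub_le uphi (fun I iI dI => ext0_sst_pi sX iI dI) kh km; lia.
have [Z [l ls]] := ker_ses qh qe; have [lh _ lm _ lex] := ls.
have dZ : df Z = 0 by have := df_ses A ls; have := sU'.1; lia.
have [[h hh hE]|[h hh hE]] := uni_chain u' lh lm dZ jh jm (uni_sst uU).1.
  have hm : mono h by apply: (@cmp_mono _ _ _ _ _ j); rewrite hE.
  have := tot_mono hm; have := tot_mono km; have := tot_ses ls; have := uni_tot u'.
  by rewrite /N; lia.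
have := vE (push X j c); rewrite psi1 -push_cmp -hE E1 -cmpA (cmpA q) .
have -> : cmp q l = 0 by apply: C0P => w x; rewrite !FE; apply/lex; exists x.
by rewrite cmp0F cmpF0 push0 lf0 => /esym/eqP; rewrite oner_eq0.
Qed.

End Uniserial.

Section Uni2.
Variables (K : numClosedFieldType) (Q : quiver) (A : affdata Q).
Let aQ := ad_acyclic A.
Implicit Types (X Y Z W E M L N P I T S R U V : rep K Q).
Local Notation df := (df A).
Local Notation sst := (sst A).
Local Notation stable := (stable A).
Local Notation isTop := (isTop A).
Local Notation orbit := (orbit K A).

Lemma stable_isTop T : stable T -> isTop (idF T).
Proof.
move=> sT; split=> //; [exact: isHom_id|by case: (idF_iso T)|].
by move=> S f sS fh v x; rewrite FE => ->; rewrite lf0.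
Qed.

Lemma top_factor U T (pi : C0 U T) S (f : C0 U S) : isTop pi -> stable S -> isHom f -> f <> 0 ->
  exists k : C0 T S, [/\ isHom k, isoF k & cmp k pi = f].
Proof.
move=> [sT pih pie kl] sS fh f0.
have [k kh kE] := desc_epi pih pie fh (kl S f sS fh).
have ke : cmp k pi = f by apply: C0P => v x; rewrite FE kE.
exists k; split=> //; apply: (stable_iso sT sS kh) => k0; apply: f0.
by rewrite -ke k0 cmp0F.
Qed.

Lemma isTop_iso U T S (pi : C0 U T) (k : C0 T S) : isTop pi -> stable S -> isHom k -> isoF k ->
  isTop (cmp k pi).
Proof.
move=> [sT pih pie kl] sS kh ki; split=> //; [exact: isHom_cmp|exact: epi_comp ki.2 pie|].
move=> R f sR fh v x; rewrite FE => /ki.1; exact: kl.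
Qed.

Lemma quo_top U T (pi : C0 U T) C (q : C0 U C) : isTop pi -> sst C -> ~ rep_zero C ->
  isHom q -> epi q -> exists pi' : C0 C T, isTop pi'.
Proof.
move=> t sC C0' qh qe; have [sT pih pie kl] := t.
have [S [h [sS hh he]]] := stable_quo sC C0'.
have hq0 : cmp h q <> 0 by apply: not_zero_epi (epi_comp he qe) _; case: sS.
have [k [kh ki ke]] := top_factor t sS (isHom_cmp hh qh) hq0.
have [g [gh kg gk gi]] := isoF_inv kh ki.
exists (cmp g h); split=> //; [exact: isHom_cmp|exact: epi_comp gi.2 he|].
move=> R f sR fh v y; have [x <-] := qe v y; rewrite FE => /gi.1 e.
rewrite -cmpE; apply: (kl R _ sR (isHom_cmp fh qh)); apply: (ki.1 v).
by rewrite -cmpE ke FE.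
Qed.

(* maximality of a local subobject [U] forces the extension of [U <= M] to a
   map from M to a longer uniserial object to retract M onto U *)
Lemma indec_uni M : sst M -> indecomposable M -> exists (O : orbit) n, uni O n.+1 0 M.
Proof.
move=> sM iM.
pose P n := exists Y (f : C0 Y M) T (pi : C0 Y T), [/\ isHom f, mono f, sst Y, isTop pi & tot Y = n].
have ex0 : exists n, `[< P n >].
  have [T [j [sT jh jm]]] := stable_sub sM iM.1; exists (tot T); apply/asboolP.
  exists T, j, T, (idF T); split=> //; [by case: sT|exact: stable_isTop].
have ub n : `[< P n >] -> (n <= tot M)%N.
  by move=> /asboolP[Y [f [T [pi [fh fm sY t <-]]]]]; apply: tot_mono fm.
case: (ex_maxnP ex0 ub) => n /asboolP[U [f [T [pi [fh fm sU t totU]]]]] nmax.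
have [sT pih pie kl] := t.
have [O O0] := orbit_ex sT; move: pi t pih pie kl; rewrite -O0 => pi t pih pie kl.
have [c uU] := top_uni sU t.
have [n' [i' [U' [j [g [u' jh jm gh gf]]]]]] := uni_embed uU sM fh fm.
have sU' := uni_sst u'.
have [V [q [m [qh qe mh mm E1]]]] := im_fact gh.
have dV : df V = 0 by have := sst_quo_ge sM qh qe; have := sU'.2 _ _ mh mm; lia.
have sV := sst_sub sU' mh mm dV.
have qfm : mono (cmp q f) by apply: (@cmp_mono _ _ _ _ _ m); rewrite cmpA -E1 gf.
have U0 : ~ rep_zero U by move/tot0P => e; have := uni_tot uU; rewrite e.
have V0 : ~ rep_zero V by move=> V0; apply: U0; apply: zero_mono qfm V0.
have [c' _ uV] := uni_sub u' mh mm dV; case: c' uV => [//|c' uV].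
have [V' [j' [piV [sesV tV _]]]] := uV; have [_ piVh _ piVe _] := sesV.
(* Z is a smallest regular subobject of M mapping onto V. Minimality makes its quasi-top simple, so
   Z is no larger than U by the choice of U. Hence U maps isomorphically onto V and splits off M. *)
pose P2 n := exists Y (h : C0 Y M), [/\ isHom h, mono h, df Y = 0, epi (cmp q h) & tot Y = n].
have ex1 : exists n, `[< P2 n >].
  exists (tot M); apply/asboolP; exists M, (idF M).
  split=> //; [exact: isHom_id|by case: (idF_iso M)|by case: sM|by rewrite cmpF1].
case: (ex_minnP ex1) => n2 /asboolP[Z [h [hh hm dZ qhe totZ]]] nmin.
have sZ := sst_sub sM hh hm dZ.
have qhh : isHom (cmp q h) := isHom_cmp qh hh.
have tZ : isTop (cmp piV (cmp q h)).
  split; [by case: tV|exact: isHom_cmp|exact: epi_comp|].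
  move=> S s sS sh; have [->|s0] := pselect (s = 0); first by move=> v x _; rewrite FE.
  have se := stable_epi sZ sS sh s0; have [Z' [k ks]] := ker_ses sh se.
  have [kh _ km _ kex] := ks.
  have dZ' : df Z' = 0 by have := df_ses A ks; have := sZ.1; have := sS; case=> -[-> _] _ _; lia.
  have sZ' := sst_sub sZ kh km dZ'.
  have ltZ : (tot Z' < n2)%N.
    rewrite -totZ (tot_ses ks); have : tot S <> 0%N by move/tot0P; case: sS.
    by lia.
  have qhkh : isHom (cmp (cmp q h) k) := isHom_cmp qhh kh.
  have [W [a [b [ah ae bh bm E2]]]] := im_fact qhkh.
  have dW : df W = 0 by have := sst_quo_ge sZ' ah ae; have := sV.2 _ _ bh bm; lia.
  have pib : cmp piV b = 0.
    have [bi|//] := top_sub sV tV bh bm dW.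
    have : (n2 <= tot Z')%N; last by lia.
    apply: nmin; apply/asboolP; exists Z', (cmp h k).
    split=> //; [exact: isHom_cmp|exact: mono_comp|].
    by rewrite cmpA E2; apply: epi_comp bi.2 ae.
  have kk : forall v x, s v x = 0 -> cmp piV (cmp q h) v x = 0.
    move=> v x /kex[y <-]; have := congr1 (fun F : C0 Z' V => piV v (F v y)) E2.
    rewrite !cmpE => ->; by rewrite -(cmpE piV b) pib FE.
  have pqh0 : cmp piV (cmp q h) <> 0.
    by apply: not_zero_epi (epi_comp piVe qhe) _; case: tV => -[_ ? _] _ _ _.
  have [u uh uE] := desc_epi sh se (isHom_cmp piVh qhh) kk.
  have ue : cmp u s = cmp piV (cmp q h) by apply: C0P => v x; rewrite FE uE.
  have u0 : u <> 0 by move=> u0; apply: pqh0; rewrite -ue u0 cmp0F.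
  have [um _] : isoF u by apply: (stable_iso sS _ uh u0); case: tV.
  by move=> v x; rewrite -uE => /um.
have le1 : (tot Z <= n)%N by apply: nmax; apply/asboolP; exists Z, h, (O (i' + (n' - c'.+1))%N), (cmp piV (cmp q h)).
have le2 := tot_epi qhe; have le3 := tot_mono qfm.
have qfi : isoF (cmp q f) by apply: mono_tot_iso => //; lia.
have [k [kh _ kq _]] := isoF_inv (isHom_cmp qh fh) qfi.
have [//|fi] := indec_split (s := f) (r := cmp k q) iM fh (isHom_cmp kh qh) (etrans (esym (cmpA _ _ _)) kq).
by exists O, c; apply: uni_iso uU; exists f.
Qed.

Section OneOrbit.
Variable O : orbit.

Lemma uni_dv n i U : uni O n i U -> dv U = fun v => \sum_(l < n) dv (O (i + l)%N) v.
Proof.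
elim: n i U => [|n IH] i U.
  by move/dv0 => ->; apply/funext => v; rewrite big_ord0.
move=> [V [j [pi [s t uV]]]]; rewrite (dv_ses s) (IH _ _ uV); apply/funext => v.
rewrite big_ord_recl addn0 addrC; congr (_ + _); apply: eq_bigr => l _.
by rewrite /bump /= addnA addn1.
Qed.

Definition osum i n : vertex Q -> int := fun v => \sum_(l < n) dv (O (i + l)%N) v.

(** This reads quasi-lengths off dimension vectors: each summand is nonnegative and nonzero. *)
Lemma osum_inj i n m : osum i n = osum i m -> n = m.
Proof.
wlog le : n m / (n <= m)%N.
  by move=> H e; have [l|l] := leqP n m; [apply: H | apply/esym/H => //; exact: ltnW].
move=> e; apply/eqP; rewrite eqn_leq le leqNgt; apply/negP => lt.
have [_ T0 _] := o_stable O (i + n); apply: T0; apply: dv_eq0 => v.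
have := congr1 (fun g => g v) e; rewrite /osum -(big_mkord xpredT (fun l => dv (O (i + l)%N) v)).
rewrite -(big_mkord xpredT (fun l => dv (O (i + l)%N) v)).
rewrite [RHS](big_cat_nat (n := n)) //= (big_ltn (m := n)) // => h.
have p1 : 0 <= dv (O (i + n)%N) v by rewrite /dv.
have p2 : 0 <= \sum_(n.+1 <= l < m) dv (O (i + l)%N) v.
  by apply: sumr_ge0 => l _; rewrite /dv.
have : dv (O (i + n)%N) v + \sum_(n.+1 <= l < m) dv (O (i + l)%N) v = 0.
  by apply: (addrI (\sum_(0 <= l < n) dv (O (i + l)%N) v)); rewrite addr0 -h.
by move/eqP; rewrite paddr_eq0 // => /andP[/eqP].
Qed.

Lemma uni_indec n i U : uni O n.+1 i U -> indecomposable U.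
Proof.
move=> uU; have sU := uni_sst uU; have [V [j [pi [s t uV]]]] := uU.
have [sT pih pie kl] := t; split.
  by move/tot0P => e; have := uni_tot uU; rewrite e.
move=> B C BC.
have side (D D' : subrep U) : complementary D D' -> rep_zero (rep_of D') \/ cmp pi (incl D) = 0.
  move=> DD; have [r [rh ri rk]] := compl_split DD.
  have [dD _] := sst_summand sU (isHom_incl D) rh ri.
  have [[_ ie]|e0] := top_sub sU t (isHom_incl D) (mono_incl D) dD; [left|by right].
  apply/rep_zeroP => v y; apply: (mono_incl D').
  have yD : incl D' v y \in D' v by apply/inclP; exists y.
  have yD2 : incl D' v y \in D v by apply/inclP; apply: ie.
  by apply/eqP; rewrite -memv0 -(DD v).2 memv_cap yD2.
have [?|e1] := side B C BC; first by right.
have [?|e2] := side C B (complC BC); first by left.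
exfalso; apply: (not_zero_epi pie); first by case: sT.
apply: C0P => v x; have : x \in (B v + C v)%VS by rewrite (BC v).1 memvf.
case/memv_addP => y /inclP[y' <-] [z /inclP[z' <-] ->].
by rewrite lfD -!cmpE e1 e2 !FE addr0.
Qed.

(** Hom(Y, O (i + 1)) = Hom(X, O i) finds the quasi-top of Y. The quasi-length comes from the
    dimension vectors: by nondegeneracy, that of Y is the shifted sum over the orbit. *)
Lemma uni_len n i X Y : uni O n.+1 i X -> tau X Y -> uni O n.+1 i.+1 Y.
Proof.
move=> uX t; have [iX iY h1 h2] := tauP aQ t; have sX := uni_sst uX.
have sY : sst Y by apply: indec_sst iY _; rewrite (tau_df A t); case: sX.
have [O' [m uY']] := indec_uni sY iY.
have [V [j [pi [s tX uV]]]] := uX; have [_ pih pie _] := tX.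
have [V' [j' [pi' [s' tY uV']]]] := uY'.
have : hom Y (O i.+1) <> 0%N.
  rewrite (tau_hom A t (o_tau O i)); apply: hom_neq0I pih _.
  by apply: not_zero_epi pie _; case: (o_stable O i).
move=> /hom_neq0[f fh f0].
have [k [kh ki ke]] := top_factor tY (o_stable O i.+1) fh f0.
have [m' uY] := top_uni sY (isTop_iso tY (o_stable O i.+1) kh ki).
suff -> : n = m' by [].
suff /osum_inj[] : osum i.+1 n.+1 = osum i.+1 m'.+1 by [].
rewrite /osum -(uni_dv uY); apply/funext => v; apply/eqP; rewrite -subr_eq0 -mulN1r; apply/eqP.
apply: (euler_nondegr aQ (v := fun w => osum i.+1 n.+1 w + (-1) * dv Y w)) => y.
have [_ g2 _ _] := euler_lin (osum i.+1 n.+1) (fun w => -1 * dv Y w) y 0.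
have [_ _ _ g4] := euler_lin (dv Y) (dv Y) y (-1).
rewrite g2 g4 (tau_dv A t) (uni_dv uX).
have [e1 e2 e3 e4] : [/\ forall a b c, euler_form (fun i => a i + b i) c = @euler_form Q a c + euler_form b c,
     forall a b c, euler_form c (fun i => a i + b i) = @euler_form Q c a + euler_form c b,
     forall k a c, euler_form (fun i => k * a i) c = k * @euler_form Q a c &
     forall k a c, euler_form c (fun i => k * a i) = k * @euler_form Q c a].
  by split=> [a b c|a b c|k' a c|k' a c];
    [case: (euler_lin a b c 0) | case: (euler_lin a b c 0) | case: (euler_lin a a c k') | case: (euler_lin a a c k')].
rewrite (E_sum e1 e3) (E_sumr e2 e4) mulrN mulN1r opprK -big_split big1 // => l _.
by rewrite addSn (tau_dv A (o_tau O (i + l))); apply: addNr.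
Qed.

Lemma uni_ex_sub n i U m : uni O n i U -> (m <= n)%N -> exists Y (f : C0 Y U),
  [/\ isHom f, mono f & uni O m (i + (n - m))%N Y].
Proof.
elim: n i U => [|n IH] i U uU le.
  exists U, (idF U); split; [exact: isHom_id|by case: (idF_iso U)|].
  by move: le; rewrite leqn0 => /eqP ->.
move: le; rewrite leq_eqVlt => /orP[/eqP ->|lt].
  by exists U, (idF U); split; [exact: isHom_id|case: (idF_iso U)|rewrite subnn addn0].
have [V [j [pi [s t uV]]]] := uU; have [jh _ jm _ _] := s.
have [Y [f [fh fm uY]]] := IH _ _ uV lt; exists Y, (cmp j f).
by split; [exact: isHom_cmp|exact: mono_comp|rewrite subSn // addnS -addSn].
Qed.

Lemma uni_totE n i U : uni O n i U -> tot U = (\sum_(l < n) tot (O (i + l)))%N.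
Proof.
elim: n i U => [|n IH] i U.
  by move/tot0P => ->; rewrite big_ord0.
move=> [V [j [pi [s t uV]]]]; rewrite (tot_ses s) (IH _ _ uV) big_ord_recl addn0 addnC.
by congr (_ + _)%N; apply: eq_bigr => l _; rewrite /bump /= addnA addn1.
Qed.

Lemma uni_incl n i U m1 m2 Y1 Y2 (f1 : C0 Y1 U) (f2 : C0 Y2 U) : uni O n i U ->
  (m1 <= m2)%N -> (m2 <= n)%N -> uni O m1 (i + (n - m1))%N Y1 -> uni O m2 (i + (n - m2))%N Y2 ->
  isHom f1 -> mono f1 -> isHom f2 -> mono f2 -> exists2 h : C0 Y1 Y2, isHom h & cmp f2 h = f1.
Proof.
move=> uU le le2 u1 u2 h1 i1 h2 i2.
have [[h hh he]|[h hh he]] := uni_chain uU h1 i1 (uni_sst u1).1 h2 i2 (uni_sst u2).1.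
  by exists h.
have hm : mono h by apply: (@cmp_mono _ _ _ _ _ f1); rewrite he.
have hi : isoF h.
  apply: mono_tot_iso => //; rewrite (uni_totE u1) (uni_totE u2).
  rewrite -[in X in (_ <= X)%N](subnK le) big_split_ord /=.
  apply: leq_trans (leq_addl _ _); apply: leq_sum => l _.
  suff -> : (i + (n - m1) + l = i + (n - (m2 - m1 + m1)) + (m2 - m1 + l))%N by [].
  by lia.
have [g [gh hg _ _]] := isoF_inv hh hi; exists g => //.
by rewrite -he -cmpA hg cmpF1.
Qed.

Lemma uni_ql n i U : uni O n i U -> quasi_length U n.
Proof.
elim: n i U => [|n IH] i U; first by move=> ?; apply: quasi_length0.
move=> uU; have := uU => -[V [j [pi [s t uV]]]]; have [jh pih _ _ _] := s.
apply: (@quasi_lengthS _ _ V U (O i) n (toRH jh) (toRH pih)).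
- apply/(regular_sst A); exact: uni_sst uU.
- exact/ses_RH.
- exact: IH uV.
- apply/(quasi_simple_stable A); exact: o_stable.
Qed.

(** [quasi_length] asks for some composition series; in a uniserial object its largest proper member
    is always the kernel of the quasi-top, so all lengths agree. *)
Lemma ql_uni n i U m : uni O n i U -> quasi_length U m -> m = n.
Proof.
move=> uU qU; elim: qU n i uU => {U m} [U U0|L U S m f g rU /ses_RH s qL IH qS] n i uU.
  case: n uU => // n uU; have := uni_tot uU; by rewrite ((tot0P U).1 U0).
have sS := (quasi_simple_stable A S).1 qS; have sU := uni_sst uU.
have [fh gh fm ge ex] := s.
case: n uU => [|n] uU; first by case: sS => _ S0 _; case: S0; apply: zero_epi ge uU.
congr _.+1; have [V [j [pi [s' t uV]]]] := uU; have [jh pih jm pie ex'] := s'.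
have [sT _ _ kl] := t.
have dL : df L = 0 by have := df_ses A s; have := sU.1; have := sS; case=> -[-> _] _ _; lia.
have pf : cmp pi (famRH f) = 0.
  have [[_ fe]|//] := top_sub sU t fh fm dL.
  exfalso; case: sS => _ S0 _; apply: S0; apply/rep_zeroP => v y; have [x <-] := ge v y.
  by apply/ex; apply: fe.
have [a ah aE] : exists2 a : C0 L V, isHom a & forall v x, j v (a v x) = famRH f v x.
  by apply: lift_mono => // v x; apply/ex'; rewrite -cmpE pf FE.
have [b bh bE] : exists2 b : C0 V L, isHom b & forall v x, famRH f v (b v x) = j v x.
  apply: lift_mono => // v x; apply/ex; apply: (kl S _ sS gh); apply/ex'; by exists x.
apply: IH (uni_iso _ uV); exists b; split=> //; split=> [v x b0|v y].
  by apply: (jm v); rewrite -bE b0 lf0.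
by exists (a v y); apply: (monoB fm); rewrite bE aE.
Qed.

Lemma hom_OO i j : hom (O i) (O j) = (i == j %[mod op O]) :> nat.
Proof.
case: eqP => e; last first.
  apply: contrapT => /(hom_stable_iso (o_stable O i) (o_stable O j)) h; apply: e.
  exact: o_inj h.
have per l m : O (l + m * op O)%N = O l.
  by elim: m => [|m IH]; rewrite ?mul0n ?addn0 // mulSn addnCA addnC o_per.
have -> : O i = O j; last exact: hom_stable1 (o_stable O j).
by rewrite (divn_eq i (op O)) (divn_eq j (op O)) e addnC per addnC per.
Qed.

Lemma ext_OO i j : ext (O i) (O j) = (j == i.+1 %[mod op O]) :> nat.
Proof. by have [_ _ <- _] := tauP aQ (o_tau O i); rewrite hom_OO. Qed.

Lemma oT_mod i j : i = j %[mod op O] -> O i = O j.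
Proof.
have per l m : O (l + m * op O)%N = O l.
  by elim: m => [|m IH]; rewrite ?mul0n ?addn0 // mulSn addnCA addnC o_per.
by move=> e; rewrite (divn_eq i (op O)) (divn_eq j (op O)) e addnC per addnC per.
Qed.

End OneOrbit.
End Uni2.

(** * Transverse subrepresentations *)

Section Transverse.
Variables (K : numClosedFieldType) (Q : quiver) (A : affdata Q).
Let aQ := ad_acyclic A.
Implicit Types (X Y Z W E M L N P I T S R U V : rep K Q).
Local Notation df := (df A).
Local Notation sst := (sst A).
Local Notation stable := (stable A).
Local Notation isTop := (isTop A).
Local Notation orbit := (orbit K A).

Lemma tau_ext_self X Y : tau X Y -> ext Y Y = ext X X.
Proof.
move=> t; have h := tau_hom A t t.
have e1 := tau_dv A t (dv X); have e2 := tau_dv A t (dv Y).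
have := euler_he X X; have := euler_he Y Y; rewrite e2 e1 h; lia.
Qed.

Lemma pp_rigid X : preprojective X -> ext X X = 0%N.
Proof.
elim=> {X} [P _ /(proj_ext)|X Y t _ IH]; first by apply.
by rewrite -(tau_ext_self t).
Qed.

Lemma pi_rigid X : preinjective X -> ext X X = 0%N.
Proof.
elim=> {X} [P _ /(inj_ext)|X Y t _ IH]; first by apply.
by rewrite (tau_ext_self t).
Qed.

(** The dimension of Ext(X, X) is invariant under tau, so preprojectives and preinjectives are rigid
    and M has defect 0. *)
Lemma nonrigid_uni M : indecomposable M -> ext M M <> 0%N -> exists (O : orbit) n, uni O n.+1 0 M.
Proof.
move=> iM e0; apply: indec_uni => //; apply: indec_sst => //.
case: (ltgtP (df M) 0) => // h.
- by case: e0; apply: pp_rigid; apply: df_neg_pp h.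
- by case: e0; apply: pi_rigid; apply: df_pos_pi h.
Qed.

Lemma sub_im_iso X M (f : C0 X M) : isHom f -> mono f -> exists N : subrep M,
  (forall i x, x \in N i <-> exists y, f i y = x) /\
  exists g : C0 X (rep_of N), [/\ isHom g, isoF g & cmp (incl N) g = f].
Proof.
move=> fh fm; have [N HN] := sub_im fh; exists N; split=> //.
have [g gh gE] : exists2 g : C0 X (rep_of N), isHom g & forall v x, incl N v (g v x) = f v x.
  apply: lift_mono => //; [exact: isHom_incl|exact: mono_incl|].
  by move=> v x; apply/inclP/HN; exists x.
exists g; split=> //; last by apply: C0P => v x; rewrite FE gE.
split=> [v x e|v y]; first by apply: (fm v); rewrite -gE e lf0.
have /HN[x xE] : incl N v y \in N v by apply/inclP; exists y.
by exists x; apply: (monoB (mono_incl N)); rewrite gE.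
Qed.

(** The congruences say that m is k + 1 modulo p, and k + 1 is the least positive number of its
    class because k < p. *)
Lemma modS_ge p n m k : (k < p)%N -> (0 < m)%N -> (m <= n)%N -> (n = k %[mod p])%N ->
  (0 = (n - m).+1 %[mod p])%N -> (k < m)%N.
Proof.
move=> kp m0 mn nk h; rewrite ltnNge; apply/negP => mk.
have e : ((n - m).+1 + m = n.+1)%N by rewrite addSn subnK.
have e2 : (m = k.+1 %[mod p])%N.
  have := congr1 (fun x => (x + m) %% p)%N h; rewrite !modnDml e add0n => ->.
  by rewrite -addn1 -modnDml nk modnDml addn1.
have mp : (m < p)%N := leq_ltn_trans mk kp.
move: (kp); rewrite leq_eqVlt => /orP[/eqP e3|e3].
  by move: e2; rewrite e3 modnn modn_small // => e2; rewrite e2 in m0.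
by move: e2; rewrite !modn_small // => e2; rewrite e2 ltnn in mk.
Qed.

Lemma mod_sub_inj p n x y : (x < p)%N -> (y < p)%N -> (n + p - x = n + p - y %[mod p])%N -> x = y.
Proof.
wlog le : x y / (x <= y)%N.
  move=> H xp yp e; have [l|l] := leqP x y; first exact: H l xp yp e.
  by apply/esym; apply: H (ltnW l) yp xp (esym e).
move=> xp yp /eqP; rewrite eqn_mod_dvd; last by lia.
have -> : (n + p - x - (n + p - y) = y - x)%N by lia.
move=> d; have [//|lt] : (x = y \/ 0 < y - x)%N by lia.
by have := dvdn_leq lt d; lia.
Qed.

Section OneOrbit.
Variable O : orbit.
Local Notation p := (op O).

(** Under tau the index of an orbit grows, whereas that of a [tube] drops, hence the sign. The
    offset gives index 0 to O n, the quasi-socle of an object of quasi-length n + 1 and quasi-top O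
    0; adding p keeps the subtraction exact. *)
Definition tubeR (n : nat) (x : 'I_p) : rep K Q := O (n + p - x)%N.

Lemma tube_tubeR n : tube (tubeR n).
Proof.
have p0 := op_gt0 O; split.
- by move=> x; apply/(quasi_simple_stable A)/o_stable.
- move=> x y /iso_RH h; have := o_inj h => e; apply/val_inj => /=.
  exact: mod_sub_inj (ltn_ord x) (ltn_ord y) e.
- move=> x; rewrite /tubeR; have := ltn_ord x; case: x => -[|x] /= lt _.
    have -> : O (n + p - 0)%N = O (n : nat) by rewrite subn0 o_per.
    suff -> : O (n + p - (0 + p).-1 %% p)%N = O n.+1 by exact: o_tau.
    rewrite add0n modn_small ?ltn_predL //; congr (O _); lia.
  suff -> : (n + p - (x.+1 + p).-1 %% p = (n + p - x.+1).+1)%N by exact: o_tau.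
  by rewrite addSn /= modnDr modn_small; lia.
Qed.

Lemma uni_subrep n i U m : uni O n i U -> (m <= n)%N -> exists S : subrep U, uni O m (i + (n - m))%N (rep_of S).
Proof.
move=> uU le; have [Y [f [fh fm uY]]] := uni_ex_sub uU le.
have [S [_ [g [gh gi _]]]] := sub_im_iso fh fm; exists S.
by apply: uni_iso uY; exists g.
Qed.

Lemma uni1_iso i U : uni O 1 i U -> isoR U (O i).
Proof.
move=> [V [j [pi [s [_ ph pe _] V0]]]]; exists pi; split=> //; split=> // v x.
by have [_ _ _ _ ex] := s; move/ex => [y <-]; rewrite ((rep_zeroP V).1 V0 v y) lf0.
Qed.

Lemma uni_sub_le n i U m1 m2 (S1 S2 : subrep U) : uni O n i U -> (m1 <= m2)%N -> (m2 <= n)%N ->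
  uni O m1 (i + (n - m1))%N (rep_of S1) -> uni O m2 (i + (n - m2))%N (rep_of S2) -> sub_le S1 S2.
Proof.
move=> uU le le2 u1 u2 v.
have [h _ hE] := uni_incl uU le le2 u1 u2 (isHom_incl S1) (mono_incl S1) (isHom_incl S2) (mono_incl S2).
apply/subvP => x /inclP[y <-]; apply/inclP; exists (h v y).
by rewrite -cmpE hE.
Qed.

Lemma uni_socle n i U (S : subrep U) : uni O n.+1 i U -> quasi_socle S ->
  uni O 1 (i + n)%N (rep_of S).
Proof.
move=> uU [h1 h2]; have [S1 u1] := uni_subrep (m := 1) uU isT.
rewrite subSS subn0 in u1.
have q1 : quasi_simple (rep_of S1).
  apply/(quasi_simple_stable A); have [f [fh fi]] := isoR_sym (uni1_iso u1).
  exact: stable_isoF (o_stable O _) fh fi.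
have le1 := h1 _ q1.
have le2 : sub_le S S1.
  apply: h2 => B /(quasi_simple_stable A) sB.
  have sS1 := (quasi_simple_stable A _).1 q1.
  have dB : df (rep_of B) = 0 by case: sB => -[].
  have dS : df (rep_of S1) = 0 by case: sS1 => -[].
  have [[h hh hE]|[h hh hE]] := uni_chain uU (isHom_incl B) (mono_incl B) dB (isHom_incl S1) (mono_incl S1) dS.
    by move=> v; apply/subvP => x /inclP[y <-]; apply/inclP; exists (h v y); rewrite -cmpE hE.
  have h0 : h <> 0.
    move=> h0; case: sS1 => _ S0 _; apply: S0; apply/rep_zeroP => v x.
    by apply: (mono_incl S1); rewrite -hE h0 cmpF0 FE.
  have [_ he] := stable_iso sS1 sB hh h0.
  move=> v; apply/subvP => x /inclP[y <-]; have [z <-] := he v y.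
  by apply/inclP; exists z; rewrite -cmpE hE.
have E v : S v = S1 v by apply/eqP; rewrite eqEsubv le1 le2.
have [g gh gE] : exists2 g : C0 (rep_of S1) (rep_of S), isHom g & forall v x, incl S v (g v x) = incl S1 v x.
  apply: lift_mono; [exact: isHom_incl|exact: mono_incl|exact: isHom_incl|].
  by move=> v x; apply/inclP; rewrite E; apply/inclP; exists x.
apply: uni_iso u1; exists g; split=> //; split=> [v x e|v y].
  by apply: (mono_incl S1); rewrite -gE e lf0.
have : incl S v y \in S1 v by rewrite -E; apply/inclP; exists y.
by move/inclP=> [x xE]; exists x; apply: (monoB (mono_incl S)); rewrite gE.
Qed.

Lemma socle_uni n i U (S : subrep U) : uni O n.+1 i U -> uni O 1 (i + n)%N (rep_of S) -> quasi_socle S.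
Proof.
move=> uU u1; have sS : quasi_simple (rep_of S).
  apply/(quasi_simple_stable A); have [f [fh fi]] := isoR_sym (uni1_iso u1).
  exact: stable_isoF (o_stable O _) fh fi.
split=> [B qB|B]; last by apply.
have /(quasi_simple_stable A) sB := qB; have sS' := (quasi_simple_stable A _).1 sS.
have dB : df (rep_of B) = 0 by case: sB => -[].
have dS : df (rep_of S) = 0 by case: sS' => -[].
have [[h hh hE]|[h hh hE]] := uni_chain uU (isHom_incl B) (mono_incl B) dB (isHom_incl S) (mono_incl S) dS.
  by move=> v; apply/subvP => x /inclP[y <-]; apply/inclP; exists (h v y); rewrite -cmpE hE.
have h0 : h <> 0.
  move=> h0; case: sS' => _ S0 _; apply: S0; apply/rep_zeroP => v x.
  by apply: (mono_incl S); rewrite -hE h0 cmpF0 FE.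
have [_ he] := stable_iso sS' sB hh h0.
move=> v; apply/subvP => x /inclP[y <-]; have [z <-] := he v y.
by apply/inclP; exists z; rewrite -cmpE hE.
Qed.

Lemma uni_regular_indec n M : uni O n.+1 0 M ->
  regular_indec (tubeR n (Ordinal (op_gt0 O))) n.+1 M.
Proof.
move=> uM; split.
- exact: uni_indec uM.
- exact/(regular_sst A)/(uni_sst uM).
- exact: uni_ql uM.
have [S uS] := uni_subrep (m := 1) uM isT; rewrite subSS subn0 in uS; exists S.
  exact: socle_uni uM uS.
apply/iso_RH; rewrite /tubeR subn0 o_per; exact: uni1_iso uS.
Qed.

Lemma top_eq i j U (pi : C0 U (O i)) (f : C0 U (O j)) : isTop pi -> isHom f -> f <> 0 -> i = j %[mod p].
Proof.
move=> t fh f0; have [k [kh ki _]] := top_factor t (o_stable O j) fh f0.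
by apply: o_inj; exists k.
Qed.

Lemma not_zero_cmp X Y Z (g : C0 Y Z) (f : C0 X Y) : mono g -> f <> 0 -> cmp g f <> 0.
Proof.
move=> gm f0 gf; apply: f0; apply: C0P => v x; rewrite FE; apply: (gm v).
by rewrite -cmpE gf FE.
Qed.

Lemma osum_mod i j n : i = j %[mod p] -> osum O i n = osum O j n.
Proof.
move=> e; apply/funext => v; apply: eq_bigr => l _.
by rewrite (@oT_mod _ _ _ O (i + l)%N (j + l)%N) // -modnDml e modnDml.
Qed.

Lemma osumD i m n v : osum O i (m + n)%N v = osum O i m v + osum O (i + m)%N n v.
Proof. by rewrite /osum big_split_ord /=; congr (_ + _); apply: eq_bigr => l _; rewrite addnA. Qed.

(* Ext(N, M / N) is dual to Hom(M / N, tau N), and a nonzero map has a regular image C.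
   The image A' of a nonzero map from C' = tau^-1 C to N is a regular subobject of N,
   and the kernel B of M -> C -> tau A' a regular subobject containing N; counting
   quasi-tops modulo the rank of the tube bounds the quasi-lengths of A' and B. *)
Lemma ext_non_transverse n M (N : subrep M) : uni O n.+1 0 M ->
  ext (rep_of N) (quo N) <> 0%N -> non_transverse N.
Proof.
move=> uM ex0; have sM := uni_sst uM; have p0 := op_gt0 O.
pose X := rep_of N; pose Y := quo N.
have [L [phi uphi]] := exists_univF aQ X.
have [f fh f0] : exists2 f : C0 Y L, isHom f & f <> 0.
  by apply: hom_neq0; rewrite (univF_hom uphi).
have [C [q [j [qh qe jh jm fE]]]] := im_fact fh.
have qMh := isHom_cmp qh (isHom_prj N); have qMe := epi_comp qe (epi_prj N).
have dC : df C = 0.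
  have := sst_quo_ge sM qMh qMe.
  have H I : indecomposable I -> 0 < df I -> ext X I = 0%N.
    by move=> iI dI; apply: (ext0_sub (isHom_incl N) (mono_incl N)); apply: ext0_sst_pi sM iI dI.
  have := univF_sub_le uphi H jh jm; lia.
have sC := sst_quo sM qMh qMe dC.
have C0' : ~ rep_zero C by move=> z; apply: f0; rewrite fE (zero_to q z) cmpF0.
have eXC : ext X C <> 0%N.
  rewrite -(univF_hom uphi); apply: hom_neq0I jh _; exact: not_zero_mono jm C0'.
have [V [jV [piM [sV tM uV]]]] := uM.
have [pi' tC] := quo_top tM sC C0' qMh qMe.
have [c uC] := top_uni sC tC; have iC := uni_indec uC.
have [C' tCC] := tau_ex' aQ iC (sst_notinj iC dC).
have [iC' _ _ hC'] := tauP aQ tCC.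
have dC' : df C' = 0 by rewrite -(tau_df A tCC).
have sC' := indec_sst iC' dC'.
have [g gh g0] : exists2 g : C0 C' X, isHom g & g <> 0 by apply: hom_neq0; rewrite -hC'.
have [A' [q' [j' [qh' qe' jh' jm' gE]]]] := im_fact gh.
have A0 : ~ rep_zero A' by move=> z; apply: g0; rewrite gE (zero_to q' z) cmpF0.
have hAh := isHom_cmp (isHom_incl N) jh'; have hAm := mono_comp (mono_incl N) jm'.
have dA : df A' = 0 by have := sst_quo_ge sC' qh' qe'; have := sM.2 _ _ hAh hAm; lia.
have [m mn uA] := uni_sub uM hAh hAm dA; rewrite add0n in uA.
case: m mn uA => [|m] mn uA; first by case: A0.
have [VA [jA [piA [seA tA _]]]] := uA.
(* As a quotient of M, C has quasi-top O 0. Translating the map from C' to the quasi-top of A' gives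
   a nonzero map from C to the orbit member of index [(n.+1 - m.+1).+1]. *)
have e1 : 0 = (n.+1 - m.+1).+1 %[mod p].
  have : hom C' (O (n.+1 - m.+1)%N) <> 0%N.
    case: tA => [sT ph pe _]; apply: (hom_neq0I (isHom_cmp ph qh')).
    by apply: not_zero_epi (epi_comp pe qe') _; case: sT.
  rewrite -(tau_hom A tCC (o_tau O _)) => /hom_neq0[u uh u0].
  exact: top_eq tC uh u0.
have iA := uni_indec uA.
have [A'' tAA] := tau_ex aQ iA (sst_notproj iA dA).
have uA'' := uni_len uA tAA.
have [_ _ hA'' _] := tauP aQ tAA.
have [g2 gh2 g20] : exists2 g2 : C0 C A'', isHom g2 & g2 <> 0.
  apply: hom_neq0; rewrite hA'' hC'; apply: (hom_neq0I qh').
  exact: not_zero_epi qe' A0.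
have [D [q2 [j2 [qh2 qe2 jh2 jm2 gE2]]]] := im_fact gh2.
have D0 : ~ rep_zero D by move=> z; apply: g20; rewrite gE2 (zero_to q2 z) cmpF0.
have dD : df D = 0.
  by have := sst_quo_ge sC qh2 qe2; have := (uni_sst uA'').2 _ _ jh2 jm2; lia.
have [d dm uD] := uni_sub uA'' jh2 jm2 dD.
have Ed : ((n.+1 - m.+1).+1 + (m.+1 - d) = (n.+1 - d).+1)%N by lia.
rewrite Ed in uD; case: d dm uD Ed => [|d] dm uD Ed; first by case: D0.
have [VD [jD [piD [seD tD _]]]] := uD.
have e2 : 0 = (n.+1 - d.+1).+1 %[mod p].
  have [sT ph pe _] := tD; apply: top_eq tC (isHom_cmp ph qh2) _.
  by apply: not_zero_epi (epi_comp pe qe2) _; case: sT.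
have rh := isHom_cmp qh2 qMh; have re := epi_comp qe2 qMe.
have [B [HB sB]] := ses_ker rh re.
have NB : sub_le N B.
  move=> v; apply/subvP => x xN; apply/HB; rewrite !cmpE (prjP N x).2 //.
  by rewrite !lf0.
have dB : df (rep_of B) = 0 by have := df_ses A sB; have := sM.1; lia.
have [b bn uB] := uni_sub uM (isHom_incl B) (mono_incl B) dB; rewrite add0n in uB.
have bE : (n.+1 - b = d.+1)%N.
  apply: (@osum_inj _ _ _ O 0); apply/funext => v.
  have := congr1 (fun F => F v) (dv_ses sB).
  rewrite (uni_dv uM) (uni_dv uB) (uni_dv uD) -!/(osum O _ _ _).
  rewrite -(osum_mod _ e2) -{1}(subnK bn) osumD add0n [RHS]addrC; exact: addIr.
set k := (n.+1 %% p)%N; set l := (n.+1 %/ p)%N.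
have nE : n.+1 = (l * p + k)%N by rewrite -divn_eq.
have kp : (k < p)%N by rewrite ltn_mod.
have nk : (n.+1 = k %[mod p])%N by rewrite /k modn_mod.
have km := modS_ge kp (ltn0Sn m) mn nk e1.
have dn : (d.+1 <= n.+1)%N by exact: leq_trans dm mn.
have kd := modS_ge kp (ltn0Sn d) dn nk e2.
have l1 : (1 <= l)%N by rewrite lt0n; apply/eqP => l0; have := leq_trans km mn; rewrite nE l0 ltnn.
have lp : (p <= l * p)%N by rewrite leq_pmull.
exists p, (tubeR n), (Ordinal p0), l, k; split=> //; first exact: tube_tubeR.
  by rewrite -nE; exact: uni_regular_indec.
have le1 : (k.+1 <= n.+1)%N by exact: leq_trans km mn.
have le2 : (l * p - 1 <= n.+1)%N by rewrite nE; apply: leq_trans (leq_subr _ _) (leq_addr _ _).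
have [S1 u1] := uni_subrep uM le1; have [S2 u2] := uni_subrep uM le2; exists S1, S2.
have r1 := (regular_sst A _).2 (uni_sst u1); have r2 := (regular_sst A _).2 (uni_sst u2).
split; [by split=> //; exact: uni_ql u1|by split=> //; exact: uni_ql u2| |].
  have [S [HS [s [sh si sE]]]] := sub_im_iso hAh hAm.
  have uS : uni O m.+1 (0 + (n.+1 - m.+1))%N (rep_of S) by rewrite add0n; apply: uni_iso uA; exists s.
  move=> v; apply: subv_trans (uni_sub_le uM km mn u1 uS v) _.
  by apply/subvP => x /HS[y <-]; apply/inclP; exists (j' v y); rewrite cmpE.
move=> v; apply: subv_trans (NB v) _.
have bl : (b <= l * p - 1)%N.
  by move: nE bE kd bn; move: (l * p)%N (k) => z k'; clear; lia.
by apply: uni_sub_le uM bl le2 _ u2 v; rewrite add0n.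
Qed.

Lemma sum_mod_eq c r : (r <= p)%N -> (\sum_(b < r) (c == b %[mod p]) = (c %% p < r)%N)%N.
Proof.
move=> rp; have E (b : 'I_r) : (c == b %[mod p]) = (c %% p == b)%N.
  by rewrite (@modn_small b) //; apply: leq_trans (ltn_ord b) rp.
under eq_bigr do rewrite E.
case: (ltnP (c %% p) r) => [lt|ge].
  rewrite (bigD1 (Ordinal lt)) //= eqxx big1 // => b /eqP nb.
  by case: eqP => // e; case: nb; apply/val_inj.
rewrite big1 // => b _; case: eqP => // e; have := ltn_ord b; lia.
Qed.

Lemma euler_osum i j r s : euler_form (osum O i r) (osum O j s) =
  \sum_(a < r) \sum_(b < s) ((i + a == j + b %[mod p])%:Z - (j + b == (i + a).+1 %[mod p])%:Z).
Proof.
have e1 a b c := let: And4 x _ _ _ := @euler_lin Q a b c 0 in x.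
have e2 a b c := let: And4 _ x _ _ := @euler_lin Q a b c 0 in x.
have e3 k a c := let: And4 _ _ x _ := @euler_lin Q a a c k in x.
have e4 k a c := let: And4 _ _ _ x := @euler_lin Q a a c k in x.
rewrite (E_sum e1 e3); apply: eq_bigr => a _; rewrite (E_sumr e2 e4); apply: eq_bigr => b _.
by rewrite euler_he hom_OO ext_OO.
Qed.

(* Otherwise Ext(B1, M / B2) = 0, and the Euler form of B1 and M / B2, which is at most 0,
   is the dimension of Hom(B1, M / B2). *)
Lemma transverse_ext n M (N : subrep M) l k (B1 B2 : subrep M) : uni O n.+1 0 M ->
  n.+1 = (l * p + k)%N -> (1 <= l)%N -> (k < p)%N ->
  regular (rep_of B1) -> quasi_length (rep_of B1) k.+1 ->
  regular (rep_of B2) -> quasi_length (rep_of B2) (l * p - 1) ->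
  sub_le B1 N -> sub_le N B2 -> ext (rep_of N) (quo N) <> 0%N.
Proof.
move=> uM nE l1 kp r1 q1 r2 q2 le1 le2 ex0; have sM := uni_sst uM.
have lp : (p <= l * p)%N by rewrite leq_pmull.
have s1 := (regular_sst A _).1 r1; have s2 := (regular_sst A _).1 r2.
have [m1 mn1 u1] := uni_sub uM (isHom_incl B1) (mono_incl B1) s1.1.
have [m2 mn2 u2] := uni_sub uM (isHom_incl B2) (mono_incl B2) s2.1.
have e1 := ql_uni u1 q1; have e2 := ql_uni u2 q2; subst m1 m2.
have i1 : (0 + (n.+1 - k.+1) = l * p - 1)%N by lia.
have i2 : (0 + (n.+1 - (l * p - 1)) = k.+1)%N by lia.
rewrite i1 in u1; rewrite i2 in u2.
have [h hh hE] : exists2 h : C0 (rep_of B1) (rep_of N), isHom h & forall v x, incl N v (h v x) = incl B1 v x.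
  apply: lift_mono; [exact: isHom_incl|exact: mono_incl|exact: isHom_incl|].
  by move=> v x; apply/inclP; apply: (subvP (le1 v)); apply/inclP; exists x.
have hm : mono h by move=> v x e; apply: (mono_incl B1); rewrite -hE e lf0.
have [g gh gE] : exists2 g : C0 (quo N) (quo B2), isHom g & forall v x, g v (prj N v x) = prj B2 v x.
  apply: desc_epi; [exact: isHom_prj|exact: epi_prj|exact: isHom_prj|].
  by move=> v x /prjP xN; apply/prjP; apply: (subvP (le2 v)).
have ge : epi g by move=> v y; have [x <-] := epi_prj B2 v y; exists (prj N v x); rewrite gE.
have ex1 := ext0_quo gh ge (ext0_sub hh hm ex0).
have dq : dv (quo B2) = osum O 0 k.+1.
  apply/funext => v; have := congr1 (fun F => F v) (dv_ses (ses_quo B2)).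
  rewrite (uni_dv uM) (uni_dv u2) -!/(osum O _ _ _).
  have -> : n.+1 = (k.+1 + (l * p - 1))%N by lia.
  rewrite osumD [X in _ = X -> _]addrC add0n => /addIr; by [].
have := euler_he (rep_of B1) (quo B2); rewrite ex1 subr0 dq (uni_dv u1) -/(osum O _ _) euler_osum.
(* Modulo p the index l p - 1 + a + 1 is a, which is one of the values of b; so the Ext terms of a
   row sum to 1, and its Hom terms to at most 1. *)
have E (a : 'I_k.+1) : \sum_(b < k.+1) ((l * p - 1 + a == 0 + b %[mod p])%:Z - (0 + b == (l * p - 1 + a).+1 %[mod p])%:Z)
   = ((l * p - 1 + a) %% p < k.+1)%:Z - 1.
  rewrite sumrB -!Posz_sum; congr (_ - _).
    by rewrite -(sum_mod_eq (l * p - 1 + a) kp); congr (Posz _); apply: eq_bigr => b _; rewrite add0n.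
  have ap : (a < p)%N by apply: leq_trans (ltn_ord a) kp.
  have -> : 1 = (((l * p - 1 + a).+1 %% p < k.+1)%N : nat)%:Z.
    have -> : ((l * p - 1 + a).+1 = l * p + a)%N by lia.
    by rewrite modnMDl modn_small // ltn_ord.
  rewrite -(sum_mod_eq _ kp); congr (Posz _); apply: eq_bigr => b _.
  by rewrite add0n eq_sym.
rewrite (eq_bigr _ (fun a _ => E a)) big_ord_recl.
have S0 : \sum_(a < k) ((((l * p - 1 + lift ord0 a) %% p < k.+1)%N : nat)%:Z - 1) <= 0.
  by apply: sumr_le0 => a _; case: (_ < _)%N.
have T0 : ((l * p - 1 + (ord0 : 'I_k.+1)) %% p = p.-1)%N.
  have -> : (l * p - 1 + (ord0 : 'I_k.+1) = l.-1 * p + p.-1)%N.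
    by rewrite /= addn0; case: (l) l1 => // l' _; rewrite mulSn /=; have := op_gt0 O; lia.
  by rewrite modnMDl modn_small // ltn_predL; exact: op_gt0.
(* No row is positive, and the row a = 0 is -1 unless k + 1 = p. If k + 1 < p, the form is negative
   although Ext is 0. If k + 1 = p, it is at most 0 although the quasi-top of B1 is the quasi-socle
   of M / B2, which gives a nonzero map. *)
rewrite T0; have [lt|e] : (k.+1 < p \/ k.+1 = p)%N by lia.
  have -> : (p.-1 < k.+1)%N = false by lia.
  move: S0; set z := \sum_(_ < _) _; move: z => z; lia.
have hn : hom (rep_of B1) (quo B2) <> 0%N.
  have dqs : df (quo B2) = 0 by have := df_ses A (ses_quo B2); have := sM.1; have := s2.1; lia.
  have sq := sst_quo sM (isHom_prj B2) (epi_prj B2) dqs.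
  have q0 : ~ rep_zero (quo B2).
    move=> /dv0 z; have : osum O 0 k.+1 = osum O 0 0.
      by rewrite -dq z; apply/funext => v; rewrite /osum big_ord0.
    by move/osum_inj.
  have [VM [jM [piM [_ tM _]]]] := uM.
  have [pi' tq] := quo_top tM sq q0 (isHom_prj B2) (epi_prj B2).
  have [c uq] := top_uni sq tq.
  have cE : c.+1 = k.+1 by apply: (@osum_inj _ _ _ O 0); rewrite -dq (uni_dv uq).
  rewrite cE in uq; have [S uS] := uni_subrep (m := 1) uq isT.
  rewrite add0n subSS subn0 in uS.
  have [VA [jA [piA [_ tA _]]]] := u1; have [sT ph pe _] := tA.
  have eO : O (l * p - 1)%N = O k.
    apply: oT_mod; have -> : (l * p - 1 = l.-1 * p + k)%N.
      by case: (l) l1 => // l' _; rewrite mulSn /=; have := op_gt0 O; lia.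
    by rewrite modnMDl.
  have [s [sh [sm _]]] := isoR_sym (uni1_iso uS); rewrite -eO in s sh sm.
  apply: (hom_neq0I (isHom_cmp (isHom_cmp (isHom_incl S) sh) ph)).
  apply: not_zero_cmp; first exact: mono_comp (mono_incl S) sm.
  by apply: not_zero_epi pe _; case: sT.
have -> : (p.-1 < k.+1)%N by lia.
move: S0 hn; set z := \sum_(_ < _) _; move: z => z; lia.
Qed.

End OneOrbit.

Lemma tau_uniq X X' Y Y' : stable X -> stable X' -> tau X Y -> tau X' Y' -> isoR X X' -> isoR Y Y'.
Proof.
move=> sX sX' t t' [f [fh fi]]; apply: hom_stable_iso (tau_stable sX t) (tau_stable sX' t') _.
rewrite (tau_hom A t t'); apply: (hom_neq0I fh).
by apply: not_zero_mono fi.1 _; case: sX.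
Qed.

Lemma iter_ord_pred p (i : 'I_p) j : (iter j (@ord_pred p) i + j = i %[mod p])%N.
Proof.
elim: j => [|j IH]; first by rewrite addn0.
rewrite iterS /= modnDml; case: p i IH => [[]//|p] i IH.
have -> : ((iter j (ord_pred (n:=p.+1)) i + p.+1).-1 + j.+1 = iter j (ord_pred (n:=p.+1)) i + j + p.+1)%N by lia.
by rewrite modnDr.
Qed.

(** The tube in the definition is arbitrary. It and the orbit of M are both tau-orbits through the
    quasi-socle of M, and comparing where they return shows that each rank divides the other. *)
Lemma non_transverse_ext M (N : subrep M) : indecomposable M -> non_transverse N ->
  ext (rep_of N) (quo N) <> 0%N.
Proof.
move=> iM [p [R [i [l [k [[tq tinj tt] l1 kp [_ rM qM [S qS iS]] [B1 [B2 [[r1 q1] [r2 q2] le1 le2]]]]]]]]].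
have [O [n uM]] := indec_uni ((regular_sst A M).1 rM) iM.
have nE := ql_uni uM qM.
have uS := uni_socle uM qS; rewrite add0n in uS.
have i0 : isoR (O n) (R i).
  by apply: isoR_trans (isoR_sym (uni1_iso uS)) _; apply/iso_RH.
have sR x : stable (R x) by apply/(quasi_simple_stable A).
have ij j : isoR (O (n + j)%N) (R (iter j (@ord_pred p) i)).
  elim: j => [|j IH]; first by rewrite addn0.
  rewrite addnS iterS; exact: tau_uniq (o_stable O _) (sR _) (o_tau O _) (tt _) IH.
have RO x y : isoR (R x) (R y) -> x = y by move=> h; apply: tinj; apply/iso_RH.
have d1 : (op O %| p)%N.
  have := ij p; have -> : iter p (@ord_pred p) i = i.
    apply/val_inj => /=; have := iter_ord_pred i p; rewrite modnDr !modn_small //.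
  move=> h; have /o_inj/eqP := isoR_trans h (isoR_sym i0).
  by rewrite -[X in _ == X %[mod _]]addn0 eqn_modDl mod0n.
have d2 : (p %| op O)%N.
  have := ij (op O); rewrite o_per => h; have e := RO _ _ (isoR_trans (isoR_sym i0) h).
  have := iter_ord_pred i (op O); rewrite -e => /eqP.
  by rewrite -[X in _ == X %[mod _]]addn0 eqn_modDl mod0n.
have pE : p = op O by apply/eqP; rewrite eqn_dvd d1 d2.
move: nE kp q2; rewrite pE => nE kp q2.
exact: transverse_ext uM (esym nE) l1 kp r1 q1 r2 q2 le1 le2.
Qed.

Theorem transverse_extP M (N : subrep M) : indecomposable M ->
  Tr N <-> ext (rep_of N) (quo N) = 0%N.
Proof.
move=> iM; split=> [tN|e0 _ nt]; last exact: non_transverse_ext nt e0.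
apply: contrapT => e0; have eM : ext M M <> 0%N.
  move=> z; apply: e0; apply: (ext0_quo (isHom_prj N) (epi_prj N)).
  exact: (ext0_sub (isHom_incl N) (mono_incl N)).
have [O [n uM]] := nonrigid_uni iM eM.
by apply: tN (ext_non_transverse uM e0) => /rigid_RH.
Qed.
End Transverse.

(** * Ideals of iterated polynomial rings *)

Section Ideals.
Variable A : comNzRingType.
Implicit Types I J : A -> Prop.

Definition ideal I := I 0 /\ forall a u v, I u -> I v -> I (a * u + v).
Definition prime_ideal I := [/\ ideal I, ~ I 1 & forall a b, I (a * b) -> I a \/ I b].

Lemma idD I u v : ideal I -> I u -> I v -> I (u + v).
Proof. by case=> _ h Iu Iv; have := h 1 _ _ Iu Iv; rewrite mul1r. Qed.
Lemma idM I a u : ideal I -> I u -> I (a * u).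
Proof. by case=> h0 h Iu; have := h a _ _ Iu h0; rewrite addr0. Qed.
Lemma idMr I a u : ideal I -> I u -> I (u * a).
Proof. by rewrite mulrC; exact: idM. Qed.
Lemma idN I u : ideal I -> I u -> I (- u).
Proof. by move=> h Iu; rewrite -mulN1r; exact: idM. Qed.
Lemma idB I u v : ideal I -> I u -> I v -> I (u - v).
Proof. by move=> h Iu Iv; apply: idD => //; exact: idN. Qed.
Lemma idDl I u v : ideal I -> I u -> I (u + v) <-> I v.
Proof.
move=> h Iu; split=> [w|]; last exact: idD.
by have := idB h w Iu; rewrite addrAC subrr add0r.
Qed.
Lemma id_sum I (T : Type) (r : seq T) (P : pred T) F : ideal I -> (forall j, P j -> I (F j)) ->
  I (\sum_(j <- r | P j) F j).
Proof. by move=> h H; elim/big_ind: _ => //; [case: h|move=> *; exact: idD]. Qed.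
Lemma prime_exp I a n : prime_ideal I -> I (a ^+ n) -> I a.
Proof.
move=> [h n1 p]; elim: n => [|n IH]; first by rewrite expr0.
by rewrite exprS => /p[].
Qed.
End Ideals.

Section IterPoly.
Variable K : fieldType.

(** Iterated univariate polynomials, so that inductions on the number of variables can divide with
    respect to the outermost one. *)
Fixpoint itp (n : nat) : idomainType :=
  if n is n'.+1 then ({poly (itp n')} : idomainType) else (K : idomainType).

Fixpoint cst n : {rmorphism K -> itp n} :=
  match n with
  | 0 => idfun : {rmorphism K -> K}
  | n'.+1 => (@polyC (itp n') \o cst n' : {rmorphism K -> {poly itp n'}})
  end.

(** The outermost variable has index n - 1; an index out of range gives 0. *)
Fixpoint vr n (l : nat) : itp n :=
  match n with
  | 0 => 0
  | n'.+1 => if l == n' then 'X else (vr n' l)%:P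
  end.

Lemma itp_ind n (P : itp n -> Prop) : (forall c, P (cst n c)) -> (forall l, (l < n)%N -> P (vr n l)) ->
  (forall p q, P p -> P q -> P (p + q)) -> (forall p q, P p -> P q -> P (p * q)) -> forall p, P p.
Proof.
elim: n P => [|n IH] P Pc Pv PD PM p; first exact: (Pc p).
have PC (c : itp n) : P c%:P.
  apply: (IH (fun c : itp n => P c%:P)) => [c'|l ln|u v|u v]; first exact: (Pc c').
  - by have := Pv l (leqW ln); rewrite /= ltn_eqF.
  - by rewrite polyCD; exact: PD.
  - by rewrite polyCM; exact: PM.
elim/poly_ind: p => [|p c Pp]; first by rewrite -polyC0.
apply: PD (PC c); apply: PM => //.
by have := Pv n (ltnSn n); rewrite /= eqxx.
Qed.

Section Ev.
Variables (B : comNzRingType) (i : {rmorphism K -> B}).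

Fact comm_ev n (f : {rmorphism itp n -> B}) (u : B) : commr_rmorph f u.
Proof. move=> a; exact: mulrC. Qed.

Fixpoint ev n (x : nat -> B) : {rmorphism itp n -> B} :=
  match n with
  | 0 => i
  | n'.+1 => (horner_morph (comm_ev (ev n' x) (x n')) : {rmorphism {poly itp n'} -> B})
  end.

Lemma evS n x (p : itp n.+1) : ev n.+1 x p = (map_poly (ev n x) p).[x n].
Proof. by []. Qed.

Lemma evC n x (c : itp n) : ev n.+1 x c%:P = ev n x c.
Proof. by rewrite evS map_polyC hornerC. Qed.

Lemma evX n x : ev n.+1 x 'X = x n.
Proof. by rewrite evS map_polyX hornerX. Qed.

Lemma ev_cst n x c : ev n x (cst n c) = i c.
Proof.
elim: n => [//|n IH].
by rewrite -[RHS]IH -[RHS]evC.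
Qed.

Lemma ev_vr n x l : (l < n)%N -> ev n x (vr n l) = x l.
Proof.
elim: n => [//|n IH] lt; rewrite [vr _ _]/=; case: eqP => [->|ne].
  exact: evX.
by rewrite evC IH //; lia.
Qed.
End Ev.

Lemma ev_cmp (B B' : comNzRingType) (i : {rmorphism K -> B}) (i' : {rmorphism K -> B'})
    (th : {rmorphism B -> B'}) n x x' :
  (forall c, th (i c) = i' c) -> (forall l, (l < n)%N -> th (x l) = x' l) ->
  forall p, th (ev i n x p) = ev i' n x' p.
Proof.
move=> hi hx; apply: itp_ind => [c|l ln|p q e1 e2|p q e1 e2].
- by rewrite !ev_cst.
- by rewrite !ev_vr // hx.
- by rewrite !rmorphD e1 e2.
- by rewrite !rmorphM e1 e2.
Qed.

Lemma ev_ext (B : comNzRingType) (i : {rmorphism K -> B}) n x x' :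
  (forall l, (l < n)%N -> x l = x' l) -> forall p, ev i n x p = ev i n x' p.
Proof. exact: (@ev_cmp _ _ i i idfun). Qed.

Lemma ev_id n p : ev (cst n) n (vr n) p = p.
Proof.
move: p; apply: itp_ind => [c|l ln|p q e1 e2|p q e1 e2].
- by rewrite ev_cst.
- by rewrite ev_vr.
- by rewrite rmorphD e1 e2.
- by rewrite rmorphM e1 e2.
Qed.

Lemma ev_congr (B : comNzRingType) (i : {rmorphism K -> B}) n x x' (I : B -> Prop) : ideal I ->
  (forall l, (l < n)%N -> I (x l - x' l)) -> forall p, I (ev i n x p - ev i n x' p).
Proof.
move=> hI hx; apply: itp_ind => [c|l ln|p q e1 e2|p q e1 e2].
- by rewrite !ev_cst subrr; case: hI.
- by rewrite !ev_vr //; exact: hx.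
- rewrite !rmorphD.
  have -> : forall a b c d : B, a + b - (c + d) = (a - c) + (b - d) by move=> *; ring.
  exact: idD.
- rewrite !rmorphM.
  have -> : forall a b c d : B, a * b - c * d = b * (a - c) + c * (b - d) by move=> *; ring.
  by apply: idD => //; exact: idM.
Qed.

(* the polynomials without terms of degree less than k *)
Fixpoint mpow n (k : nat) : itp n -> Prop :=
  match n with
  | 0 => fun p => k = 0%N \/ p = 0
  | n'.+1 => fun p => forall j, mpow (k - j) (p : {poly itp n'})`_j
  end.

Lemma mpow_0 n (p : itp n) : mpow 0 p.
Proof. by elim: n p => [|n IH] p; [left|move=> j; exact: IH]. Qed.

Lemma mpow_z n k : mpow k (0 : itp n).
Proof. by elim: n k => [|n IH] k; [right|move=> j; rewrite coef0; exact: IH]. Qed.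

Lemma mpow_le n k k' (p : itp n) : (k <= k')%N -> mpow k' p -> mpow k p.
Proof.
elim: n k k' p => [|n IH] k k' p le; first by case=> [k0|->]; [left; lia|right].
by move=> h j; apply: IH (h j); lia.
Qed.

Lemma mpowD n k (p q : itp n) : mpow k p -> mpow k q -> mpow k (p + q).
Proof.
elim: n k p q => [|n IH] k p q.
  by case=> [k0|->]; [left|rewrite add0r].
by move=> h1 h2 j; rewrite coefD; apply: IH.
Qed.

Lemma mpow_sum n k (T : Type) (r : seq T) (P : pred T) (F : T -> itp n) : (forall j, P j -> mpow k (F j)) ->
  mpow k (\sum_(j <- r | P j) F j).
Proof. by move=> H; elim/big_ind: _ => //; [exact: mpow_z|move=> *; exact: mpowD]. Qed.

Lemma mpowM n a b (p q : itp n) : mpow a p -> mpow b q -> mpow (a + b) (p * q).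
Proof.
elim: n a b p q => [|n IH] a b p q.
  case=> [->|->]; last by rewrite mul0r; right.
  by case=> [->|->]; [left|rewrite mulr0; right].
move=> h1 h2 j; rewrite coefM; apply: mpow_sum => i _.
by apply: mpow_le (IH _ _ _ _ (h1 i) (h2 (j - i)%N)); have := ltn_ord i; lia.
Qed.

Lemma mpow_ideal n k : ideal (@mpow n k).
Proof.
split=> [|a u v hu hv]; first exact: mpow_z.
by apply: mpowD => //; apply: mpow_le (mpowM (mpow_0 a) hu).
Qed.

Lemma mpow_vr n l : mpow 1 (vr n l).
Proof.
elim: n l => [|n IH] l; first by right.
rewrite /=; case: eqP => [_|ne] j; case: j => [|j]; rewrite ?subn0 ?coefX ?coefC /=.
- exact: mpow_z.
- by rewrite subSS sub0n; exact: mpow_0.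
- exact: IH.
- exact: mpow_z.
Qed.

(** A monomial of degree above n s contains a variable to the power s: either the outermost exponent
    reaches s, or the coefficient has degree above (n - 1) s. *)
Lemma mpow_sub n (L : itp n -> Prop) s : ideal L -> (0 < s)%N -> (forall l, (l < n)%N -> L (vr n l ^+ s)) ->
  forall p, mpow (n * s).+1 p -> L p.
Proof.
move=> hL s0; elim: n L hL => [|n IH] L hL hv p.
  by case=> // ->; case: hL.
have IH' : forall c : itp n, mpow (n * s).+1 c -> L c%:P.
  apply: (IH (fun c : itp n => L c%:P)) => [|l ln].
    split=> [|a u v hu hv']; first by rewrite polyC0; case: hL.
    by rewrite polyCD polyCM; apply: idD => //; exact: idM.
  by have := hv l (leqW ln); rewrite [vr _ _]/= ltn_eqF // -polyC_exp.
move=> hp; rewrite -[p : {poly itp n}]coefK poly_def; apply: id_sum => // j _.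
rewrite -mul_polyC; have [sj|js] := leqP s j.
  apply: idM => //; rewrite -(subnK sj) exprD; apply: idM => //.
  by have := hv n (ltnSn n); rewrite /= eqxx.
apply: idMr => //; apply: IH'; apply: mpow_le (hp j); rewrite mulSn; lia.
Qed.

Definition idK : {rmorphism K -> K} := idfun.
Definition pt n (x : nat -> K) : {rmorphism itp n -> K} := ev idK n x.

Lemma mpow1_pt n (p : itp n) : mpow 1 p -> pt n (fun=> 0) p = 0.
Proof.
elim: n p => [|n IH] p; first by case.
move=> h; rewrite /pt evS horner_coef0 coef_map; exact: IH (h 0%N).
Qed.

Lemma pt_cst n x c : pt n x (cst n c) = c. Proof. exact: ev_cst. Qed.
Lemma pt_vr n x l : (l < n)%N -> pt n x (vr n l) = x l. Proof. exact: ev_vr. Qed.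
End IterPoly.

(** * Noetherian rings and Krull's intersection theorem *)

Section Noetherian.
Variable A : comNzRingType.
Implicit Types (I J L : A -> Prop) (s : seq A).

Fixpoint idspan s x : Prop := if s is y :: s' then exists a, idspan s' (x - a * y) else x = 0.

Lemma idspan_ideal s : ideal (idspan s).
Proof.
elim: s => [|y s [IH0 IH]]; first by split=> // a u v -> ->; rewrite mulr0 addr0.
split=> [|a u v [b hb] [c hc]]; first by exists 0; rewrite mul0r subrr.
exists (a * b + c).
have -> : a * u + v - (a * b + c) * y = a * (u - b * y) + (v - c * y) by ring.
exact: IH.
Qed.

Lemma idspan_sub s I : ideal I -> (forall x, x \in s -> I x) -> forall x, idspan s x -> I x.
Proof.
move=> hI; elim: s => [|y s IH] H x /=; first by move=> ->; case: hI.
move=> [a h]; have -> : x = (x - a * y) + a * y by rewrite subrK.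
apply: idD => //; first by apply: IH h => z zs; apply: H; rewrite inE zs orbT.
by apply: idM => //; apply: H; rewrite inE eqxx.
Qed.

Lemma idspan_mem s x : x \in s -> idspan s x.
Proof.
elim: s => // y s IH; rewrite inE => /orP[/eqP ->|xs].
  by exists 1; rewrite mul1r subrr; case: (idspan_ideal s).
by exists 0; rewrite mul0r subr0; exact: IH.
Qed.

Definition noeth := forall I, ideal I -> exists s,
  (forall x, x \in s -> I x) /\ forall x, I x -> idspan s x.

Lemma noeth_stable (I : nat -> A -> Prop) : noeth -> (forall k, ideal (I k)) ->
  (forall k x, I k x -> I k.+1 x) -> exists m, forall k x, I k x -> I m x.
Proof.
move=> nA hI up; have mon k l x : (k <= l)%N -> I k x -> I l x.
  by move=> /subnK <-; elim: (l - k)%N => // d IH h; apply: up; apply: IH.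
pose J x := exists k, I k x.
have hJ : ideal J.
  split; first by exists 0%N; case: (hI 0%N).
  move=> a u v [k uk] [l vl]; exists (maxn k l); apply: (hI _).2.
    by apply: mon uk; rewrite leq_maxl.
  by apply: mon vl; rewrite leq_maxr.
have [s [sJ Js]] := nA J hJ.
suff [m Hm] : exists m, forall x, x \in s -> I m x.
  exists m => k x kx; apply: (idspan_sub (hI m) Hm); apply: Js; by exists k.
elim: s sJ {Js} => [|y s IH] sJ; first by exists 0%N.
have [m Hm] := IH (fun x xs => sJ x (mem_behead (s := y :: s) xs)).
have [k yk] := sJ y (mem_head _ _); exists (maxn m k) => x; rewrite inE => /orP[/eqP ->|xs].
  by apply: mon yk; rewrite leq_maxr.
by apply: mon (Hm x xs); rewrite leq_maxl.
Qed.

Lemma noeth_max (F : (A -> Prop) -> Prop) I0 : noeth -> (forall I, F I -> ideal I) -> F I0 ->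
  exists L, [/\ F L, (forall x, I0 x -> L x) &
    forall L', F L' -> (forall x, L x -> L' x) -> forall x, L' x -> L x].
Proof.
move=> nA hF F0; apply: contrapT => H.
have /choice[nxt Hn] : forall L, exists L' : A -> Prop, F L -> (forall x, I0 x -> L x) ->
    [/\ F L', (forall x, L x -> L' x) & ~ forall x, L' x -> L x].
  move=> L; apply: contrapT => H1; apply: H; exists L; split.
  - by apply: contrapT => nF; apply: H1; exists L.
  - by apply: contrapT => nF; apply: H1; exists L.
  - move=> L' FL' LL'; apply: contrapT => nL; apply: H1; by exists L'.
pose I k := iter k nxt I0.
have P k : F (I k) /\ forall x, I0 x -> I k x.
  elim: k => [//|k [Fk k0]]; have [h1 h2 h3] := Hn _ Fk k0.
  by split=> // x /k0/h2.
have [m Hm] : exists m, forall k x, I k x -> I m x.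
  apply: noeth_stable => // k; first by apply: hF; case: (P k).
  by have [h1 h2] := P k; case: (Hn _ h1 h2).
have [h1 h2] := P m; have [_ _ h3] := Hn _ h1 h2; apply: h3 => x; exact: (Hm m.+1).
Qed.
End Noetherian.

Lemma idspan_lead (A : comNzRingType) (s : seq {poly A}) d a : (forall f, f \in s -> (size f <= d.+1)%N) ->
  idspan (map lead_coef s) a -> exists g, [/\ idspan s g, (size g <= d.+1)%N & g`_d = a].
Proof.
elim: s a => [|f s IH] a H /=.
  by move=> ->; exists 0; rewrite size_poly0 coef0.
move=> [c hc]; have [|g [gs gd ga]] := IH _ _ hc; first by move=> f' fs; apply: H; rewrite inE fs orbT.
have fd : (size f <= d.+1)%N by apply: H; rewrite inE eqxx.
exists (g + (c%:P * 'X^(d - (size f).-1)) * f); split.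
- by exists (c%:P * 'X^(d - (size f).-1)); rewrite addrK.
- apply: leq_trans (size_polyD _ _) _; rewrite geq_max gd -mulrA.
  apply: leq_trans (size_polyMleq _ _) _; have c1 := size_polyC_leq1 c.
  suff : (size ('X^(d - (size f).-1) * f)%R <= d.+1)%N by move: (size _) (size _) c1 => ? ?; lia.
  have [->|f0] := eqVneq f 0; first by rewrite mulr0 size_poly0.
  by rewrite mulrC size_mulXn //; lia.
- rewrite coefD ga -mulrA coefCM coefXnM.
  have -> : (d < d - (size f).-1)%N = false by lia.
  have -> : (d - (d - (size f).-1) = (size f).-1)%N by lia.
  by rewrite lead_coefE subrK.
Qed.

(** Generators of least degree outside the ideal generated so far are chosen one after the other.
    Once the leading coefficients stabilise, earlier generators cancel the leading term of the next
    one, against its minimality. *)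
Theorem hilbert_basis (A : comNzRingType) : noeth A -> noeth {poly A}.
Proof.
move=> nA I hI; apply: contrapT => H.
have /choice[nxt Hn] : forall s : seq {poly A}, exists f, (forall x, x \in s -> I x) ->
    [/\ I f, ~ idspan s f & forall g, I g -> ~ idspan s g -> (size f <= size g)%N].
  move=> s; have [sI|nI] := pselect (forall x, x \in s -> I x); last by exists 0.
  have ex : exists n, `[< exists f, [/\ I f, ~ idspan s f & size f = n] >].
    apply: contrapT => nex; apply: H; exists s; split=> // x Ix; apply: contrapT => nx.
    by apply: nex; exists (size x); apply/asboolP; exists x.
  have [n /asboolP[f [If fs fn]] nmin] := ex_minnP ex; exists f => _; split=> // g Ig gs.
  by rewrite fn; apply: nmin; apply/asboolP; exists g.
pose st k := iter k (fun s => nxt s :: s) [::].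
have stI k : forall x, x \in st k -> I x.
  elim: k => // k IH x; rewrite inE => /orP[/eqP ->|]; last exact: IH.
  by case: (Hn _ IH).
have stS k : forall x, idspan (st k) x -> idspan (st k.+1) x.
  by move=> x hx; exists 0; rewrite mul0r subr0.
have [m Hm] : exists m, forall k x, idspan (map lead_coef (st k)) x -> idspan (map lead_coef (st m)) x.
  apply: noeth_stable => // [k|k x hx]; first exact: idspan_ideal.
  by exists 0; rewrite mul0r subr0.
have [If nf fmin] := Hn _ (stI m).
set f := nxt (st m) in If nf fmin.
have f0 : f != 0 by apply/eqP => f0; apply: nf; rewrite f0; case: (idspan_ideal (st m)).
have sz : forall k, (forall x, idspan (st k) x -> idspan (st m) x) -> forall g, g \in st k -> (size g <= size f)%N.
  elim=> // k IH sub g; rewrite inE => /orP[/eqP ->|gs]; last first.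
    by apply: IH gs => x /stS; exact: sub.
  have [_ _] := Hn _ (stI k); apply=> // /stS; exact: contra_not (sub _) nf.
have sf : size f = (size f).-1.+1 by rewrite prednK // size_poly_gt0.
have [||g [gs gd ga]] := @idspan_lead A (st m) (size f).-1 (lead_coef f).
- by rewrite -sf; apply: sz.
- by apply: (Hm m.+1); apply: idspan_mem; rewrite inE eqxx.
have g1 : I (f - g) by apply: idB => //; exact: idspan_sub (stI m) _ gs.
have g2 : ~ idspan (st m) (f - g).
  by move=> h; apply: nf; rewrite -(subrK g f); apply: idD => //; exact: idspan_ideal.
have := fmin _ g1 g2; rewrite leqNgt => /negP; apply.
rewrite sf ltnS; apply/leq_sizeP => j; rewrite leq_eqVlt => /orP[/eqP <-|lt].
  by rewrite coefB ga lead_coefE subrr.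
by rewrite coefB !nth_default ?subrr //; [apply: leq_trans gd _|rewrite sf].
Qed.

Section Krull.
Variable K : fieldType.

Lemma noeth_itp n : noeth (itp K n).
Proof.
elim: n => [|n IH]; last exact: hilbert_basis.
move=> I hI; have [[x [Ix x0]]|H] := pselect (exists x, I x /\ x != 0).
  exists [:: x]; split=> [y|y Iy]; first by rewrite inE => /eqP ->.
  by exists ((y : K) / x); rewrite (@divfK K) // subrr.
exists [::]; split=> // x Ix; apply: contrapT => /eqP x0; apply: H; by exists x.
Qed.

(* An ideal L containing m p + J and maximal with L /\ (A p + J) = m p + J contains a power of m. *)
Theorem krull_intersection n (J : itp K n -> Prop) p : ideal J ->
  (forall k, exists2 j, J j & mpow k (p - j)) -> exists2 c, mpow 1 c & J (p - c * p).
Proof.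
move=> hJ H.
pose mp x := exists c j, [/\ mpow 1 c, J j & x = c * p + j].
pose F L := ideal L /\ forall x, L x -> (exists a j, J j /\ x = a * p + j) -> mp x.
have hmp : ideal mp.
  split; first by exists 0, 0; split; [exact: mpow_z|case: hJ|rewrite mul0r addr0].
  move=> a u v [c [j [mc Jj ->]]] [c' [j' [mc' Jj' ->]]].
  exists (a * c + c'), (a * j + j'); split; [exact: (mpow_ideal K n 1).2|exact: hJ.2|ring].
have F0 : F mp by split.
have [L [[hL FL] mpL Lmax]] := noeth_max (@noeth_itp n) (fun I (h : F I) => h.1) F0.
have pw l : (l < n)%N -> exists s, L (vr K n l ^+ s).
  move=> ln; set x := vr K n l.
  have [m Hm] : exists m, forall k a, L (a * x ^+ k) -> L (a * x ^+ m).
    apply: (@noeth_stable _ (fun k a => L (a * x ^+ k))) => [|k|k a h]; first exact: noeth_itp.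
      split=> [|a u v h1 h2]; first by rewrite mul0r; case: hL.
      by rewrite mulrDl -mulrA; exact: hL.2.
    by rewrite exprS mulrCA; apply: idM.
  (* L + (x ^ m) satisfies [F]: if y = u + a x ^ m, with u in L, lies in A p + J, then x y is in
     [mp], hence in L. So a x ^ m.+1 is in L, and a x ^ m too by the choice of m. Maximality puts x
     ^ m in L. *)
  exists m; pose L' y := exists a, L (y - a * x ^+ m).
  have LL' y : L y -> L' y by exists 0; rewrite mul0r subr0.
  have hL' : ideal L'.
    split=> [|a u v [b hb] [c hc]]; first by apply: LL'; case: hL.
    exists (a * b + c).
    have -> : a * u + v - (a * b + c) * x ^+ m = a * (u - b * x ^+ m) + (v - c * x ^+ m) by ring.
    exact: hL.2.
  suff FL' : F L'.
    by rewrite -[_ ^+ _]mul1r; apply: (Lmax _ FL' LL'); exists 1; rewrite subrr; case: hL.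
  split=> // y [a ha] [b [j [Jj yE]]]; apply: FL; last by exists b, j.
  have xy : L (x * y).
    apply: mpL; exists (x * b), (x * j); split; [|exact: idM|by rewrite yE; ring].
    by rewrite mulrC; apply: (idM b (mpow_ideal K n 1)); exact: mpow_vr.
  have h1 : L (a * x ^+ m.+1).
    have -> : a * x ^+ m.+1 = x * y - x * (y - a * x ^+ m) by rewrite exprS; ring.
    by apply: idB => //; exact: idM.
  by rewrite -(subrK (a * x ^+ m) y); apply: idD => //; exact: Hm h1.
have [s [s0 sL]] : exists s, (0 < s)%N /\ forall l, (l < n)%N -> L (vr K n l ^+ s).
  have /choice[s0 Hs] : forall l, exists s, (l < n)%N -> L (vr K n l ^+ s).
    by move=> l; have [/pw[s hs]|_] := ltnP l n; [exists s|exists 0%N].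
  exists (\sum_(l < n) s0 l).+1; split=> // l ln.
  have le : (s0 l <= \sum_(l < n) s0 l)%N by rewrite (bigD1 (Ordinal ln)) //= leq_addr.
  by rewrite -(subnK (leqW le)) exprD; apply: idM => //; exact: Hs.
have [j Jj pj] := H (n * s).+1.
have /(FL _) : L (p - j) by exact: mpow_sub hL s0 sL _ pj.
case; first by exists 1, (- j); split; [exact: idN|rewrite mul1r].
move=> c [j' [mc Jj' E]]; exists c => //.
have -> : p - c * p = j' + j by rewrite -[p in p - _](subrK j) E; ring.
exact: idD.
Qed.
End Krull.

Section MinDegree.
Variables (A : idomainType) (P : A -> Prop).
Hypothesis pP : prime_ideal P.
Let hP : ideal P. Proof. by case: pP. Qed.

Definition coef_in (p : {poly A}) := forall j, P p`_j.

(* L plays the role of an ideal of polynomials over the fraction field of A / P *)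
Lemma min_degree (L : {poly A} -> Prop) : ideal L -> (forall p, coef_in p -> L p) ->
  (exists2 p, L p & ~ coef_in p) ->
  exists f, [/\ L f, ~ P (lead_coef f), (forall p, L p -> (size p < size f)%N -> coef_in p)
    & forall p, L p -> coef_in (p %% f)].
Proof.
move=> hL cL [p0 Lp0 np0].
have ex : exists n, `[< exists f, [/\ L f, ~ coef_in f & size f = n] >].
  by exists (size p0); apply/asboolP; exists p0.
have [n /asboolP[f [Lf nf fn]] nmin] := ex_minnP ex.
have mn p : L p -> (size p < size f)%N -> coef_in p.
  move=> Lp lt; apply: contrapT => np; have : (n <= size p)%N; last by lia.
  by apply: nmin; apply/asboolP; exists p.
have lf : ~ P (lead_coef f).
  move=> lf; pose m := (lead_coef f)%:P * 'X^((size f).-1).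
  have f0 : f != 0 by apply/eqP => f0; apply: nf => j; rewrite f0 coef0; case: hP.
  have sf : (size f).-1.+1 = size f by rewrite prednK // size_poly_gt0.
  have cm : coef_in m.
    by move=> j; rewrite /m coefCM coefXn; apply: idMr.
  apply: nf => j; rewrite -(subrK m f) coefD; apply: idD => //.
  apply: mn; first by apply: idB => //; apply: cL.
  rewrite -sf ltnS; apply/leq_sizeP => i; rewrite leq_eqVlt coefB /m coefCM coefXn => /orP[/eqP <-|lt].
    by rewrite eqxx mulr1 lead_coefE subrr.
  by rewrite gtn_eqF // mulr0 subr0 nth_default // -sf.
have f0 : f != 0 by apply/eqP => f0; apply: lf; rewrite f0 lead_coef0; case: hP.
exists f; split=> // p Lp; apply: mn; last by rewrite ltn_modp.
have /= := @Pdiv.Idomain.divp_eq _ p f => E.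
have -> : p %% f = (lead_coef f ^+ scalp p f)%:P * p - p %/ f * f.
  by rewrite mul_polyC E addrAC subrr add0r.
by apply: idB => //; exact: idM.
Qed.
End MinDegree.

(** * The Nullstellensatz *)

Section Nullstellensatz.
Variable K : closedFieldType.

Definition upd (x : nat -> K) n c l := if l == n then c else x l.

Lemma pt_upd n x c (p : itp K n.+1) : pt n.+1 (upd x n c) p = (map_poly (pt n x) p).[c].
Proof.
rewrite /pt evS /upd eqxx; congr (_.[c]); apply: eq_map_poly => a.
by apply: ev_ext => l ln; rewrite ltn_eqF.
Qed.

(** Let P' be the trace of P on constants in the last variable. If P is generated by P', some
    coefficient of q is outside P', and a non-root of q is taken over a point of P'. Otherwise let f
    in P and e in P + (q) have least degree modulo P'. Then e is constant; over a point where both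
    leading coefficients survive, any root of f works, because t q = e there. *)
Theorem nullstellensatz n (P : itp K n -> Prop) q : prime_ideal P -> ~ P q ->
  exists x, (forall p, P p -> pt n x p = 0) /\ pt n x q <> 0.
Proof.
elim: n P q => [|n IH] P q pP nq; have [hP n1 pr] := pP.
  exists (fun=> 0); split=> [p Pp|q0]; last by apply: nq; rewrite [q]q0; case: hP.
  have [//|p0] := eqVneq (p : K) 0; case: n1.
  by have := idM ((p : K)^-1) hP Pp; rewrite (@mulVf K).
pose P' c := P (c%:P : itp K n.+1).
have pP' : prime_ideal P'.
  split=> [|/n1//|a b]; last by rewrite /P' polyCM => /pr.
  split=> [|a u v hu hv]; first by rewrite /P' polyC0; case: hP.
  by rewrite /P' polyCD polyCM; apply: idD => //; exact: idM.
have hP' : ideal P' by case: pP'.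
have cP p : coef_in P' p -> P p.
  move=> h; rewrite -[p]coefK poly_def; apply: id_sum => // j _.
  by rewrite -mul_polyC; apply: idMr => //; exact: h.
have [ex|nex] := pselect (exists2 p, P p & ~ coef_in P' p); last first.
  have [j nj] : exists j, ~ P' (q : {poly itp K n})`_j.
    by apply: contrapT => H; apply: nq; apply: cP => j; apply: contrapT => h; apply: H; exists j.
  have [x [xP xq]] := IH _ _ pP' nj.
  have q0 : map_poly (pt n x) q != 0.
    by apply/eqP => e; apply: xq; have := congr1 (fun r : {poly K} => r`_j) e; rewrite coef_map coef0.
  have [c rc] := closed_nonrootP _ q0.
  exists (upd x n c); split=> [p Pp|]; rewrite pt_upd; last by apply/eqP.
  have -> : map_poly (pt n x) p = 0; last by rewrite horner0.
  apply/polyP => i; rewrite coef_map coef0; apply: xP; apply: contrapT => h.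
  by apply: nex; exists p => // /(_ i).
have [f [Pf lf fmin fdiv]] := min_degree pP' hP cP ex.
pose L2 p := exists t, P (p - t * q).
have PL2 p : P p -> L2 p by move=> Pp; exists 0; rewrite mul0r subr0.
have hL2 : ideal L2.
  split=> [|a u v [b hb] [c hc]]; first by apply: PL2; case: hP.
  exists (a * b + c).
  have -> : a * u + v - (a * b + c) * q = a * (u - b * q) + (v - c * q) by ring.
  exact: hP.2.
have nf : ~ coef_in P' f by move=> /(_ (size f).-1); rewrite -lead_coefE.
have [|e [Le le emin ediv]] := min_degree pP' hL2 (fun p h => PL2 p (cP p h)).
  by exists f => //; exact: PL2.
have nP c N : ~ P' c -> ~ P (c ^+ N)%:P by move=> nc h; apply: nc; exact: prime_exp pP' h.
have nePe : ~ P e.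
  move=> Pe; have Lq : L2 q by exists 1; rewrite mul1r subrr; case: hP.
  have := @Pdiv.Idomain.divp_eq _ q e; rewrite -mul_polyC => E.
  have : P ((lead_coef e ^+ scalp q e)%:P * q).
    by rewrite E; apply: idD => //; [exact: idM|apply: cP; exact: ediv].
  by case/pr => //; exact: nP.
have e0 : e != 0 by apply/eqP => e0; apply: nePe; rewrite e0; case: hP.
(* Pseudo-division of f by e leaves coefficients in P'. If e were not constant, the quotient would
   be in P and of smaller degree than f, hence have coefficients in P', and
   [lead_coef e ^+ scalp f e * lead_coef f] would lie in P'. *)
have se : (size e <= 1)%N.
  rewrite leqNgt; apply/negP => se.
  have := @Pdiv.Idomain.divp_eq _ f e; rewrite -mul_polyC => E.
  have cr := ediv f (PL2 f Pf).
  have : P (f %/ e * e).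
    by apply: (idDl _ hP (cP _ cr)).1; rewrite addrC -E; exact: idM.
  case/pr => // Pa.
  have ca : coef_in P' (f %/ e).
    apply: fmin => //; have f0 : (0 < size f)%N.
      by rewrite size_poly_gt0; apply/eqP => f0; apply: nf; rewrite f0 => j; rewrite coef0; case: hP'.
    by rewrite size_divp //; lia.
  have : P' ((lead_coef e ^+ scalp f e) * lead_coef f).
    rewrite [lead_coef f]lead_coefE -coefCM E coefD; apply: idD => //.
    by rewrite coefM; apply: id_sum => // i _; exact: idMr.
  by have [_ _ pr'] := pP'; case/pr' => //; exact: nP.
have eE : e = (lead_coef e)%:P by rewrite [LHS]size1_polyC // lead_coefE; case: (size e) se => [|[]].
have [t Pt] := Le.
have nlc : ~ P' (lead_coef f * lead_coef e) by have [_ _ pr'] := pP'; case/pr'.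
have [x [xP /eqP]] := IH _ _ pP' nlc; rewrite rmorphM mulf_eq0 negb_or => /andP[xf xe].
have sf : (1 < size f)%N.
  rewrite ltnNge; apply/negP => sf; apply: lf.
  have fE : f = (lead_coef f)%:P by rewrite [LHS]size1_polyC // lead_coefE; case: (size f) sf => [|[]].
  by rewrite /P' -fE.
have smf : size (map_poly (pt n x) f) = size f by apply: size_map_poly_id0.
have [c /rootP rc] : exists c, root (map_poly (pt n x) f) c.
  by apply/closed_rootP; rewrite smf; case: (size f) sf => [|[]].
have Pc p : P p -> pt n.+1 (upd x n c) p = 0.
  move=> Pp; have := @Pdiv.Idomain.divp_eq _ p f; rewrite -mul_polyC.
  move/(congr1 (pt n.+1 (upd x n c))).
  rewrite rmorphM rmorphD rmorphM.
  have -> : pt n.+1 (upd x n c) f = 0 by rewrite pt_upd.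
  have -> : pt n.+1 (upd x n c) (p %% f) = 0.
    rewrite pt_upd; have -> : map_poly (pt n x) (p %% f) = 0; last by rewrite horner0.
    by apply/polyP => i; rewrite coef_map coef0; apply: xP; exact: fdiv.
  have -> : pt n.+1 (upd x n c) (lead_coef f ^+ scalp p f)%:P = pt n x (lead_coef f) ^+ scalp p f.
    by rewrite pt_upd map_polyC hornerC; exact: rmorphXn.
  rewrite mulr0 addr0 => /eqP; rewrite mulf_eq0 => /orP[h|/eqP //].
  by have := expf_neq0 (scalp p f) xf; rewrite h.
exists (upd x n c); split=> // q0.
have := Pc _ Pt; rewrite rmorphB rmorphM q0 mulr0 subr0 eE pt_upd map_polyC hornerC => h.
by move: xe => /eqP; apply; exact: h.
Qed.
End Nullstellensatz.

(** * Transcendence degree and derivations *)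

Section PrimeQuotient.
Variables (R : comNzRingType) (P : R -> Prop) (pP : prime_ideal P).

Definition primeb : {pred R} := fun x => `[< P x >].

Fact primeb_idealr : idealr_closed primeb.
Proof.
have [hP n1 _] := pP; split; first by apply/asboolP; case: hP.
  by apply/asboolP.
by move=> a u v /asboolP hu /asboolP hv; apply/asboolP; exact: hP.2.
Qed.
HB.instance Definition _ := isIdealr.Build R primeb primeb_idealr.

Definition quotT := {ideal_quot primeb}.
HB.instance Definition _ := GRing.ComNzRing.on quotT.

Definition qproj : {rmorphism R -> quotT} := (\pi_quotT)%qT : {rmorphism R -> {ideal_quot primeb}}.

Fact qproj_eq0 x : qproj x = 0 <-> P x.
Proof.
have -> : (qproj x = 0) <-> (qproj x == qproj 0).
  by rewrite rmorph0; split=> [->|/eqP].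
rewrite /qproj /= -Quotient.idealrBE subr0; split=> [/asboolP //|h]; exact/asboolP.
Qed.

Fact qproj_surj (y : quotT) : exists x, qproj x = y.
Proof. by exists (repr y); exact: reprK. Qed.

Fact quotT_integral (x y : quotT) : x * y = 0 -> (x == 0) || (y == 0).
Proof.
have [a <-] := qproj_surj x; have [b <-] := qproj_surj y.
rewrite -rmorphM => /qproj_eq0; have [_ _ h] := pP => /h[] /qproj_eq0 ->; by rewrite eqxx ?orbT.
Qed.

Definition quot_unit : pred quotT := fun x => `[< exists y, y * x = 1 >].
Definition quot_inv (x : quotT) : quotT :=
  if pselect (exists y, y * x = 1) is left h then projT1 (cid h) else x.
Fact quot_mulVx : {in quot_unit, left_inverse 1 quot_inv *%R}.
Proof.
move=> x /asboolP h; rewrite /quot_inv; case: pselect => // h'; exact: projT2 (cid h').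
Qed.
Fact quot_unitP (x y : quotT) : y * x = 1 -> quot_unit x.
Proof. by move=> h; apply/asboolP; exists y. Qed.
Fact quot_inv_out : {in [predC quot_unit], quot_inv =1 id}.
Proof.
move=> x /negP nx; rewrite /quot_inv; case: pselect => // h; case: nx; exact/asboolP.
Qed.
HB.instance Definition _ := GRing.ComNzRing_hasMulInverse.Build quotT quot_mulVx quot_unitP quot_inv_out.
HB.instance Definition _ := GRing.ComUnitRing_isIntegral.Build quotT quotT_integral.
End PrimeQuotient.

(** E is the fraction field of the quotient, that is the function field of the zero set of P. *)
Lemma generic_point (R : comNzRingType) (P : R -> Prop) : prime_ideal P ->
  exists (E : fieldType) (f : {rmorphism R -> E}), forall x, f x = 0 <-> P x.
Proof.
move=> pP; pose g : {rmorphism quotT pP -> {fraction (quotT pP)}} := @tofrac _.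
exists {fraction (quotT pP)}, (g \o qproj pP : {rmorphism R -> {fraction (quotT pP)}}) => x.
rewrite -(qproj_eq0 pP) /=; split=> [/eqP|->]; last exact: rmorph0.
by rewrite -(rmorph0 g) tofrac_eq => /eqP.
Qed.

(** Derivations with values in E, an A-module through f; they descend to the image of f when they
    vanish on its kernel. *)
Definition der (A : nzRingType) (E : comNzRingType) (f d : A -> E) :=
  (forall a b, d (a + b) = d a + d b) /\ (forall a b, d (a * b) = f a * d b + f b * d a).

Lemma der_zmod (A : nzRingType) (E : comNzRingType) (f d : A -> E) : der f d -> zmod_morphism d.
Proof. by move=> [D _] a b; apply/eqP; rewrite eq_sym subr_eq -D subrK. Qed.

Section DerExtension.
Variables (A : idomainType) (E : fieldType) (f : {rmorphism A -> E}) (d : A -> E) (x : E).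
Hypotheses (hd : der f d) (d0 : forall a, f a = 0 -> d a = 0).
Hypothesis char0 : forall n, n.+1%:R != 0 :> E.

Let cF : commr_rmorph f x. Proof. by move=> a; exact: mulrC. Qed.
Let F : {rmorphism {poly A} -> E} := horner_morph cF.
Let da : {additive A -> E} := HB.pack d (GRing.isZmodMorphism.Build A E d (der_zmod hd)).
Let D0 (p : {poly A}) : E := (map_poly da p).[x].

Let D0D p q : D0 (p + q) = D0 p + D0 q.
Proof. by rewrite /D0 raddfD hornerD. Qed.

Let d00 : d 0 = 0. Proof. by apply: d0; exact: rmorph0. Qed.

Let D0S p c : D0 (p * 'X + c%:P) = D0 p * x + d c.
Proof.
rewrite /D0; have -> : map_poly da (p * 'X + c%:P) = map_poly da p * 'X + (d c)%:P.
  apply/polyP => i; rewrite coef_map !coefD !coefMX !coefC coef_map raddfD /=.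
  by case: i => [|i] /=; rewrite ?d00 ?addr0.
by rewrite hornerD hornerMX hornerC.
Qed.

Let D0_0 : D0 0 = 0. Proof. by rewrite /D0 raddf0 horner0. Qed.

Let D0C c q : D0 (c%:P * q) = f c * D0 q + F q * d c.
Proof.
elim/poly_ind: q => [|q a IH]; first by rewrite mulr0 D0_0 rmorph0 mulr0 mul0r addr0.
rewrite mulrDr mulrA -polyCM !D0S IH hd.2 rmorphD rmorphM.
have -> : F 'X = x by rewrite /F /= /horner_morph map_polyX hornerX.
have -> : F a%:P = f a by rewrite /F /= /horner_morph map_polyC hornerC.
ring.
Qed.

Let D0M p q : D0 (p * q) = F p * D0 q + F q * D0 p.
Proof.
elim/poly_ind: p q => [|p a IH] q; first by rewrite !mul0r D0_0 rmorph0 mulr0 mul0r addr0.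
have -> : (p * 'X + a%:P) * q = p * q * 'X + 0%:P + a%:P * q by rewrite polyC0; ring.
rewrite D0D !D0S D0C IH d00 rmorphD rmorphM.
have -> : F 'X = x by rewrite /F /= /horner_morph map_polyX hornerX.
have -> : F a%:P = f a by rewrite /F /= /horner_morph map_polyC hornerC.
ring.
Qed.

Let Dw w (p : {poly A}) := D0 p + w * F p^`().

Let Dw_der w : der F (Dw w).
Proof.
split=> p q; rewrite /Dw; first by rewrite D0D derivD rmorphD; ring.
by rewrite D0M derivM rmorphD !rmorphM; ring.
Qed.

Let Dw_C w c : Dw w c%:P = d c.
Proof. by rewrite /Dw derivC rmorph0 mulr0 addr0 -[c%:P]add0r -(mul0r 'X) D0S D0_0 mul0r add0r. Qed.

Let Dw_X w : Dw w 'X = w.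
Proof.
have d1 : d 1 = 0.
  have := hd.2 1 1; rewrite mulr1 rmorph1 !mul1r => h; apply: (addrI (d 1)).
  by rewrite addr0 -h.
rewrite /Dw derivX rmorph1 mulr1 -['X]mul1r -[1 * 'X]addr0 -polyC0 D0S d00.
have e1 := Dw_C 0 1; rewrite /Dw mul0r addr0 in e1.
by rewrite -polyC1 e1 d1 mul0r !add0r.
Qed.

Let P a := f a = 0.
Let pP : prime_ideal P.
Proof.
split; rewrite /P; last by move=> a b; rewrite rmorphM => /eqP; rewrite mulf_eq0 => /orP[]/eqP; [left|right].
  by split=> [|a u v hu hv]; rewrite ?rmorph0 // rmorphD rmorphM hu hv mulr0 addr0.
by rewrite rmorph1 => /eqP; rewrite oner_eq0.
Qed.

Let coef_in_F p : coef_in P p -> F p = 0.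
Proof.
move=> h; rewrite /F /= /horner_morph; have -> : map_poly f p = 0; last by rewrite horner0.
apply/polyP => i; rewrite coef_map coef0; exact: h.
Qed.

Let coef_in_Dw w p : coef_in P p -> Dw w p = 0.
Proof.
move=> h; have h' : coef_in P p^`() by move=> j; rewrite /P coef_deriv rmorphMn h mul0rn.
rewrite /Dw (coef_in_F h') mulr0 addr0 /D0; have -> : map_poly da p = 0; last by rewrite horner0.
by apply/polyP => i; rewrite coef_map coef0; apply: d0; exact: h.
Qed.

Lemma der_transc : (forall p, F p = 0 -> coef_in P p) -> forall w, exists d' : {poly A} -> E,
  [/\ der F d', (forall c, d' c%:P = d c), d' 'X = w & forall p, F p = 0 -> d' p = 0].
Proof. by move=> H w; exists (Dw w); split=> // p /H; exact: coef_in_Dw. Qed.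

(** For x algebraic with minimal relation q, the value at x is forced: it is - D0 q / q'(x), where
    q'(x) is nonzero in characteristic 0. For x transcendental the value 0 will do. *)
Lemma der_extend : exists d' : {poly A} -> E,
  [/\ der F d', (forall c, d' c%:P = d c) & forall p, F p = 0 -> d' p = 0].
Proof.
have [H|nH] := pselect (forall p, F p = 0 -> coef_in P p).
  by have [d' [h1 h2 _ h3]] := der_transc H 0; exists d'.
have hL : ideal (fun p => F p = 0).
  by split=> [|a u v hu hv]; rewrite ?rmorph0 // rmorphD rmorphM hu hv mulr0 addr0.
have [|q [Fq lq qmin qdiv]] := min_degree pP hL coef_in_F.
  by apply: contrapT => H; apply: nH => p Fp; apply: contrapT => np; apply: H; exists p.
have Fq' : F q^`() != 0.
  apply/eqP => h; have q0 : q != 0 by apply/eqP => q0; apply: lq; rewrite q0 lead_coef0 /P rmorph0.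
  have c := qmin _ h (lt_size_deriv q0).
  case E1 : (size q) => [|[|m]].
  - by move: q0; rewrite -size_poly_eq0 E1.
  - apply: lq; have qE : q = (q`_0)%:P by apply: size1_polyC; rewrite E1.
    by move: Fq; rewrite /F /= /horner_morph qE map_polyC hornerC lead_coefC.
  - have := c m; rewrite coef_deriv /P rmorphMn => h2; apply: lq.
    rewrite /P lead_coefE E1 /=; apply/eqP; move/eqP: h2; rewrite -mulr_natl mulf_eq0.
    by rewrite (negPf (char0 m)).
exists (Dw (- D0 q / F q^`())); set w := - _ / _; split=> // p Fp.
have Dq : Dw w q = 0 by rewrite /Dw /w mulrAC -mulrA divff // mulr1 subrr.
have := @Pdiv.Idomain.divp_eq _ p q; rewrite -mul_polyC => /(congr1 (Dw w)).
rewrite (Dw_der w).1 !(Dw_der w).2 Fq Fp Dq (coef_in_Dw w (qdiv _ Fp)) mulr0 !mul0r !addr0.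
have -> : F (lead_coef q ^+ scalp p q)%:P = f (lead_coef q) ^+ scalp p q.
  by rewrite /F /= /horner_morph map_polyC hornerC; exact: rmorphXn.
move/eqP; rewrite mulf_eq0 => /orP[h|/eqP //].
by have := expf_neq0 (scalp p q) (introN eqP lq); rewrite (eqP h) eqxx.
Qed.
End DerExtension.

Section TrDeg.
Variables (K : fieldType) (E : fieldType) (i : {rmorphism K -> E}).
Hypothesis char0 : forall n, n.+1%:R != 0 :> E.

Definition alg_indep n (u : nat -> E) := forall p, ev i n u p = 0 -> p = 0.

Lemma alg_indepS n u : alg_indep n.+1 u -> alg_indep n u.
Proof. by move=> H p h; apply/polyC_inj/H; rewrite evC h. Qed.

Lemma der_free n u w : alg_indep n u -> exists d : itp K n -> E,
  [/\ der (ev i n u) d, (forall c, d (cst K n c) = 0),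
      (forall l, (l < n)%N -> d (vr K n l) = w l) & forall p, ev i n u p = 0 -> d p = 0].
Proof.
elim: n => [|n IH] H.
  exists (fun=> 0); split=> //; split=> a b; by rewrite ?addr0 ?mulr0 ?addr0.
have [d [h1 h2 h3 h4]] := IH (alg_indepS H).
have [|d' [g1 g2 g3 g4]] := @der_transc _ _ (ev i n u) d (u n) h1 h4 _ (w n).
  by move=> p h j; rewrite (H p h) coef0 rmorph0.
exists d'; split=> // [c|l]; first by rewrite -(h2 c) -g2.
rewrite ltnS leq_eqVlt => /orP[/eqP ->|lt]; first by rewrite /= eqxx.
by rewrite [vr _ _ _]/= ltn_eqF // g2 h3.
Qed.

Lemma der_ex n m u w : alg_indep n u -> exists d : itp K (m + n) -> E,
  [/\ der (ev i (m + n) u) d, (forall c, d (cst K (m + n) c) = 0),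
      (forall l, (l < n)%N -> d (vr K (m + n) l) = w l) & forall p, ev i (m + n) u p = 0 -> d p = 0].
Proof.
move=> H; elim: m => [|m [d [h1 h2 h3 h4]]]; first exact: der_free.
have [d' [g1 g2 g3]] := @der_extend _ _ (ev i (m + n) u) d (u (m + n)%N) h1 h4 char0.
exists d'; split=> // [c|l ln]; first by rewrite -(h2 c) -g2.
by rewrite [vr _ _ _]/= ltn_eqF ?g2 ?h3 //; lia.
Qed.

Variables (D h : nat) (c : nat -> nat -> nat -> K) (eta : nat -> E).
Hypothesis hD : (h <= D)%N.
Hypothesis eta_eq : forall l, (h <= l < D)%N ->
  eta l = \sum_(a < D) \sum_(b < D) i (c l a b) * eta a * eta b.

Definition jacm : 'M[E]_(D - h) := \matrix_(l, m)
  ((l == m)%:R - \sum_(a < D) i (c (h + l)%N a (h + m)%N + c (h + l)%N (h + m)%N a) * eta a).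
Hypothesis jac0 : \det jacm != 0.

(* Independent elements carry derivations d_j with d_j u_k = [j = k], which extend to the
   field generated by eta; by the Jacobian condition they are determined by their values
   on the first h coordinates. *)
Theorem trdeg_bound n (u : nat -> E) : alg_indep n u ->
  (forall j, (j < n)%N -> exists num den : itp K D,
     ev i D eta den <> 0 /\ u j * ev i D eta den = ev i D eta num) -> (n <= h)%N.
Proof.
move=> ind urat; rewrite leqNgt; apply/negP => hn.
(* The independent elements come first and the D coordinates after them, so that the derivations
   extend one coordinate at a time. *)
pose x l := if (l < n)%N then u l else eta (l - n)%N.
have ind' : alg_indep n x.
  by move=> p hp; apply: ind; rewrite -hp; apply: ev_ext => l ln; rewrite /x ln.
have /choice[d Hd] : forall j : 'I_n, exists d : itp K (D + n) -> E,
    [/\ der (ev i (D + n) x) d, (forall c, d (cst K (D + n) c) = 0),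
      (forall l, (l < n)%N -> d (vr K (D + n) l) = (l == j)%:R) & forall p, ev i (D + n) x p = 0 -> d p = 0].
  by move=> j; exact: der_ex.
pose V : 'M[E]_(n, h) := \matrix_(j, l) d j (vr K (D + n) (n + l)).
have [a a0 aV] : exists2 a : 'rV[E]_n, a != 0 & a *m V = 0.
  have : (0 < \rank (kermx V))%N by rewrite mxrank_ker subn_gt0 (leq_ltn_trans (rank_leq_col V)).
  rewrite lt0n mxrank_eq0 => /rowV0Pn[a ak a0]; exists a => //; exact/sub_kermxP.
(* As n > h, some combination of the n derivations kills the first h coordinates. Differentiating
   the equations, it kills all coordinates, hence all u j, where its values are the a_j. *)
pose dd p := \sum_j a 0 j * d j p.
have ddD p q : dd (p + q) = dd p + dd q.
  by rewrite -big_split; apply: eq_bigr => j _; have [[-> _] _ _ _] := Hd j; rewrite mulrDr.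
have ddM p q : dd (p * q) = ev i (D + n) x p * dd q + ev i (D + n) x q * dd p.
  rewrite !mulr_sumr -big_split /=; apply: eq_bigr => j _; have [[_ ->] _ _ _] := Hd j; ring.
have ddc k : dd (cst K (D + n) k) = 0.
  by apply: big1 => j _; have [_ -> _ _] := Hd j; rewrite mulr0.
have ddu l : dd (vr K (D + n) (l : 'I_n)) = a 0 l.
  rewrite /dd (bigD1 l) //= big1 ?addr0.
    by have [_ _ -> // _] := Hd l; rewrite eqxx mulr1.
  by move=> j jl; have [_ _ -> // _] := Hd j; rewrite eq_sym (inj_eq val_inj) (negPf jl) mulr0.
have dd0 p : ev i (D + n) x p = 0 -> dd p = 0.
  by move=> hp; apply: big1 => j _; have [_ _ _ -> //] := Hd j; rewrite mulr0.
pose v l := dd (vr K (D + n) (n + l)).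
have xe l : (l < D)%N -> ev i (D + n) x (vr K (D + n) (n + l)) = eta l.
  move=> lD; rewrite ev_vr; last by lia.
  rewrite /x; have -> : (n + l < n)%N = false by lia.
  by rewrite addKn.
have dd_sum (I : finType) (G : I -> itp K (D + n)) : dd (\sum_k G k) = \sum_k dd (G k).
  apply: (big_morph dd ddD); have := ddc 0; by rewrite rmorph0.
have v_lo l : (l < h)%N -> v l = 0.
  move=> lh; have := congr1 (fun M : 'rV_h => M 0 (Ordinal lh)) aV; rewrite !mxE => <-.
  by apply: eq_bigr => j _; rewrite mxE.
have v_hi l : (h <= l < D)%N -> v l = \sum_(b < D) \sum_(a < D) i (c l a b + c l b a) * eta a * v b.
  move=> hl; pose q := \sum_(a < D) \sum_(b < D) cst K (D + n) (c l a b) * vr K (D + n) (n + a) * vr K (D + n) (n + b).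
  have vq : v l = dd q.
    apply/eqP; rewrite -subr_eq0; apply/eqP.
    have -> : v l - dd q = dd (vr K (D + n) (n + l) + cst K (D + n) (-1) * q).
      rewrite ddD ddM ddc mulr0 addr0 ev_cst rmorphN rmorph1 mulN1r; by [].
    apply: dd0; rewrite rmorphD rmorphM ev_cst rmorphN rmorph1 mulN1r xe; last by lia.
    rewrite eta_eq // rmorph_sum -sumrB big1 // => a' _; rewrite rmorph_sum -sumrB big1 // => b' _.
    by rewrite !rmorphM ev_cst !xe // subrr.
  rewrite vq dd_sum.
  transitivity (\sum_(a < D) \sum_(b < D) (i (c l a b) * eta a * v b + i (c l a b) * eta b * v a)).
    apply: eq_bigr => a' _; rewrite dd_sum; apply: eq_bigr => b' _.
    rewrite !ddM ddc rmorphM ev_cst !xe // /v; ring.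
  under eq_bigr do rewrite big_split; rewrite big_split /= [X in X + _]exchange_big /= -big_split /=.
  apply: eq_bigr => b' _; rewrite -big_split /=; apply: eq_bigr => a' _.
  by rewrite rmorphD; ring.
have v0 l : (l < D)%N -> v l = 0.
  have [lh|hl lD] := ltnP l h; first by move=> _; exact: v_lo.
  pose w : 'cV[E]_(D - h) := \col_m v (h + m)%N.
  have Jw : jacm *m w = 0.
    apply/colP => k; rewrite !mxE.
    have kD : (h <= h + k < D)%N by have := ltn_ord k; lia.
    rewrite (eq_bigr (fun m : 'I_(D - h) => (k == m)%:R * v (h + m)%N -
       \sum_(a < D) i (c (h + k)%N a (h + m)%N + c (h + k)%N (h + m)%N a) * eta a * v (h + m)%N)); last first.
      by move=> m _; rewrite !mxE mulrBl mulr_suml.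
    rewrite sumrB (bigD1 k) //= eqxx mul1r big1 ?addr0; last first.
      by move=> m mk; rewrite eq_sym (negPf mk) mul0r.
    rewrite (v_hi _ kD).
    pose G b := \sum_(a < D) i (c (h + k)%N a b + c (h + k)%N b a) * eta a * v b.
    have -> : \sum_(b < D) \sum_(a < D) i (c (h + k)%N a b + c (h + k)%N b a) * eta a * v b = \sum_(b < D) G b by [].
    rewrite -(big_mkord xpredT G) (big_cat_nat (n := h)) //= [X in X + _ - _]big1_seq ?add0r; last first.
      move=> b /andP[_]; rewrite mem_index_iota => /andP[_ bh].
      by rewrite /G big1 // => a' _; rewrite v_lo // mulr0.
    by rewrite -{1}[h]add0n big_addn big_mkord; apply/eqP; rewrite subr_eq0; apply/eqP; apply: eq_bigr => b _; rewrite addnC.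
  have := congr1 (mulmx (invmx jacm)) Jw; rewrite mulKmx ?mulmx0; last by rewrite unitmxE unitfE.
  have lt : (l - h < D - h)%N by lia.
  by move=> /(congr1 (fun M : 'cV_(D - h) => M (Ordinal lt) 0)); rewrite !mxE /= subnKC.
pose th := ev (cst K (D + n)) D (fun l => vr K (D + n) (n + l)).
have evth p : ev i (D + n) x (th p) = ev i D eta p.
  apply: ev_cmp => [k|l lD]; [exact: ev_cst|exact: xe].
have ddth p : dd (th p) = 0.
  move: p; apply: itp_ind => [k|l lD|p q e1 e2|p q e1 e2].
  - by rewrite /th ev_cst ddc.
  - by rewrite /th ev_vr //; exact: v0.
  - by rewrite /th rmorphD ddD [X in X + _]e1 [X in _ + X]e2 addr0.
  - by rewrite /th rmorphM ddM [X in _ * X + _]e2 [X in _ + _ * X]e1 !mulr0 addr0.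
case/eqP: a0; apply/rowP => j; rewrite mxE.
have [num [den [den0 uE]]] := urat j (ltn_ord j).
have : dd (vr K (D + n) j * th den + cst K (D + n) (-1) * th num) = 0.
  apply: dd0; rewrite rmorphD !rmorphM !evth ev_cst rmorphN rmorph1 ev_vr; last by have := ltn_ord j; lia.
  by rewrite /x ltn_ord uE mulN1r subrr.
rewrite ddD !ddM !ddth ddc ddu evth !mulr0 !addr0 add0r => /eqP.
by rewrite mulf_eq0 => /orP[/eqP //|/eqP].
Qed.
End TrDeg.

(* If u_k is in P k but not in P (k + 1), then a relation modulo P (k + 1) may be taken not
   divisible by the last variable, and its constant term is a relation modulo P k. *)
Lemma chain_indep (K : fieldType) (A : comNzRingType) (i : {rmorphism K -> A}) (P : nat -> A -> Prop) n (u : nat -> A) :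
  (forall k, (k <= n)%N -> prime_ideal (P k)) ->
  (forall k, (k < n)%N -> [/\ P k (u k), ~ P k.+1 (u k) & forall a, P k.+1 a -> P k a]) ->
  forall p, P n (ev i n u p) -> p = 0.
Proof.
elim: n => [|n IH] pP Hu p.
  have [hP n1 _] := pP 0%N isT; move=> h; apply: contrapT => /eqP p0; apply: n1.
  have := idM (i (p : K)^-1) hP h; rewrite [ev _ _ _ _]/= -rmorphM mulVf // rmorph1.
  by [].
have [un un' sub] := Hu n (ltnSn n).
have hP := pP n.+1 (leqnn _); have [hPn _ _] := pP n (leqnSn n).
elim/poly_ind: p => [//|p c IHp]; rewrite rmorphD rmorphM evX evC => h.
have c0 : c = 0.
  apply: IH => [k kn|k kn|]; [exact: pP (leqW kn)|exact: Hu (leqW kn)|].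
  by apply: (idDl _ hPn _).1 (sub _ h); exact: idM.
move: h; rewrite c0 rmorph0 addr0; have [_ _ pr] := hP; case/pr => // h.
by rewrite (IHp h) mul0r polyC0 addr0.
Qed.

(** * Formal arcs *)

Section Order.
Variable B : comNzRingType.
Implicit Types r : {poly B}.

Definition vanish k r := forall j, (j < k)%N -> r`_j = 0.

Lemma vanishM a b r r' : vanish a r -> vanish b r' -> vanish (a + b) (r * r').
Proof.
move=> h h' j jab; rewrite coefM big1 // => m _; have mj := ltn_ord m.
have [ma|am] := ltnP m a; first by rewrite h ?mul0r.
by rewrite h' ?mulr0 //; lia.
Qed.

Lemma vanish_ideal k : ideal (vanish k).
Proof.
split=> [j _|a u v hu hv j jk]; first by rewrite coef0.
by rewrite coefD (vanishM (a := 0) _ hu) ?hv ?addr0.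
Qed.

End Order.

Section Arcs.
Variables (K : fieldType) (D h : nat) (c : nat -> nat -> nat -> K).

Definition qf (A : comNzRingType) (i : K -> A) l (x : nat -> A) : A :=
  \sum_(a < D) \sum_(b < D) i (c l a b) * x a * x b.

Lemma qf_cmp (A A' : comNzRingType) (i : K -> A) (i' : K -> A') (th : {rmorphism A -> A'}) l x x' :
  (forall k, th (i k) = i' k) -> (forall a, (a < D)%N -> th (x a) = x' a) -> th (qf i l x) = qf i' l x'.
Proof.
move=> hi hx; rewrite /qf rmorph_sum; apply: eq_bigr => a _.
by rewrite rmorph_sum; apply: eq_bigr => b _; rewrite !rmorphM hi !hx.
Qed.

Lemma qf_congr (A : comNzRingType) (i : K -> A) l x y (J : A -> Prop) : ideal J ->
  (forall a b, (a < D)%N -> (b < D)%N -> J (x a * (x b - y b))) ->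
  (forall a b, (a < D)%N -> (b < D)%N -> J (y b * (x a - y a))) -> J (qf i l x - qf i l y).
Proof.
move=> hJ h1 h2; rewrite /qf -sumrB; apply: id_sum => // a _; rewrite -sumrB; apply: id_sum => // b _.
have -> : i (c l a b) * x a * x b - i (c l a b) * y a * y b =
  i (c l a b) * (x a * (x b - y b) + y b * (x a - y a)) by ring.
by apply: idM => //; apply: idD => //; [exact: h1|exact: h2].
Qed.

Local Notation B := (itp K D).
Local Notation R := {poly B}.
Definition kR : {rmorphism K -> R} := (@polyC B \o cst K D : {rmorphism K -> {poly B}}).

(* truncations of the arc x_l = t s_l (l < h), x_l = q_l(x) (l >= h) *)
Fixpoint phi (s : nat -> B) k l : R := if (l < h)%N then 'X * (s l)%:P else
  if k is k'.+1 then qf kR l (phi s k') else 0.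

Lemma phi_lo s k l : (l < h)%N -> phi s k l = 'X * (s l)%:P.
Proof. by case: k => [|k] /= ->. Qed.
Lemma phi_hi s k l : (h <= l)%N -> phi s k.+1 l = qf kR l (phi s k).
Proof. by rewrite /= ltnNge => ->. Qed.

Section OneArc.
Variable s : nat -> B.
Local Notation phi := (phi s).

Lemma phi_v1 k l : vanish 1 (phi k l).
Proof.
elim: k l => [|k IH] l /=; case: ifP => _.
- by move=> [] // _; rewrite coefXM.
- by move=> j _; rewrite coef0.
- by move=> [] // _; rewrite coefXM.
apply: id_sum => [|a _]; first exact: vanish_ideal.
apply: id_sum => [|b _]; first exact: vanish_ideal.
by apply: (idM _ (@vanish_ideal _ 1)); exact: IH.
Qed.

(** The equations are quadratic and the arc has order 1, so each iteration gains one order. *)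
Lemma phi_stab k l : vanish k.+1 (phi k.+1 l - phi k l).
Proof.
elim: k l => [|k IH] l.
  by apply: (idB (@vanish_ideal _ 1)); exact: phi_v1.
have [lh|hl] := ltnP l h; first by rewrite !phi_lo // subrr => j _; rewrite coef0.
rewrite !phi_hi //; apply: (@qf_congr R _ _ _ _ (vanish k.+2) (vanish_ideal _ k.+2)) => a b _ _.
- exact: (vanishM (a := 1) (phi_v1 _ _) (IH b)).
- exact: (vanishM (a := 1) (phi_v1 _ _) (IH a)).
Qed.

Lemma ev_phi_stab p k j : (j <= k)%N -> (ev kR D (phi k) p)`_j = (ev kR D (phi j) p)`_j.
Proof.
move=> /subnK <-; elim: (k - j)%N => // m IH; rewrite -IH addSn; apply/eqP; rewrite -subr_eq0 -coefB; apply/eqP.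
apply: (ev_congr kR (vanish_ideal B (m + j).+1)) => [l _|]; first exact: phi_stab.
by rewrite ltnS leq_addl.
Qed.

(** The kernel of evaluation at the power series arc: the coefficient of t^j is already exact at
    truncation j. *)
Definition arc_ideal (p : B) := forall j, (ev kR D (phi j) p)`_j = 0.

Lemma arc_vanish p k : arc_ideal p -> vanish k.+1 (ev kR D (phi k) p).
Proof. by move=> hp j jk; rewrite ev_phi_stab // hp. Qed.

Lemma vanish_arc p : (forall k, vanish k.+1 (ev kR D (phi k) p)) -> arc_ideal p.
Proof. by move=> hp j; apply: hp. Qed.

(** Power series over a domain form a domain: the product of the two lowest coefficients
    survives. *)
Lemma arc_prime : prime_ideal arc_ideal.
Proof.
split.
- split=> [j|a u v hu hv]; first by rewrite rmorph0 coef0.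
  apply: vanish_arc => k; rewrite rmorphD rmorphM; apply: (vanish_ideal _ _).2; exact: arc_vanish.
- by move=> /(_ 0%N)/eqP; rewrite rmorph1 coef1 eqxx oner_eq0.
move=> p q hpq; apply: contrapT => /not_orP[np nq].
have mn r : ~ arc_ideal r -> exists i, (ev kR D (phi i) r)`_i != 0 /\
    forall j, (j < i)%N -> (ev kR D (phi j) r)`_j = 0.
  move=> nr; have ex : exists i, (ev kR D (phi i) r)`_i != 0.
    by apply: contrapT => H; apply: nr => j; apply: contrapT => /eqP hj; apply: H; exists j.
  have [i hi imin] := ex_minnP ex; exists i; split=> // j ji; apply: contrapT => /eqP /imin; lia.
have [i [hi imin]] := mn p np; have [j [hj jmin]] := mn q nq.
have := hpq (i + j)%N; rewrite rmorphM coefM.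
have lt : (i < (i + j).+1)%N by rewrite ltnS leq_addr.
rewrite (bigD1 (Ordinal lt)) //= big1 ?addr0; last first.
  move=> m mi; have mij : (m <= i + j)%N by rewrite -ltnS.
  have [lt'|] := ltnP m i; first by rewrite ev_phi_stab // imin ?mul0r.
  rewrite leq_eqVlt => /orP[/eqP e|lt']; first by case/eqP: mi; apply/val_inj.
  by rewrite [X in _ * X]ev_phi_stab ?leq_subr // jmin ?mulr0 //; lia.
rewrite ev_phi_stab ?leq_addr // addKn ev_phi_stab ?leq_addl // => /eqP.
by rewrite mulf_eq0 (negPf hi) (negPf hj).
Qed.

Lemma arc_pt p : arc_ideal p -> pt D (fun=> 0) p = 0.
Proof.
move=> /(_ 0%N); rewrite -horner_coef0 => e.
have e1 : horner_eval (0 : B) (ev kR D (phi 0) p) = ev (cst K D) D (fun=> 0) p.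
  apply: (@ev_cmp K _ _ kR (cst K D) (horner_eval (0 : B) : {rmorphism R -> B})) => [k|l _].
    by rewrite /= /horner_eval hornerC.
  by rewrite /= /horner_eval; case: ifP; rewrite ?horner0 // mulrC hornerMX mulr0.
have e2 : cst K D (ev (idK K) D (fun=> 0) p) = ev (cst K D) D (fun=> 0) p.
  by apply: ev_cmp => // l _; exact: rmorph0.
by apply/eqP; rewrite -(fmorph_eq0 (cst K D)) /pt e2 -e1 /horner_eval e.
Qed.
End OneArc.

Definition gl l : B := vr K D l - qf (cst K D) l (vr K D).

Lemma ev_gl (A : comNzRingType) (i : {rmorphism K -> A}) x l : (l < D)%N ->
  ev i D x (gl l) = x l - qf i l x.
Proof.
move=> lD; rewrite rmorphB ev_vr // (@qf_cmp _ _ _ i (ev i D x) _ _ x) // => [k|a aD].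
  exact: ev_cst.
exact: ev_vr.
Qed.

Lemma arc_gl s l : (h <= l < D)%N -> arc_ideal s (gl l).
Proof.
move=> /andP[hl lD]; apply: vanish_arc => k; rewrite ev_gl // -(phi_hi s k hl) -opprB.
by apply: (idN (@vanish_ideal _ k.+1)); exact: phi_stab.
Qed.

Lemma arc_vr s l : (l < h)%N -> (l < D)%N -> arc_ideal s (vr K D l) <-> s l = 0.
Proof.
move=> lh lD; split=> [/(_ 1%N)|e j].
  by rewrite ev_vr // phi_lo // coefXM coefC.
by rewrite ev_vr // phi_lo // e polyC0 mulr0 coef0.
Qed.

(** Applying th to coefficients takes the arc of s to that of s'. Setting variables to 0 in this way
    produces the chain of primes. *)
Lemma arc_mono s s' (th : {rmorphism B -> B}) p : (forall k, th (cst K D k) = cst K D k) ->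
  (forall l, (l < h)%N -> th (s l) = s' l) -> arc_ideal s p -> arc_ideal s' p.
Proof.
move=> hc hs hp j.
have hk k : map_poly th (kR k) = kR k by rewrite /kR /= map_polyC; congr (_%:P); exact: hc.
have ph k l : map_poly th (phi s k l) = phi s' k l.
  have hX l' : (l' < h)%N -> map_poly th ('X * (s l')%:P) = 'X * (s' l')%:P.
    move=> lh; rewrite [LHS]rmorphM -hs //; congr (_ * _); [exact: map_polyX|exact: map_polyC].
  elim: k l => [|k IH] l /=; case: ifP => lh.
  - exact: hX.
  - exact: rmorph0.
  - exact: hX.
  - apply: (@qf_cmp R R _ _ (map_poly th)) => [k'|a _]; [exact: hk|exact: IH].
have <- := @ev_cmp K _ _ kR kR (map_poly th) D (phi s j) (phi s' j) hk (fun l _ => ph j l) p.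
by rewrite coef_map hp; exact: rmorph0.
Qed.

Definition gI p := exists a : nat -> B, p = \sum_(l < D - h) a l * gl (h + l).

Lemma gI_ideal : ideal gI.
Proof.
split; first by exists (fun=> 0); rewrite big1 // => l _; rewrite mul0r.
move=> a u v [b ->] [b' ->]; exists (fun l => a * b l + b' l).
rewrite mulr_sumr -big_split; apply: eq_bigr => l _ /=; ring.
Qed.

Lemma gI_gl l : (h <= l < D)%N -> gI (gl l).
Proof.
move=> hl; exists (fun m => (m == l - h)%N%:R); have lt : (l - h < D - h)%N by lia.
rewrite (bigD1 (Ordinal lt)) //= eqxx mul1r subnKC ?big1 ?addr0 //; last by lia.
by move=> m ml; rewrite -[(l - h)%N]/(val (Ordinal lt)) (inj_eq val_inj) (negPf ml) mul0r.
Qed.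

Lemma gI_sub I : ideal I -> (forall l, (h <= l < D)%N -> I (gl l)) -> forall p, gI p -> I p.
Proof.
move=> hI H p [a ->]; apply: id_sum => // l _; apply: idM => //; apply: H; have := ltn_ord l; lia.
Qed.

Section Generic.
Local Notation x := (vr K D).
Local Notation ph := (phi x).

(** For s the variables themselves, t records the degree, and setting t = 1 turns orders in t into
    orders at the origin. *)
Definition homog (r : R) := forall j, mpow j r`_j.

Lemma homogD r r' : homog r -> homog r' -> homog (r + r').
Proof. by move=> a b j; rewrite coefD; apply: mpowD. Qed.
Lemma homogM r r' : homog r -> homog r' -> homog (r * r').
Proof.
move=> a b j; rewrite coefM; apply: mpow_sum => m _.
by apply: mpow_le (mpowM (a m) (b (j - m)%N)); rewrite subnKC // -ltnS.
Qed.
Lemma homogC k : homog (kR k).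
Proof. by case=> [|j]; rewrite /kR /= coefC; [exact: mpow_0|exact: mpow_z]. Qed.
Lemma homog_sum (T : finType) (G : T -> R) : (forall t, homog (G t)) -> homog (\sum_t G t).
Proof.
by move=> H; elim/big_ind: _ => [j|r r'|t _] //; [rewrite coef0; exact: mpow_z|exact: homogD].
Qed.

Lemma homog_phi k l : homog (ph k l).
Proof.
have hv l' : homog ('X * (x l')%:P).
  move=> [|[|j]]; rewrite coefXM /=; [exact: mpow_z| |].
    by rewrite coefC; exact: mpow_vr.
  by rewrite coefC; exact: mpow_z.
elim: k l => [|k IH] l /=; case: ifP => // _; first by move=> j; rewrite coef0; exact: mpow_z.
by apply: homog_sum => a; apply: homog_sum => b; do !apply: homogM => //; exact: homogC.
Qed.

Lemma homog_at1 k r : homog r -> vanish k r -> mpow k r.[1].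
Proof.
move=> hr vr; rewrite horner_coef; apply: mpow_sum => j _; rewrite expr1n mulr1.
have [jk|kj] := ltnP j k; first by rewrite vr //; exact: mpow_z.
exact: mpow_le kj (hr j).
Qed.

Let Jk k p := exists2 j, gI j & mpow k (p - j).

Let Jk_ideal k : ideal (Jk k).
Proof.
split; first by exists 0; [case: gI_ideal|rewrite subr0; exact: mpow_z].
move=> a u v [j gj mj] [j' gj' mj']; exists (a * j + j'); first exact: gI_ideal.2.
have -> : a * u + v - (a * j + j') = a * (u - j) + (v - j') by ring.
exact: (mpow_ideal K D k).2.
Qed.

Let JkM k y u : mpow 1 y -> Jk k u -> Jk k.+1 (y * u).
Proof.
move=> my [j gj mj]; exists (y * j); first by apply: idM => //; exact: gI_ideal.
by rewrite -mulrBr; exact: (mpowM (a := 1)).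
Qed.

(** Modulo the [gl] the coordinates satisfy the recursion that defines the arc, so the truncations
    at t = 1 approximate them to growing order. *)
Let phi_congr k l : (l < D)%N -> Jk k.+1 (x l - (ph k l).[1]).
Proof.
have lo k' l' : (l' < h)%N -> Jk k'.+1 (x l' - (ph k' l').[1]).
  move=> lh; rewrite phi_lo // mulrC hornerMX mulr1 hornerC subrr; by case: (Jk_ideal k'.+1).
have m1 k' l' : mpow 1 (ph k' l').[1] by apply: homog_at1; [exact: homog_phi|exact: phi_v1].
elim: k l => [|k IH] l lD; have [lh|hl] := ltnP l h; [exact: lo| |exact: lo|].
  exists 0; first by case: gI_ideal.
  rewrite subr0; apply: (idB (mpow_ideal K D 1)) => //; exact: mpow_vr.
have -> : x l - (ph k.+1 l).[1] = gl l + (qf (cst K D) l x - qf (cst K D) l (fun a => (ph k a).[1])).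
  rewrite phi_hi // -[X in _ = _ + (_ - X)](@qf_cmp _ _ kR (cst K D) (horner_eval (1 : B) : {rmorphism R -> B}) l (ph k)) //.
    by rewrite /gl addrA subrK.
  by move=> k'; rewrite /= /horner_eval hornerC.
apply: idD => //; first by exists (gl l); [apply: gI_gl; rewrite hl|rewrite subrr; exact: mpow_z].
by apply: (@qf_congr B _ _ _ _ (Jk k.+2) (Jk_ideal k.+2)) => // a b aD bD; apply: JkM => //; [exact: mpow_vr|exact: IH|exact: IH].
Qed.

(** An element of the arc ideal lies in (g) + m^k for every k, m being the ideal of the origin;
    Krull's theorem puts it in (g) up to the factor 1 - e, which is 1 at the origin. *)
Lemma arc_krull p : arc_ideal x p -> exists2 e, mpow 1 e & gI (p - e * p).
Proof.
move=> hp; apply: krull_intersection => [|k]; first exact: gI_ideal.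
suff : Jk k.+1 p by case=> j gj mj; exists j => //; apply: mpow_le mj.
have E : (ev kR D (ph k) p).[1] = ev (cst K D) D (fun l => (ph k l).[1]) p.
  apply: (@ev_cmp K _ _ kR (cst K D) (horner_eval (1 : B) : {rmorphism R -> B})) => // k'.
  by rewrite /= /horner_eval hornerC.
have h1 : Jk k.+1 (p - (ev kR D (ph k) p).[1]).
  rewrite E -{1}(ev_id p); apply: ev_congr => // l lD; exact: phi_congr.
have h2 : Jk k.+1 (ev kR D (ph k) p).[1].
  exists 0; first by case: gI_ideal.
  rewrite subr0; apply: homog_at1; last exact: arc_vanish.
  move: p {hp E h1}; apply: itp_ind => [k'|l lD|p q e1 e2|p q e1 e2].
  - by rewrite ev_cst; exact: homogC.
  - by rewrite ev_vr //; exact: homog_phi.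
  - by rewrite rmorphD; exact: homogD.
  - by rewrite rmorphM; exact: homogM.
by rewrite -(subrK (ev kR D (ph k) p).[1] p); apply: idD.
Qed.
End Generic.
End Arcs.

(** * Charts of quiver Grassmannians *)

Lemma coord_linear (K : fieldType) (W : vectType K) n (X : n.-tuple W) j :
  linear (fun v => coord X j v : K^o).
Proof. by move=> a u v; rewrite linearP. Qed.
Definition coordH (K : fieldType) (W : vectType K) n (X : n.-tuple W) j : 'Hom(W, K^o) :=
  mkhom (@coord_linear K W n X j).

(** For the kernel of [dlt], the first coordinates become the tangent directions. Indices in nat
    avoid casts between ordinals of equal dimensions. *)
Lemma adapted_basis (K : fieldType) (W : vectType K) (L : {vspace W}) :
  exists (w : nat -> W) (k : nat -> 'Hom(W, K^o)),
  [/\ forall v, v = \sum_(j < \dim {: W}) k j v *: w j,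
      forall i j, (i < \dim {: W})%N -> (j < \dim {: W})%N -> k j (w i) = (i == j)%:R,
      forall l, (l < \dim L)%N -> w l \in L
    & forall l v, (\dim L <= l)%N -> (l < \dim {: W})%N -> v \in L -> k l v = 0].
Proof.
pose X := vbasis L ++ vbasis (L^C)%VS.
have bX : basis_of fullv X.
  by rewrite -(addv_complf L); apply: cat_basis; rewrite ?vbasisP //; apply/directv_addP; exact: capv_compl.
have sX : size X = \dim {: W} by rewrite (size_basis (bX : basis_of fullv (in_tuple X))).
have fX : free X by case/andP: bX.
pose k l : 'Hom(W, K^o) := if insub l is Some l' then coordH (in_tuple X) l' else 0.
have kE l v (ln : (l < size X)%N) : k l v = coord (in_tuple X) (Ordinal ln) v.
  by rewrite /k insubT mkhomE.
have kX i j : (i < \dim {: W})%N -> (j < \dim {: W})%N -> k j (X`_i) = (i == j)%:R.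
  rewrite -sX => iD jD; rewrite kE.
  by have := coord_free (X := in_tuple X) (Ordinal iD) (Ordinal jD) fX.
exists (fun l => X`_l), k; split=> //.
- move=> v; rewrite {1}(coord_basis (bX : basis_of fullv (in_tuple X)) (memvf v)) -sX.
  by apply: eq_bigr => j _; rewrite (kE j _ (ltn_ord j)); congr (coord _ _ _ *: _); apply/val_inj.
- by move=> l lL; rewrite nth_cat size_tuple lL; apply: vbasis_mem; rewrite mem_nth ?size_tuple.
- move=> l v hl lD vL; rewrite (coord_vbasis vL) linear_sum; apply: big1 => j _.
  have jL := ltn_ord j.
  have -> : (vbasis L)`_j = X`_j by rewrite nth_cat size_tuple jL.
  have z : k l (X`_j) = 0.
    by rewrite kX ?(leq_trans jL) ?(leq_trans hl (ltnW lD)) // ltn_eqF //; lia.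
  by apply: etrans (lfZ _ _ _) _; rewrite z scaler0.
Qed.

Section PolyFun.
Variables (K : fieldType) (Th : Type) (Pf : (Th -> K) -> Prop).
Hypothesis PfC : forall c, Pf (fun=> c).
Hypothesis PfD : forall F G, Pf F -> Pf G -> Pf (fun t => F t + G t).
Hypothesis PfM : forall F G, Pf F -> Pf G -> Pf (fun t => F t * G t).

Lemma Pf_sum (I : Type) (r : seq I) (P : pred I) (F : I -> Th -> K) : (forall i, Pf (F i)) ->
  Pf (fun t => \sum_(i <- r | P i) F i t).
Proof.
move=> H; elim: r => [|i r IH].
  by rewrite (_ : (fun _ => _) = (fun=> 0)) //; apply/funext => t; rewrite big_nil.
case Pi : (P i); last by rewrite (_ : (fun _ => _) = (fun t => \sum_(i <- r | P i) F i t)) //; apply/funext => t; rewrite big_cons Pi.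
rewrite (_ : (fun _ => _) = (fun t => F i t + \sum_(i <- r | P i) F i t)); first exact: PfD.
by apply/funext => t; rewrite big_cons Pi.
Qed.

Lemma Pf_prod (I : Type) (r : seq I) (P : pred I) (F : I -> Th -> K) : (forall i, Pf (F i)) ->
  Pf (fun t => \prod_(i <- r | P i) F i t).
Proof.
move=> H; elim: r => [|i r IH].
  by rewrite (_ : (fun _ => _) = (fun=> 1)) //; apply/funext => t; rewrite big_nil.
case Pi : (P i); last by rewrite (_ : (fun _ => _) = (fun t => \prod_(i <- r | P i) F i t)) //; apply/funext => t; rewrite big_cons Pi.
rewrite (_ : (fun _ => _) = (fun t => F i t * \prod_(i <- r | P i) F i t)); first exact: PfM.
by apply/funext => t; rewrite big_cons Pi.
Qed.

Lemma Pf_exp F n : Pf F -> Pf (fun t => F t ^+ n).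
Proof.
move=> h; elim: n => [|n IH]; first by rewrite (_ : (fun _ => _) = (fun=> 1)).
rewrite (_ : (fun _ => _) = (fun t => F t * F t ^+ n)); first exact: PfM.
by apply/funext => t; rewrite exprS.
Qed.

Lemma Pf_det n (A : Th -> 'M[K]_n) : (forall i j, Pf (fun t => A t i j)) -> Pf (fun t => \det (A t)).
Proof. by move=> H; apply: Pf_sum => s; apply: PfM => //; apply: Pf_prod => i. Qed.

(** Testing with all functionals avoids a choice of bases. *)
Definition vPf (W : vectType K) (F : Th -> W) := forall la : 'Hom(W, K^o), Pf (fun t => la (F t)).

Lemma vPf_cst (W : vectType K) (w : W) : vPf (fun=> w).
Proof. by move=> la; exact: PfC. Qed.
Lemma vPfD (W : vectType K) (F G : Th -> W) : vPf F -> vPf G -> vPf (fun t => F t + G t).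
Proof.
move=> h1 h2 la; rewrite (_ : (fun _ => _) = (fun t => la (F t) + la (G t))); first exact: PfD.
by apply/funext => t; rewrite lfD.
Qed.
Lemma vPfZ (W : vectType K) (a : Th -> K) (F : Th -> W) : Pf a -> vPf F -> vPf (fun t => a t *: F t).
Proof.
move=> h1 h2 la; rewrite (_ : (fun _ => _) = (fun t => a t * la (F t))); first exact: PfM.
by apply/funext => t; rewrite lfZ.
Qed.
Lemma vPf_sum (W : vectType K) (I : Type) (r : seq I) (F : I -> Th -> W) : (forall i, vPf (F i)) ->
  vPf (fun t => \sum_(i <- r) F i t).
Proof.
move=> H la; rewrite (_ : (fun _ => _) = (fun t => \sum_(i <- r) la (F i t))).
  by apply: Pf_sum => i; exact: H.
by apply/funext => t; rewrite linear_sum.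
Qed.
Lemma vPf_lin (W W' : vectType K) (L : 'Hom(W, W')) (F : Th -> W) : vPf F -> vPf (fun t => L (F t)).
Proof.
move=> h la; rewrite (_ : (fun _ => _) = (fun t => (la \o L)%VF (F t))); first exact: h.
by apply/funext => t; rewrite comp_lfunE.
Qed.
Lemma vPf_fam (I : finType) (V : I -> vectType K) (F : Th -> fam V) : (forall i, vPf (fun t => F t i)) -> vPf F.
Proof.
move=> H; rewrite (_ : F = (fun t => \sum_i mkhom (@place_linear K I V i) (F t i))).
  by apply: vPf_sum => i; apply: vPf_lin; exact: H.
apply/funext => t; apply/famP => i; rewrite fam_sum (bigD1 i) // big1.
  by rewrite mkhomE place_eq; exact: (esym (addr0 _)).
by move=> j /= ji; rewrite mkhomE place_neq.
Qed.
End PolyFun.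

Section Frames.
Variables (K : fieldType) (Q : quiver) (M : rep K Q) (e : vertex Q -> nat).
Local Notation frame := (@frame K Q M e).
Local Notation frame_poly := (@frame_poly K Q M e).
Local Notation frame_eval := (@frame_eval K Q M e).

Definition fpf (F : frame -> K) := exists p, forall b, frame_eval p b = F b.
Lemma fpfC c : fpf (fun=> c).
Proof. by exists (mpoly.mpolyC _ c) => b; rewrite /frame_eval mpoly.mevalC. Qed.
Lemma fpfD F G : fpf F -> fpf G -> fpf (fun t => F t + G t).
Proof. by move=> [p hp] [q hq]; exists (p + q) => b; rewrite /frame_eval mpoly.mevalD -hp -hq. Qed.
Lemma fpfM F G : fpf F -> fpf G -> fpf (fun t => F t * G t).
Proof. by move=> [p hp] [q hq]; exists (p * q) => b; rewrite /frame_eval mpoly.mevalM -hp -hq. Qed.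

Lemma fpf_entry (x : entry M e) : fpf (fun b => frame_entry b x).
Proof.
by exists (mpoly.mpolyX K (mpoly.mnm1 (enum_rank x))) => b; rewrite /frame_eval mpoly.mevalXU enum_rankK.
Qed.

Lemma fpf_vec i (j : 'I_(e i)) : vPf fpf (fun b : frame => tnth (b i) j).
Proof.
rewrite (_ : (fun _ => _) = (fun b => \sum_(l < dimvec M i)
   frame_entry b (existT _ i (j, l) : entry M e) *: (vbasis {: M i})`_l)).
  apply: (vPf_sum fpfC fpfD) => l; apply: (vPfZ fpfM); first exact: fpf_entry.
  exact: (vPf_cst fpfC).
apply/funext => b; exact: coord_vbasis (memvf _).
Qed.

Section Points.
Variable D : nat.
Definition ppf (F : (nat -> K) -> K) := exists q : itp K D, forall x, pt D x q = F x.
Lemma ppfC c : ppf (fun=> c).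
Proof. by exists (cst K D c) => x; exact: pt_cst. Qed.
Lemma ppfD F G : ppf F -> ppf G -> ppf (fun t => F t + G t).
Proof. by move=> [p hp] [q hq]; exists (p + q) => b; rewrite rmorphD; congr (_ + _). Qed.
Lemma ppfM F G : ppf F -> ppf G -> ppf (fun t => F t * G t).
Proof. by move=> [p hp] [q hq]; exists (p * q) => b; rewrite rmorphM; congr (_ * _). Qed.
Lemma ppf_var l : (l < D)%N -> ppf (fun x => x l).
Proof. by move=> lD; exists (vr K D l) => x; exact: pt_vr. Qed.

Lemma ppf_pull (B : (nat -> K) -> frame) : (forall i j, vPf ppf (fun x => tnth (B x i) j)) ->
  forall p, ppf (fun x => frame_eval p (B x)).
Proof.
move=> H p.
rewrite (_ : (fun _ => _) = (fun x => \sum_(m <- mpoly.msupp p) mpoly.mcoeff m p *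
   \prod_i frame_entry (B x) (enum_val i) ^+ mpoly.fun_of_multinom m i)); last first.
  by apply/funext => x; rewrite /frame_eval mpoly.mevalE.
apply: (Pf_sum ppfC ppfD) => m; apply: ppfM; first exact: ppfC.
apply: (Pf_prod ppfC ppfM) => i; apply: (Pf_exp ppfC ppfM).
have := H (tag (enum_val i)) (tagged (enum_val i)).1 (coordH (vbasis {: M (tag (enum_val i))}) (tagged (enum_val i)).2).
by rewrite (_ : (fun _ => _) = (fun x => frame_entry (B x) (enum_val i))) //; apply/funext => x; rewrite mkhomE.
Qed.
End Points.
End Frames.

Lemma vsval0 (K : fieldType) (V : vectType K) (U : {vspace V}) : vsval (0 : subvs_of U) = 0.
Proof. exact: raddf0. Qed.

Section Projection.
Variables (K : fieldType) (V : vectType K) (U : {vspace V}).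

Fact prk_linear : linear (fun v => vsproj U (v - vsval (prjv U v))).
Proof.
move=> a u v; rewrite -linearP; congr (vsproj U _).
have -> : vsval (prjv U (a *: u + v)) = a *: vsval (prjv U u) + vsval (prjv U v).
  by rewrite lfD lfZ.
by rewrite scalerBr opprD addrACA.
Qed.
Definition prk : 'Hom(V, subvs_of U) := mkhom prk_linear.

Lemma prkE v : vsval (prk v) = v - vsval (prjv U v).
Proof. by rewrite /prk mkhomE vsprojK //; exact: prjv_dec. Qed.

Lemma prk_dec v : v = vsval (prk v) + vsval (prjv U v).
Proof. by rewrite prkE subrK. Qed.

Lemma prjv_val (u : subvs_of U) : prjv U (vsval u) = 0.
Proof. by apply/prjv_eq0; exact: subvsP. Qed.

Lemma prk_val (u : subvs_of U) : prk (vsval u) = u.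
Proof. by apply: val_inj; rewrite [LHS]prkE prjv_val vsval0 subr0. Qed.

Lemma prk_compl (c : subvs_of (U^C)%VS) : prk (vsval c) = 0.
Proof. by apply: val_inj; rewrite [LHS]prkE prjv_section subrr. Qed.
End Projection.

Section Chart.
Variables (K : fieldType) (Q : quiver) (M : rep K Q) (e : vertex Q -> nat).
Local Notation T := (qGr M e).
Local Notation frame := (@frame K Q M e).
Local Notation frame_poly := (@frame_poly K Q M e).
Local Notation frame_eval := (@frame_eval K Q M e).

(* The chart at y consists of the graphs of the families f from y to M / y, which are
   subrepresentations exactly when f solves a quadratic equation with linear part dlt.
   In coordinates adapted to the kernel of dlt the equations of index at least chom
   read x_l = q_l(x). *)
Record chart (y : T) := Chart {
  cU : T -> Prop;
  cco : T -> nat -> K;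
  cfr : (nat -> K) -> frame;
  cc : nat -> nat -> nat -> K;
  cden : frame_poly;
  cnum : nat -> frame_poly;
  cdim : nat;
  chom := hom (rep_of y) (quo y);
  c_le : (chom <= cdim)%N;
  c_fr : forall V : T, cU V -> frame_of V (cfr (cco V));
  c_pull : forall p, exists q : itp K cdim, forall x, pt cdim x q = frame_eval p (cfr x);
  c_den : forall (V : T) b, frame_of V b -> (cU V <-> frame_eval cden b <> 0);
  c_num : forall (V : T) b l, frame_of V b -> cU V -> (l < cdim)%N ->
    cco V l * frame_eval cden b = frame_eval (cnum l) b;
  c_eq : forall V l, cU V -> (chom <= l < cdim)%N -> cco V l = qf cdim cc (idK K) l (cco V);
  c_ex : ext (rep_of y) (quo y) = 0%N -> forall x,
    (forall l, (chom <= l < cdim)%N -> x l = qf cdim cc (idK K) l x) ->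
    exists2 V, cU V & forall l, (l < cdim)%N -> cco V l = x l;
  c_pt : cU y;
  c_pt0 : forall l, cco y l = 0 }.

Variable y : T.
Local Notation X := (rep_of y).
Local Notation Y := (quo y).
Local Notation pr i := (prjv (y i)).
Local Notation pk i := (prk (y i)).

Definition isgraph (V : T) (f : C0 X Y) := forall i v, v \in V i <-> pr i v = f i (pk i v).

Lemma graph_val (f : C0 X Y) i (n : X i) :
  pk i (vsval n + vsval (f i n)) = n /\ pr i (vsval n + vsval (f i n)) = f i n.
Proof. by rewrite !lfD prk_val prk_compl addr0 prjv_val prjv_section add0r. Qed.

Lemma graph_mem V f i n : isgraph V f -> vsval n + vsval (f i n) \in V i.
Proof. by move=> H; apply/H; have [-> ->] := graph_val f n. Qed.

Lemma graph_dec V (f : C0 X Y) i v : isgraph V f -> v \in V i ->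
  v = vsval (pk i v) + vsval (f i (pk i v)).
Proof. by move=> H vV; rewrite {1}(prk_dec (y i) v) ((H i v).1 vV). Qed.

Lemma graph_uniq V f g : isgraph V f -> isgraph V g -> f = g.
Proof.
move=> hf hg; apply: C0P => i n; have := (hg i _).1 (graph_mem n hf).
by have [-> ->] := graph_val f n.
Qed.

(** Of the four blocks of an arrow, the one from the complement back to y does not enter [dlt];
    between g and f it gives the quadratic term. *)
Definition quad (f g : C0 X Y) : C1 X Y :=
  fun a => (f (tgt a) \o pk (tgt a) \o rep_map M a \o linfun vsval \o g (src a))%VF.

Lemma quadE f g a n : quad f g a n = f (tgt a) (pk (tgt a) (rep_map M a (vsval (g (src a) n)))).
Proof. by rewrite /quad 4!comp_lfunE; congr (f _ (prk _ (rep_map M a _))); exact: lfunE. Qed.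

Lemma graph_stable (f : C0 X Y) : dlt X Y f = quad f f <-> forall a (n : X (src a)),
  pr (tgt a) (rep_map M a (vsval n + vsval (f (src a) n))) =
  f (tgt a) (pk (tgt a) (rep_map M a (vsval n + vsval (f (src a) n)))).
Proof.
have E a n : dlt X Y f a n - quad f f a n =
    pr (tgt a) (rep_map M a (vsval n + vsval (f (src a) n))) -
    f (tgt a) (pk (tgt a) (rep_map M a (vsval n + vsval (f (src a) n)))).
  have yn : rep_map M a (vsval n) \in y (tgt a) by apply: sub_stableE; exact: subvsP.
  have e1 : pr (tgt a) (rep_map M a (vsval n)) = 0 by apply/prjv_eq0.
  have e2 : pk (tgt a) (rep_map M a (vsval n)) = rep_map X a n.
    apply: val_inj; rewrite [LHS]prkE e1 vsval0 subr0.
    by have := @isHom_incl K Q M y a n; rewrite !inclE.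
  rewrite !lfD e1 e2 add0r dltE quo_map quadE opprD addrA; by [].
split=> [h a n|h].
  by apply/eqP; rewrite -subr_eq0 -E h subrr.
by apply: C1P => a n; apply/eqP; rewrite -subr_eq0 E h subrr.
Qed.

Lemma graph_eq V f : isgraph V f -> dlt X Y f = quad f f.
Proof. by move=> H; apply/graph_stable => a n; apply/H; apply: sub_stableE; exact: graph_mem. Qed.

Lemma graph_ex f : dlt X Y f = quad f f -> exists V, isgraph V f.
Proof.
move=> /graph_stable H.
pose g i : 'Hom(M i, Y i) := (f i \o pk i)%VF.
pose L i : 'Hom(M i, Y i) := (pr i : 'Hom(M i, Y i)) - g i.
have LE i v : L i v = pr i v - f i (pk i v).
  by rewrite /L add_lfunE opp_lfunE; congr (_ - _); rewrite /g comp_lfunE.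
have mem i v : v \in lker (L i) <-> pr i v = f i (pk i v).
  by rewrite memv_ker LE subr_eq0; split=> /eqP.
have st a x : x \in lker (L (src a)) -> rep_map M a x \in lker (L (tgt a)).
  move=> /mem hx; apply/mem; have := H a (pk (src a) x); rewrite -hx -prk_dec; by [].
pose V0 := @mkSub K Q M (fun i => lker (L i)) st.
have dV i : \dim (V0 i) = e i.
  have := limg_ker_dim (L i) fullv; rewrite capfv.
  have -> : limg (L i) = fullv.
    apply/limg_fullP => w; exists (vsval w).
    by rewrite LE prjv_section prk_compl lf0 subr0.
  have -> : \dim {: Y i} = \dim (y i)^C%VS by rewrite dimvf.
  rewrite dimv_compl (qGr_dim y i) => h; have := dimvS (subvf (y i)); rewrite (qGr_dim y i) => h2.
  by move: h h2; rewrite /V0; move: (\dim _) (\dim _) => ? ?; lia.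
by exists (QGr dV) => i v; exact: mem.
Qed.

Lemma frame_gen (V : T) b i v : frame_of V b -> v \in V i ->
  exists a : 'I_(e i) -> K, v = \sum_j a j *: tnth (b i) j.
Proof.
move=> hb vV; exists (fun j => coord (b i) j v); rewrite {1}(coord_basis (hb i) vV).
by apply: eq_bigr => j _; rewrite (tnth_nth 0).
Qed.

Lemma frame_free (V : T) b i (a : 'I_(e i) -> K) : frame_of V b ->
  \sum_j a j *: tnth (b i) j = 0 -> forall j, a j = 0.
Proof.
move=> hb h; have /andP[_ /freeP F] := hb i; apply: F; rewrite -[RHS]h.
by apply: eq_bigr => j _; rewrite (tnth_nth 0).
Qed.

Lemma frame_mem (V : T) b i j : frame_of V b -> tnth (b i) j \in V i.
Proof. by move=> hb; apply: (basis_mem (hb i)); exact: mem_tnth. Qed.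

Section Coordinates.
Variables (nb : forall i, nat -> X i) (nk : forall i, nat -> 'Hom(X i, K^o)).
Hypothesis nb_gen : forall i v, v = \sum_(j < e i) nk i j v *: nb i j.

Fact hm_linear i k (z : Y i) : linear (fun n : X i => (nk i k n : K) *: z).
Proof. by move=> a u v; rewrite lfD lfZ scalerDl -scalerA. Qed.
Definition hm i k z : 'Hom(X i, Y i) := mkhom (@hm_linear i k z).
Fact hmz_linear i k : linear (fun z : Y i => hm k z).
Proof.
move=> a u v; apply/lfunP => n; rewrite add_lfunE scale_lfunE !mkhomE.
by rewrite scalerDr !scalerA mulrC.
Qed.
Definition hmz i k : 'Hom(Y i, 'Hom(X i, Y i)) := mkhom (@hmz_linear i k).
Lemma hmzE i k z n : hmz i k z n = (nk i k n : K) *: z.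
Proof. by rewrite /hmz (mkhomE (@hmz_linear i k)) /hm mkhomE. Qed.

Definition fmat (b : frame) i : 'M[K]_(e i) := \matrix_(j, k) nk i k (pk i (tnth (b i) j)).
Definition fden (b : frame) := \prod_i \det (fmat b i).
(** Cramer's rule: if b is a frame of the graph of f, the inverse of [fmat] recovers f from b. The
    determinants at the other vertices are multiplied in to have one denominator [fden]. *)
Definition fnum (b : frame) : C0 X Y := fun i => \sum_(k < e i) \sum_(j < e i)
  ((\adj (fmat b i)) k j * \prod_(i' | i' != i) \det (fmat b i')) *: hmz i k (pr i (tnth (b i) j)).

Lemma fmat_pk b i j : pk i (tnth (b i) j) = \sum_(k < e i) fmat b i j k *: nb i k.
Proof. by rewrite {1}(nb_gen (pk i (tnth (b i) j))); apply: eq_bigr => k _; rewrite mxE. Qed.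

Lemma fnumE b i n : fnum b i n = \sum_(k < e i) \sum_(j < e i)
  ((\adj (fmat b i)) k j * \prod_(i' | i' != i) \det (fmat b i') * (nk i k n : K)) *: pr i (tnth (b i) j).
Proof.
rewrite /fnum sum_lfunE; apply: eq_bigr => k _; rewrite sum_lfunE; apply: eq_bigr => j _.
by rewrite scale_lfunE hmzE scalerA.
Qed.

Lemma fden_split b i : fden b = \det (fmat b i) * \prod_(i' | i' != i) \det (fmat b i').
Proof. by rewrite /fden (bigD1 i). Qed.

Lemma fnum_graph V f b : isgraph V f -> frame_of V b -> fnum b = fden b *: f.
Proof.
move=> hf hb; apply: C0P => i n; rewrite scaleFE fnumE; set P := \prod_(_ | _) _.
have pb j : pr i (tnth (b i) j) = \sum_(m < e i) fmat b i j m *: f i (nb i m).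
  rewrite ((hf i _).1 (frame_mem j hb)) fmat_pk linear_sum; apply: eq_bigr => m _; exact: lfZ.
transitivity (\sum_(k < e i) \sum_(m < e i) (P * (nk i k n : K) * (\adj (fmat b i) *m fmat b i) k m) *: f i (nb i m)).
  apply: eq_bigr => k _.
  rewrite (eq_bigr (fun j => \sum_(m < e i) ((\adj (fmat b i)) k j * P * (nk i k n : K) * fmat b i j m) *: f i (nb i m))).
    rewrite exchange_big; apply: eq_bigr => m _; rewrite -scaler_suml; congr (_ *: _).
    by rewrite mxE mulr_sumr; apply: eq_bigr => j _; ring.
  by move=> j _; rewrite pb scaler_sumr; apply: eq_bigr => m _; rewrite scalerA.
rewrite {2}(nb_gen n) linear_sum scaler_sumr; apply: eq_bigr => k _.
rewrite (bigD1 k) // big1; last first.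
  by move=> m mk; rewrite mul_adj_mx mxE eq_sym (negPf mk) mulr0n mulr0 scale0r.
rewrite mul_adj_mx mxE eqxx mulr1n (fden_split b i) -/P.
apply: etrans (addr0 _) _; apply: etrans (esym (congr1 _ (lfZ _ _ _))); rewrite scalerA; congr (_ *: _); ring.
Qed.

Lemma graph_den V f b : isgraph V f -> frame_of V b -> fden b != 0.
Proof.
move=> hf hb; apply/prodf_neq0 => i _; apply/negP => /det0P[u u0 uA].
case/eqP: u0; apply/rowP => j; rewrite mxE.
apply: (frame_free (b := b) (i := i) hb (a := fun j => u 0 j)).
set v := \sum_j _; have vV : v \in V i.
  by apply: memv_suml => m _; apply: memvZ; exact: frame_mem hb.
have pv : pk i v = 0.
  rewrite linear_sum (eq_bigr (fun m => \sum_(k < e i) (u 0 m * fmat b i m k) *: nb i k)).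
    rewrite exchange_big big1 // => k _; rewrite -scaler_suml.
    by have := congr1 (fun B : 'rV_(e i) => B 0 k) uA; rewrite !mxE => ->; rewrite scale0r.
  by move=> m _; apply: etrans (lfZ _ _ _) _; rewrite fmat_pk scaler_sumr; apply: eq_bigr => k _; rewrite scalerA.
by rewrite (prk_dec (y i) v) ((hf i v).1 vV) pv lf0 vsval0 addr0.
Qed.

Lemma den_graph (V : T) b : frame_of V b -> fden b != 0 -> exists f, isgraph V f.
Proof.
move=> hb d0; pose f : C0 X Y := (fden b)^-1 *: fnum b; exists f.
have fb i j : f i (pk i (tnth (b i) j)) = pr i (tnth (b i) j).
  rewrite /f scaleFE fnumE exchange_big; set P := \prod_(_ | _) _.
  rewrite (eq_bigr (fun l => (P * (fmat b i *m \adj (fmat b i)) j l) *: pr i (tnth (b i) l))); last first.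
    move=> l _; rewrite -scaler_suml mxE mulr_sumr; congr (_ *: _); apply: eq_bigr => k _.
    by rewrite [fmat b i j k]mxE; ring.
  rewrite (bigD1 j) // big1; last first.
    by move=> l lj; rewrite mul_mx_adj mxE eq_sym (negPf lj) mulr0n mulr0 scale0r.
  rewrite mul_mx_adj mxE eqxx mulr1n.
  have -> : P * \det (fmat b i) = fden b by rewrite (fden_split b i) mulrC.
  apply: etrans (congr1 _ (addr0 _)) _; by rewrite scalerA mulVf // scale1r.
have fV i (a : 'I_(e i) -> K) : pr i (\sum_j a j *: tnth (b i) j) = f i (pk i (\sum_j a j *: tnth (b i) j)).
  rewrite !linear_sum; apply: eq_bigr => j _.
  by rewrite [LHS]lfZ; apply: esym; apply: etrans (congr1 (f i) (lfZ _ _ _)) _; rewrite [LHS]lfZ fb.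
move=> i v; split=> [/(frame_gen hb)[a ->] //|hv].
have di : \det (fmat b i) != 0 by move/prodf_neq0: d0; apply.
pose r : 'rV[K]_(e i) := \row_k (nk i k (pk i v) : K).
pose a j := (r *m invmx (fmat b i)) 0 j.
pose v' := \sum_j a j *: tnth (b i) j.
have pE : pk i v' = pk i v.
  rewrite linear_sum (eq_bigr (fun m => \sum_(k < e i) (a m * fmat b i m k) *: nb i k)).
    rewrite exchange_big [RHS](nb_gen (pk i v)); apply: eq_bigr => k _; rewrite -scaler_suml; congr (_ *: _).
    have uA : fmat b i \in unitmx by rewrite unitmxE unitfE.
    by have := congr1 (fun B : 'rV_(e i) => B 0 k) (mulmxKV uA r); rewrite mxE => ->; rewrite mxE.
  by move=> m _; apply: etrans (lfZ _ _ _) _; rewrite fmat_pk scaler_sumr; apply: eq_bigr => k _; rewrite scalerA.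
have -> : v = v'.
  by rewrite (prk_dec (y i) v) (prk_dec (y i) v') pE fV pE hv.
by apply: memv_suml => m _; apply: memvZ; exact: frame_mem hb.
Qed.

Local Notation fpf := (@fpf K Q M e).

Lemma fpf_mat i j k : fpf (fun b => fmat b i j k).
Proof.
rewrite (_ : (fun _ => _) = (fun b => (nk i k \o pk i)%VF (tnth (b i) j))); first exact: fpf_vec.
by apply/funext => b; rewrite mxE comp_lfunE.
Qed.

Lemma fpf_den : fpf fden.
Proof.
apply: (Pf_prod (@fpfC K Q M e) (@fpfM K Q M e)) => i.
apply: (Pf_det (@fpfC K Q M e) (@fpfD K Q M e) (@fpfM K Q M e)) => j k; exact: fpf_mat.
Qed.

Lemma fpf_num : vPf fpf fnum.
Proof.
apply: (vPf_fam (@fpfC K Q M e) (@fpfD K Q M e)) => i.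
apply: (vPf_sum (@fpfC K Q M e) (@fpfD K Q M e)) => k.
apply: (vPf_sum (@fpfC K Q M e) (@fpfD K Q M e)) => j.
apply: (vPfZ (@fpfM K Q M e)).
  apply: fpfM.
    rewrite (_ : (fun _ => _) = (fun b => cofactor (fmat b i) j k)); last by apply/funext => b; rewrite mxE.
    apply: fpfM; first exact: fpfC.
    apply: (Pf_det (@fpfC K Q M e) (@fpfD K Q M e) (@fpfM K Q M e)) => j' k'.
    rewrite (_ : (fun _ => _) = (fun b => fmat b i (lift j j') (lift k k'))); first exact: fpf_mat.
    by apply/funext => b; rewrite !mxE.
  apply: (Pf_prod (@fpfC K Q M e) (@fpfM K Q M e)) => i'.
  apply: (Pf_det (@fpfC K Q M e) (@fpfD K Q M e) (@fpfM K Q M e)) => j' k'; exact: fpf_mat.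
do 2!apply: vPf_lin; exact: fpf_vec.
Qed.
End Coordinates.
End Chart.

Section ChartEx.
Variables (K : fieldType) (Q : quiver) (M : rep K Q) (e : vertex Q -> nat).
Local Notation T := (qGr M e).
Local Notation frame_eval := (@frame_eval K Q M e).
Variable y : T.
Local Notation X := (rep_of y).
Local Notation Y := (quo y).
Local Notation pr i := (prjv (y i)).
Local Notation pk i := (prk (y i)).

Fact quad_linearl g : linear (fun f : C0 X Y => quad f g).
Proof.
move=> a u v; apply: C1P => x n; rewrite addF1E scaleF1E !quadE; set t := prk _ _.
by rewrite famD famZ add_lfunE scale_lfunE.
Qed.
Fact quad_linearr f : linear (fun g : C0 X Y => quad f g).
Proof.
move=> a u v; apply: C1P => x n; rewrite addF1E scaleF1E !quadE.
rewrite famD famZ add_lfunE scale_lfunE linearP !lfD; congr (_ + _).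
by rewrite !lfZ.
Qed.

Fact graph_vec_linear i (n : X i) : linear (fun f : C0 X Y => vsval (f i n) : M i).
Proof. by move=> a u v; rewrite famD famZ add_lfunE scale_lfunE linearP. Qed.

Fact graph_map_linear (f : C0 X Y) i : linear (fun n : X i => vsval n + vsval (f i n) : M i).
Proof.
move=> a u v; rewrite lfD lfZ linearP [X in _ + X]linearP addrACA scalerDr; by [].
Qed.

Theorem chart_ex : inhabited (chart y).
Proof.
have dX i : \dim {: X i} = e i by rewrite -(qGr_dim y i) -(dim_rep_of y).
have [nb Hnb] : exists nb : forall i, (nat -> X i) * (nat -> 'Hom(X i, K^o)),
    forall i v, v = \sum_(j < e i) (nb i).2 j v *: (nb i).1 j.
  apply: (@dchoice _ _ (fun i (b : (nat -> X i) * (nat -> 'Hom(X i, K^o))) => forall v, v = \sum_(j < e i) b.2 j v *: b.1 j)) => i.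
  by have [w [k [h _ _ _]]] := adapted_basis {: X i}%VS; exists (w, k) => v; rewrite -(dX i); exact: h.
pose b1 i := (nb i).1; pose b2 i := (nb i).2.
have nb_gen i v : v = \sum_(j < e i) b2 i j v *: b1 i j by exact: Hnb.
pose L0 := lker (dlt X Y); set D := \dim {: C0 X Y}.
have [w [k [kg kd wL kL]]] := adapted_basis L0.
pose fx (x : nat -> K) : C0 X Y := \sum_(l < D) x l *: w l.
have kfx x l : (l < D)%N -> k l (fx x) = x l.
  move=> lD; rewrite linear_sum (bigD1 (Ordinal lD)) // big1.
    apply: etrans (addr0 _) _; apply: etrans (lfZ _ _ _) _.
    by rewrite kd // eqxx; exact: mulr1.
  move=> m ml; apply: etrans (lfZ _ _ _) _; rewrite kd // -[l]/(val (Ordinal lD)) (inj_eq val_inj) (negPf ml).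
  exact: scaler0.
pose bfr x : frame M e := fun i => [tuple vsval (b1 i j) + vsval (fx x i (b1 i j)) | j < e i].
have bfrE x i j : tnth (bfr x i) j = vsval (b1 i j) + vsval (fx x i (b1 i j)) by rewrite tnth_mktuple.
have [phi Hphi] : exists phi : T -> C0 X Y, forall V f, isgraph V f -> phi V = f.
  have /choice[phi Hp] : forall V : T, exists f : C0 X Y, forall g, isgraph V g -> f = g.
    move=> V; have [[f hf]|nf] := pselect (exists f, isgraph (y := y) V f).
      by exists f => g; exact: graph_uniq hf.
    by exists 0 => g hg; case: nf; exists g.
  by exists phi.
pose co V l : K := if (l < D)%N then k l (phi V) else 0.
have fxco V : fx (co V) = phi V.
  rewrite [RHS]kg; apply: eq_bigr => l _; by rewrite /co ltn_ord.
pose U V := exists f, isgraph (y := y) V f.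
have phiU V : U V -> isgraph V (phi V) by move=> [f hf]; rewrite (Hphi _ _ hf).
have [den Hden] := fpf_den b2.
have /choice[num Hnum] : forall l, exists p, forall b, frame_eval p b = k l (fnum b2 b).
  by move=> l; exact: (fpf_num b2 (k l)).
(* A linear partial inverse of [dlt]: applied to dlt f = quad f f, it expresses the coordinates
   outside the kernel by quadratic forms with coefficients c. *)
pose di := ((dlt X Y)^-1)%VF.
pose c l a b : K := k l (di (quad (w a) (w b))).
have dlim u : di (dlt X Y u) - u \in L0.
  apply/lkerP; rewrite lfB limg_lfunVK ?subrr //; exact: memv_img (memvf _).
have kdi l u : (\dim L0 <= l < D)%N -> k l (di (dlt X Y u)) = k l u.
  move=> /andP[hl lD]; apply/eqP; rewrite -subr_eq0 -lfB; apply/eqP; exact: kL.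
have qE x l : k l (di (quad (fx x) (fx x))) = qf D c (idK K) l x.
  have e1 : quad (fx x) (fx x) = \sum_(a < D) \sum_(b < D) (x a * x b) *: quad (w a) (w b).
    rewrite {1}/fx -[LHS](mkhomE (quad_linearl (fx x))) linear_sum; apply: eq_bigr => a _.
    apply: etrans (lfZ _ _ _) _; rewrite mkhomE -(mkhomE (quad_linearr (w a))) /fx linear_sum scaler_sumr.
    apply: eq_bigr => b _; apply: etrans (congr1 _ (lfZ _ _ _)) _; rewrite scalerA; congr (_ *: _).
    exact: mkhomE.
  rewrite e1 /qf !linear_sum; apply: eq_bigr => a _; rewrite !linear_sum; apply: eq_bigr => b _.
  apply: etrans (congr1 (k l) (lfZ di _ _)) _; apply: etrans (lfZ _ _ _) _.
  by rewrite /c /=; apply: etrans (mulrC _ _) _; rewrite mulrA.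
have Uden V b : frame_of V b -> U V <-> frame_eval den b <> 0.
  move=> hb; rewrite Hden; split=> [[f hf]|/eqP d0].
    by apply/eqP; exact: (graph_den nb_gen hf hb).
  exact: (den_graph nb_gen hb d0).
apply: inhabits; apply: (@Chart _ _ _ _ y U co bfr c den num D).
- by apply: dimvS; exact: subvf.
- move=> V /phiU gV i; rewrite basisEdim size_tuple (qGr_dim V i) leqnn andbT.
  apply/subvP => v vV; rewrite (graph_dec gV vV) -(mkhomE (graph_map_linear (phi V) (i := i))).
  rewrite (nb_gen i (pk i v)) linear_sum; apply: memv_suml => j _.
  have E : mkhom (graph_map_linear (phi V) (i := i)) (b2 i j (pk i v) *: b1 i j) =
      (b2 i j (pk i v) : K) *: tnth (bfr (co V) i) j.
    by apply: etrans (lfZ _ _ _) _; rewrite bfrE fxco mkhomE.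
  have h : (b2 i j (pk i v) : K) *: tnth (bfr (co V) i) j \in <<bfr (co V) i>>%VS.
    by apply: memvZ; apply: memv_span; exact: mem_tnth.
  by rewrite -E in h; exact: h.
- move=> p; apply: (@ppf_pull _ _ _ _ D bfr) => i j.
  rewrite (_ : (fun _ => _) = (fun x => vsval (b1 i j) + mkhom (graph_vec_linear (b1 i j)) (fx x))); last first.
    by apply/funext => x; rewrite bfrE mkhomE.
  apply: (vPfD (@ppfD K D)); first exact: (vPf_cst (@ppfC K D)).
  apply: vPf_lin; apply: (vPf_sum (@ppfC K D) (@ppfD K D)) => l.
  by apply: (vPfZ (@ppfM K D)); [exact: ppf_var|exact: (vPf_cst (@ppfC K D))].
- exact: Uden.
- move=> V b l hb /phiU gV lD; rewrite Hden Hnum (fnum_graph nb_gen gV hb) /co lD.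
  by rewrite lfZ; exact: mulrC.
- move=> V l /phiU gV hl; have lD : (l < D)%N by case/andP: hl.
  by rewrite -qE fxco -(graph_eq gV) kdi // /co lD.
(* When Ext is 0, dlt f - quad f f has a preimage under [dlt]. The equations of index at least
   [chom] say that this preimage lies in the kernel, so the difference is 0. *)
- move=> /ext0P e0 x hx.
  have z0 : dlt X Y (fx x) - quad (fx x) (fx x) = 0.
    set z := (_ - _); have zl : z \in limg (dlt X Y) by exact: e0.
    have uL : di z \in L0.
      rewrite (kg (di z)); apply: memv_suml => l _; have [lh|hl] := ltnP l (\dim L0).
        by apply: memvZ; exact: wL.
      have -> : k l (di z) = 0; last by rewrite scale0r mem0v.
      by rewrite /z !lfB qE kdi ?hl ?ltn_ord // kfx // -hx ?hl ?ltn_ord // subrr.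
    by rewrite -(limg_lfunVK zl); apply/lkerP.
  have [V gV] := graph_ex (subr0_eq z0); exists V; first by exists (fx x).
  by move=> l lD; rewrite /co lD (Hphi _ _ gV) kfx.
- exists 0 => i v; rewrite fam0 zero_lfunE; exact: iff_sym (prjv_eq0 _ _).
- move=> l; rewrite /co (Hphi y 0) ?lf0; first by case: ifP.
  by move=> i v; rewrite fam0 zero_lfunE; exact: iff_sym (prjv_eq0 _ _).
Qed.
End ChartEx.

(** * Dimension *)

Local Open Scope classical_set_scope.

Section Irreducible.
Variable T : topologicalType.
Implicit Types S U A B Z : set T.

Lemma irr_open S U A : irreducible S -> open U -> S `&` U !=set0 -> closed A ->
  S `&` U `<=` A -> S `<=` A.
Proof.
move=> [S0 iS] oU [x [Sx Ux]] cA sub.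
have cU : closed (~` U) by apply: open_closedC.
have : S `<=` A `|` ~` U.
  by move=> z Sz; have [Uz|nU] := pselect (U z); [left; exact: sub|right].
by case/(iS _ _ cA cU) => // /(_ x Sx).
Qed.

Lemma irr_cap_open S U : irreducible S -> open U -> S `&` U !=set0 -> irreducible (S `&` U).
Proof.
move=> iS oU h; split=> // A B cA cB sub.
have cU : closed (~` U) by apply: open_closedC.
have : S `<=` A `|` (B `|` ~` U).
  by move=> z Sz; have [Uz|nU] := pselect (U z); [case: (sub z (conj Sz Uz)); [left|right; left]|right; right].
case/(iS.2 _ _ cA (closedU cB cU)) => sub'; first by left; apply: subset_trans sub'; exact: subIsetl.
by right=> z [Sz Uz]; case: (sub' z Sz).
Qed.

Lemma closure_min S A : closed A -> S `<=` A -> closure S `<=` A.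
Proof. by move=> cA sub; rewrite (closure_id A).1 //; exact: closure_subset. Qed.

Lemma irr_closure S : irreducible S -> irreducible (closure S).
Proof.
move=> [[x Sx] iS]; split; first by exists x; exact: subset_closure.
move=> A B cA cB sub; have : S `<=` A `|` B by apply: subset_trans sub; exact: subset_closure.
by case/(iS _ _ cA cB) => h; [left|right]; exact: closure_min.
Qed.

Lemma has_chain_le S m n : (m <= n)%N -> has_chain S n -> has_chain S m.
Proof.
move=> mn [Z [h1 h2]]; exists Z; split=> j jm; [apply: h1|apply: h2]; exact: leq_trans jm mn.
Qed.

Lemma chain_mono S n (Z : nat -> set T) : (forall j, (j < n)%N -> Z j `&` S `<` Z j.+1 `&` S) ->
  forall j k, (j <= k)%N -> (k <= n)%N -> Z j `&` S `<=` Z k `&` S.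
Proof.
move=> H j k /subnK <-; elim: (k - j)%N => [|d IH] le; first exact: subset_refl.
by apply: subset_trans (IH (ltnW le)) _; case: (H (d + j)%N le).
Qed.

Lemma chain_top U n : has_chain U n -> exists S, [/\ irreducible S, S `<=` U & has_chain S n].
Proof.
move=> [Z [h1 h2]]; exists (Z n `&` U); split; [by case: (h1 n (leqnn n))|exact: subIsetr|].
have E j : (j <= n)%N -> Z j `&` (Z n `&` U) = Z j `&` U.
  move=> jn; apply/seteqP; split=> x [Zx]; first by case.
  by move=> Ux; split=> //; apply: (chain_mono h2 jn (leqnn n)).
exists Z; split=> j jn; first by have [c i] := h1 j jn; rewrite E.
by rewrite !E //; [exact: h2|exact: ltnW].
Qed.
End Irreducible.

Section Algebraic.
Variables (K : numFieldType) (D h : nat) (c : nat -> nat -> nat -> K).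
Hypothesis hD : (h <= D)%N.
Local Notation B := (itp K D).

(** The Jacobian determinant of the equations [gl] in the dependent coordinates; c is symmetrised
    because each product has two factors to differentiate. *)
Definition jacp : B := \det (\matrix_(l < D - h, m < D - h)
  ((l == m)%:R - \sum_(a < D) cst K D (c (h + l)%N a (h + m)%N + c (h + l)%N (h + m)%N a) * vr K D a)).

Lemma jacp_pt0 : pt D (fun=> 0) jacp = 1.
Proof.
rewrite /jacp -det_map_mx -[RHS](det1 K (D - h)); congr (\det _); apply/matrixP => l m; rewrite !mxE.
rewrite rmorphB rmorph_nat rmorph_sum big1 ?subr0 // => a _.
by rewrite rmorphM [X in _ * X]pt_vr // mulr0.
Qed.

Lemma trdeg_prime (P : B -> Prop) (E : fieldType) (f : {rmorphism B -> E}) : prime_ideal P ->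
  (forall x, f x = 0 <-> P x) -> (forall l, (h <= l < D)%N -> P (gl D c l)) -> ~ P jacp ->
  forall n (u : nat -> E),
    alg_indep (f \o cst K D : {rmorphism K -> E}) n u ->
    (forall j, (j < n)%N -> exists num den : B, f den <> 0 /\ u j * f den = f num) -> (n <= h)%N.
Proof.
move=> pP fP Pg nJ n u ui ur; pose i : {rmorphism K -> E} := f \o cst K D.
pose eta l := f (vr K D l).
have fE p : f p = ev i D eta p by rewrite -{1}(ev_id p); apply: ev_cmp.
have char0 m : m.+1%:R != 0 :> E.
  have -> : m.+1%:R = i m.+1%:R by rewrite rmorph_nat.
  by rewrite fmorph_eq0 pnatr_eq0.
apply: (@trdeg_bound K E i char0 D h c eta hD _ _ n u ui).
- move=> l hl; have lD : (l < D)%N by case/andP: hl.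
  have /fP := Pg l hl; rewrite fE ev_gl // => /subr0_eq; by [].
- apply/eqP => d0; apply: nJ; apply/fP; rewrite -[RHS]d0 /jacp -det_map_mx; congr (\det _).
  apply/matrixP => l m; rewrite !mxE rmorphB rmorph_nat rmorph_sum; congr (_ - _).
  by apply: eq_bigr => a _; rewrite rmorphM.
- by move=> j jn; have [num [den [d0 e]]] := ur j jn; exists num, den; rewrite -!fE.
Qed.

(** The arc ideal is finitely generated, so the factors 1 - e of [arc_krull] for its generators
    multiply to a single q. *)
Lemma arc_unit : exists q : B, pt D (fun=> 0) q = 1 /\
  forall p, arc_ideal h c (vr K D) p -> gI h c (q * p).
Proof.
have [s [sP Ps]] := @noeth_itp K D _ (let: And3 x _ _ := arc_prime h c (vr K D) in x).
have [q [q1 qs]] : exists q : B, pt D (fun=> 0) q = 1 /\ forall p, p \in s -> gI h c (q * p).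
  elim: s sP {Ps} => [|p s IH] sP; first by exists 1; rewrite rmorph1.
  have [q [q1 qs]] := IH (fun x xs => sP x (mem_behead (s := p :: s) xs)).
  have [e me ge] := arc_krull (sP p (mem_head _ _)).
  exists (q * (1 - e)); split.
    by rewrite rmorphM rmorphB rmorph1 [pt _ _ e](mpow1_pt me) subr0 mulr1.
  move=> x; rewrite inE => /orP[/eqP ->|xs].
    have -> : q * (1 - e) * p = q * (p - e * p) by ring.
    by apply: idM => //; exact: gI_ideal.
  have -> : q * (1 - e) * x = (1 - e) * (q * x) by ring.
  by apply: idM; [exact: gI_ideal|exact: qs].
exists q; split=> // p Pp; have hI := gI_ideal D h c.
apply: (@idspan_sub _ s (fun p => gI h c (q * p))) => //; last exact: Ps.
split=> [|a u v hu hv]; first by rewrite mulr0; case: hI.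
have -> : q * (a * u + v) = a * (q * u) + q * v by ring.
exact: hI.2.
Qed.
End Algebraic.

(** * The Zariski topology in a chart *)

Section ChartTopology.
Variables (K : numClosedFieldType) (Q : quiver) (M : rep K Q) (e : vertex Q -> nat).
Local Notation T := (qGr M e).
Local Notation frame_eval := (@frame_eval K Q M e).

Lemma closedE (Z : set T) : closed Z <-> zariski_closed Z.
Proof.
have -> : closed Z <-> open (~` Z) by split; [exact: closed_openC|move/open_closedC; rewrite setCK].
by rewrite -[open _]/(zariski_closed (~` ~` Z)) setCK.
Qed.

Lemma fevM p p' b : frame_eval (p * p') b = frame_eval p b * frame_eval p' b.
Proof. exact: mpoly.mevalM. Qed.

Section OneChart.
Variables (y : T) (C : chart y).
Local Notation D := (cdim C).
Local Notation U := (cU C).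
Local Notation co := (cco C).
Local Notation val V q := (pt D (co V) q).

Lemma chart_pull (q : itp K D) : exists k p, forall V b, frame_of V b -> U V ->
  frame_eval p b = frame_eval (cden C) b ^+ k * val V q.
Proof.
have evD p p' b : frame_eval (p + p') b = frame_eval p b + frame_eval p' b by exact: mpoly.mevalD.
have evX p k b : frame_eval (p ^+ k) b = frame_eval p b ^+ k.
  by elim: k => [|k IH]; [exact: mpoly.meval1|rewrite !exprS fevM IH].
move: q; apply: itp_ind => [a|l lD|q q' [k [p hp]] [k' [p' hp']]|q q' [k [p hp]] [k' [p' hp']]].
- exists 0%N, (mpoly.mpolyC _ a) => V b _ _; rewrite expr0 mul1r pt_cst; exact: mpoly.mevalC.
- exists 1%N, (cnum C l) => V b hb hU; rewrite expr1 pt_vr // mulrC; exact/esym/c_num.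
- exists (k + k')%N, (cden C ^+ k' * p + cden C ^+ k * p') => V b hb hU.
  by rewrite evD !fevM !evX (hp V b hb hU) (hp' V b hb hU) rmorphD exprD; ring.
- exists (k + k')%N, (p * p') => V b hb hU.
  by rewrite fevM (hp V b hb hU) (hp' V b hb hU) rmorphM exprD; ring.
Qed.

(** The complement of the chart is included, which makes the set closed in the whole
    Grassmannian. *)
Definition zset (q : itp K D) : set T := [set V | U V -> val V q = 0].

Lemma closed_zset q : closed (zset q).
Proof.
apply/closedE; have [k [p hp]] := chart_pull q.
(* The factor [cden C] makes the polynomial vanish off the chart, where p is not controlled. *)
exists [set cden C * p] => V b hb; split=> [hV _ ->|/(_ _ erefl)].
  rewrite fevM; have [->|d0] := eqVneq (frame_eval (cden C) b) 0; first by rewrite mul0r.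
  have hU : U V by apply/(c_den C hb)/eqP.
  by rewrite (hp V b hb hU) hV // !mulr0.
rewrite fevM => h hU; have d0 := (c_den C hb).1 hU.
move: h; rewrite (hp V b hb hU) => /eqP; rewrite !mulf_eq0 expf_eq0.
by move/eqP/negPf: d0 => ->; rewrite andbF /= => /eqP.
Qed.

Arguments closed_zset q : clear implicits.

Lemma open_principal q : open [set V | U V /\ val V q <> 0].
Proof.
rewrite (_ : [set V | _] = ~` zset q); first by apply: closed_openC; exact: closed_zset.
apply/seteqP; split=> V /=; first by move=> [hU n] h; apply: n; exact: h.
move=> h; split; [apply: contrapT => n; apply: h => // | move=> n; exact: h].
Qed.

Lemma open_chart : open U.
Proof.
rewrite (_ : (U : set T) = [set V | U V /\ val V 1 <> 0]); first exact: open_principal.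
apply/seteqP; split=> V; last by case.
by move=> hU; split=> //; rewrite rmorph1; exact/eqP/oner_neq0.
Qed.

Lemma closed_polys (Z : set T) : closed Z -> exists P : itp K D -> Prop,
  forall V, U V -> (Z V <-> forall p, P p -> val V p = 0).
Proof.
move=> /closedE[P HP]; exists (fun q => exists2 p, P p & forall x, pt D x q = frame_eval p (cfr C x)).
move=> V hU; have hb := c_fr hU; rewrite (HP V _ hb); split=> [h q [p Pp ->]|h p Pp]; first exact: h.
by have [q hq] := c_pull C p; rewrite -hq; apply: h; exists p.
Qed.

Definition vanI (S : set T) (p : itp K D) := forall V, S V -> U V -> val V p = 0.

Lemma vanI_ideal S : ideal (vanI S).
Proof.
split=> [V _ _|a u v hu hv V SV UV]; first exact: rmorph0.
by rewrite rmorphD rmorphM [X in _ * X]hu // [X in _ + X]hv // mulr0 addr0.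
Qed.

Lemma vanI_prime S : irreducible S -> S `&` U !=set0 -> prime_ideal (vanI S).
Proof.
move=> iS [V0 [S0 U0]]; split; first exact: vanI_ideal.
  by move=> /(_ V0 S0 U0)/eqP; rewrite rmorph1 oner_eq0.
move=> p q hpq; have sub : S `<=` zset p `|` zset q.
  move=> V SV; have [UV|nU] := pselect (U V); last by left=> /nU.
  have /eqP := hpq V SV UV; rewrite rmorphM mulf_eq0 => /orP[/eqP h|/eqP h]; [left|right]; by [].
by case/(iS.2 _ _ (closed_zset p) (closed_zset q)): sub => h; [left|right] => V SV UV; exact: h.
Qed.

Lemma vanI_sep (Z S : set T) : closed Z -> S `<=` U -> ~ (S `<=` Z) -> exists2 p, vanI Z p & ~ vanI S p.
Proof.
move=> cZ SU nSZ; have [P HP] := closed_polys cZ.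
apply: contrapT => H; apply: nSZ => V SV; apply/(HP V (SU V SV)) => p Pp.
apply: contrapT => np; apply: H; exists p; first by move=> W ZW UW; exact: (HP W UW).1.
by move=> h; apply: np; apply: h; [|exact: SU].
Qed.

Lemma vanI_gl S l : (chom C <= l < D)%N -> vanI S (gl D (cc C) l).
Proof.
move=> hl V SV UV; have lD : (l < D)%N by case/andP: hl.
by rewrite [LHS]ev_gl // -(c_eq UV hl) subrr.
Qed.

Lemma vanI_gI p V : gI (chom C) (cc C) p -> U V -> val V p = 0.
Proof.
move=> hp UV; apply: (gI_sub (vanI_ideal setT) _ hp) => // l hl; exact: vanI_gl.
Qed.

Definition jacU := [set V | U V /\ val V (jacp (cdim C) (chom C) (cc C)) <> 0].
End OneChart.

Arguments closed_zset {y C} q.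
Arguments vanI {y} C S p.
Arguments zset {y} C q.

(* The chain is read in the chart at a point of its first member, and the resulting
   independent functions are transported to the function field of S in the chart C. *)
Theorem dim_bound_irr (y : T) (C : chart y) S n : irreducible S -> S `&` jacU C !=set0 ->
  has_chain S n -> (n <= chom C)%N.
Proof.
move=> iS [V0 [SV0 [UV0 JV0]]] [Z [Zc Zs]].
have SU : S `&` cU C !=set0 by exists V0.
have [[y' [Zy' Sy']] _] := (Zc 0%N isT).2.
have [C'] := chart_ex y'.
have y'U := c_pt C'.
pose S' k := Z k `&` S; pose P k := vanI C' (S' k).
have y'S k : (k <= n)%N -> S' k y' by move=> kn; exact: (chain_mono Zs (leq0n k) kn).
have pP k : (k <= n)%N -> prime_ideal (P k).
  by move=> kn; apply: vanI_prime; [exact: (Zc k kn).2|exists y'; split=> //; exact: y'S].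
have /choice[u Hu] : forall k, exists u, (k < n)%N -> P k u /\ ~ P k.+1 u.
  move=> k; have [kn|_] := ltnP k n; last by exists 0.
  have [sub nsub] := Zs k kn.
  have iS1 := (Zc k.+1 kn).2.
  have m1 : S' k.+1 `&` cU C' !=set0 by exists y'; split=> //; exact: y'S.
  have [|u uZ nu] := vanI_sep (C := C') (Zc k (ltnW kn)).1 (@subIsetr _ (S' k.+1) (cU C')).
    move=> h; apply: nsub => V SV; split; last by case: SV.
    exact: (irr_open iS1 (open_chart C') m1 (Zc k (ltnW kn)).1 h).
  exists u => _; split; first by move=> V [ZV _]; exact: uZ.
  by move=> h; apply: nu => V [SV UV] _; exact: h.
have ind := @chain_indep K (itp K (cdim C')) (cst K (cdim C')) P n u pP.
have {}ind : forall p, P n (ev (cst K (cdim C')) n u p) -> p = 0.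
  apply: ind => k kn; have [h1 h2] := Hu k kn; split=> // p hp V SV UV; apply: hp => //.
  by have [sub _] := Zs k kn; exact: sub.
have pS := vanI_prime iS SU.
have [E [f fP]] := generic_point pS.
pose i : {rmorphism K -> E} := f \o cst K (cdim C).
have [den hden] := c_pull C (cden C').
have /choice[num hnum] : forall l, exists q, forall x, pt (cdim C) x q = frame_eval (cnum C' l) (cfr C x).
  by move=> l; exact: c_pull.
pose W := (cU C : set T) `&` cU C'.
have oW : open W by apply: openI; exact: open_chart.
have SW : S `&` W !=set0.
  have [V [[SV UV] UV']] : (S `&` cU C) `&` cU C' !=set0.
    apply: contrapT => H; have cC' : closed (~` (cU C' : set T)) by apply: open_closedC; exact: open_chart.
    have : S `<=` ~` (cU C' : set T).
      by apply: (irr_open iS (open_chart C) SU cC') => V SV UV'; apply: H; exists V.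
    by move=> /(_ y' Sy'); apply.
  by exists V.
have Wden V : W V -> pt (cdim C) (cco C V) den <> 0.
  by move=> [UV UV']; rewrite hden; exact: (c_den C' (c_fr UV)).1.
have Wnum V l : W V -> (l < cdim C')%N ->
    cco C' V l * pt (cdim C) (cco C V) den = pt (cdim C) (cco C V) (num l).
  by move=> [UV UV'] lD; rewrite hden hnum; apply: c_num => //; exact: c_fr.
have fden : f den != 0.
  apply/eqP => /fP h; have [V [SV [UV UV']]] := SW.
  by apply: (Wden V) => //; exact: h.
pose xi l := f (num l) / f den.
(* A polynomial on C' becomes r / den^k on C, both in the function field of S and at points of the
   overlap; the pointwise form brings identities back to C'. *)
have rat (q : itp K (cdim C')) : exists k r, f r = f den ^+ k * ev i (cdim C') xi q /\
    forall V, W V -> pt (cdim C) (cco C V) r = pt (cdim C) (cco C V) den ^+ k * pt (cdim C') (cco C' V) q.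
  move: q; apply: itp_ind => [a|l lD|q q' [k [r [h1 h2]]] [k' [r' [h1' h2']]]|q q' [k [r [h1 h2]]] [k' [r' [h1' h2']]]].
  - exists 0%N, (cst K (cdim C) a); rewrite expr0 mul1r ev_cst; split=> // V _.
    by rewrite !pt_cst expr0 mul1r.
  - exists 1%N, (num l); rewrite expr1 ev_vr // /xi mulrC divfK //; split=> // V WV.
    by rewrite expr1 pt_vr // mulrC Wnum.
  - exists (k + k')%N, (den ^+ k' * r + den ^+ k * r'); split=> [|V WV].
      by rewrite !rmorphD !rmorphM !rmorphXn h1 h1' exprD /=; ring.
    by rewrite !rmorphD !rmorphM !rmorphXn (h2 V WV) (h2' V WV) exprD /=; ring.
  - exists (k + k')%N, (r * r'); split=> [|V WV].
      by rewrite !rmorphM h1 h1' exprD /=; ring.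
    by rewrite !rmorphM (h2 V WV) (h2' V WV) exprD /=; ring.
apply: (trdeg_prime (c_le C) pS fP _ _ (u := fun j => ev i (cdim C') xi (u j))).
- by move=> l hl; exact: vanI_gl.
- by move=> h; apply: JV0; exact: h.
- move=> p hp; apply: ind.
  have e0 : ev i (cdim C') xi (ev (cst K (cdim C')) n u p) = 0.
    rewrite -[RHS]hp; apply: ev_cmp => [a|l ln]; [exact: ev_cst|by []].
  have [k [r [h1 h2]]] := rat (ev (cst K (cdim C')) n u p).
  move: h1; rewrite e0 mulr0 => /fP hr.
  have sub : S `<=` zset C' (ev (cst K (cdim C')) n u p).
    apply: (irr_open iS oW SW (closed_zset _)) => V [SV WV] _.
    have := h2 V WV; rewrite (hr V SV WV.1) => /esym/eqP; rewrite mulf_eq0 expf_eq0.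
    by move/eqP/negPf: (Wden V WV) => ->; rewrite andbF => /eqP.
  by move=> V [_ SV] UV; exact: sub.
- move=> j jn; have [k [r [h1 _]]] := rat (u j); exists r, (den ^+ k).
  by rewrite rmorphXn h1 mulrC; split=> //; apply/eqP; exact: expf_neq0.
Qed.
End ChartTopology.
Arguments closed_zset {K Q M e y C} q.
Arguments vanI {K Q M e y} C S p.
Arguments zset {K Q M e y} C q.

(** * Tangent spaces *)

Section Tangent.
Variables (K : fieldType) (Q : quiver) (M : rep K Q) (e : vertex Q -> nat) (N : qGr M e).
Local Notation X := (rep_of N).
Local Notation Y := (quo N).

Definition tproj (psi : lift_family N) : C0 X Y := fun i => (prjv (N i) \o psi i)%VF.

Lemma tprojE psi i n : tproj psi i n = prjv (N i) (psi i n).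
Proof. by rewrite /tproj comp_lfunE. Qed.

Lemma tangentE psi : tangent psi <-> isHom (tproj psi).
Proof.
split=> [h a n|h a v w [vN wN]].
  have [|_] := h a (vsval n) (psi (src a) n).
    by split; [exact: subvsP|rewrite vsvalK subrr mem0v].
  move/prjv_eq0; rewrite lfB => /subr0_eq E.
  have e1 : vsproj (N (tgt a)) (rep_map M a (vsval n)) = rep_map X a n.
    by apply: val_inj; rewrite /= vsprojK; [have := @isHom_incl K Q M N a n; rewrite !inclE|apply: sub_stableE; exact: subvsP].
  by rewrite !tprojE -e1 -E; exact: (@isHom_prj K Q M N a).
have st := sub_stableE vN; split=> //; apply/prjv_eq0.
pose n := vsproj (N (src a)) v.
have := h a n; rewrite !tprojE => E.
have e1 : vsproj (N (tgt a)) (rep_map M a v) = rep_map X a n.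
  apply: val_inj; rewrite [LHS]vsprojK //.
  have E1 := @isHom_incl K Q M N a n; rewrite !inclE in E1.
  by apply: etrans _ (esym E1); rewrite vsprojK.
have e2 : prjv (N (src a)) w = prjv (N (src a)) (psi (src a) n).
  by apply/eqP; rewrite -subr_eq0 -lfB; apply/eqP/prjv_eq0.
have e3 : prjv (N (tgt a)) (rep_map M a w) = rep_map Y a (prjv (N (src a)) w).
  exact: (@isHom_prj K Q M N a).
by rewrite lfB e1 E e3 e2 subrr.
Qed.

Lemma tproj_sub psi n (t : 'I_n -> lift_family N) (c : 'rV[K]_n) :
  null_tangent (fun i => psi i - \sum_j c 0 j *: t j i) <-> tproj psi = \sum_j c 0 j *: tproj (t j).
Proof.
have E i u : prjv (N i) ((psi i - \sum_j c 0 j *: t j i) u) =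
    tproj psi i u - (\sum_j c 0 j *: tproj (t j)) i u.
  rewrite add_lfunE opp_lfunE lfB tprojE; congr (_ - _).
  rewrite fam_sum !sum_lfunE linear_sum; apply: eq_bigr => j _.
  by rewrite famZ !scale_lfunE tprojE; exact: lfZ.
split=> [h|h i u]; last by apply/prjv_eq0; rewrite E h subrr.
by apply: C0P => i u; apply/eqP; rewrite -subr_eq0 -E; apply/eqP/prjv_eq0; exact: h.
Qed.

Definition tlift (f : C0 X Y) : lift_family N := fun i => (linfun vsval \o f i)%VF.

Lemma tliftK f : tproj (tlift f) = f.
Proof.
apply: C0P => i n; rewrite tprojE.
have -> : tlift f i n = vsval (f i n) by rewrite /tlift comp_lfunE lfunE.
exact: prjv_section.
Qed.

Lemma tangent_dimP n : tangent_dim N n <-> n = hom X Y.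
Proof.
split=> [[t [ht hu]]|->].
  pose b := [tuple tproj (t j) | j < n].
  have bE (c : 'I_n -> K) : \sum_(j < n) c j *: b`_j = \sum_j c j *: tproj (t j).
    by apply: eq_bigr => j _; rewrite -tnth_nth tnth_mktuple.
  suff bb : basis_of (lker (dlt X Y)) b by rewrite /hom (size_basis bb).
  have sub1 : (<<b>> <= lker (dlt X Y))%VS.
    by apply/span_subvP => v /tnthP[j ->]; rewrite tnth_mktuple; apply/isHomP/tangentE; exact: ht.
  have sub2 : (lker (dlt X Y) <= <<b>>)%VS.
    apply/subvP => f /isHomP hf; have tf : tangent (tlift f) by apply/tangentE; rewrite tliftK.
    have [c [/tproj_sub hc _]] := hu _ tf; rewrite -(tliftK f) hc -(bE (fun j => c 0 j)).
    by apply: memv_suml => j _; apply: memvZ; apply: memv_span; apply: mem_nth; rewrite size_tuple.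
  rewrite /basis_of eqEsubv sub1 sub2; apply/freeP => c hc.
  have t0 : tangent (tlift 0) by apply/tangentE; rewrite tliftK; exact: isHom0.
  have [c0 [_ uc]] := hu _ t0.
  have H (c' : 'rV[K]_n) : \sum_j c' 0 j *: tproj (t j) = 0 -> c0 = c'.
    by move=> z; apply: uc; apply/tproj_sub; rewrite tliftK z.
  have e1 : c0 = 0 by apply: H; rewrite big1 // => j _; rewrite mxE scale0r.
  have e2 : c0 = \row_j c j.
    by apply: H; rewrite -[RHS]hc bE; apply: eq_bigr => j _; rewrite mxE.
  by move=> j; have := congr1 (fun v : 'rV_n => v 0 j) e2; rewrite e1 !mxE.
pose b := vbasis (lker (dlt X Y)); exists (fun j => tlift b`_j).
have bE (c : 'rV[K]_(hom X Y)) : \sum_j c 0 j *: tproj (tlift b`_j) = \sum_j c 0 j *: b`_j.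
  by apply: eq_bigr => j _; rewrite tliftK.
split=> [j|psi /tangentE/isHomP hp].
  by apply/tangentE/isHomP; rewrite tliftK; apply: vbasis_mem; apply: mem_nth; rewrite size_tuple.
exists (\row_j coord b j (tproj psi)); split.
  apply/tproj_sub; rewrite bE {1}(coord_vbasis hp); by apply: eq_bigr => j _; rewrite mxE.
move=> c /tproj_sub; rewrite bE => E; apply/rowP => j; rewrite mxE E linear_sum.
have fb : free b by exact: basis_free (vbasisP _).
rewrite (bigD1 j) //= big1.
  by rewrite linearZ /= (coord_free _ _ fb) eqxx mulr1 addr0.
by move=> m mj; rewrite linearZ /= (coord_free _ _ fb) (negPf mj) mulr0.
Qed.
End Tangent.

Lemma euler_chi (K : fieldType) (Q : quiver) (M : rep K Q) (e : vertex Q -> nat) (N : qGr M e) :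
  euler_form (fun i => (e i)%:Z) (fun i => (dimvec M i)%:Z - (e i)%:Z) =
  (hom (rep_of N) (quo N))%:Z - (ext (rep_of N) (quo N))%:Z.
Proof.
rewrite euler_hom_ext; congr euler_form; apply/funext => i.
  by rewrite dim_rep_of (qGr_dim N).
rewrite (ses_dim (ses_quo N)) PoszD dim_rep_of (qGr_dim N); lia.
Qed.

(** * Smooth points and the vanishing of Ext *)

Section Local.
Variables (K : numClosedFieldType) (Q : quiver) (M : rep K Q) (e : vertex Q -> nat).
Local Notation T := (qGr M e).
Variables (N : T) (C : chart N).
Local Notation D := (cdim C).
Local Notation h := (chom C).
Local Notation U := (cU C).
Local Notation val V q := (pt D (cco C V) q).

Lemma val0 q : val N q = pt D (fun=> 0) q.
Proof. by apply: ev_ext => l _; exact: c_pt0. Qed.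

Lemma jacU_pt : jacU C N.
Proof. by split; [exact: c_pt|rewrite val0 jacp_pt0; exact/eqP/oner_neq0]. Qed.

Section ExtZero.
Hypothesis ext0 : ext (rep_of N) (quo N) = 0%N.

(** Arcs that move only in the first j tangent directions; with j, the ideals P j decrease and their
    zero sets S j grow. *)
Let s j l : itp K D := if (l < j)%N then vr K D l else 0.
Let P j := arc_ideal h (cc C) (s j).
Let S j : set T := [set V | U V /\ forall p, P j p -> val V p = 0].
Let W j := closure (S j).

(** The Nullstellensatz gives a solution of the chart equations, and [c_ex], which needs Ext = 0,
    turns it into a subrepresentation. *)
Let S_point j q : ~ P j q -> exists2 V, S j V & val V q <> 0.
Proof.
move=> nq; have [x [xP xq]] := nullstellensatz (arc_prime h (cc C) (s j)) nq.
have [V UV Vx] : exists2 V, U V & forall l, (l < D)%N -> cco C V l = x l.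
  apply: c_ex => // l hl; have lD : (l < D)%N by case/andP: hl.
  by have := xP _ (arc_gl (cc C) (s j) hl); rewrite [pt _ _ _]ev_gl // => /subr0_eq.
have E q' : val V q' = pt D x q' by exact: ev_ext.
by exists V; [split=> // p Pp; rewrite E xP|rewrite E].
Qed.

Let S_N j : S j N.
Proof. by split=> [|p Pp]; [exact: c_pt|rewrite val0; exact: arc_pt Pp]. Qed.

Let S_irr j : irreducible (S j).
Proof.
split; first by exists N.
have sep A : closed A -> ~ (S j `<=` A) -> exists2 a, ~ P j a & forall V, A V -> U V -> val V a = 0.
  move=> cA nA; have [a aA na] := vanI_sep (C := C) cA (fun V (h : S j V) => h.1) nA.
  exists a => // Pa; apply: na => V [_ h] _; exact: h.
move=> A B cA cB sub; apply: contrapT => /not_orP[/(sep A cA)[a na aA] /(sep B cB)[b nb bB]].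
have nab : ~ P j (a * b) by have [_ _ pr] := arc_prime h (cc C) (s j) => /pr[].
have [V SV] := S_point nab; rewrite rmorphM; apply; have [UV _] := SV.
by case: (sub V SV) => h; [rewrite [X in X * _]aA ?mul0r|rewrite [X in _ * X]bB ?mulr0].
Qed.

Let P_sub j p : P j.+1 p -> P j p.
Proof.
pose th : {rmorphism itp K D -> itp K D} := ev (cst K D) D (fun l => if l == j then 0 else vr K D l).
apply: (arc_mono (th := th)) => [k|l lh]; first exact: ev_cst.
have lD : (l < D)%N by apply: leq_trans lh (c_le C).
rewrite /s ltnS; case: (ltngtP l j) => [lj|jl|lj].
- by rewrite ev_vr // ltn_eqF.
- exact: rmorph0.
- by rewrite lj in lD *; rewrite ev_vr // eqxx.
Qed.

Let W_sub j k : (j <= k)%N -> W j `<=` W k.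
Proof.
move=> /subnK <-; elim: (k - j)%N => [|d IH]; first exact: subset_refl.
apply: subset_trans IH _; apply: closure_subset => V [UV h]; split=> // p /P_sub; exact: h.
Qed.

Let W_N j : W j N. Proof. exact: subset_closure. Qed.
Let W_irr j : irreducible (W j). Proof. exact: irr_closure. Qed.

(** The coordinate j vanishes on W j but not on all of S (j + 1), and irreducibility makes the
    difference visible in every neighbourhood of N. *)
Let W_strict (O : set T) j : open O -> O N -> (j < h)%N -> ~ (W j.+1 `&` O `<=` W j).
Proof.
move=> oO ON jh sub; have jD : (j < D)%N := leq_trans jh (c_le C).
have z1 : W j `<=` zset C (vr K D j).
  apply: closure_min; first exact: closed_zset.
  by move=> V [UV h] _; apply: h; apply/arc_vr => //; rewrite /s ltnn.
have : W j.+1 `<=` zset C (vr K D j).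
  apply: (irr_open (W_irr j.+1) oO _ (closed_zset _)); first by exists N.
  by apply: subset_trans z1.
move=> z2; have [|V SV nV] := @S_point j.+1 (vr K D j).
  move=> /arc_vr => /(_ jh jD); rewrite /s ltnSn => e0.
  by have := pt_vr (fun=> 1 : K) jD; rewrite e0 rmorph0 => /esym/eqP; rewrite oner_eq0.
by apply: nV; apply: z2; [exact: subset_closure|case: SV].
Qed.

Let chainW (O : set T) : open O -> O N -> has_chain O h.
Proof.
move=> oO ON; exists W; split=> j jh.
  by split; [exact: closed_closure|apply: irr_cap_open => //; exists N].
split; first by move=> V [/(W_sub (leqnSn j)) WV OV].
by move=> sub; apply: (W_strict oO ON jh) => V /sub[].
Qed.

Let WsubW j (Z : set T) : W h `<=` Z -> (j <= h)%N -> W j `&` Z = W j.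
Proof.
move=> WZ jh; apply/seteqP; split=> V; first by case.
by move=> WV; split=> //; apply: WZ; exact: W_sub WV.
Qed.

Lemma ext0_smooth : smooth_point N /\ exists Z : set T,
  [/\ irreducible_component Z, Z N & krull_dim Z h].
Proof.
have noc Z : irreducible Z -> Z N -> ~ has_chain Z h.+1.
  move=> iZ ZN hc; have ne : Z `&` jacU C !=set0 by exists N; split=> //; exact: jacU_pt.
  by have := dim_bound_irr iZ ne hc; rewrite ltnn.
have str j : (j < h)%N -> ~ (W j.+1 `<=` W j).
  by move=> jh sub; apply: (W_strict openT I jh); rewrite setIT.
split.
  exists h; split; first exact/tangent_dimP.
  split=> [|O oO ON]; last exact: chainW.
  exists (jacU C); split; [exact: open_principal|exact: jacU_pt|split].
    by apply: chainW; [exact: open_principal|exact: jacU_pt].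
  move=> /chain_top[Z [iZ ZJ hc]].
  have ne : Z `&` jacU C !=set0 by have [[V ZV] _] := iZ; exists V; split=> //; exact: ZJ.
  by have := dim_bound_irr iZ ne hc; rewrite ltnn.
exists (W h); split=> //.
  split=> // Z' iZ' WZ'; apply: contrapT => nZ'; apply: (noc Z' iZ' (WZ' _ (W_N h))).
  (* If Z' were larger than W h, then Z' itself, here [setT] cut down to Z', would prolong the chain
     to length h + 1. *)
  exists (fun j => if (j <= h)%N then W j else setT); split=> j jh.
    case: ifP => [jh'|_]; first by rewrite WsubW //; split; [exact: closed_closure|].
    by rewrite setTI; split=> //; exact: closedT.
  rewrite ltnS in jh; rewrite jh WsubW //; case: ifP => [jh'|/negbT].
    by rewrite WsubW //; split; [exact: W_sub|exact: str].
  rewrite -leqNgt => hj; have -> : j = h by apply/eqP; rewrite eqn_leq jh.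
  by rewrite setTI.
split; last exact: noc.
exists W; split=> j jh; first by rewrite WsubW //; split; [exact: closed_closure|].
by rewrite !WsubW ?(ltnW jh) //; split; [exact: W_sub|exact: str].
Qed.
End ExtZero.

(* A chain of length h near N makes the ideal of its top member equal to the arc
   ideal, so Gr is irreducible near N and every component through N has a chain
   of length h. *)
Lemma smooth_chain (Z : set T) : local_dim N h -> irreducible_component Z -> Z N -> has_chain Z h.
Proof.
move=> [_ loc] [iZ mZ] ZN.
have [q [q1 qg]] := arc_unit D h (cc C).
pose x := vr K D; pose P := arc_ideal h (cc C) x.
pose jp := jacp D h (cc C).
(* Where q is nonzero, [arc_unit] makes every point satisfy the equations in P. *)
pose O : set T := [set V | U V /\ val V (q * jp) <> 0].
have oO : open O by exact: open_principal.
have ON : O N.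
  split; first exact: c_pt.
  by rewrite val0 rmorphM q1 [X in _ * X]jacp_pt0 mulr1; exact/eqP/oner_neq0.
have OP V p : O V -> P p -> val V p = 0.
  move=> [UV nq] Pp; have /eqP := vanI_gI (qg p Pp) UV; rewrite rmorphM mulf_eq0 => /orP[/eqP h0|/eqP //].
  by case: nq; rewrite rmorphM [X in X * _]h0 mul0r.
have [Y [Yc Ys]] := loc O oO ON.
pose Qi k := if (k <= h)%N then vanI C (Y k `&` O) else P.
have OU S : S `&` O `<=` U by move=> V [_ []].
have pQ k : (k <= h.+1)%N -> prime_ideal (Qi k).
  move=> kh; rewrite /Qi; case: ifP => [kh'|_]; last exact: arc_prime.
  have [_ iY] := Yc k kh'; apply: vanI_prime => //.
  by have [[V YV] _] := iY; exists V; split=> //; exact: (OU (Y k)).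
have PQ k p : P p -> vanI C (Y k `&` O) p by move=> Pp V [_ OV] _; exact: OP.
(* If the ideal of the last member were not inside P, P would prolong the chain of ideals and give h
   + 1 independent elements in its function field, against [trdeg_prime]. So it is inside P, and O
   lies in Y h. *)
have [sub|nsub] := pselect (forall p, vanI C (Y h `&` O) p -> P p); last first.
  exfalso; have [uh uhQ uhP] : exists2 u, vanI C (Y h `&` O) u & ~ P u.
    by apply: contrapT => H; apply: nsub => p hp; apply: contrapT => np; apply: H; exists p.
  have /choice[u Hu] : forall k, exists u, (k < h)%N -> vanI C (Y k `&` O) u /\ ~ vanI C (Y k.+1 `&` O) u.
    move=> k; have [kh|_] := ltnP k h; last by exists 0.
    have [s1 ns] := Ys k kh.
    have [|u uY nu] := vanI_sep (C := C) (Yc k (ltnW kh)).1 (OU (Y k.+1)).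
      by move=> hs; apply: ns => V YV; split; [exact: hs|case: YV].
    by exists u => _; split=> // V [YV _]; exact: uY.
  pose u' k := if (k < h)%N then u k else uh.
  have ind : forall p, P (ev (cst K D) h.+1 u' p) -> p = 0.
    have -> : P = Qi h.+1 by rewrite /Qi ltnn.
    apply: (chain_indep pQ) => k; rewrite ltnS => kh; rewrite /Qi /u' kh.
    case: (ltnP k h) => [lt|ge].
      have [h1 h2] := Hu k lt; split=> // p hp V YV UV; apply: hp => //.
      by have [s1 _] := Ys k lt; exact: s1.
    have -> : k = h by apply/eqP; rewrite eqn_leq kh ge.
    by split=> // p; exact: PQ.
  have pP := arc_prime h (cc C) x.
  have [E [f fP]] := generic_point pP.
  suff : (h.+1 <= h)%N by rewrite ltnn.
  apply: (trdeg_prime (c_le C) pP fP _ _ (u := fun k => f (u' k))).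
  - by move=> l hl; exact: arc_gl.
  - by move=> /arc_pt; rewrite jacp_pt0 => /eqP; rewrite oner_eq0.
  - move=> p hp; apply: ind; apply/fP; rewrite -[RHS]hp; exact: ev_cmp.
  - by move=> j _; exists (u' j), 1; rewrite rmorph1 mulr1; split=> //; exact/eqP/oner_neq0.
have OY : O `<=` Y h.
  have [PY HY] := closed_polys C (Yc h (leqnn h)).1.
  move=> V OV; apply/(HY V OV.1) => p Pp; apply: OP OV _; apply: sub => V' [YV' OV'] UV'.
  exact: (HY V' UV').1.
(* As Y h contains O, the largest closure contains the component Z, and lies in it by maximality;
   the chain on O becomes a chain on Z. *)
pose Z1 k := closure (Y k `&` O).
have Z1i k : (k <= h)%N -> irreducible (Z1 k) by move=> kh; apply: irr_closure; exact: (Yc k kh).2.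
have Z1m k : (k <= h)%N -> Z1 k `<=` Z1 h.
  by move=> kh; apply: closure_subset; exact: (chain_mono Ys kh (leqnn h)).
have ZZ : Z1 h `<=` Z.
  apply: mZ; first exact: Z1i.
  apply: (irr_open iZ oO _ (@closed_closure _ _)); first by exists N.
  by move=> V [_ OV]; apply: subset_closure; split=> //; exact: OY.
have E k : (k <= h)%N -> Z1 k `&` Z = Z1 k.
  move=> kh; apply/seteqP; split=> V; first by case.
  by move=> ZV; split=> //; apply: ZZ; exact: Z1m ZV.
exists Z1; split=> k kh; first by rewrite E //; split; [exact: closed_closure|exact: Z1i].
rewrite !E ?(ltnW kh) //; have [s1 ns] := Ys k kh; split; first exact: closure_subset.
move=> hs; apply: ns => V YV; split; last by case: YV.
have sub2 : Z1 k `<=` Y k by apply: closure_min; [exact: (Yc k (ltnW kh)).1|exact: subIsetl].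
by apply/sub2/hs; exact: subset_closure.
Qed.
End Local.

(** For the converse, the component has dimension h - dim Ext by assumption and at least h by
    [smooth_chain], where h is the dimension of Hom(N, M / N). *)
Theorem ext0_smoothP (K : numClosedFieldType) (Q : quiver) (M : rep K Q) (e : vertex Q -> nat) (N : qGr M e) :
  ext (rep_of N) (quo N) = 0%N <->
  (smooth_point N /\ exists Z : set (qGr M e),
     [/\ irreducible_component Z, Z N
       & exists n : nat, krull_dim Z n /\
           n%:Z = euler_form (fun i => (e i)%:Z) (fun i => (dimvec M i)%:Z - (e i)%:Z)]).
Proof.
have [C] := chart_ex N; rewrite (euler_chi N); split=> [e0|].
  have [sN [Z [cZ ZN dZ]]] := ext0_smooth C e0; split=> //; exists Z; split=> //.
  by exists (hom (rep_of N) (quo N)); split=> //; rewrite e0 subr0.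
move=> [[n [/tangent_dimP -> loc]] [Z [cZ ZN [m [[_ nc] mE]]]]].
have := smooth_chain (C := C) loc cZ ZN => hc.
have le : (chom C <= m)%N.
  by rewrite leqNgt; apply/negP => lt; apply: nc; exact: has_chain_le lt hc.
rewrite /chom in le; lia.
Qed.

Theorem corollary1p2 (R : realType) (Q : quiver) (hQ : affine_quiver Q)
    (M : rep R[i] Q) (hM : indecomposable M) (e : vertex Q -> nat)
    (N : qGr M e) :
  Tr_e M e N <->
  (smooth_point N /\ exists Z : set (qGr M e),
     [/\ irreducible_component Z, Z N
       & exists n : nat, krull_dim Z n /\
           n%:Z = euler_form (fun i => (e i)%:Z)
                             (fun i => (dimvec M i)%:Z - (e i)%:Z)]).
Proof.
have [d [r0 [rk [h1 h2 h3]]]] := affine_data hQ.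
pose A := AffData hQ.2 h1 h2 h3.
exact: iff_trans (transverse_extP A N hM) (ext0_smoothP N).
Qed.
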